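(* There exists a constant $c>0$ such that the following holds. Let $h\in\dot H^1(\mathbb{H}^1)\cap V_0^+$, and suppose that $h$ is orthogonal to $Q_+$, $iQ_+$, $\partial_sQ_+$ and $i\partial_sQ_+$ in the (real) Hilbert space $\dot H^1(\mathbb{H}^1)$. Then $$(\mathcal{L}h,h)_{\dot H^{-1}(\mathbb{H}^1)\times\dot H^1(\mathbb{H}^1)}\geq c\,\|h\|_{\dot H^1(\mathbb{H}^1)}^2 .$$
   Context: $\mathbb{H}^1$ is the Heisenberg group identified with $\mathbb{R}^3$, with coordinates $(x,y,s)$ and Lebesgue measure. Functions are complex valued. Set $\Delta_{\mathbb{H}^1}=\frac14(\partial_x^2+\partial_y^2)+(x^2+y^2)\partial_s^2$ and $D_s=-i\partial_s$. $\dot H^1(\mathbb{H}^1)$ is the completion of the Schwartz space for $\|u\|_{\dot H^1}=\|(-\Delta_{\mathbb{H}^1})^{1/2}u\|_{L^2}$, a real Hilbert space with $(u,v)_{\dot H^1}=\mathrm{Re}\int(-\Delta_{\mathbb{H}^1}u)\overline v$; $\dot H^{-1}$ is its dual, with pairing $(u,v)_{\dot H^{-1}\times\dot H^1}=\mathrm{Re}\int u\overline v$. With $\widehat u(x,y,\sigma)=\frac1{\sqrt{2\pi}}\int_{\mathbb{R}}e^{-is\sigma}u(x,y,s)\,ds$, for $k\in\{-1,0,1\}$ the space $\dot H^k(\mathbb{H}^1)\cap V_0^+$ is the closed subspace of those $u\in\dot H^k(\mathbb{H}^1)$ (with $\dot H^0=L^2$) such that $\widehat u(x,y,\sigma)=f(\sigma)\frac1{\sqrt\pi}e^{-(x^2+y^2)\sigma}\mathbf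 1_{\sigma\ge0}$ for some function $f$; then $\|u\|_{\dot H^k}^2=\int_0^\infty|f(\sigma)|^2\frac{d\sigma}{2\sigma^{1-k}}$. On $V_0^+$ one has $-\Delta_{\mathbb{H}^1}=D_s$. $\Pi_0^+$ is the orthogonal projector of $L^2(\mathbb{H}^1)$ onto $L^2(\mathbb{H}^1)\cap V_0^+$, extended to $L^{4/3}(\mathbb{H}^1)\subset\dot H^{-1}(\mathbb{H}^1)$ (recall $\dot H^1\hookrightarrow L^4$). $Q_+(x,y,s)=\dfrac{\sqrt2\,i}{s+i(x^2+y^2)+i}$, and for $h\in\dot H^1(\mathbb{H}^1)\cap V_0^+$, $$\mathcal{L}h=D_sh-2\Pi_0^+(|Q_+|^2h)-\Pi_0^+(Q_+^2\overline h).$$ *)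

(* Defs.v *)
From HB Require Import structures.
From mathcomp Require Import all_boot all_order all_algebra.
From mathcomp Require Import complex.
From mathcomp Require Import all_classical all_reals all_analysis.

Set Implicit Arguments.
Unset Strict Implicit.
Unset Printing Implicit Defensive.

Import Order.TTheory GRing.Theory Num.Theory.
Import numFieldNormedType.Exports.

Local Open Scope classical_set_scope.
Local Open Scope ring_scope.
Local Open Scope complex_scope.

(* R^3 with coordinates (x, y, s) = (p.1.1, p.1.2, p.2); elements of function
   spaces are represented by functions, every notion below being invariant
   under modification on a null set unless it concerns smooth functions. *)
Notation heis R := (R * R * R)%type.
Notation hfun R := (heis R -> R[i]).
Notation hmeas R :=
  (measurableTypeR R * measurableTypeR R * measurableTypeR R)%type.
Notation leb3 R :=
  (@lebesgue_measure R \x @lebesgue_measure R \x @lebesgue_measure R)%E.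

Section Integration.
Context {R : realType}.

Definition cmeasurable d (T : measurableType d) (u : T -> R[i]) : Prop :=
  measurable_fun setT (fun x => complex.Re (u x)) /\
  measurable_fun setT (fun x => complex.Im (u x)).

Definition cintegrable d (T : measurableType d)
    (mu : {measure set T -> \bar R}) (u : T -> R[i]) : Prop :=
  mu.-integrable setT (fun x => (complex.Re (u x))%:E) /\
  mu.-integrable setT (fun x => (complex.Im (u x))%:E).

Definition cintegral d (T : measurableType d)
    (mu : {measure set T -> \bar R}) (u : T -> R[i]) : R[i] :=
  Rintegral mu setT (fun x => complex.Re (u x)) +i*
  Rintegral mu setT (fun x => complex.Im (u x)).

Definition Lpnorm (p : R) (u : hfun R) : \bar R :=
  Lnorm (leb3 R) p%:E (fun x => (Normc.normc (u x))%:E).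

Definition inL2 (u : hfun R) : Prop :=
  cmeasurable (u : hmeas R -> R[i]) /\ (Lpnorm 2 u < +oo)%E.

End Integration.

Section Schwartz.
Context {R : realType}.

Definition ex : heis R := (1, 0, 0).
Definition ey : heis R := (0, 1, 0).
Definition es : heis R := (0, 0, 1).

Definition pd (v : heis R) (u : hfun R) : hfun R := fun p =>
  'D_v (fun q => complex.Re (u q)) p +i* 'D_v (fun q => complex.Im (u q)) p.

Definition cderivable (u : hfun R) (p v : heis R) : Prop :=
  derivable (fun q => complex.Re (u q)) p v /\
  derivable (fun q => complex.Im (u q)) p v.

(* All iterated partial derivatives exist and are rapidly decreasing; in
   particular they are bounded, hence continuous, so that u is smooth. *)
Definition schwartz (u : hfun R) : Prop :=
  forall l : seq (heis R), {subset l <= [:: ex; ey; es]} ->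
    (forall p v, v \in [:: ex; ey; es] -> cderivable (foldr pd u l) p v) /\
    (forall k : nat, exists C : R, forall p,
       `|p| ^+ k * Normc.normc (foldr pd u l p) <= C).

Definition Lap (u : hfun R) : hfun R := fun p =>
  (4^-1)%:C * (pd ex (pd ex u) p + pd ey (pd ey u) p)
  + (p.1.1 ^+ 2 + p.1.2 ^+ 2)%:C * pd es (pd es u) p.

Definition Ds (u : hfun R) : hfun R := fun p => - 'i%C * pd es u p.

Definition rpair (u v : hfun R) : R :=
  complex.Re (cintegral (leb3 R) (fun p => u p * (v p)^*%C)).

End Schwartz.

Section Sobolev.
Context {R : realType}.

Definition dotS (u v : hfun R) : R := rpair (fun p => - Lap u p) v.

(* The completion of the Schwartz space is realized inside L^4 through the
   embedding of \dot H^1 into L^4: its elements are the L^4-limits of sequences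
   of Schwartz functions that are Cauchy for the \dot H^1 norm. *)
Definition approximates (w : (hfun R)^nat) (u : hfun R) : Prop :=
  [/\ forall n, schwartz (w n),
      forall e : R, 0 < e -> exists N : nat, forall m n : nat,
        (N <= m)%N -> (N <= n)%N ->
        dotS (fun p => w m p - w n p) (fun p => w m p - w n p) < e
    & (fun n => Lpnorm 4 (fun p => w n p - u p)) @ \oo --> 0%E].

Definition inH1 (u : hfun R) : Prop :=
  cmeasurable (u : hmeas R -> R[i]) /\ exists w, approximates w u.

(* The inner product, and the value of a functional, do not depend on the
   approximating sequence chosen by appr. *)
Definition appr (u : hfun R) : (hfun R)^nat :=
  xget (fun _ _ => 0) [set w | approximates w u].

Definition dotH1 (u v : hfun R) : R :=
  lim ((fun n => dotS (appr u n) (appr v n)) @ \oo).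

Definition normH1 (u : hfun R) : R := Num.sqrt (dotH1 u u).

(* An element T of the dual \dot H^{-1} is given by its (real) values
   T w = Re \int T conj(w) on Schwartz functions, a dense subspace of \dot H^1;
   its value at u in \dot H^1 is obtained by continuity. *)
Definition dualpair (T : hfun R -> R) (u : hfun R) : R :=
  lim ((fun n => T (appr u n)) @ \oo).

End Sobolev.

Section V0.
Context {R : realType}.

Definition cis (t : R) : R[i] := cos t +i* sin t.

Definition fourier_s (u : hfun R) : hfun R := fun p =>
  ((Num.sqrt (2 * pi))^-1)%:C *
  cintegral (@lebesgue_measure R)
    (fun s : measurableTypeR R => cis (- (s * p.2)) * u (p.1, s)).

(* (x, y, sigma) |-> f(sigma) pi^{-1/2} exp(-(x^2+y^2) sigma) 1_{sigma >= 0} *)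
Definition gauss_profile (f : R -> R[i]) : hfun R := fun p =>
  if 0 <= p.2 then
    f p.2 * ((Num.sqrt pi)^-1 * expR (- (p.1.1 ^+ 2 + p.1.2 ^+ 2) * p.2))%:C
  else 0.

(* The partial Fourier transform of u, in the sense of tempered distributions,
   is the function gauss_profile f. *)
Definition V0plus (u : hfun R) : Prop :=
  exists2 f : measurableTypeR R -> R[i], cmeasurable f &
    forall phi : hfun R, schwartz phi ->
      cintegrable (leb3 R) (fun p => gauss_profile f p * phi p) /\
      cintegral (leb3 R) (fun p => u p * fourier_s phi p) =
      cintegral (leb3 R) (fun p => gauss_profile f p * phi p).

Definition is_proj0 (u p : hfun R) : Prop :=
  [/\ inL2 p, V0plus p &
      forall v, inL2 v -> V0plus v ->
        cintegral (leb3 R) (fun x => (u x - p x) * (v x)^*%C) = 0].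

Definition Pi0 (u : hfun R) : hfun R := xget (fun _ => 0) [set p | is_proj0 u p].

(* Extension of Pi0 by duality to L^{4/3}, with values in \dot H^{-1}: Pi0 being
   self-adjoint on L^2, this is w |-> Re \int (Pi0 v) conj(w) if v is in L^2. *)
Definition Pi0_dist (v : hfun R) : hfun R -> R := fun w => rpair v (Pi0 w).

Definition Ds_dist (h : hfun R) : hfun R -> R := fun w => rpair h (Ds w).

Definition Qplus : hfun R := fun p =>
  (Num.sqrt 2)%:C * 'i%C /
  (p.2%:C + 'i%C * (p.1.1 ^+ 2 + p.1.2 ^+ 2)%:C + 'i%C).

Definition Lop (h : hfun R) : hfun R -> R := fun w =>
  Ds_dist h w
  - 2 * Pi0_dist (fun p => (Normc.normc (Qplus p) ^+ 2)%:C * h p) w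
  - Pi0_dist (fun p => Qplus p ^+ 2 * (h p)^*%C) w.

End V0.

(* Main.v *)
Require Import Defs.
From HB Require Import structures.
From mathcomp Require Import all_boot all_order all_algebra.
From mathcomp Require Import complex.
From mathcomp Require Import all_classical all_reals all_analysis.
From mathcomp Require Import measurable_realfun lebesgue_integral_under.
From mathcomp Require Import ring lra.

(** Write [z = s + i (x^2 + y^2)].  An element of [V0plus] is a superposition
    [J psi = \int psi(s) e^{isz} ds] over frequencies [s > 0], so that the
    statement is about functions of one variable.  Let [S u (s)] be the pairing
    of [u] with [e^{isz}] and [chi u (s) = s S u (s)].  Since [- Lap] and [Ds]
    both multiply [e^{isz}] by [s] ([S_Lap], [S_Ds]) and
    [S (J psi) (s) = (pi^2 / s) psi (s)] ([S_J], from Fourier inversion in the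
    central variable and a Gaussian integral in the others), the energy of [h]
    is [pi^-2 \int |chi|^2] ([chi_energy], [kinetic_limit]).

    Because [i / (z + i) = \int_0^\infty e^{-s} e^{isz} ds] ([J_ek]), the product
    with [Q] is, on profiles, the convolution with [sqrt 2 e^{-s}], that is the
    Volterra operator [V] solving [u' + u = f], [u (0) = 0] ([Qplus_J]).  Hence
    the term in [|Q|^2] of the quadratic form is [4 pi^-2 \int |V chi|^2 / s]
    ([potential_form], [term_A]), while the term in [Q^2] is a multiple of the
    square of the moment [\int e^{-s} chi] ([S_Q2], [term_B]).  Orthogonality to
    [Q], [i Q], [d_s Q] and [i d_s Q] in the energy space says precisely that
    the moments of [chi] against [e^{-s}] and [s e^{-s}] vanish
    ([moments_vanish]).

    What remains is an inequality on the half-line: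
    [6 \int |V f|^2 / s <= \int |f|^2] if [f] is orthogonal to [e^{-s}] and
    [s e^{-s}] ([hardy_sixth]); the form has the eigenfunctions [e^{-s}] and
    [(1 - 2 s) e^{-s}], for which 2 and 4 would replace 6, and 4 is the value at
    which the linearized operator degenerates.  The difference of the two sides
    is, up to a factor 3, the integral of a sum of three squares, plus that of the
    derivative of an explicit function that vanishes at both ends thanks to the
    two orthogonality relations.  As 4 < 6, coercivity follows.

    The elements of the completion are only reached through Schwartz functions
    [w n], which need not lie in [V0plus] nor in the orthogonal of [Q].  Each
    identity above is therefore used in the limit: the profiles [chi (w n)] form
    a Cauchy sequence in [L^2] and converge weakly to the profile of [h]
    ([chi_weak]); the projection of [w n] is [J (bar (w n))] ([proj_exists],
    [rpair_Pi0]); the moments tend to 0 instead of vanishing, which costs a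
    little of the constant 6 ([hardy_moments]).  A profile gives a Schwartz
    function once it is cut off at low frequencies by [exp (- e / s)]
    ([flat_J]); the cut-off is removed by Cauchy-Schwarz, uniformly in [n].  The
    orthogonality relations can be exploited because [Q] and [d_s Q] are
    themselves limits of such cut off functions ([soliton_approx]). *)

Set Implicit Arguments.
Unset Strict Implicit.
Unset Printing Implicit Defensive.

Import Order.TTheory GRing.Theory Num.Theory.
Import numFieldNormedType.Exports.

Local Open Scope classical_set_scope.
Local Open Scope ring_scope.
Local Open Scope complex_scope.

Notation Re := complex.Re (only parsing).
Notation Im := complex.Im (only parsing).
Notation normcM := Normc.normcM (only parsing).
Notation "z ^*" := (conjc z) : ring_scope.
Notation "`N z" := (Normc.normc z) (at level 2, z at level 1, format "`N z").

Lemma le_of_eq d (T : porderType d) (x y : T) : x = y -> (x <= y)%O.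
Proof. by move=> ->. Qed.

(** * Complex numbers and complex-valued integrals *)
Section ComplexNumbers.
Context {R : realType}.
Implicit Types (z w : R[i]) (a b : R).

Lemma ReD z w : Re (z + w) = Re z + Re w. Proof. by case: z; case: w. Qed.
Lemma ImD z w : Im (z + w) = Im z + Im w. Proof. by case: z; case: w. Qed.
Lemma ReN z : Re (- z) = - Re z. Proof. by case: z. Qed.
Lemma ImN z : Im (- z) = - Im z. Proof. by case: z. Qed.
Lemma ReM z w : Re (z * w) = Re z * Re w - Im z * Im w.
Proof. by case: z; case: w. Qed.
Lemma ImM z w : Im (z * w) = Re z * Im w + Im z * Re w.
Proof. by case: z => a b; case: w => c d /=; rewrite addrC [b * c]mulrC. Qed.
Lemma ReJ z : Re z^* = Re z. Proof. by case: z. Qed.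
Lemma ImJ z : Im z^* = - Im z. Proof. by case: z. Qed.
Lemma ReC a : Re a%:C = a. Proof. by []. Qed.
Lemma ImC a : Im a%:C = 0. Proof. by []. Qed.
Lemma Re0 : Re (0 : R[i]) = 0. Proof. by []. Qed.
Lemma Im0 : Im (0 : R[i]) = 0. Proof. by []. Qed.
Lemma Re1 : Re (1 : R[i]) = 1. Proof. by []. Qed.
Lemma Im1 : Im (1 : R[i]) = 0. Proof. by []. Qed.
Lemma Rei : Re ('i%C : R[i]) = 0. Proof. by []. Qed.
Lemma Imi : Im ('i%C : R[i]) = 1. Proof. by []. Qed.
Lemma cplxP z w : Re z = Re w -> Im z = Im w -> z = w.
Proof. by case: z => a b; case: w => c d /= -> ->. Qed.

Definition cE := (Rei, Imi, ReD, ImD, ReN, ImN, ReM, ImM, ReJ, ImJ, ReC, ImC,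
  Re0, Im0, Re1, Im1).

Lemma normcE2 z : `N z ^+ 2 = Re z ^+ 2 + Im z ^+ 2.
Proof. by case: z => a b /=; rewrite sqr_sqrtr// addr_ge0// sqr_ge0. Qed.
Lemma normc_ge0 z : 0 <= `N z. Proof. by case: z => a b; rewrite sqrtr_ge0. Qed.
Lemma normcN z : `N (- z) = `N z.
Proof. by case: z => a b /=; rewrite !sqrrN. Qed.
Lemma normcJ z : `N z^* = `N z.
Proof. by case: z => a b /=; rewrite !sqrrN. Qed.
Lemma normcR a : `N a%:C = `|a|.
Proof. by rewrite /= expr0n/= addr0 sqrtr_sqr. Qed.
Lemma normci : `N ('i%C : R[i]) = 1.
Proof. by rewrite /= expr0n/= add0r expr1n sqrtr1. Qed.
Lemma normcX z n : `N (z ^+ n) = `N z ^+ n.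
Proof.
elim: n => [|n IH]; first by rewrite !expr0 Normc.normc1.
by rewrite !exprS normcM IH.
Qed.
Lemma le_normcD z w : `N (z + w) <= `N z + `N w. Proof. exact: le_normcD. Qed.
Lemma le_normcB z w : `N (z - w) <= `N z + `N w.
Proof. by rewrite -(normcN w); exact: le_normcD. Qed.
Lemma normc_Re z : `|Re z| <= `N z.
Proof.
by rewrite -(ler_pXn2r (n := 2))// ?nnegrE ?normc_ge0// normcE2 real_normK ?num_real// lerDl sqr_ge0.
Qed.
Lemma normc_Im z : `|Im z| <= `N z.
Proof.
by rewrite -(ler_pXn2r (n := 2))// ?nnegrE ?normc_ge0// normcE2 real_normK ?num_real// lerDr sqr_ge0.
Qed.
Lemma normc_leD z : `N z <= `|Re z| + `|Im z|.
Proof.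
rewrite -(ler_pXn2r (n := 2))// ?nnegrE ?normc_ge0 ?addr_ge0//.
rewrite normcE2 sqrrD !real_normK ?num_real// lerD2r lerDl.
by rewrite mulrn_wge0// mulr_ge0.
Qed.
Lemma mulcJ z : z * z^* = (`N z ^+ 2)%:C.
Proof. by apply: cplxP; rewrite normcE2 !cE; ring. Qed.
Lemma normc_eq0 z : (`N z == 0) = (z == 0).
Proof. by apply/eqP/eqP => [/Normc.eq0_normc//|->]; rewrite Normc.normc0. Qed.
Lemma normc_cis a : `N (cis a) = 1.
Proof.
apply/eqP; rewrite -(@eqrXn2 _ 2)// ?normc_ge0// normcE2 /= cos2Dsin2.
by rewrite expr1n.
Qed.
Lemma cisD a b : cis (a + b) = cis a * cis b.
Proof. by apply: cplxP; rewrite !cE /= ?cosD ?sinD; ring. Qed.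
Lemma cisN a : cis (- a) = (cis a)^*.
Proof. by rewrite /cis cosN sinN. Qed.
Lemma cis0 : cis (0 : R) = 1.
Proof. by rewrite /cis cos0 sin0. Qed.

End ComplexNumbers.
Arguments Normc.normc : simpl never.

Section ComplexIntegral.
Context {R : realType}.
Context d (T : measurableType d) (mu : {measure set T -> \bar R}).
Implicit Types (u v : T -> R[i]) (f g : T -> R).

Local Notation intble f := (mu.-integrable setT (EFin \o f)).

Lemma cmeasurableD u v : cmeasurable u -> cmeasurable v ->
  cmeasurable (fun x => u x + v x).
Proof.
move=> [u1 u2] [v1 v2]; split.
  by under eq_fun do rewrite ReD; apply: measurable_funD.
by under eq_fun do rewrite ImD; apply: measurable_funD.
Qed.
Lemma cmeasurableN u : cmeasurable u -> cmeasurable (fun x => - u x).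
Proof.
move=> [u1 u2]; split.
  by under eq_fun do rewrite ReN; apply: measurableT_comp => //.
by under eq_fun do rewrite ImN; apply: measurableT_comp => //.
Qed.
Lemma cmeasurableB u v : cmeasurable u -> cmeasurable v ->
  cmeasurable (fun x => u x - v x).
Proof. by move=> mu_ mv; apply: cmeasurableD => //; apply: cmeasurableN. Qed.
Lemma cmeasurableM u v : cmeasurable u -> cmeasurable v ->
  cmeasurable (fun x => u x * v x).
Proof.
move=> [u1 u2] [v1 v2]; split.
  under eq_fun do rewrite ReM.
  by apply: measurable_funB; apply: measurable_funM.
under eq_fun do rewrite ImM.
by apply: measurable_funD; apply: measurable_funM.
Qed.
Lemma cmeasurableJ u : cmeasurable u -> cmeasurable (fun x => (u x)^*).
Proof.
move=> [u1 u2]; split.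
  by under eq_fun do rewrite ReJ.
by under eq_fun do rewrite ImJ; apply: measurableT_comp => //.
Qed.
Lemma cmeasurableC f : measurable_fun setT f -> cmeasurable (fun x => (f x)%:C).
Proof. by move=> mf; split => //=; apply: measurable_cst. Qed.
Lemma cmeasurable_cst (c : R[i]) : cmeasurable (fun _ : T => c).
Proof. by split; apply: measurable_cst. Qed.
Lemma cmeasurable_cis f : measurable_fun setT f -> cmeasurable (fun x => cis (f x)).
Proof.
move=> mf; split => /=.
  by apply: measurableT_comp => //; apply: continuous_measurable_fun; exact: continuous_cos.
by apply: measurableT_comp => //; apply: continuous_measurable_fun; exact: continuous_sin.
Qed.
Lemma cmeasurable_comp d' (T' : measurableType d') (g : T' -> T) u :
  measurable_fun setT g -> cmeasurable u -> cmeasurable (fun x => u (g x)).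
Proof. by move=> mg [u1 u2]; split; [exact: (measurableT_comp u1)|exact: (measurableT_comp u2)]. Qed.
Lemma measurable_normc u : cmeasurable u -> measurable_fun setT (fun x => `N (u x)).
Proof.
move=> [u1 u2]; rewrite (_ : (fun _ => _) = (fun x => Num.sqrt (Re (u x) ^+ 2 + Im (u x) ^+ 2))).
  apply: measurableT_comp; first by apply: continuous_measurable_fun => ?; exact: sqrt_continuous.
  by apply: measurable_funD; apply: measurable_funX.
by apply/funext => x; case: (u x).
Qed.

Lemma intble_le f g : measurable_fun setT f -> (forall x, `|f x| <= g x) ->
  intble g -> intble f.
Proof.
move=> mf fg ig; apply: le_integrable ig => //; first exact/measurable_EFinP.
by move=> x _ /=; rewrite lee_fin (le_trans (fg x))// ler_norm.
Qed.

Lemma cint_dom u g : cmeasurable u -> (forall x, `N (u x) <= g x) ->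
  intble g -> cintegrable mu u.
Proof.
move=> [u1 u2] ug ig; split.
  by apply: intble_le ig => // x; apply: le_trans (ug x); exact: normc_Re.
by apply: intble_le ig => // x; apply: le_trans (ug x); exact: normc_Im.
Qed.

Lemma cint_meas u : cintegrable mu u -> cmeasurable u.
Proof. by move=> [/measurable_int/measurable_EFinP + /measurable_int/measurable_EFinP]. Qed.

Lemma cint_normc u : cintegrable mu u -> intble (fun x => `N (u x)).
Proof.
move=> iu; have [i1 i2] := iu; have m := cint_meas iu.
apply: (@intble_le _ (fun x => `|Re (u x)| + `|Im (u x)|)).
- exact: measurable_normc.
- by move=> x; rewrite ger0_norm ?normc_ge0// normc_leD.
- have := integrableD measurableT (integrable_abse i1) (integrable_abse i2).
  by apply: eq_integrable.
Qed.

Lemma intbleD f g : intble f -> intble g -> intble (fun x => f x + g x).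
Proof. by move=> f1 g1; have := integrableD measurableT f1 g1; apply: eq_integrable. Qed.
Lemma intbleB f g : intble f -> intble g -> intble (fun x => f x - g x).
Proof. by move=> f1 g1; have := integrableB measurableT f1 g1; apply: eq_integrable. Qed.
Lemma intbleZ k f : intble f -> intble (fun x => k * f x).
Proof. by move=> f1; have := integrableZl measurableT k f1; apply: eq_integrable. Qed.

Lemma cintD u v : cintegrable mu u -> cintegrable mu v ->
  cintegrable mu (fun x => u x + v x).
Proof.
move=> iu iv; apply: (@cint_dom _ (fun x => `N (u x) + `N (v x))).
- by apply: cmeasurableD; exact: cint_meas.
- by move=> x; exact: le_normcD.
- by apply: intbleD; exact: cint_normc.
Qed.
Lemma cintZ c u : cintegrable mu u -> cintegrable mu (fun x => c * u x).
Proof.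
move=> iu; apply: (@cint_dom _ (fun x => `N c * `N (u x))).
- by apply: cmeasurableM; [exact: cmeasurable_cst|exact: cint_meas].
- by move=> x; rewrite normcM.
- by apply: intbleZ; exact: cint_normc.
Qed.
Lemma cintN u : cintegrable mu u -> cintegrable mu (fun x => - u x).
Proof. by move=> /(cintZ (-1)); under eq_fun do rewrite mulN1r. Qed.
Lemma cintB u v : cintegrable mu u -> cintegrable mu v ->
  cintegrable mu (fun x => u x - v x).
Proof. by move=> iu iv; apply: cintD => //; exact: cintN. Qed.
Lemma cintJ u : cintegrable mu u -> cintegrable mu (fun x => (u x)^*).
Proof.
move=> iu; apply: (@cint_dom _ (fun x => `N (u x))).
- by apply: cmeasurableJ; exact: cint_meas.
- by move=> x; rewrite normcJ.
- exact: cint_normc.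
Qed.
Lemma cint0 : cintegrable mu (fun=> 0).
Proof. by split; exact: integrable0. Qed.

Lemma eq_cintegral u v : u =1 v -> cintegral mu u = cintegral mu v.
Proof. by move=> /funext ->. Qed.

Lemma cintegralD u v : cintegrable mu u -> cintegrable mu v ->
  cintegral mu (fun x => u x + v x) = cintegral mu u + cintegral mu v.
Proof.
move=> [u1 u2] [v1 v2]; rewrite /cintegral.
by apply: cplxP; rewrite !cE /= -RintegralD//;
  apply: eq_Rintegral => x _; rewrite !cE.
Qed.

Lemma cintegralZ c u : cintegrable mu u ->
  cintegral mu (fun x => c * u x) = c * cintegral mu u.
Proof.
move=> [u1 u2]; apply: cplxP; rewrite !cE /=.
  by rewrite -!RintegralZl// -RintegralB//; [apply: eq_Rintegral => x _; rewrite !cE|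
   exact: intbleZ|exact: intbleZ].
by rewrite -!RintegralZl// -RintegralD//; [apply: eq_Rintegral => x _; rewrite !cE|
   exact: intbleZ|exact: intbleZ].
Qed.
Lemma cintegralN u : cintegrable mu u ->
  cintegral mu (fun x => - u x) = - cintegral mu u.
Proof. by move=> iu; rewrite -mulN1r -cintegralZ//; apply: eq_cintegral => x; rewrite mulN1r. Qed.
Lemma cintegralB u v : cintegrable mu u -> cintegrable mu v ->
  cintegral mu (fun x => u x - v x) = cintegral mu u - cintegral mu v.
Proof. by move=> iu iv; rewrite cintegralD// ?cintegralN//; exact: cintN. Qed.
Lemma cintegralJ u : cintegrable mu u ->
  cintegral mu (fun x => (u x)^*) = (cintegral mu u)^*.
Proof.
move=> [u1 u2]; apply: cplxP; rewrite !cE /=; first by apply: eq_Rintegral => x _; rewrite cE.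
by rewrite -[RHS]mulN1r -RintegralZl//; apply: eq_Rintegral => x _; rewrite cE mulN1r.
Qed.
Lemma cintegral0 : cintegral mu (fun=> 0) = 0.
Proof.
by rewrite /cintegral /Rintegral /= !integral0_eq// fine0.
Qed.
Lemma cintegralC f : cintegral mu (fun x => (f x)%:C) = (Rintegral mu setT f)%:C.
Proof. by rewrite /cintegral /= /Rintegral [X in _ +i* fine X]integral0_eq. Qed.

Lemma Rint_ge0 f : (forall x, 0 <= f x) -> 0 <= Rintegral mu setT f.
Proof. by move=> f0; apply: Rintegral_ge0. Qed.
Lemma Rint_le f g : intble f -> intble g -> (forall x, f x <= g x) ->
  Rintegral mu setT f <= Rintegral mu setT g.
Proof. by move=> f1 g1 fg; apply: le_Rintegral. Qed.

(** The modulus of an integral is reached by rotating the integrand so that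
    its integral becomes real. *)
Lemma normc_cintegral u : cintegrable mu u ->
  `N (cintegral mu u) <= Rintegral mu setT (fun x => `N (u x)).
Proof.
move=> iu; set c := cintegral mu u.
have [c0|c0] := eqVneq (`N c) 0; first by rewrite c0 Rint_ge0// => x; exact: normc_ge0.
have cp : 0 < `N c by rewrite lt0r c0 normc_ge0.
rewrite -(ler_pM2l cp) -expr2.
have -> : `N c ^+ 2 = Re (c^* * c) by rewrite mulrC mulcJ.
rewrite -cintegralZ// /= -RintegralZl//; last exact: cint_normc.
apply: Rint_le; [exact: (cintZ _ iu).1|by apply: intbleZ; exact: cint_normc|].
move=> x; rewrite -(normcJ c) -normcM.
exact: le_trans (ler_norm _) (normc_Re _).
Qed.

Lemma normc_cintegral_le u g : cmeasurable u -> (forall x, `N (u x) <= g x) ->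
  intble g -> `N (cintegral mu u) <= Rintegral mu setT g.
Proof.
move=> mu_ ug ig; have iu := cint_dom mu_ ug ig.
apply: le_trans (normc_cintegral iu) _.
by apply: Rint_le => //; exact: cint_normc.
Qed.

Lemma Rint_dct (f_ : nat -> T -> R) f g :
  (forall n, measurable_fun setT (f_ n)) -> measurable_fun setT f ->
  (forall x, f_ ^~ x @ \oo --> f x) -> intble g ->
  (forall n x, `|f_ n x| <= g x) ->
  intble f /\ Rintegral mu setT (f_ n) @[n --> \oo] --> Rintegral mu setT f.
Proof.
move=> mf_ mf cvgf ig fg.
have cvgf' x : (f_ n x)%:E @[n --> \oo] --> (f x)%:E.
  by apply: cvg_EFin => //; [exact: nearW|exact: cvgf].
have [i1 _ i3] := @dominated_convergence _ _ _ mu setT measurableT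
   (fun n x => (f_ n x)%:E) (EFin \o f) (EFin \o g)
   (fun n => (@measurable_EFinP _ _ _ _ (f_ n)).2 (mf_ n))
   ((@measurable_EFinP _ _ _ _ f).2 mf)
   (aeW mu (fun x _ => cvgf' x)) ig
   (aeW mu (fun x n _ => fg n x)).
split => //; apply: fine_cvg => //.
by rewrite /Rintegral fineK//; exact: integrable_fin_num.
Qed.

(** Convergence of complex sequences is reduced to that of real moduli. *)
Definition ccvg (z_ : nat -> R[i]) (z : R[i]) :=
  (fun n => `N (z_ n - z)) @ \oo --> (0 : R).

Lemma cvg_le0 (a_ b_ : nat -> R) : (forall n, 0 <= a_ n <= b_ n) ->
  b_ @ \oo --> (0 : R) -> a_ @ \oo --> (0 : R).
Proof.
move=> ab b0; apply: (@squeeze_cvgr _ _ _ _ (fun=> 0) b_) => //.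
  by apply: nearW => n.
exact: cvg_cst.
Qed.

Lemma ccvgP z_ z : ccvg z_ z <->
  ((fun n => Re (z_ n)) @ \oo --> Re z /\ (fun n => Im (z_ n)) @ \oo --> Im z).
Proof.
split => [h|[h1 h2]].
  split; apply/cvgrPdist_lt => e e0; have /cvgrPdist_lt/(_ _ e0) [N _ HN] := h; exists N => // n /HN;
  rewrite sub0r normrN => /(le_lt_trans (ler_norm _)); apply: le_lt_trans.
    by rewrite -normrN opprB -ReN -ReD normc_Re.
  by rewrite -normrN opprB -ImN -ImD normc_Im.
apply: (@cvg_le0 _ (fun n => `|Re (z_ n) - Re z| + `|Im (z_ n) - Im z|)).
  by move=> n; rewrite normc_ge0/= -!ReN -!ImN -ReD -ImD normc_leD.
rewrite -[0]addr0; apply: cvgD.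
  by rewrite -[X in _ --> X](normr0 R); apply: cvg_norm; apply/subr_cvg0.
by rewrite -[X in _ --> X](normr0 R); apply: cvg_norm; apply/subr_cvg0.
Qed.

Lemma ccvg_unique z_ z w : ccvg z_ z -> ccvg z_ w -> z = w.
Proof.
move=> /ccvgP[a1 a2] /ccvgP[b1 b2]; apply: cplxP.
  by have := cvg_unique _ a1 b1; apply.
by have := cvg_unique _ a2 b2; apply.
Qed.

Lemma cint_dct (u_ : nat -> T -> R[i]) u g :
  (forall n, cmeasurable (u_ n)) -> cmeasurable u ->
  (forall x, ccvg (u_ ^~ x) (u x)) -> intble g ->
  (forall n x, `N (u_ n x) <= g x) ->
  cintegrable mu u /\ ccvg (fun n => cintegral mu (u_ n)) (cintegral mu u).
Proof.
move=> mu_ [mu1 mu2] cu ig ug.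
have [a1 a2] := @Rint_dct (fun n x => Re (u_ n x)) (fun x => Re (u x)) g
  (fun n => (mu_ n).1) mu1 (fun x => ((ccvgP _ _).1 (cu x)).1) ig
  (fun n x => le_trans (normc_Re _) (ug n x)).
have [b1 b2] := @Rint_dct (fun n x => Im (u_ n x)) (fun x => Im (u x)) g
  (fun n => (mu_ n).2) mu2 (fun x => ((ccvgP _ _).1 (cu x)).2) ig
  (fun n x => le_trans (normc_Im _) (ug n x)).
by split => //; apply/ccvgP.
Qed.

End ComplexIntegral.

Notation intble mu f := ((mu : {measure set _ -> \bar _}).-integrable setT (EFin \o f)).

(** * Square integrable functions *)
Section L2.
Context {R : realType}.
Context d (T : measurableType d) (mu : {measure set T -> \bar R}).
Implicit Types (u v : T -> R[i]) (f g : T -> R).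

Lemma intble_sqM f g : measurable_fun setT f -> measurable_fun setT g ->
  intble mu (fun x => f x ^+ 2) -> intble mu (fun x => g x ^+ 2) ->
  intble mu (fun x => f x * g x).
Proof.
move=> mf mg f2 g2; apply: (@intble_le _ _ _ _ _ (fun x => f x ^+ 2 + g x ^+ 2)).
- exact: measurable_funM.
- move=> x; rewrite normrM -(real_normK (num_real (f x))) -(real_normK (num_real (g x))).
  by have := sqr_ge0 (`|f x| - `|g x|); have := normr_ge0 (f x); have := normr_ge0 (g x); nra.
- exact: intbleD.
Qed.

(** Cauchy-Schwarz, from the discriminant of [t |-> \int (f + t g)^2]. *)
Lemma CauchySchwarz f g : measurable_fun setT f -> measurable_fun setT g ->
  intble mu (fun x => f x ^+ 2) -> intble mu (fun x => g x ^+ 2) ->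
  Rintegral mu setT (fun x => f x * g x) ^+ 2 <=
  Rintegral mu setT (fun x => f x ^+ 2) * Rintegral mu setT (fun x => g x ^+ 2).
Proof.
move=> mf mg f2 g2; have fg := intble_sqM mf mg f2 g2.
set a := Rintegral _ _ (fun x => f x ^+ 2); set c := Rintegral _ _ (fun x => g x ^+ 2).
set b := Rintegral _ _ _.
have a0 : 0 <= a by apply: Rint_ge0 => x; exact: sqr_ge0.
have c0 : 0 <= c by apply: Rint_ge0 => x; exact: sqr_ge0.
have key s t : 0 <= s ^+ 2 * a - (2 * s * t) * b + t ^+ 2 * c.
  rewrite -!RintegralZl// -RintegralB//; [|exact: intbleZ|exact: intbleZ].
  rewrite -RintegralD//; [|by apply: intbleB; exact: intbleZ|exact: intbleZ].
  apply: Rint_ge0 => x.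
  rewrite (_ : _ + _ = (s * f x - t * g x) ^+ 2) ?sqr_ge0//; ring.
have [c00|c00] := eqVneq c 0.
  have [->|b0] := eqVneq b 0; first by rewrite expr0n/= c00 mulr0.
  have := key 1 ((a + 1) / b); rewrite c00 !mulr0 addr0 expr1n mul1r mulr1.
  by rewrite -mulrA divfK// => h; lra.
have cp : 0 < c by rewrite lt0r c00.
have := key c b.
rewrite (_ : _ + _ = c * (a * c - b ^+ 2)); last by ring.
by rewrite pmulr_rge0// subr_ge0.
Qed.

Lemma normc2_meas u : cmeasurable u -> measurable_fun setT (fun x => `N (u x) ^+ 2).
Proof. by move=> mu_; apply: measurable_funX; exact: measurable_normc. Qed.

Lemma cint_sqM u v : cmeasurable u -> cmeasurable v ->
  intble mu (fun x => `N (u x) ^+ 2) -> intble mu (fun x => `N (v x) ^+ 2) ->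
  cintegrable mu (fun x => u x * v x).
Proof.
move=> mu_ mv u2 v2; apply: (@cint_dom _ _ _ _ _ (fun x => `N (u x) * `N (v x))).
- exact: cmeasurableM.
- by move=> x; rewrite normcM.
- by apply: intble_sqM => //; exact: measurable_normc.
Qed.

Lemma CauchySchwarzC u v : cmeasurable u -> cmeasurable v ->
  intble mu (fun x => `N (u x) ^+ 2) -> intble mu (fun x => `N (v x) ^+ 2) ->
  `N (cintegral mu (fun x => u x * v x)) ^+ 2 <=
  Rintegral mu setT (fun x => `N (u x) ^+ 2) * Rintegral mu setT (fun x => `N (v x) ^+ 2).
Proof.
move=> mu_ mv u2 v2.
apply: le_trans (CauchySchwarz (measurable_normc mu_) (measurable_normc mv) u2 v2).
rewrite ler_pXn2r// ?nnegrE ?normc_ge0//; last first.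
  by apply: Rint_ge0 => x; rewrite mulr_ge0 ?normc_ge0.
apply: normc_cintegral_le; first exact: cmeasurableM.
  by move=> x; rewrite normcM.
by apply: intble_sqM => //; exact: measurable_normc.
Qed.

Lemma normcD2 (z w : R[i]) : `N (z + w) ^+ 2 <= 2 * `N z ^+ 2 + 2 * `N w ^+ 2.
Proof.
rewrite !normcE2 !cE; have := sqr_ge0 (Re z - Re w).
by have := sqr_ge0 (Im z - Im w); nra.
Qed.

Lemma intble_sqD u v : cmeasurable u -> cmeasurable v ->
  intble mu (fun x => `N (u x) ^+ 2) -> intble mu (fun x => `N (v x) ^+ 2) ->
  intble mu (fun x => `N (u x + v x) ^+ 2).
Proof.
move=> mu_ mv u2 v2.
apply: (@intble_le _ _ _ _ _ (fun x => 2 * `N (u x) ^+ 2 + 2 * `N (v x) ^+ 2)).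
- by apply: normc2_meas; exact: cmeasurableD.
- by move=> x; rewrite ger0_norm ?sqr_ge0// normcD2.
- by apply: intbleD; exact: intbleZ.
Qed.

(** Fatou's lemma turns uniform bounds on the integrals into integrability of
    the limit; a dominating function is not available when cut-offs are removed. *)
Lemma Rint_fatou (f_ : nat -> T -> R) f M :
  (forall n, intble mu (f_ n)) -> measurable_fun setT f ->
  (forall n x, 0 <= f_ n x) ->
  (forall x, f_ ^~ x @ \oo --> f x) ->
  (forall n, Rintegral mu setT (f_ n) <= M) ->
  intble mu f /\ Rintegral mu setT f <= M.
Proof.
move=> if_ mf f0 cf fM.
have f00 x : 0 <= f x.
  by have /cvg_lim <- := cf x => //; apply: limr_ge; [apply/cvg_ex; exists (f x); exact: cf|exact: nearW].
have key : (\int[mu]_x (f x)%:E <= M%:E)%E.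
  have -> : (\int[mu]_x (f x)%:E = \int[mu]_x limn_einf (fun n => (f_ n x)%:E))%E.
    apply: eq_integral => x _.
    have /cvg_limn_einf_sup[-> _]// : (fun n => (f_ n x)%:E) @ \oo --> (f x)%:E.
    by apply: cvg_EFin; [exact: nearW|exact: cf].
  apply: le_trans (@fatou _ _ _ mu setT measurableT (fun n x => (f_ n x)%:E) _ _) _.
  - by move=> n; exact: measurable_int (if_ n).
  - by move=> n x _; rewrite lee_fin.
  rewrite limn_einf_lim; apply: lime_le; first exact: is_cvg_einfs.
  apply: nearW => n; apply: (@le_trans _ _ (\int[mu]_x (f_ n x)%:E)%E).
    by apply: ereal_inf_lbound; exists n => /=.
  have := fM n; rewrite /Rintegral -lee_fin fineK//.
  by apply: integrable_fin_num => //; exact: if_.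
have fi : intble mu f.
  apply/integrableP; split; first exact/measurable_EFinP.
  rewrite (eq_integral (EFin \o f)); last by move=> x _ /=; rewrite ger0_norm.
  by apply: le_lt_trans key _; rewrite ltry.
split => //; rewrite -lee_fin /Rintegral fineK//.
exact: integrable_fin_num.
Qed.

End L2.

(** * Product measures *)
Section ProductIntegrals.
Context {R : realType} d1 d2 (T1 : measurableType d1) (T2 : measurableType d2).
Variables (m1 : {sigma_finite_measure set T1 -> \bar R})
          (m2 : {sigma_finite_measure set T2 -> \bar R}).

Lemma sigma_finite_prod : sigma_finite setT (m1 \x m2)%E.
Proof.
have /sigma_finiteP[F [TF ndF Foo]] := sigma_finiteT m1.
have /sigma_finiteP[G [TG ndG Goo]] := sigma_finiteT m2.
exists (fun n => F n `*` G n) => [|k]; last first.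
  have [mF Fk] := Foo k; have [mG Gk] := Goo k; split; first exact: measurableX.
  by rewrite product_measure1E// lte_mul_pinfty// ge0_fin_numE.
apply/seteqP; split => // -[x y] _.
have [[i _ Fi] [j _ Gj]] : (\bigcup_n F n) x /\ (\bigcup_n G n) y by rewrite -TF -TG.
exists (maxn i j) => //; split => /=.
  by apply: subsetPset (ndF _ _ (leq_maxl i j)) _ Fi.
by apply: subsetPset (ndG _ _ (leq_maxr i j)) _ Gj.
Qed.

(** Iterating products requires the sigma-finiteness of the product to be part
    of the measure. *)
Definition prod_sf : {sigma_finite_measure set (T1 * T2)%type -> \bar R} :=
  HB.pack (m1 \x m2)%E (Measure_isSigmaFinite.Build _ _ _ (m1 \x m2)%E sigma_finite_prod).

Lemma intble_prod (a : T1 -> R) (b : T2 -> R) : intble m1 a -> intble m2 b ->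
  intble (m1 \x m2)%E (fun p => a p.1 * b p.2).
Proof.
move=> ia ib.
have ma : measurable_fun setT a by move/measurable_int/measurable_EFinP: ia.
have mb : measurable_fun setT b by move/measurable_int/measurable_EFinP: ib.
apply/integrable12ltyP.
  by apply/measurable_EFinP; apply: measurable_funM; apply: measurableT_comp.
under eq_integral => x _.
  rewrite (_ : (\int[m2]_y _ = (`|a x| * Rintegral m2 setT (fun y => `|b y|))%:E)%E); last first.
    rewrite /= (eq_integral (fun y => `|a x|%:E * (`|b y|)%:E)%E); last first.
      by move=> y _; rewrite /= normrM.
    rewrite ge0_integralZl//; last by apply/measurable_EFinP; exact: measurableT_comp.
    rewrite EFinM /Rintegral fineK//.
    apply: integrable_fin_num => //; have := integrable_abse ib.
    by apply: eq_integrable.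
  over.
have iab : intble m1 (fun x => `|a x|).
  by have := integrable_abse ia; apply: eq_integrable.
have := intbleZ (Rintegral m2 setT (fun y => `|b y|)) iab.
move=> /(integrable_lty measurableT); apply: le_lt_trans.
by apply: le_of_eq; apply: eq_integral => x _ /=; rewrite mulrC.
Qed.

Variables (K : T1 * T2 -> R[i]) (a : T1 -> R) (b : T2 -> R).
Hypotheses (mK : cmeasurable K) (Kab : forall p, `N (K p) <= a p.1 * b p.2)
  (ia : intble m1 a) (ib : intble m2 b).

Lemma cint_prod : cintegrable (m1 \x m2)%E K.
Proof. by apply: cint_dom Kab _ => //; exact: intble_prod. Qed.

Lemma cint_sec1 x : cintegrable m2 (fun y => K (x, y)).
Proof.
apply: (@cint_dom _ _ _ _ _ (fun y => a x * b y)) => //; last exact: intbleZ.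
by apply: cmeasurable_comp mK => //; exact: measurable_pair1.
Qed.
Lemma cint_sec2 y : cintegrable m1 (fun x => K (x, y)).
Proof.
apply: (@cint_dom _ _ _ _ _ (fun x => b y * a x)) => //; last exact: intbleZ.
  by apply: cmeasurable_comp mK => //; exact: measurable_pair2.
by move=> x; rewrite mulrC; exact: (Kab (x, y)).
Qed.

Lemma cmeas_sec1 : cmeasurable (fun x => cintegral m2 (fun y => K (x, y))).
Proof.
have [i1 i2] := cint_prod; split => /=.
  have := measurable_fubini_F i1; by apply: measurableT_comp; exact: fine_measurable.
have := measurable_fubini_F i2; by apply: measurableT_comp; exact: fine_measurable.
Qed.
Lemma cmeas_sec2 : cmeasurable (fun y => cintegral m1 (fun x => K (x, y))).
Proof.
have [i1 i2] := cint_prod; split => /=.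
  have := measurable_fubini_G i1; by apply: measurableT_comp; exact: fine_measurable.
have := measurable_fubini_G i2; by apply: measurableT_comp; exact: fine_measurable.
Qed.

Lemma cfubini1 : cintegral m1 (fun x => cintegral m2 (fun y => K (x, y))) =
  cintegral (m1 \x m2)%E K.
Proof.
have [i1 i2] := cint_prod; rewrite /cintegral /=; congr (_ +i* _).
  rewrite /Rintegral -(integral12_prod_meas1 i1); congr fine.
  apply: eq_integral => x _; rewrite /fubini_F /= fineK//.
  by apply: integrable_fin_num => //; exact: (cint_sec1 x).1.
rewrite /Rintegral -(integral12_prod_meas1 i2); congr fine.
apply: eq_integral => x _; rewrite /fubini_F /= fineK//.
by apply: integrable_fin_num => //; exact: (cint_sec1 x).2.
Qed.
Lemma cfubini2 : cintegral m2 (fun y => cintegral m1 (fun x => K (x, y))) =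
  cintegral (m1 \x m2)%E K.
Proof.
have [i1 i2] := cint_prod; rewrite /cintegral /=; congr (_ +i* _).
  rewrite /Rintegral -(integral21_prod_meas1 i1); congr fine.
  apply: eq_integral => x _; rewrite /fubini_G /= fineK//.
  by apply: integrable_fin_num => //; exact: (cint_sec2 x).1.
rewrite /Rintegral -(integral21_prod_meas1 i2); congr fine.
apply: eq_integral => x _; rewrite /fubini_G /= fineK//.
by apply: integrable_fin_num => //; exact: (cint_sec2 x).2.
Qed.
Lemma cfubini : cintegral m1 (fun x => cintegral m2 (fun y => K (x, y))) =
  cintegral m2 (fun y => cintegral m1 (fun x => K (x, y))).
Proof. by rewrite cfubini1 cfubini2. Qed.

Lemma cint_iter2 : cintegrable m2 (fun y => cintegral m1 (fun x => K (x, y))).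
Proof.
apply: (@cint_dom _ _ _ _ _ (fun x => Rintegral m1 setT a * b x)); last exact: intbleZ.
  exact: cmeas_sec2.
move=> y; rewrite mulrC -RintegralZl//.
apply: normc_cintegral_le; [exact: cint_meas (cint_sec2 y)| |exact: intbleZ].
by move=> x; rewrite mulrC; exact: (Kab (x, y)).
Qed.

End ProductIntegrals.

(** * Integrals and derivatives on the line *)
Section LineIntegrals.
Context {R : realType}.
Local Notation leb := (@lebesgue_measure R).
Local Notation R1 := (measurableTypeR R).
Local Notation Rint := (Rintegral leb setT).
Implicit Types (f F : R -> R) (u : R -> R[i]).

(** Translations and reflections are treated together: all that matters is that
    they preserve the measure. *)
Lemma Rint_preserving (g : R1 -> R1) f : measurable_fun setT g ->
  (forall A, measurable A -> leb A = pushforward leb g A) -> intble leb f ->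
  intble leb (f \o g) /\ Rint (f \o g) = Rint f.
Proof.
move=> mg hg fi; have mE := measurable_int _ fi.
have mf : measurable_fun setT f by move/measurable_EFinP: mE.
pose phi : {mfun R1 >-> R1} := @mfun_Sub _ _ R1 R1 _ (mem_set mg).
have E (h : R1 -> \bar R) : (\int[leb]_x h x = \int[pushforward leb phi]_x h x)%E.
  by apply: eq_measure_integral => A mA _; exact: hg.
have ig : intble leb (f \o g).
  apply/integrableP; split; first by apply/measurable_EFinP; exact: (measurableT_comp mf mg).
  move/integrableP : (fi) => [_]; apply: le_lt_trans.
  have := @ge0_integral_pushforward _ _ _ _ R _ mg leb setT (fun x => `|f x|%:E) measurableT.
  rewrite preimage_setT /= => <-//; first by rewrite [leRHS]E.
  by apply/measurable_EFinP; exact: measurableT_comp.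
split=> //; rewrite /Rintegral; congr fine; rewrite [RHS]E.
by have := @integral_pushforward _ _ _ _ R _ mg leb setT (EFin \o f) mE; rewrite preimage_setT => ->.
Qed.

Lemma Rint_translate f (a : R) : intble leb f ->
  intble leb (fun x => f (x + a)) /\ Rint (fun x => f (x + a)) = Rint f.
Proof.
have mg : @measurable_fun _ _ R1 R1 setT (fun x => x + a) by exact: measurable_funD.
apply: (Rint_preserving mg) => A mA.
pose phi : {mfun R1 >-> R1} := @mfun_Sub _ _ R1 R1 _ (mem_set mg).
apply: (@lebesgue_measure_unique R (pushforward leb phi)) => //.
move=> X [[x y] _ <-].
rewrite /= /pushforward.
have -> : (fun x0 : R => x0 + a) @^-1` `]x, y] = `](x - a), (y - a)]%classic.
  by apply/seteqP; split => z /=; rewrite !in_itv/= ltrBlDr lerBrDr.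
rewrite !lebesgue_measure_itv/= !lte_fin ltrD2r; case: ifPn => // _.
by rewrite -!EFinD; congr (_%:E); ring.
Qed.

Lemma Rint_reflect f : intble leb f ->
  intble leb (fun x => f (- x)) /\ Rint (fun x => f (- x)) = Rint f.
Proof.
have mg : @measurable_fun _ _ R1 R1 setT (fun x => - x) by exact: measurableT_comp.
apply: (Rint_preserving mg) => A mA.
pose phi : {mfun R1 >-> R1} := @mfun_Sub _ _ R1 R1 _ (mem_set mg).
apply: (@lebesgue_measure_unique R (pushforward leb phi)) => //.
move=> X [[x y] _ <-].
rewrite /= /pushforward.
have -> : (fun x0 : R => - x0) @^-1` `]x, y] = `[(- y), (- x)[%classic.
  by apply/seteqP; split => z /=; rewrite !in_itv/= ltrNr lerNl andbC.
rewrite !lebesgue_measure_itv/= !lte_fin ltrN2; case: ifPn => // _.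
by rewrite -!EFinD; congr (_%:E); ring.
Qed.

Lemma cintegral_translate u (a : R) : cintegrable leb u ->
  cintegral leb (fun x => u (x + a)) = cintegral leb u.
Proof.
move=> [i1 i2]; rewrite /cintegral.
by rewrite (Rint_translate a i1).2 (Rint_translate a i2).2.
Qed.

Lemma FTC_segment f F (a b : R) : a < b ->
  (forall x, a <= x <= b -> {for x, continuous f}) ->
  (forall x, a <= x <= b -> is_derive x 1 F (f x)) ->
  intble leb (fun x => f x * \1_`[a, b] x) /\
  Rint (fun x => f x * \1_`[a, b] x) = F b - F a.
Proof.
move=> ab cf dF.
have cfw : {within `[a, b], continuous f}.
  by apply: continuous_in_subspaceT => x /set_mem /=; rewrite in_itv/= => /cf.
have fE : (fun x => f x * \1_`[a, b] x) = f \_ `[a, b].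
  by apply/funext => x; rewrite patchE indicE; case: ifPn; rewrite ?mulr1 ?mulr0.
have ifab : leb.-integrable `[a, b] (EFin \o f).
  by apply: continuous_compact_integrable => //; exact: segment_compact.
split.
  rewrite fE -restrict_EFin; apply/integrable_restrict => //=; by rewrite setTI.
rewrite fE -Rintegral_mkcond /Rintegral (@continuous_FTC2 R f F a b) //=.
- split.
  + by move=> x; rewrite in_itv/= => /andP[/ltW ax /ltW xb]; have [] := dF x; rewrite ?ax.
  + apply: cvg_at_right_filter; apply: differentiable_continuous; apply/derivable1_diffP.
    by have [] := dF a; rewrite ?lexx ?ltW.
  + apply: cvg_at_left_filter; apply: differentiable_continuous; apply/derivable1_diffP.
    by have [] := dF b; rewrite ?lexx ?ltW.
- move=> x; rewrite in_itv/= => /andP[/ltW ax /ltW xb]; rewrite derive1E.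
  by have [|_ ->] := dF x; rewrite ?ax.
Qed.

(** The fundamental theorem of calculus on a half-line, by exhausting it with
    segments; the boundary value at infinity is read along integers. *)
Lemma FTC_halfline f F (a l : R) :
  (forall x, a <= x -> {for x, continuous f}) ->
  (forall x, a <= x -> is_derive x 1 F (f x)) ->
  intble leb (fun x => f x * \1_`[a, +oo[ x) ->
  F (a + n.+1%:R) @[n --> \oo] --> l ->
  Rint (fun x => f x * \1_`[a, +oo[ x) = l - F a.
Proof.
move=> cf dF fi Fl.
have an n : a < a + n.+1%:R by rewrite ltrDl.
have seg n := @FTC_segment f F a (a + n.+1%:R) (an n)
   (fun x ax => cf x (proj1 (andP ax))) (fun x ax => dF x (proj1 (andP ax))).
have mfi : measurable_fun setT (fun x => f x * \1_`[a, +oo[ x).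
  by move/measurable_int/measurable_EFinP : fi.
have := @Rint_dct _ _ _ leb (fun n x => f x * \1_`[a, (a + n.+1%:R)] x) _ _ _ mfi.
move=> /(_ (fun x => `|f x * \1_`[a, +oo[ x|)) [| | | |_].
- by move=> n; have [/measurable_int/measurable_EFinP] := seg n.
- move=> x; apply: cvg_near_cst.
  have [N Nx] : exists N : nat, x <= a + N.+1%:R.
    exists (Num.truncn `|x - a|); rewrite -lerBlDl (le_trans (ler_norm _))//.
    by apply/ltW; rewrite truncnS_gt.
  exists N => // n /= Nn; rewrite !indicE; congr (f x * (nat_of_bool _)%:R).
  apply/idP/idP => /set_mem /=; rewrite ?in_itv/= ?andbT => h; apply/mem_set => /=;
    rewrite in_itv/= ?andbT; first by case/andP: h.
  by rewrite h (le_trans Nx)// lerD2l ler_nat.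
- by have := integrable_abse fi; apply: eq_integrable.
- move=> n x; rewrite !normrM ler_wpM2l// !indicE !normr_nat ler_nat.
  case: (boolP (x \in `[a, (a + n.+1%:R)]%classic)) => //= /set_mem/=.
  by rewrite in_itv/= => /andP[ax _]; rewrite mem_set//= in_itv/= ax.
under eq_fun do rewrite (seg _).2.
move=> h1; have h2 : F (a + n.+1%:R) - F a @[n --> \oo] --> l - F a.
  by apply: cvgB => //; exact: cvg_cst.
by have := cvg_unique _ h1 h2; apply.
Qed.

Lemma FTC_line f F (l m : R) : continuous f -> (forall x : R, is_derive x 1 F (f x)) ->
  intble leb f ->
  F (n.+1%:R) @[n --> \oo] --> l -> F (- n.+1%:R) @[n --> \oo] --> m ->
  Rint f = l - m.
Proof.
move=> cf dF fi Fl Fm.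
have an n : (- n.+1%:R : R) < n.+1%:R by rewrite (@lt_trans _ _ 0)// oppr_lt0.
have seg n := @FTC_segment f F _ _ (an n)
   (fun x _ => cf x) (fun x _ => dF x).
have mfi : measurable_fun setT f by move/measurable_int/measurable_EFinP : fi.
have := @Rint_dct _ _ _ leb (fun n x => f x * \1_`[(- n.+1%:R), n.+1%:R] x) f (fun x => `|f x|).
move=> [| | | | |_].
- by move=> n; have [/measurable_int/measurable_EFinP] := seg n.
- by [].
- move=> x; apply: cvg_near_cst.
  exists (Num.truncn `|x|) => // n /= Nn; rewrite indicE mem_set ?mulr1//= in_itv/=.
  rewrite -ler_norml (@le_trans _ _ ((Num.truncn `|x|).+1%:R))// ?ler_nat//.
  by apply/ltW; rewrite truncnS_gt.
- by have := integrable_abse fi; apply: eq_integrable.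
- by move=> n x; rewrite normrM ler_piMr// indicE normr_nat lern1 leq_b1.
under eq_fun do rewrite (seg _).2.
move=> h1; have h2 : F n.+1%:R - F (- n.+1%:R) @[n --> \oo] --> l - m by exact: cvgB.
by have := cvg_unique _ h1 h2; apply.
Qed.

End LineIntegrals.

Section Derivatives.
Context {R : realType}.

Definition hasder (V : normedModType R) (u : V -> R[i]) (p v : V) (l : R[i]) : Prop :=
  is_derive p v (fun q => Re (u q)) (Re l) /\
  is_derive p v (fun q => Im (u q)) (Im l).

Section rules.
Variable V : normedModType R.
Implicit Types (u w : V -> R[i]) (p v : V).

Lemma hasder_eq u p v l l' : hasder u p v l -> l = l' -> hasder u p v l'.
Proof. by move=> h <-. Qed.
Lemma hasder_cst c p v : hasder (fun=> c) p v 0.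
Proof. by split; exact: is_derive_cst. Qed.
Lemma hasderD u w p v l m : hasder u p v l -> hasder w p v m ->
  hasder (fun q => u q + w q) p v (l + m).
Proof.
move=> [u1 u2] [w1 w2]; split; rewrite !cE.
  by under eq_fun do rewrite ReD; exact: is_deriveD.
by under eq_fun do rewrite ImD; exact: is_deriveD.
Qed.
Lemma hasderN u p v l : hasder u p v l -> hasder (fun q => - u q) p v (- l).
Proof.
move=> [u1 u2]; split; rewrite !cE.
  by under eq_fun do rewrite ReN; exact: is_deriveN.
by under eq_fun do rewrite ImN; exact: is_deriveN.
Qed.
Lemma hasderJ u p v l : hasder u p v l -> hasder (fun q => (u q)^*) p v l^*.
Proof.
move=> [u1 u2]; split; rewrite !cE.
  by under eq_fun do rewrite ReJ.
by under eq_fun do rewrite ImJ; exact: is_deriveN.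
Qed.
Lemma hasderM u w p v l m : hasder u p v l -> hasder w p v m ->
  hasder (fun q => u q * w q) p v (l * w p + u p * m).
Proof.
move=> [u1 u2] [w1 w2]; split; rewrite !cE.
  under eq_fun do rewrite ReM.
  apply: (is_derive_eq (is_deriveB (is_deriveM u1 w1) (is_deriveM u2 w2))).
  by rewrite /= /GRing.scale/=; ring.
under eq_fun do rewrite ImM.
apply: (is_derive_eq (is_deriveD (is_deriveM u1 w2) (is_deriveM u2 w1))).
by rewrite /= /GRing.scale/=; ring.
Qed.
Lemma hasderR (f : V -> R) p v l : is_derive p v f l ->
  hasder (fun q => (f q)%:C) p v l%:C.
Proof. by move=> df; split => //=; exact: is_derive_cst. Qed.
End rules.

Lemma hasderV (u : R -> R[i]) (x : R) l : u x != 0 -> hasder u x 1 l ->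
  hasder (fun t => (u t)^-1) x 1 (- l * (u x)^-1 ^+ 2).
Proof.
move=> u0 [u1 u2].
pose n t := Re (u t) * Re (u t) + Im (u t) * Im (u t).
have uE t : (u t)^-1 = (n t)^-1%:C * (u t)^*.
  rewrite /n -!expr2; case: (u t) => a b; apply: cplxP; rewrite !cE /=.
    by rewrite mul0r subr0 mulrC.
  by rewrite mul0r addr0 mulrN mulrC.
have n0 : n x != 0 by rewrite /n -!expr2 -normcE2 expf_eq0/= normc_eq0.
have dn : is_derive x 1 n (2 * Re (u x) * Re l + 2 * Im (u x) * Im l).
  apply: (is_derive_eq (is_deriveD (is_deriveM u1 u1) (is_deriveM u2 u2))).
  by rewrite /GRing.scale/=; ring.
have := hasderM (hasderR (is_deriveV n0 dn)) (hasderJ (conj u1 u2 : hasder u x 1 l)).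
under [X in hasder X _ _ _ -> _]eq_fun do rewrite -uE.
move/hasder_eq; apply.
rewrite uE /GRing.scale/=; move: n0; clear dn u1 u2 u0 uE; rewrite /n.
case: (u x) => a b; case: l => c e /= n0.
by apply: cplxP; rewrite !cE /=; field.
Qed.

Lemma hasder_cis (f : R -> R) (x l : R) : is_derive x 1 f l ->
  hasder (fun t => cis (f t)) x 1 ('i%C * l%:C * cis (f x)).
Proof.
move=> df; split; rewrite !cE !(mul0r, mulr0, mul1r, add0r, subr0, sub0r)/=.
  apply: (@is_derive_eq _ _ _ _ _ _ _ _ (is_derive1_comp (is_derive_cos _) df)).
  by rewrite /GRing.scale/=; ring.
apply: (@is_derive_eq _ _ _ _ _ _ _ _ (is_derive1_comp (is_derive_sin _) df)).
by rewrite /GRing.scale/=; ring.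
Qed.

End Derivatives.

(** * Schwartz functions and their multipliers *)
Section LineDerivatives.
Context {R : realType}.
Implicit Types (f : heis R -> R) (u : hfun R) (p : heis R).

Lemma derive_line (g : heis R -> R) (f : R -> R) p (v : heis R) (x : R) :
  (forall h, g (h *: v + p) = f (h + x)) -> g p = f x ->
  (derivable g p v <-> derivable f x 1) /\ 'D_v g p = 'D_1 f x.
Proof.
move=> gf gfx.
have E : (fun h => h^-1 *: (g (h *: v + p) - g p)) =
         (fun h => h^-1 *: (f (h *: (1:R) + x) - f x)).
  by apply/funext => h; rewrite gf gfx /GRing.scale/= mulr1.
by rewrite /derivable /derive E.
Qed.

Definition xline u p : R -> R[i] := fun t => u (t, p.1.2, p.2).
Definition yline u p : R -> R[i] := fun t => u (p.1.1, t, p.2).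
Definition sline u p : R -> R[i] := fun t => u (p.1.1, p.1.2, t).

Lemma hasder_line_gen u (g : R -> R[i]) p v (x : R) l :
  (forall h, u (h *: v + p) = g (h + x)) -> u p = g x ->
  hasder u p v l <-> hasder g x 1 l.
Proof.
move=> ug ugx.
have [d1 e1] := @derive_line (fun q => Re (u q)) (fun t => Re (g t)) p v x
  (fun h => congr1 (@Re _) (ug h)) (congr1 (@Re _) ugx).
have [d2 e2] := @derive_line (fun q => Im (u q)) (fun t => Im (g t)) p v x
  (fun h => congr1 (@Im _) (ug h)) (congr1 (@Im _) ugx).
rewrite /hasder; split=> -[[a1 b1] [a2 b2]]; split; split.
- exact: (d1.1 a1). - by rewrite -e1. - exact: (d2.1 a2). - by rewrite -e2.
- exact: (d1.2 a1). - by rewrite e1. - exact: (d2.2 a2). - by rewrite e2.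
Qed.

Lemma hasder_ex u p l : hasder u p ex l <-> hasder (xline u p) p.1.1 1 l.
Proof.
apply: hasder_line_gen => [h|]; rewrite /xline; last by case: p => -[].
by case: p => -[x y] s; congr (u (_, _, _)); rewrite /= /GRing.scale/= ?mulr1 ?mulr0 ?add0r.
Qed.
Lemma hasder_ey u p l : hasder u p ey l <-> hasder (yline u p) p.1.2 1 l.
Proof.
apply: hasder_line_gen => [h|]; rewrite /yline; last by case: p => -[].
by case: p => -[x y] s; congr (u (_, _, _)); rewrite /= /GRing.scale/= ?mulr1 ?mulr0 ?add0r.
Qed.
Lemma hasder_es u p l : hasder u p es l <-> hasder (sline u p) p.2 1 l.
Proof.
apply: hasder_line_gen => [h|]; rewrite /sline; last by case: p => -[].
by case: p => -[x y] s; congr (u (_, _, _)); rewrite /= /GRing.scale/= ?mulr1 ?mulr0 ?add0r.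
Qed.

Lemma hasder_pd u p v l : hasder u p v l -> pd v u p = l.
Proof. by move=> [[_ h1] [_ h2]]; rewrite /pd h1 h2; case: l {h1 h2}. Qed.
Lemma hasder_cder u p v l : hasder u p v l -> cderivable u p v.
Proof. by move=> [[? _] [? _]]. Qed.
Lemma cder_hasder u p v : cderivable u p v -> hasder u p v (pd v u p).
Proof. by move=> [d1 d2]; split; exact: DeriveDef. Qed.

End LineDerivatives.

Section SchwartzClass.
Context {R : realType}.
Implicit Types (u w : hfun R) (p v : heis R).

Definition dirs : seq (heis R) := [:: ex; ey; es].

Definition rdec u := forall k, exists C : R, forall p, (1 + `|p|) ^+ k * `N (u p) <= C.

Lemma rdecP u : rdec u <->
  (forall k : nat, exists C : R, forall p, `|p| ^+ k * `N (u p) <= C).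
Proof.
split=> h k.
  have [C HC] := h k; exists C => p; apply: le_trans (HC p).
  by rewrite ler_wpM2r ?normc_ge0// lerXn2r ?nnegrE ?addr_ge0// lerDr.
have [C HC] := h k; have [D HD] := h 0; exists (2 ^+ k * (C + D)) => p.
have np : 0 <= `|p| := normr_ge0 p.
have : (1 + `|p|) ^+ k <= 2 ^+ k * (`|p| ^+ k + 1).
  have [p1|p1] := leP `|p| 1.
    apply: (@le_trans _ _ (2 ^+ k)); first by rewrite lerXn2r ?nnegrE ?addr_ge0//; lra.
    by rewrite ler_peMr ?exprn_ge0// lerDr exprn_ge0.
  apply: (@le_trans _ _ (2 ^+ k * `|p| ^+ k)); last by rewrite ler_wpM2l ?exprn_ge0// lerDl.
  by rewrite -exprMn lerXn2r ?nnegrE ?addr_ge0 ?mulr_ge0//; lra.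
move=> /(ler_wpM2r (normc_ge0 (u p))) /le_trans; apply.
rewrite -mulrA ler_wpM2l ?exprn_ge0// mulrDl mul1r lerD//.
by have := HD p; rewrite expr0 mul1r.
Qed.

(** The class of Schwartz functions is the largest class of rapidly decreasing
    functions that is stable under the three partial derivatives; membership
    is proved by exhibiting a stable class. *)
Lemma schwartz_coind (X : hfun R -> Prop) :
  (forall u, X u -> rdec u) ->
  (forall u v, X u -> v \in dirs -> exists2 u', X u' & forall p, hasder u p v (u' p)) ->
  forall u, X u -> schwartz u.
Proof.
move=> Xr Xd u Xu l lD.
have Xl : X (foldr pd u l).
  elim: l lD => // v l IH lD /=.
  have vD : v \in dirs by apply: lD; rewrite inE eqxx.
  have [|w Xw wd] := Xd _ v (IH _) vD; first by move=> x xl; apply: lD; rewrite inE xl orbT.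
  suff -> : pd v (foldr pd u l) = w by [].
  by apply/funext => p; exact: hasder_pd (wd p).
split; last exact/rdecP/Xr.
by move=> p v vD; have [w _ /(_ p) /hasder_cder] := Xd _ v Xl vD.
Qed.

Lemma schwartz_rdec u : schwartz u -> rdec u.
Proof. by move=> /(_ [::]) h; apply/rdecP; have [] := h (fun x (xl : x \in [::]) => ltac:(by [])). Qed.

Lemma schwartz_pd u v : schwartz u -> v \in dirs -> schwartz (pd v u).
Proof.
move=> su vD l lD; have := su (rcons l v); rewrite foldr_rcons; apply.
by move=> x; rewrite mem_rcons inE => /orP[/eqP->//|/lD].
Qed.

Lemma schwartz_hasder u v p : schwartz u -> v \in dirs -> hasder u p v (pd v u p).
Proof. by move=> /(_ [::]) h vD; apply: cder_hasder; have [h1 _] := h (fun x (xl : x \in [::]) => ltac:(by [])); exact: h1. Qed.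

Lemma exD : ex \in dirs. Proof. by rewrite !inE eqxx. Qed.
Lemma eyD : ey \in dirs. Proof. by rewrite !inE eqxx orbT. Qed.
Lemma esD : es \in dirs. Proof. by rewrite !inE eqxx !orbT. Qed.

Definition r2 p : R := p.1.1 ^+ 2 + p.1.2 ^+ 2.
Lemma r2_ge0 p : 0 <= r2 p. Proof. by rewrite addr_ge0 ?sqr_ge0. Qed.
Definition pos (s : R) : R := Num.max s 0.
Lemma pos_ge0 s : 0 <= pos s. Proof. by rewrite le_max lexx orbT. Qed.
Lemma pos_id s : 0 <= s -> pos s = s. Proof. by move=> s0; rewrite /pos max_l. Qed.
Lemma pos_neg s : s <= 0 -> pos s = 0. Proof. by move=> s0; rewrite /pos max_r. Qed.

(** [wav s] is [exp (i s z)] with [z = p.2 + i r2 p], frozen at frequency 0 for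
    negative [s] so that it is always bounded by 1. *)
Definition wav (s : R) : hfun R := fun p =>
  (expR (- pos s * r2 p))%:C * cis (pos s * p.2).
Definition den : hfun R := fun p => p.2%:C + 'i%C * (r2 p)%:C + 'i%C.

Lemma normc_wav s p : `N (wav s p) = expR (- pos s * r2 p).
Proof. by rewrite /wav normcM normc_cis mulr1 normcR ger0_norm ?expR_ge0. Qed.
Lemma wav_le1 s p : `N (wav s p) <= 1.
Proof. by rewrite normc_wav -expR0 ler_expR mulNr oppr_le0 mulr_ge0 ?pos_ge0 ?r2_ge0. Qed.
Lemma Im_den p : Im (den p) = 1 + r2 p.
Proof. by rewrite /den !cE; ring. Qed.
Lemma Re_den p : Re (den p) = p.2.
Proof. rewrite /den !cE. ring. Qed.
Lemma den_ge1 p : 1 <= `N (den p).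
Proof.
apply: le_trans (normc_Im _); rewrite Im_den; apply: le_trans (ler_norm _).
by rewrite lerDl r2_ge0.
Qed.
Lemma den_neq0 p : den p != 0.
Proof. by rewrite -normc_eq0 gt_eqF// (lt_le_trans _ (den_ge1 p)). Qed.

(** Smooth multipliers of polynomial growth, together with their derivatives. *)
Inductive mult : hfun R -> Prop :=
| mult_cst c : mult (fun=> c)
| mult_x : mult (fun p => (p.1.1)%:C)
| mult_y : mult (fun p => (p.1.2)%:C)
| mult_s : mult (fun p => (p.2)%:C)
| mult_wav s : mult (wav s)
| mult_den : mult (fun p => (den p)^-1)
| multD m n : mult m -> mult n -> mult (fun p => m p + n p)
| multM m n : mult m -> mult n -> mult (fun p => m p * n p)
| multJ m : mult m -> mult (fun p => (m p)^*).

Lemma mult_growth m : mult m -> exists C k, 0 <= C /\ forall p, `N (m p) <= C * (1 + `|p|) ^+ k.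
Proof.
have co1 (a b c : R) : `|a| <= `|(a, b, c)| by rewrite /Num.norm/= !le_max lexx.
have co2 (a b c : R) : `|b| <= `|(a, b, c)| by rewrite /Num.norm/= !le_max lexx ?orbT.
have co3 (a b c : R) : `|c| <= `|(a, b, c)| by rewrite /Num.norm/= !le_max lexx ?orbT.
have p1 p : 1 <= 1 + `|p| by rewrite lerDl.
elim => [c| | | |s| |m' n _ [C [k [C0 mk]]] _ [D [l [D0 nl]]]|m' n _ [C [k [C0 mk]]] _ [D [l [D0 nl]]]|m' _ [C [k [C0 mk]]]].
- by exists (`N c), 0; split; [exact: normc_ge0|move=> p; rewrite expr0 mulr1].
- by exists 1, 1; split => // -[[a b] c]; rewrite expr1 mul1r normcR (le_trans (co1 a b c))// lerDr.
- by exists 1, 1; split => // -[[a b] c]; rewrite expr1 mul1r normcR (le_trans (co2 a b c))// lerDr.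
- by exists 1, 1; split => // -[[a b] c]; rewrite expr1 mul1r normcR (le_trans (co3 a b c))// lerDr.
- by exists 1, 0; split => // p; rewrite expr0 mulr1 wav_le1.
- exists 1, 0; split => // p; rewrite expr0 mulr1 Normc.normcV.
  by rewrite invf_le1 ?den_ge1// (lt_le_trans _ (den_ge1 p)).
- exists (C + D), (k + l); split => [|p]; first exact: addr_ge0.
  apply: le_trans (le_normcD _ _) _; rewrite mulrDl lerD//.
    by apply: le_trans (mk p) _; rewrite ler_wpM2l// ler_weXn2l// leq_addr.
  by apply: le_trans (nl p) _; rewrite ler_wpM2l// ler_weXn2l// leq_addl.
- exists (C * D), (k + l); split => [|p]; first exact: mulr_ge0.
  by rewrite normcM exprD mulrACA ler_pM// normc_ge0.
- by exists C, k; split => // p; rewrite normcJ.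
Qed.

Lemma is_derive_sqr (x : R) : is_derive x 1 (fun t : R => t ^+ 2) (2 * x).
Proof.
apply: (is_derive_eq (is_deriveM (is_derive_id x 1) (is_derive_id x 1))).
by rewrite /GRing.scale/=; ring.
Qed.

Lemma hasder_wavline (s t l1 l2 : R) (f g : R -> R) :
  is_derive t 1 f l1 -> is_derive t 1 g l2 ->
  hasder (fun t => (expR (- pos s * f t))%:C * cis (pos s * g t)) t 1
   ((pos s)%:C * (- l1%:C + 'i%C * l2%:C) * ((expR (- pos s * f t))%:C * cis (pos s * g t))).
Proof.
move=> df dg.
have df' : is_derive t 1 (fun t => - pos s * f t) (- pos s * l1).
  exact: (is_derive_eq (is_deriveZ (- pos s) df)).
have dg' : is_derive t 1 (fun t => pos s * g t) (pos s * l2).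
  exact: (is_derive_eq (is_deriveZ (pos s) dg)).
have := hasderM (hasderR (is_derive1_comp (is_derive_expR _) df')) (hasder_cis dg').
move/hasder_eq; apply; rewrite /comp !rmorphM !rmorphN; ring.
Qed.

Lemma mult_hasder m v : mult m -> v \in dirs ->
  exists2 m', mult m' & forall p, hasder m p v (m' p).
Proof.
move=> Hm; rewrite !inE => vD; elim: Hm => [c| | | |s| |m1 m2 _ [m1' h1 d1] _ [m2' h2 d2]|m1 m2 m1h [m1' h1 d1] m2h [m2' h2 d2]|m1 _ [m1' h1 d1]].
- by exists (fun=> 0); [exact: mult_cst|move=> p; exact: hasder_cst].
- exists (fun=> ((v == ex)%:R)); first exact: mult_cst.
  move=> p; case/or3P: vD => /eqP ->.
  + by rewrite eqxx; apply/hasder_ex; apply: (hasderR (is_derive_id _ _)).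
  + apply/hasder_ey; apply: (hasder_eq (hasder_cst (p.1.1)%:C p.1.2 1)).
    rewrite (_ : (ey == ex) = false)//.
    by apply/negbTE/eqP => -[] /esym/eqP; rewrite oner_eq0.
  + apply/hasder_es; apply: (hasder_eq (hasder_cst (p.1.1)%:C p.2 1)).
    rewrite (_ : (es == ex) = false)//.
    by apply/negbTE/eqP => -[] /esym/eqP; rewrite oner_eq0.
- exists (fun=> ((v == ey)%:R)); first exact: mult_cst.
  move=> p; case/or3P: vD => /eqP ->.
  + apply/hasder_ex; apply: (hasder_eq (hasder_cst (p.1.2)%:C p.1.1 1)).
    rewrite (_ : (ex == ey) = false)//.
    by apply/negbTE/eqP => -[] /eqP; rewrite oner_eq0.
  + by rewrite eqxx; apply/hasder_ey; apply: (hasderR (is_derive_id _ _)).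
  + apply/hasder_es; apply: (hasder_eq (hasder_cst (p.1.2)%:C p.2 1)).
    rewrite (_ : (es == ey) = false)//.
    by apply/negbTE/eqP => -[] /esym/eqP; rewrite oner_eq0.
- exists (fun=> ((v == es)%:R)); first exact: mult_cst.
  move=> p; case/or3P: vD => /eqP ->.
  + apply/hasder_ex; apply: (hasder_eq (hasder_cst (p.2)%:C p.1.1 1)).
    rewrite (_ : (ex == es) = false)//.
    by apply/negbTE/eqP => -[] /eqP; rewrite oner_eq0.
  + apply/hasder_ey; apply: (hasder_eq (hasder_cst (p.2)%:C p.1.2 1)).
    rewrite (_ : (ey == es) = false)//.
    by apply/negbTE/eqP => -[] /eqP; rewrite oner_eq0.
  + by rewrite eqxx; apply/hasder_es; apply: (hasderR (is_derive_id _ _)).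
- case/or3P: vD => /eqP ->.
  + exists (fun p => (pos s)%:C * ((- 2)%:C * (p.1.1)%:C) * wav s p).
      apply: multM; last exact: mult_wav.
      apply: multM; first exact: mult_cst.
      by apply: multM; [exact: mult_cst|exact: mult_x].
    move=> p; apply/hasder_ex.
    have dr : is_derive p.1.1 1 (fun t : R => t ^+ 2 + p.1.2 ^+ 2) (2 * p.1.1).
      by apply: (is_derive_eq (is_deriveD (is_derive_sqr _) (is_derive_cst _ _ _))); rewrite addr0.
    have := hasder_wavline s dr (is_derive_cst p.2 p.1.1 1).
    by move/hasder_eq; apply; rewrite /wav /r2 !rmorphM !rmorphN !rmorph0; ring.
  + exists (fun p => (pos s)%:C * ((- 2)%:C * (p.1.2)%:C) * wav s p).
      apply: multM; last exact: mult_wav.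
      apply: multM; first exact: mult_cst.
      by apply: multM; [exact: mult_cst|exact: mult_y].
    move=> p; apply/hasder_ey.
    have dr : is_derive p.1.2 1 (fun t : R => p.1.1 ^+ 2 + t ^+ 2) (2 * p.1.2).
      by apply: (is_derive_eq (is_deriveD (is_derive_cst _ _ _) (is_derive_sqr _))); rewrite add0r.
    have := hasder_wavline s dr (is_derive_cst p.2 p.1.2 1).
    by move/hasder_eq; apply; rewrite /wav /r2 !rmorphM !rmorphN !rmorph0; ring.
  + exists (fun p => (pos s)%:C * 'i%C * wav s p).
      apply: multM; last exact: mult_wav.
      by apply: multM; exact: mult_cst.
    move=> p; apply/hasder_es.
    have := hasder_wavline s (is_derive_cst (r2 p) p.2 1) (is_derive_id p.2 1).
    by move/hasder_eq; apply; rewrite /wav /r2 rmorph0 rmorph1; ring.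
- have key d (Hd : mult d) (hd : forall p, hasder den p v (d p)) : exists2 m', mult m' & forall p, hasder (fun p => (den p)^-1) p v (m' p).
    exists (fun p => - 1 * d p * ((den p)^-1 * (den p)^-1)).
      by do !apply: multM => //; [exact: mult_cst|exact: mult_den|exact: mult_den].
    move=> p; have dp := den_neq0 p; case/or3P: vD hd => /eqP -> /(_ p) h.
    + move/hasder_ex in h; apply/hasder_ex; have := hasderV _ h; rewrite {1 2}/xline.
      by case: p dp {h} => -[a b] c /= dp /(_ dp) /hasder_eq; apply; rewrite mulN1r -expr2.
    + move/hasder_ey in h; apply/hasder_ey; have := hasderV _ h; rewrite {1 2}/yline.
      by case: p dp {h} => -[a b] c /= dp /(_ dp) /hasder_eq; apply; rewrite mulN1r -expr2.
    + move/hasder_es in h; apply/hasder_es; have := hasderV _ h; rewrite {1 2}/sline.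
      by case: p dp {h} => -[a b] c /= dp /(_ dp) /hasder_eq; apply; rewrite mulN1r -expr2.
  case/or3P: vD => /eqP vE.
  + apply: (key (fun p => 'i%C * 2 * (p.1.1)%:C)).
      by apply: multM; [exact: mult_cst|exact: mult_x].
    move=> p; rewrite vE; apply/hasder_ex.
    have dr : is_derive p.1.1 1 (fun t : R => t ^+ 2 + p.1.2 ^+ 2) (2 * p.1.1).
      by apply: (is_derive_eq (is_deriveD (is_derive_sqr _) (is_derive_cst _ _ _))); rewrite addr0.
    have := hasderD (hasderD (hasder_cst (p.2)%:C _ _) (hasderM (hasder_cst 'i%C _ _) (hasderR dr))) (hasder_cst 'i%C _ _).
    by move/hasder_eq; apply; rewrite !rmorphM; ring.
  + apply: (key (fun p => 'i%C * 2 * (p.1.2)%:C)).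
      by apply: multM; [exact: mult_cst|exact: mult_y].
    move=> p; rewrite vE; apply/hasder_ey.
    have dr : is_derive p.1.2 1 (fun t : R => p.1.1 ^+ 2 + t ^+ 2) (2 * p.1.2).
      by apply: (is_derive_eq (is_deriveD (is_derive_cst _ _ _) (is_derive_sqr _))); rewrite add0r.
    have := hasderD (hasderD (hasder_cst (p.2)%:C _ _) (hasderM (hasder_cst 'i%C _ _) (hasderR dr))) (hasder_cst 'i%C _ _).
    by move/hasder_eq; apply; rewrite !rmorphM; ring.
  + apply: (key (fun p => 1)); first exact: mult_cst.
    move=> p; rewrite vE; apply/hasder_es.
    have := hasderD (hasderD (hasderR (is_derive_id p.2 1)) (hasder_cst ('i%C * (r2 p)%:C) _ _)) (hasder_cst 'i%C _ _).
    by move/hasder_eq; apply; rewrite !addr0.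
- by exists (fun p => m1' p + m2' p); [exact: multD|move=> p; exact: hasderD].
- exists (fun p => m1' p * m2 p + m1 p * m2' p); first by apply: multD; apply: multM.
  by move=> p; exact: hasderM.
- by exists (fun p => (m1' p)^*); [exact: multJ|move=> p; exact: hasderJ].
Qed.

(** Schwartz functions are stable under multiplication by [mult] functions:
    the finite sums of such products form a class stable under derivatives. *)
Inductive msum : hfun R -> Prop :=
| msum1 m u : mult m -> schwartz u -> msum (fun p => m p * u p)
| msumD u w : msum u -> msum w -> msum (fun p => u p + w p).

Lemma rdecD u w : rdec u -> rdec w -> rdec (fun p => u p + w p).
Proof.
move=> hu hw k; have [C HC] := hu k; have [D HD] := hw k; exists (C + D) => p.
apply: (@le_trans _ _ ((1 + `|p|) ^+ k * (`N (u p) + `N (w p)))).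
  by rewrite ler_wpM2l ?le_normcD// exprn_ge0// addr_ge0.
by rewrite mulrDr lerD.
Qed.
Lemma rdec_mult m u : mult m -> rdec u -> rdec (fun p => m p * u p).
Proof.
move=> /mult_growth[C [k [C0 mk]]] hu l; have [D HD] := hu (l + k); exists (C * D) => p.
rewrite normcM (@le_trans _ _ (C * ((1 + `|p|) ^+ (l + k) * `N (u p))))//; last by rewrite ler_wpM2l.
rewrite exprD mulrA [leRHS](_ : _ = (1 + `|p|) ^+ l * (C * (1 + `|p|) ^+ k) * `N (u p)); last by ring.
by rewrite ler_wpM2r ?normc_ge0// ler_wpM2l// exprn_ge0// addr_ge0.
Qed.

Lemma msum_schwartz u : msum u -> schwartz u.
Proof.
apply: schwartz_coind => {u} [u|u v].
  elim=> [m w mm /schwartz_rdec sw|w1 w2 _ r1 _ r2]; first exact: rdec_mult.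
  exact: rdecD.
move=> uM vD; elim: uM => [m w mm sw|w1 w2 _ [w1' m1 h1] _ [w2' m2 h2]].
  have [m' mm' hm'] := mult_hasder mm vD.
  exists (fun p => m' p * w p + m p * pd v w p).
    by apply: msumD; apply: msum1 => //; exact: schwartz_pd.
  by move=> p; apply: hasderM => //; exact: schwartz_hasder.
exists (fun p => w1' p + w2' p); first exact: msumD.
by move=> p; exact: hasderD.
Qed.

Lemma schwartzM m u : mult m -> schwartz u -> schwartz (fun p => m p * u p).
Proof. by move=> mm su; apply: msum_schwartz; exact: msum1. Qed.
Lemma schwartzZ c u : schwartz u -> schwartz (fun p => c * u p).
Proof. exact: (schwartzM (mult_cst c)). Qed.
Lemma schwartzD u w : schwartz u -> schwartz w -> schwartz (fun p => u p + w p).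
Proof.
move=> su sw; rewrite (_ : (fun _ => _) = (fun p => 1 * u p + 1 * w p)).
  by apply: msum_schwartz; apply: msumD; apply: msum1 => //; exact: mult_cst.
by apply/funext => p; rewrite !mul1r.
Qed.
Lemma schwartzN u : schwartz u -> schwartz (fun p => - u p).
Proof. by move=> /(schwartzZ (-1)); under eq_fun do rewrite mulN1r. Qed.
Lemma schwartzB u w : schwartz u -> schwartz w -> schwartz (fun p => u p - w p).
Proof. by move=> su /schwartzN sw; exact: schwartzD. Qed.
Lemma schwartzJ u : schwartz u -> schwartz (fun p => (u p)^*).
Proof.
move=> su; apply: (@schwartz_coind (fun w => exists2 u, schwartz u & w = fun p => (u p)^*)); last by exists u.
  move=> _ [w sw ->] k; have [C HC] := schwartz_rdec sw k.
  by exists C => p; rewrite normcJ.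
move=> _ v [w sw ->] vD; exists (fun p => (pd v w p)^*); first by exists (pd v w) => //; exact: schwartz_pd.
by move=> p; apply: hasderJ; exact: schwartz_hasder.
Qed.

Lemma pdZ c u v p : schwartz u -> v \in dirs -> pd v (fun p => c * u p) p = c * pd v u p.
Proof.
move=> su vD; apply: hasder_pd; apply: (hasder_eq (hasderM (hasder_cst c p v) (schwartz_hasder p su vD))).
by rewrite mul0r add0r.
Qed.

End SchwartzClass.

(** * Integrability of rapidly decreasing functions *)
Section ImproperIntegrability.
Context {R : realType}.
Local Notation leb := (@lebesgue_measure R).

Lemma intble_ge0_line (f F : R -> R) (M : R) : continuous f -> (forall x, 0 <= f x) ->
  (forall x : R, is_derive x 1 F (f x)) -> (forall n : nat, F n.+1%:R - F (- n.+1%:R) <= M) ->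
  intble leb f.
Proof.
move=> cf f0 dF FM.
have an n : (- n.+1%:R : R) < n.+1%:R by rewrite (@lt_trans _ _ 0)// oppr_lt0.
have seg n := @FTC_segment R f F _ _ (an n) (fun x _ => cf x) (fun x _ => dF x).
have mf : measurable_fun setT f by exact: continuous_measurable_fun.
have [] := @Rint_fatou R _ _ leb (fun n x => f x * \1_`[(- n.+1%:R), n.+1%:R] x) f M => //.
- by move=> n; exact: (seg n).1.
- by move=> n x; rewrite mulr_ge0// indicE.
- move=> x; apply: cvg_near_cst.
  exists (Num.truncn `|x|) => // n /= Nn; rewrite indicE mem_set ?mulr1//= in_itv/=.
  rewrite -ler_norml (@le_trans _ _ ((Num.truncn `|x|).+1%:R))// ?ler_nat//.
  by apply/ltW; rewrite truncnS_gt.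
- by move=> n; rewrite (seg n).2.
Qed.

Lemma intble_ge0_halfline (f F : R -> R) (a M : R) :
  measurable_fun setT f ->
  (forall x, a <= x -> {for x, continuous f}) -> (forall x, a <= x -> 0 <= f x) ->
  (forall x : R, a <= x -> is_derive x 1 F (f x)) -> (forall n : nat, F (a + n.+1%:R) - F a <= M) ->
  intble leb (fun x => f x * \1_`[a, +oo[ x).
Proof.
move=> mf cf f0 dF FM.
have an n : a < a + n.+1%:R by rewrite ltrDl.
have seg n := @FTC_segment R f F a (a + n.+1%:R) (an n)
   (fun x ax => cf x (proj1 (andP ax))) (fun x ax => dF x (proj1 (andP ax))).
have mf1 : measurable_fun setT (fun x => f x * \1_`[a, +oo[ x).
  by apply: measurable_funM => //; exact: measurable_indic.
have [] := @Rint_fatou R _ _ leb (fun n x => f x * \1_`[a, (a + n.+1%:R)] x) (fun x => f x * \1_`[a, +oo[ x) M => //.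
- by move=> n; exact: (seg n).1.
- move=> n x; rewrite indicE; case: (boolP (x \in `[a, (a + n.+1%:R)]%classic)) => [|_]; last by rewrite mulr0.
  by move=> /set_mem/=; rewrite in_itv/= => /andP[ax _]; rewrite mulr1 f0.
- move=> x; apply: cvg_near_cst.
  have [N Nx] : exists N : nat, x <= a + N.+1%:R.
    exists (Num.truncn `|x - a|); rewrite -lerBlDl (le_trans (ler_norm _))//.
    by apply/ltW; rewrite truncnS_gt.
  exists N => // n /= Nn; rewrite !indicE; congr (f x * (nat_of_bool _)%:R).
  apply/idP/idP => /set_mem /=; rewrite ?in_itv/= ?andbT => h; apply/mem_set => /=;
    rewrite in_itv/= ?andbT; first by case/andP: h.
  by rewrite h (le_trans Nx)// lerD2l ler_nat.
- by move=> n; rewrite (seg n).2.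
Qed.

Definition w1 (t : R) : R := (1 + t ^+ 2)^-1.
Lemma w1_gt0 t : 0 < w1 t.
Proof. by rewrite invr_gt0 ltr_wpDr ?sqr_ge0. Qed.
Lemma w1_ge0 t : 0 <= w1 t. Proof. exact: ltW (w1_gt0 t). Qed.
Lemma w1_le1 t : w1 t <= 1.
Proof. by rewrite invf_le1 ?lerDl ?sqr_ge0// ltr_wpDr ?sqr_ge0. Qed.
Lemma w1_cont : continuous w1.
Proof.
move=> t; rewrite /w1; apply: (@cvgV _ _ _ _ (fun t : R => 1 + t ^+ 2)).
  by rewrite gt_eqF// ltr_wpDr ?sqr_ge0.
by apply: cvgD; [exact: cvg_cst|exact: (@exprn_continuous R 2 t)].
Qed.
Lemma intble_w1 : intble leb w1.
Proof.
apply: (@intble_ge0_line _ (@atan R) pi); [exact: w1_cont|exact: w1_ge0|].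
move=> n; have := atan_ltpi2 (n.+1%:R : R); have := atan_gtNpi2 (- n.+1%:R : R).
by move=> h1 h2; lra.
Qed.

End ImproperIntegrability.

Section Caratheodory.
Context {R : realType}.

(** A function measurable in one variable and continuous in the other is
    jointly measurable: discretise the continuous variable. *)
Lemma measurable_Carath d (T : measurableType d) (f : R * T -> R) :
  (forall x, measurable_fun setT (fun y => f (x, y))) ->
  (forall y, continuous (fun x => f (x, y))) ->
  measurable_fun setT (f : measurableTypeR R * T -> R).
Proof.
move=> mf cf.
pose q (n : nat) (x : R) : R := (Num.floor (n.+1%:R * x))%:~R / n.+1%:R.
apply: (@measurable_fun_cvg _ _ R setT (fun n (p : measurableTypeR R * T) => f (q n p.1, p.2))).
  move=> n _ Y mY; rewrite setTI.
  have -> : (fun p : measurableTypeR R * T => f (q n p.1, p.2)) @^-1` Y =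
    \bigcup_(k : int) ([set x : measurableTypeR R | Num.floor (n.+1%:R * x) = k] `*`
       [set y | Y (f (k%:~R / n.+1%:R, y))]).
    apply/seteqP; split => [[x y] /= h|[x y] [k _ /= [xk h]]].
      by exists (Num.floor (n.+1%:R * x)).
    by rewrite /q xk.
  apply: countable_bigcupT_measurable => // k.
  apply: measurableX; last by have := mf (k%:~R / n.+1%:R) measurableT _ mY; rewrite setTI.
  rewrite [X in measurable X](_ : _ = `[k%:~R / n.+1%:R, (k + 1)%:~R / n.+1%:R[%classic).
    exact: measurable_itv.
  apply/seteqP; split => x /=; rewrite in_itv/= ler_pdivrMr// ltr_pdivlMr// [x * _]mulrC.
    by move=> <-; rewrite floor_le floorD1_gt.
  by move=> h; apply: floor_def.
move=> [x y] _ /=; apply: (cvg_comp _ (fun x => f (x, y)) _ (cf y x)).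
apply/cvgrPdist_lt => e e0.
exists (Num.truncn e^-1) => // n /= Nn.
have n0 : 0 < n.+1%:R :> R by [].
have -> : x - q n x = (n.+1%:R * x - (Num.floor (n.+1%:R * x))%:~R) / n.+1%:R.
  by rewrite /q mulrBl mulrAC divff ?mul1r// gt_eqF.
rewrite ger0_norm ?divr_ge0 ?subr_ge0 ?floor_le//.
rewrite ltr_pdivrMr//; apply: (@le_lt_trans _ _ 1).
  by rewrite lerBlDl; have := floorD1_gt (n.+1%:R * x); rewrite intrD => /ltW.
rewrite -ltr_pdivrMl// mulr1 (lt_le_trans (truncnS_gt _))// ler_nat ltnS; exact: Nn.
Qed.

End Caratheodory.
Section SchwartzIntegrals.
Context {R : realType}.
Local Notation leb := (@lebesgue_measure R).
Local Notation cint := (cintegral leb).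
Local Notation cint3 := (cintegral (leb3 R)).
Local Notation cintble := (cintegrable leb).
Implicit Types (u w : hfun R) (p v : heis R).

Local Notation R1 := (measurableTypeR R).
Local Notation R2 := (measurableTypeR R * measurableTypeR R)%type.
Local Notation leb2 := (prod_sf leb leb).

Lemma cint_dom1 (u : R -> R[i]) (g : R -> R) : cmeasurable (u : R1 -> R[i]) ->
  (forall x, `N (u x) <= g x) -> intble leb g -> cintble (u : R1 -> R[i]).
Proof. exact: cint_dom. Qed.
Lemma cint_dom3 (u : hfun R) (g : heis R -> R) : cmeasurable (u : hmeas R -> R[i]) ->
  (forall x, `N (u x) <= g x) -> intble (leb3 R) (g : hmeas R -> R) -> cintegrable (leb3 R) u.
Proof. exact: cint_dom. Qed.

Definition wt p : R := w1 p.1.1 * w1 p.1.2 * w1 p.2.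
Lemma wt_ge0 p : 0 <= wt p. Proof. by rewrite /wt !mulr_ge0 ?w1_ge0. Qed.

Lemma intble_w1w1 : intble leb2 (fun q : measurableTypeR R * measurableTypeR R => w1 q.1 * w1 q.2).
Proof. exact: (@intble_prod R _ _ _ _ leb leb w1 w1 (@intble_w1 R) (@intble_w1 R)). Qed.
Lemma intble_wt : intble (leb3 R) (wt : hmeas R -> R).
Proof. exact: (@intble_prod R _ _ _ _ leb2 leb (fun q => w1 q.1 * w1 q.2) w1 intble_w1w1 (@intble_w1 R)). Qed.

Lemma norm_x p : `|p.1.1| <= `|p|. Proof. by case: p => -[a b] c; rewrite /Num.norm/= !le_max lexx. Qed.
Lemma norm_y p : `|p.1.2| <= `|p|. Proof. by case: p => -[a b] c; rewrite /Num.norm/= !le_max lexx ?orbT. Qed.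
Lemma norm_s p : `|p.2| <= `|p|. Proof. by case: p => -[a b] c; rewrite /Num.norm/= !le_max lexx ?orbT. Qed.
Lemma norm_sum p : `|p| <= `|p.1.1| + `|p.1.2| + `|p.2|.
Proof.
case: p => -[a b] c /=.
rewrite {1}/Num.norm/= !ge_max /=.
have := normr_ge0 a; have := normr_ge0 b; have := normr_ge0 c => h1 h2 h3.
by apply/andP; split; [apply/andP; split|]; lra.
Qed.

Lemma schwartz_bound u : schwartz u -> exists2 C, 0 <= C & forall p, `N (u p) <= C * wt p.
Proof.
move=> /schwartz_rdec /(_ 6)[C HC]; exists C.
  by apply: le_trans (HC 0); rewrite mulr_ge0 ?normc_ge0// exprn_ge0// addr_ge0.
move=> p; rewrite /wt /w1 -!invfM.
have h (a : R) : `|a| <= `|p| -> 0 < 1 + a ^+ 2 /\ 1 + a ^+ 2 <= (1 + `|p|) ^+ 2.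
  move=> ap; split; first by rewrite ltr_wpDr ?sqr_ge0.
  rewrite -(real_normK (num_real a)) sqrrD expr1n mul1r -addrA lerD2l.
  rewrite ler_wpDl ?mulrn_wge0//.
  by rewrite lerXn2r ?nnegrE.
have [x0 xl] := h _ (norm_x p); have [y0 yl] := h _ (norm_y p); have [s0 sl] := h _ (norm_s p).
rewrite ler_pdivlMr ?mulr_gt0// mulrC; apply: le_trans (HC p); rewrite ler_wpM2r ?normc_ge0//.
rewrite (_ : (1 + `|p|) ^+ 6 = (1 + `|p|) ^+ 2 * (1 + `|p|) ^+ 2 * (1 + `|p|) ^+ 2); last by ring.
by rewrite !ler_pM// ?mulr_ge0// ltW.
Qed.

Definition ccont (g : R -> R[i]) :=
  continuous (fun x => Re (g x)) /\ continuous (fun x => Im (g x)).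
Lemma ccontD g h : ccont g -> ccont h -> ccont (fun x => g x + h x).
Proof.
move=> [g1 g2] [h1 h2]; split => x.
  by under eq_fun do rewrite ReD; apply: cvgD; [exact: g1|exact: h1].
by under eq_fun do rewrite ImD; apply: cvgD; [exact: g2|exact: h2].
Qed.
Lemma ccontM g h : ccont g -> ccont h -> ccont (fun x => g x * h x).
Proof.
move=> [g1 g2] [h1 h2]; split => x.
  under eq_fun do rewrite ReM.
  by apply: cvgB; apply: cvgM; [exact: g1|exact: h1|exact: g2|exact: h2].
under eq_fun do rewrite ImM.
by apply: cvgD; apply: cvgM; [exact: g1|exact: h2|exact: g2|exact: h1].
Qed.
Lemma ccontJ g : ccont g -> ccont (fun x => (g x)^*).
Proof.
move=> [g1 g2]; split => x; first by under eq_fun do rewrite ReJ; exact: g1.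
by under eq_fun do rewrite ImJ; apply: cvgN; exact: g2.
Qed.
Lemma ccont_cst (c : R[i]) : ccont (fun=> c).
Proof. by split => x; exact: cvg_cst. Qed.
Lemma ccontR (f : R -> R) : continuous f -> ccont (fun x => (f x)%:C).
Proof. by move=> cf; split => x /=; [exact: cf|exact: cvg_cst]. Qed.
Lemma ccont_cis (f : R -> R) : continuous f -> ccont (fun x => cis (f x)).
Proof.
move=> cf; split => x /=; apply: (continuous_comp (cf x)).
  exact: continuous_cos.
exact: continuous_sin.
Qed.
Lemma ccont_meas g : ccont g -> cmeasurable (g : R1 -> R[i]).
Proof. by move=> [g1 g2]; split; exact: continuous_measurable_fun. Qed.

Lemma hasder_cont (g g' : R -> R[i]) : (forall x, hasder g x 1 (g' x)) ->
  ccont g.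
Proof.
move=> h; have dc (f : R -> R) x : derivable f x 1 -> {for x, continuous f}.
  by move=> /derivable1_diffP; exact: differentiable_continuous.
by split=> x; have [[d1 _] [d2 _]] := h x; apply: dc.
Qed.

Lemma schwartz_linex u p : schwartz u -> forall t, hasder (fun x => u (x, p.1.2, p.2)) t 1 (pd ex u (t, p.1.2, p.2)).
Proof. by move=> su t; have /hasder_ex := schwartz_hasder (t, p.1.2, p.2) su exD. Qed.
Lemma schwartz_liney u p : schwartz u -> forall t, hasder (fun x => u (p.1.1, x, p.2)) t 1 (pd ey u (p.1.1, t, p.2)).
Proof. by move=> su t; have /hasder_ey := schwartz_hasder (p.1.1, t, p.2) su eyD. Qed.
Lemma schwartz_lines u p : schwartz u -> forall t, hasder (fun x => u (p.1.1, p.1.2, x)) t 1 (pd es u (p.1.1, p.1.2, t)).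
Proof. by move=> su t; have /hasder_es := schwartz_hasder (p.1.1, p.1.2, t) su esD. Qed.

Lemma measurable_heis (f : heis R -> R) :
  (forall p, continuous (fun x => f (x, p.1.2, p.2))) ->
  (forall p, continuous (fun x => f (p.1.1, x, p.2))) ->
  (forall p, continuous (fun x => f (p.1.1, p.1.2, x))) ->
  measurable_fun setT (f : hmeas R -> R).
Proof.
move=> cx cy cs.
have m2 s : measurable_fun setT (fun q : measurableTypeR R * measurableTypeR R => f (q, s)).
  apply: (@measurable_Carath _ _ (measurableTypeR R) (fun q => f (q, s))).
    by move=> x; apply: continuous_measurable_fun; exact: (cy (x, 0, s)).
  by move=> y; exact: (cx (0, y, s)).
have := @measurable_Carath R _ (measurableTypeR R * measurableTypeR R)%type
  (fun z => f (z.2, z.1)) m2.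
have cs' : forall y : measurableTypeR R * measurableTypeR R, continuous (fun x => f (y, x)).
  by case=> x y; exact: (cs (x, y, 0)).
move=> /(_ cs') h.
rewrite (_ : f = (fun z : R * R2 => f (z.2, z.1)) \o (fun z : hmeas R => (z.2, z.1))).
  by apply: (measurableT_comp h); apply: measurable_fun_pair.
by apply/funext => -[].
Qed.

Lemma schwartz_meas u : schwartz u -> cmeasurable (u : hmeas R -> R[i]).
Proof.
move=> su; split; apply: measurable_heis => p.
- exact: (hasder_cont (schwartz_linex p su)).1.
- exact: (hasder_cont (schwartz_liney p su)).1.
- exact: (hasder_cont (schwartz_lines p su)).1.
- exact: (hasder_cont (schwartz_linex p su)).2.
- exact: (hasder_cont (schwartz_liney p su)).2.
- exact: (hasder_cont (schwartz_lines p su)).2.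
Qed.

Lemma schwartz_int u : schwartz u -> cintegrable (leb3 R) u.
Proof.
move=> su; have [C C0 uC] := schwartz_bound su.
apply: (cint_dom3 _ uC); first exact: schwartz_meas.
exact: (intbleZ _ intble_wt).
Qed.

Lemma schwartz_sec u q : schwartz u -> cintble (fun s : measurableTypeR R => u (q, s)).
Proof.
move=> su; have [C C0 uC] := schwartz_bound su.
apply: (@cint_dom1 _ (fun s => C * w1 q.1 * w1 q.2 * w1 s)).
- have [h1 h2] := hasder_cont (schwartz_lines (q, 0) su).
  by case: q h1 h2 => a b /= h1 h2; split; exact: continuous_measurable_fun.
- by move=> s; apply: le_trans (uC _) _; rewrite /wt/= !mulrA.
- by apply: intbleZ; exact: intble_w1.
Qed.

Lemma ler_w1 (n : nat) : w1 (n.+1%:R : R) <= n.+1%:R^-1.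
Proof.
rewrite /w1 lef_pV2 ?posrE ?ltr_wpDr ?sqr_ge0//.
by have := sqr_ge0 (n.+1%:R - 1 : R); have : 1 <= n.+1%:R :> R; [rewrite ler1n|nra].
Qed.
Lemma cvg_inv0 : (n.+1%:R^-1 : R) @[n --> \oo] --> (0 : R).
Proof. exact: cvg_harmonic. Qed.

Lemma cint_der0 (g g' : R -> R[i]) C : (forall x, hasder g x 1 (g' x)) ->
  continuous (fun x => Re (g' x)) -> continuous (fun x => Im (g' x)) ->
  cintble g' -> (forall x, `N (g x) <= C * w1 x) -> cint g' = 0.
Proof.
move=> dg c1 c2 [i1 i2] gC.
have C0 : 0 <= C by have := le_trans (normc_ge0 _) (gC 0); rewrite pmulr_lge0// w1_gt0.
have lim0 (h : R -> R) (s : R -> R) : (forall n, `|s n.+1%:R| = n.+1%:R) -> (forall x, `|h x| <= `N (g x)) -> h (s n.+1%:R) @[n --> \oo] --> (0 : R).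
  move=> sn hg; apply/cvgr0Pnorm_le => e e0.
  have /cvgr0Pnorm_le/(_ e e0) : (C * n.+1%:R^-1 : R) @[n --> \oo] --> (0 : R).
    by rewrite -[X in _ --> X](mulr0 C); apply: cvgM; [exact: cvg_cst|exact: cvg_inv0].
  apply: filterS => n; rewrite ger0_norm ?mulr_ge0// => /(le_trans _); apply.
  apply: le_trans (hg _) _; apply: le_trans (gC _) _; rewrite ler_wpM2l//.
  by apply: le_trans (ler_w1 n); rewrite /w1 -(real_normK (num_real (s _))) sn.
have s1 n : `|(n.+1%:R : R)| = n.+1%:R by rewrite ger0_norm.
have s2 n : `|- (n.+1%:R : R)| = n.+1%:R by rewrite normrN ger0_norm.
rewrite /cintegral.
rewrite (FTC_line c1 (fun x => (dg x).1) i1 (lim0 _ id s1 (fun x => normc_Re _)) (lim0 _ (fun x => - x) s2 (fun x => normc_Re _))).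
rewrite (FTC_line c2 (fun x => (dg x).2) i2 (lim0 _ id s1 (fun x => normc_Im _)) (lim0 _ (fun x => - x) s2 (fun x => normc_Im _))).
by rewrite subr0.
Qed.

Lemma fubini_s (u : hfun R) C : cmeasurable (u : hmeas R -> R[i]) -> (forall p, `N (u p) <= C * wt p) ->
  cint3 u = cintegral leb2 (fun q => cint (fun s : R1 => u (q, s))).
Proof.
move=> mu_ uC; apply/esym.
apply: (@cfubini1 R _ _ R2 R1 leb2 leb u (fun q => C * (w1 q.1 * w1 q.2)) w1 mu_).
- by move=> p; apply: le_trans (uC p) _; rewrite /wt !mulrA.
- exact: (intbleZ _ intble_w1w1).
- exact: intble_w1.
Qed.
Lemma fubini_q (u : hfun R) C : cmeasurable (u : hmeas R -> R[i]) -> (forall p, `N (u p) <= C * wt p) ->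
  cint3 u = cint (fun s : R1 => cintegral leb2 (fun q => u (q, s))).
Proof.
move=> mu_ uC; apply/esym.
apply: (@cfubini2 R _ _ R2 R1 leb2 leb u (fun q => C * (w1 q.1 * w1 q.2)) w1 mu_).
- by move=> p; apply: le_trans (uC p) _; rewrite /wt !mulrA.
- exact: (intbleZ _ intble_w1w1).
- exact: intble_w1.
Qed.
Lemma fubini_xy (u : R2 -> R[i]) C : cmeasurable u -> (forall q, `N (u q) <= C * (w1 q.1 * w1 q.2)) ->
  cintegral leb2 u = cint (fun y : R1 => cint (fun x : R1 => u (x, y))) /\
  cintegral leb2 u = cint (fun x : R1 => cint (fun y : R1 => u (x, y))).
Proof.
move=> mu_ uC.
have Kab q : `N (u q) <= (C * w1 q.1) * w1 q.2 by rewrite -mulrA.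
split; apply/esym.
  exact: (@cfubini2 R _ _ R1 R1 leb leb u (fun x => C * w1 x) w1 mu_ Kab (intbleZ _ (@intble_w1 R)) (@intble_w1 R)).
exact: (@cfubini1 R _ _ R1 R1 leb leb u (fun x => C * w1 x) w1 mu_ Kab (intbleZ _ (@intble_w1 R)) (@intble_w1 R)).
Qed.

Lemma int_pd u v : schwartz u -> v \in dirs -> cint3 (pd v u) = 0.
Proof.
move=> su vD; have su' := schwartz_pd su vD.
have [C C0 uC] := schwartz_bound su; have [D D0 uD] := schwartz_bound su'.
have mu' := schwartz_meas su'.
move: vD; rewrite !inE => /or3P[] /eqP vE; rewrite {}vE in su' mu' uD *.
- rewrite (fubini_q mu' uD).
  rewrite -[RHS](cintegral0 leb); apply: eq_cintegral => s.
  have ms : cmeasurable (fun q : R2 => pd ex u (q, s)).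
    by apply: (cmeasurable_comp _ mu'); exact: measurable_pair2.
  have bs (q : R2) : `N (pd ex u (q, s)) <= D * w1 s * (w1 q.1 * w1 q.2).
    by apply: le_trans (uD _) _; rewrite /wt/=; apply: le_of_eq; ring.
  rewrite (fubini_xy ms bs).1 -[RHS](cintegral0 leb); apply: eq_cintegral => y.
  have [c1 c2] := hasder_cont (schwartz_linex (0, y, s) su').
  apply: (cint_der0 (schwartz_linex (0, y, s) su) (C := C * w1 y * w1 s)) => //.
    apply: (@cint_dom1 _ (fun x => D * w1 y * w1 s * w1 x)).
    * by split; exact: continuous_measurable_fun.
    * by move=> x; apply: le_trans (uD _) _; rewrite /wt/=; apply: le_of_eq; ring.
    * by apply: intbleZ; exact: intble_w1.
  by move=> x; apply: le_trans (uC _) _; rewrite /wt/=; apply: le_of_eq; ring.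
- rewrite (fubini_q mu' uD).
  rewrite -[RHS](cintegral0 leb); apply: eq_cintegral => s.
  have ms : cmeasurable (fun q : R2 => pd ey u (q, s)).
    by apply: (cmeasurable_comp _ mu'); exact: measurable_pair2.
  have bs (q : R2) : `N (pd ey u (q, s)) <= D * w1 s * (w1 q.1 * w1 q.2).
    by apply: le_trans (uD _) _; rewrite /wt/=; apply: le_of_eq; ring.
  rewrite (fubini_xy ms bs).2 -[RHS](cintegral0 leb); apply: eq_cintegral => x.
  have [c1 c2] := hasder_cont (schwartz_liney (x, 0, s) su').
  apply: (cint_der0 (schwartz_liney (x, 0, s) su) (C := C * w1 x * w1 s)) => //.
    apply: (@cint_dom1 _ (fun y => D * w1 x * w1 s * w1 y)).
    * by split; exact: continuous_measurable_fun.
    * by move=> y; apply: le_trans (uD _) _; rewrite /wt/=; apply: le_of_eq; ring.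
    * by apply: intbleZ; exact: intble_w1.
  by move=> y; apply: le_trans (uC _) _; rewrite /wt/=; apply: le_of_eq; ring.
- rewrite (fubini_s mu' uD).
  rewrite -[RHS](cintegral0 leb2); apply: eq_cintegral => -[x y].
  have [c1 c2] := hasder_cont (schwartz_lines (x, y, 0) su').
  apply: (cint_der0 (schwartz_lines (x, y, 0) su) (C := C * w1 x * w1 y)) => //.
    exact: (schwartz_sec (x, y) su').
  by move=> s; apply: le_trans (uC _) _; rewrite /wt/= !mulrA.
Qed.

End SchwartzIntegrals.

(** * The partial Fourier transform *)
Section UnderIntegral.
Context {R : realType} d (Y : measurableType d) (mu : {measure set Y -> \bar R}).

Lemma hasder_under (K K' : R -> Y -> R[i]) (g : Y -> R) (a b c : R) : b < a < c ->
  (forall x, b < x < c -> cintegrable mu (K x)) ->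
  (forall x y, b < x < c -> hasder (K^~ y) x 1 (K' x y)) ->
  (forall x y, b < x < c -> `N (K' x y) <= g y) -> intble mu g ->
  hasder (fun x => cintegral mu (K x)) a 1 (cintegral mu (K' a)).
Proof.
move=> aa iK dK Kg ig.
have Ia : `]b, c[%classic a by rewrite /= in_itv.
have g0 y : 0 <= g y by apply: le_trans (Kg a y aa); exact: normc_ge0.
have itvE x : `]b, c[%classic x -> b < x < c by rewrite /= in_itv.
split.
- have d1 x y : `]b, c[%classic x -> setT y -> derivable ((fun x y => Re (K x y)) ^~ y) x 1.
    by move=> /itvE xa _; have [[]] := dK x y xa.
  have e1 x y : `]b, c[%classic x -> partial1of2 (fun x y => Re (K x y)) x y = Re (K' x y).
    by move=> /itvE xa; rewrite partial1of2E; have [[_ ->]] := dK x y xa.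
  have b1 x y : `]b, c[%classic x -> setT y -> `|partial1of2 (fun x y => Re (K x y)) x y| <= g y.
    by move=> xa _; rewrite e1//; apply: le_trans (normc_Re _) (Kg _ _ (itvE _ xa)).
  have h1 := @derivable_under_integral R _ _ mu (fun x y => Re (K x y)) _ measurableT a _ _ Ia
    (fun x xa => (iK x (itvE _ xa)).1) d1 g g0 ig b1.
  have h2 := @differentiation_under_integral R _ _ mu (fun x y => Re (K x y)) _ measurableT a _ _ Ia
    (fun x xa => (iK x (itvE _ xa)).1) d1 g g0 ig b1.
  split; first exact: h1.
  by rewrite -derive1E h2 /=; apply: eq_Rintegral => y _; rewrite e1.
- have d1 x y : `]b, c[%classic x -> setT y -> derivable ((fun x y => Im (K x y)) ^~ y) x 1.
    by move=> /itvE xa _; have [_ []] := dK x y xa.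
  have e1 x y : `]b, c[%classic x -> partial1of2 (fun x y => Im (K x y)) x y = Im (K' x y).
    by move=> /itvE xa; rewrite partial1of2E; have [_ [_ ->]] := dK x y xa.
  have b1 x y : `]b, c[%classic x -> setT y -> `|partial1of2 (fun x y => Im (K x y)) x y| <= g y.
    by move=> xa _; rewrite e1//; apply: le_trans (normc_Im _) (Kg _ _ (itvE _ xa)).
  have h1 := @derivable_under_integral R _ _ mu (fun x y => Im (K x y)) _ measurableT a _ _ Ia
    (fun x xa => (iK x (itvE _ xa)).2) d1 g g0 ig b1.
  have h2 := @differentiation_under_integral R _ _ mu (fun x y => Im (K x y)) _ measurableT a _ _ Ia
    (fun x xa => (iK x (itvE _ xa)).2) d1 g g0 ig b1.
  split; first exact: h1.
  by rewrite -derive1E h2 /=; apply: eq_Rintegral => y _; rewrite e1.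
Qed.

End UnderIntegral.

Section PartialFourier.
Context {R : realType}.
Local Notation leb := (@lebesgue_measure R).
Implicit Types (u w : hfun R) (p v : heis R).

Definition c0 : R := (Num.sqrt (2 * pi))^-1.
Lemma c0_gt0 : 0 < c0.
Proof. by rewrite invr_gt0 sqrtr_gt0 mulr_gt0// pi_gt0. Qed.

Lemma meas_cis (a : R) : cmeasurable (fun s : measurableTypeR R => cis (- (s * a))).
Proof.
apply: cmeasurable_cis; apply: continuous_measurable_fun => x.
by apply: cvgN; apply: cvgM; [exact: cvg_id|exact: cvg_cst].
Qed.

Lemma fs_int u p : schwartz u -> cintegrable leb (fun s : measurableTypeR R => cis (- (s * p.2)) * u (p.1, s)).
Proof.
move=> su; have iu := schwartz_sec p.1 su.
apply: (cint_dom _ _ (cint_normc iu)); first by apply: cmeasurableM; [exact: meas_cis|exact: cint_meas iu].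
by move=> s; rewrite normcM normc_cis mul1r.
Qed.

Lemma fsM (m : R * R -> R[i]) u p : schwartz u ->
  fourier_s (fun p => m p.1 * u p) p = m p.1 * fourier_s u p.
Proof.
move=> su; rewrite /fourier_s mulrCA -(cintegralZ _ (fs_int p su)).
by congr (_ * _); apply: eq_cintegral => s /=; rewrite mulrCA.
Qed.

Lemma fs_ds u p : schwartz u -> fourier_s (pd es u) p = 'i%C * (p.2)%:C * fourier_s u p.
Proof.
move=> su; have su' := schwartz_pd su esD.
have [C C0 uC] := schwartz_bound su.
pose g (s : R) := cis (- (s * p.2)) * u (p.1, s).
pose g' (s : R) := 'i%C * (- p.2)%:C * (cis (- (s * p.2)) * u (p.1, s)) + cis (- (s * p.2)) * pd es u (p.1, s).
have dg s : hasder g s 1 (g' s).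
  have dl : is_derive s 1 (fun s : R => - (s * p.2)) (- p.2).
    by apply: (is_derive_eq (is_deriveN (is_deriveM (is_derive_id _ _) (is_derive_cst p.2 _ _)))); rewrite /GRing.scale/=; ring.
  have := schwartz_lines p su s; rewrite -surjective_pairing => du.
  by apply: (hasder_eq (hasderM (hasder_cis dl) du)); rewrite /g'; ring.
have ig' : cintegrable leb g' by apply: cintD; [apply: cintZ; exact: fs_int|exact: fs_int].
have cdl : continuous (fun s : R => - (s * p.2)).
  by move=> s; apply: cvgN; apply: cvgM; [exact: cvg_id|exact: cvg_cst].
have cv := hasder_cont (schwartz_lines p su'); have cu := hasder_cont (schwartz_lines p su).
rewrite -surjective_pairing in cv cu.
have [cg1 cg2] : ccont g'.
  apply: ccontD; apply: ccontM => //; last exact: ccont_cis.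
    exact: ccont_cst.
  by apply: ccontM => //; exact: ccont_cis.
have := cint_der0 (C := C * w1 p.1.1 * w1 p.1.2) dg cg1 cg2 ig' _.
rewrite cintegralD; [|by apply: cintZ; exact: fs_int|exact: fs_int].
rewrite cintegralZ; last exact: fs_int.
rewrite /fourier_s; set B := cintegral _ _; set A := cintegral _ _ => h.
have -> : A = 'i%C * (p.2)%:C * B.
  apply/eqP; rewrite -subr_eq0; apply/eqP; rewrite -[RHS]h; first by rewrite rmorphN; ring.
  by move=> s; rewrite /g normcM normc_cis mul1r; apply: le_trans (uC _) _; rewrite /wt/= !mulrA.
by ring.
Qed.

Lemma fs_bound u : schwartz u -> exists C, forall p, `N (fourier_s u p) <= C.
Proof.
move=> su; have [C C0 uC] := schwartz_bound su.
exists (c0 * Rintegral leb setT (fun s => C * w1 s)) => p.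
rewrite /fourier_s normcM normcR ger0_norm ?(ltW c0_gt0)// ler_wpM2l ?(ltW c0_gt0)//.
apply: normc_cintegral_le; first exact: cint_meas (fs_int p su).
  move=> s; rewrite normcM normc_cis mul1r; apply: le_trans (uC _) _.
  rewrite /wt/= ler_wpM2l// ler_piMl ?w1_ge0//.
  by rewrite mulr_ile1 ?w1_ge0 ?w1_le1.
by apply: intbleZ; exact: intble_w1.
Qed.

Lemma fs_rdec u : schwartz u -> rdec (fourier_s u).
Proof.
move=> su k; elim: k u su => [|k IH] u su.
  by have [C HC] := fs_bound su; exists C => p; rewrite expr0 mul1r.
have [C0 H0] := IH _ su.
have [C1 H1] := IH _ (schwartzM (mult_x (R := R)) su).
have [C2 H2] := IH _ (schwartzM (mult_y (R := R)) su).
have [C3 H3] := IH _ (schwartz_pd su esD).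
exists (C0 + C1 + C2 + C3) => p.
have e1 : `N (fourier_s (fun p => (p.1.1)%:C * u p) p) = `|p.1.1| * `N (fourier_s u p).
  by rewrite (fsM (fun q => (q.1)%:C) _ su) normcM normcR.
have e2 : `N (fourier_s (fun p => (p.1.2)%:C * u p) p) = `|p.1.2| * `N (fourier_s u p).
  by rewrite (fsM (fun q => (q.2)%:C) _ su) normcM normcR.
have e3 : `N (fourier_s (pd es u) p) = `|p.2| * `N (fourier_s u p).
  by rewrite fs_ds// !normcM normci mul1r normcR.
have := H0 p; have := H1 p; have := H2 p; have := H3 p; rewrite e1 e2 e3 => h3 h2 h1 h0.
have P0 : 0 <= (1 + `|p|) ^+ k * `N (fourier_s u p) by rewrite mulr_ge0 ?normc_ge0// exprn_ge0// addr_ge0.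
apply: (@le_trans _ _ ((1 + (`|p.1.1| + `|p.1.2| + `|p.2|)) * ((1 + `|p|) ^+ k * `N (fourier_s u p)))).
  by rewrite exprS -mulrA ler_wpM2r// lerD2l norm_sum.
lra.
Qed.

Lemma fs_hasder u v : schwartz u -> v \in dirs ->
  exists2 w, schwartz w & forall p, hasder (fourier_s u) p v (fourier_s w p).
Proof.
move=> su; rewrite !inE => vD; case/or3P: vD => /eqP ->.
- exists (pd ex u); first exact: schwartz_pd su exD.
  move=> p; apply/hasder_ex; have [C C0 uC] := schwartz_bound (schwartz_pd su exD).
  have := hasder_under (mu := leb) (K := fun t s => cis (- (s * p.2)) * u (t, p.1.2, s))
    (K' := fun t s => cis (- (s * p.2)) * pd ex u (t, p.1.2, s)) (g := fun s => C * w1 s) (a := p.1.1) (b := p.1.1 - 1) (c := p.1.1 + 1).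
  move=> /(_ _ _ _ _ _) h.
  apply: (hasder_eq (hasderM (hasder_cst c0%:C _ _) (h _ _ _ _ _))).
  + by apply/andP; split; lra.
  + by move=> x _; exact: (fs_int (x, p.1.2, p.2) su).
  + move=> x s _.
    apply: (hasder_eq (hasderM (hasder_cst (cis (- (s * p.2))) _ _) (schwartz_linex (p.1, s) su x))).
    by rewrite mul0r add0r.
  + move=> x s _; rewrite normcM normc_cis mul1r; apply: le_trans (uC _) _.
    by rewrite /wt/= ler_wpM2l// ler_piMl ?w1_ge0// mulr_ile1 ?w1_ge0 ?w1_le1.
  + by apply: intbleZ; exact: intble_w1.
  + by rewrite mul0r add0r /fourier_s; case: p {h} => -[].
- exists (pd ey u); first exact: schwartz_pd su eyD.
  move=> p; apply/hasder_ey; have [C C0 uC] := schwartz_bound (schwartz_pd su eyD).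
  have := hasder_under (mu := leb) (K := fun t s => cis (- (s * p.2)) * u (p.1.1, t, s))
    (K' := fun t s => cis (- (s * p.2)) * pd ey u (p.1.1, t, s)) (g := fun s => C * w1 s) (a := p.1.2) (b := p.1.2 - 1) (c := p.1.2 + 1).
  move=> /(_ _ _ _ _ _) h.
  apply: (hasder_eq (hasderM (hasder_cst c0%:C _ _) (h _ _ _ _ _))).
  + by apply/andP; split; lra.
  + by move=> x _; exact: (fs_int (p.1.1, x, p.2) su).
  + move=> x s _.
    apply: (hasder_eq (hasderM (hasder_cst (cis (- (s * p.2))) _ _) (schwartz_liney (p.1, s) su x))).
    by rewrite mul0r add0r.
  + move=> x s _; rewrite normcM normc_cis mul1r; apply: le_trans (uC _) _.
    by rewrite /wt/= ler_wpM2l// ler_piMl ?w1_ge0// mulr_ile1 ?w1_ge0 ?w1_le1.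
  + by apply: intbleZ; exact: intble_w1.
  + by rewrite mul0r add0r /fourier_s; case: p {h} => -[].
- have sw : schwartz (fun p => - 'i%C * ((p.2)%:C * u p)).
    by apply: schwartzZ; apply: (schwartzM (mult_s (R := R))).
  exists (fun p => - 'i%C * ((p.2)%:C * u p)) => //.
  move=> [[x0 y0] s0]; apply/hasder_es; have [C C0 uC] := schwartz_bound sw.
  have := hasder_under (mu := leb) (K := fun t s => cis (- (s * t)) * u (x0, y0, s))
    (K' := fun t s => cis (- (s * t)) * (- 'i%C * (s%:C * u (x0, y0, s)))) (g := fun s => C * w1 s) (a := s0) (b := s0 - 1) (c := s0 + 1).
  move=> /(_ _ _ _ _ _) h.
  apply: (hasder_eq (hasderM (hasder_cst c0%:C _ _) (h _ _ _ _ _))).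
  + by apply/andP; split; lra.
  + by move=> x _; exact: (fs_int (x0, y0, x) su).
  + move=> t s _.
    have dl : is_derive t 1 (fun t : R => - (s * t)) (- s).
      by apply: (is_derive_eq (is_deriveN (is_deriveM (is_derive_cst s _ _) (is_derive_id _ _)))); rewrite /GRing.scale/=; ring.
    apply: (hasder_eq (hasderM (hasder_cis dl) (hasder_cst (u (x0, y0, s)) _ _))).
    by rewrite rmorphN; ring.
  + move=> t s _; rewrite normcM normc_cis mul1r; apply: le_trans (uC (x0, y0, s)) _.
    by rewrite /wt/= ler_wpM2l// ler_piMl ?w1_ge0// mulr_ile1 ?w1_ge0 ?w1_le1.
  + by apply: intbleZ; exact: intble_w1.
  + by rewrite mul0r add0r /fourier_s.
Qed.

Lemma fs_schwartz u : schwartz u -> schwartz (fourier_s u).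
Proof.
move=> su; apply: (@schwartz_coind _ (fun w => exists2 u, schwartz u & w = fourier_s u)); last by exists u.
  by move=> _ [w sw ->]; exact: fs_rdec.
move=> _ v [w sw ->] vD; have [w' sw' h] := fs_hasder sw vD.
by exists (fourier_s w') => //; exists w'.
Qed.

End PartialFourier.

(** * Fourier inversion on the line *)
Section FubiniGeneral.
Context {R : realType} d1 d2 (T1 : measurableType d1) (T2 : measurableType d2).
Variables (m1 : {sigma_finite_measure set T1 -> \bar R})
          (m2 : {sigma_finite_measure set T2 -> \bar R}).

Lemma intble_fubini2 (f : T1 * T2 -> R) : intble (m1 \x m2)%E f ->
  (forall y, intble m1 (fun x => f (x, y))) ->
  intble m2 (fun y => Rintegral m1 setT (fun x => f (x, y))) /\
  Rintegral m2 setT (fun y => Rintegral m1 setT (fun x => f (x, y))) = Rintegral (m1 \x m2)%E setT f.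
Proof.
move=> fi fs.
have mf := measurable_int _ fi.
have GE : EFin \o (fun y => Rintegral m1 setT (fun x => f (x, y))) = fubini_G m1 (EFin \o f).
  apply/funext => y; rewrite /fubini_G /= /Rintegral fineK//.
  by apply: integrable_fin_num => //; exact: fs.
have Gi : m2.-integrable setT (fubini_G m1 (EFin \o f)).
  apply/integrableP; split; first by have := measurable_fubini_G fi.
  have := (integrable21ltyP m1 m2 mf).1 fi; apply: le_lt_trans.
  apply: ge0_le_integral => //.
  - by apply: measurableT_comp => //; have := measurable_fubini_G fi.
  - apply: (@measurable_fun_fubini_tonelli_G _ _ _ _ _ m1 (abse \o (EFin \o f))).
      exact: measurableT_comp.
    by move=> x; exact: abse_ge0.
  - move=> y _; apply: le_abse_integral => //.
    by have := measurable_int _ (fs y).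
split; first by rewrite GE.
by rewrite [LHS]/Rintegral [RHS]/Rintegral -(integral21_prod_meas1 fi) -GE.
Qed.

Lemma cfubini_gen (K : T1 * T2 -> R[i]) : cintegrable (m1 \x m2)%E K ->
  (forall y, cintegrable m1 (fun x => K (x, y))) ->
  cintegrable m2 (fun y => cintegral m1 (fun x => K (x, y))) /\
  cintegral m2 (fun y => cintegral m1 (fun x => K (x, y))) = cintegral (m1 \x m2)%E K.
Proof.
move=> [K1 K2] Ks.
have [a1 a2] := intble_fubini2 K1 (fun y => (Ks y).1).
have [b1 b2] := intble_fubini2 K2 (fun y => (Ks y).2).
by split => //; rewrite /cintegral/= a2 b2.
Qed.

End FubiniGeneral.

Section Reflection.
Context {R : realType}.
Local Notation leb := (@lebesgue_measure R).
Local Notation cintble := (cintegrable leb).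

Lemma cint_reflect (u : R -> R[i]) : cintble (u : measurableTypeR R -> R[i]) ->
  cintble (fun x : measurableTypeR R => u (- x)).
Proof. by move=> [i1 i2]; split; [exact: (Rint_reflect i1).1|exact: (Rint_reflect i2).1]. Qed.

Lemma cintegral_reflect (u : R -> R[i]) : cintble (u : measurableTypeR R -> R[i]) ->
  cintegral leb (fun x : measurableTypeR R => u (- x)) = cintegral leb (u : measurableTypeR R -> R[i]).
Proof.
move=> [i1 i2]; rewrite /cintegral.
by rewrite (Rint_reflect i1).2 (Rint_reflect i2).2.
Qed.

End Reflection.

Section RealLinearity.
Context {R : realType} d (T : measurableType d) (mu : {measure set T -> \bar R}).
Implicit Types f g : T -> R.
Lemma RintD f g : intble mu f -> intble mu g ->
  Rintegral mu setT (fun x => f x + g x) = Rintegral mu setT f + Rintegral mu setT g.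
Proof. by move=> fi gi; rewrite RintegralD. Qed.
Lemma RintB f g : intble mu f -> intble mu g ->
  Rintegral mu setT (fun x => f x - g x) = Rintegral mu setT f - Rintegral mu setT g.
Proof. by move=> fi gi; rewrite RintegralB. Qed.
Lemma RintZ k f : intble mu f -> Rintegral mu setT (fun x => k * f x) = k * Rintegral mu setT f.
Proof. by move=> fi; rewrite RintegralZl. Qed.
End RealLinearity.

Lemma intble_meas1 (R : realType) (f : R -> R) : intble (@lebesgue_measure R) f ->
  measurable_fun setT (f : measurableTypeR R -> R).
Proof. by move/measurable_int/measurable_EFinP. Qed.

Section Exponentials.
Context {R : realType}.
Local Notation leb := (@lebesgue_measure R).
Local Notation cint := (cintegral leb).
Local Notation cintble := (cintegrable leb).
Local Notation R1 := (measurableTypeR R).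

Definition cexp (a b : R) (s : R) : R[i] := (expR (- (a * s)))%:C * cis (b * s).

Lemma normc_cexp a b s : `N (cexp a b s) = expR (- (a * s)).
Proof. by rewrite normcM normc_cis mulr1 normcR ger0_norm ?expR_ge0. Qed.

Lemma linear_cont (a : R) : continuous (fun s : R => a * s).
Proof. by move=> s; apply: cvgM; [exact: cvg_cst|exact: cvg_id]. Qed.
Lemma expR_cont (a : R) : continuous (fun s : R => expR (- (a * s))).
Proof.
move=> s; apply: (@continuous_comp _ _ _ (fun s : R => - (a * s)) (@expR R)); last exact: continuous_expR.
by apply: cvgN; exact: linear_cont.
Qed.
Lemma ccont_cexp a b : ccont (cexp a b).
Proof.
apply: ccontM; first by apply: ccontR; exact: expR_cont.
by apply: ccont_cis; exact: linear_cont.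
Qed.
Lemma hasder_cexp a b (s : R) : hasder (cexp a b) s 1 ((- a%:C + 'i%C * b%:C) * cexp a b s).
Proof.
have d1 : is_derive s 1 (fun s : R => - (a * s)) (- a).
  by apply: (is_derive_eq (is_deriveN (is_deriveM (is_derive_cst a _ _) (is_derive_id _ _)))); rewrite /GRing.scale/=; ring.
have d2 : is_derive s 1 (fun s : R => b * s) b.
  by apply: (is_derive_eq (is_deriveM (is_derive_cst b _ _) (is_derive_id _ _))); rewrite /GRing.scale/=; ring.
apply: (hasder_eq (hasderM (hasderR (is_derive1_comp (is_derive_expR _) d1)) (hasder_cis d2))).
by rewrite /cexp /comp rmorphM rmorphN; ring.
Qed.

Lemma cvg_expRn (a c : R) : 0 < a -> expR (- (a * (c + n.+1%:R))) @[n --> \oo] --> (0 : R).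
Proof.
move=> a0; have h : a * (c + n.+1%:R) @[n --> \oo] --> +oo%R.
  apply/cvgryPge => M.
  exists (Num.truncn `|M / a - c|) => // n /= Nn.
  rewrite -ler_pdivrMl// mulrC -lerBlDl (le_trans (ler_norm _))//.
  by rewrite (le_trans (ltW (truncnS_gt _)))// ler_nat.
exact: (cvg_comp _ _ h (@cvgr_expR R)).
Qed.

Lemma intble_expR (a c : R) : 0 < a -> intble leb (fun s => expR (- (a * s)) * \1_`[c, +oo[ s).
Proof.
move=> a0; apply: (@intble_ge0_halfline _ _ (fun s => - a^-1 * expR (- (a * s))) c (a^-1 * expR (- (a * c)))).
- by apply: continuous_measurable_fun; exact: expR_cont.
- by move=> x _; exact: expR_cont.
- by move=> x _; exact: expR_ge0.
- move=> s _.
  have d1 : is_derive s 1 (fun s : R => - (a * s)) (- a).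
    by apply: (is_derive_eq (is_deriveN (is_deriveM (is_derive_cst a _ _) (is_derive_id _ _)))); rewrite /GRing.scale/=; ring.
  apply: (is_derive_eq (is_deriveM (is_derive_cst (- a^-1) _ _) (is_derive1_comp (is_derive_expR _) d1))).
  by rewrite /GRing.scale/=; field; rewrite gt_eqF.
- move=> n; have := expR_ge0 (- (a * (c + n.+1%:R))); have : 0 < a^-1 by rewrite invr_gt0.
  by nra.
Qed.

Lemma cint_cexp (a b c : R) : 0 < a ->
  cintble (fun s : R1 => cexp a b s * (\1_`[c, +oo[ s)%:C).
Proof.
move=> a0; apply: (cint_dom1 _ _ (intble_expR c a0)).
  apply: cmeasurableM; first by apply: ccont_meas; exact: ccont_cexp.
  by apply: cmeasurableC; exact: measurable_indic.
by move=> s; rewrite normcM normc_cexp normcR indicE normr_nat.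
Qed.

Lemma cintegral_cexp (a b c : R) : 0 < a ->
  cint (fun s : R1 => cexp a b s * (\1_`[c, +oo[ s)%:C) =
  cexp a b c * (a%:C - 'i%C * b%:C)^-1.
Proof.
move=> a0.
have z0 : a%:C - 'i%C * b%:C != 0 :> R[i].
  by apply/eqP => /(congr1 (@Re R)); rewrite !cE; move=> h; lra.
pose G s := - (a%:C - 'i%C * b%:C)^-1 * cexp a b s.
have dG s : hasder G s 1 (cexp a b s).
  apply: (hasder_eq (hasderM (hasder_cst (- (a%:C - 'i%C * b%:C)^-1) _ _) (hasder_cexp a b s))).
  by field.
have [i1 i2] := cint_cexp b c a0.
have e0 := cvg_expRn c a0.
have [c1 c2] := ccont_cexp a b.
have lim0 (h : R -> R) : (forall s, `|h s| <= `N (G s)) -> h (c + n.+1%:R) @[n --> \oo] --> (0 : R).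
  move=> hG; apply/cvgr0Pnorm_le => e ep.
  have /cvgr0Pnorm_le/(_ e ep) : (`N ((a%:C - 'i%C * b%:C)^-1) * expR (- (a * (c + n.+1%:R))) : R) @[n --> \oo] --> (0 : R).
    by rewrite -[X in _ --> X](mulr0 (`N ((a%:C - 'i%C * b%:C)^-1))); apply: cvgM; [exact: cvg_cst|exact: e0].
  apply: filterS => n; rewrite ger0_norm ?mulr_ge0 ?expR_ge0 ?normc_ge0// => /(le_trans _); apply.
  by apply: le_trans (hG _) _; rewrite /G normcM normcN normc_cexp.
have fE1 : (fun s => Re (cexp a b s * (\1_`[c, +oo[ s)%:C)) = (fun s => Re (cexp a b s) * \1_`[c, +oo[ s).
  by apply/funext => s; rewrite ReM ReC ImC mulr0 subr0.
have fE2 : (fun s => Im (cexp a b s * (\1_`[c, +oo[ s)%:C)) = (fun s => Im (cexp a b s) * \1_`[c, +oo[ s).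
  by apply/funext => s; rewrite ImM ReC ImC mulr0 add0r.
have i1' : intble leb (fun s => Re (cexp a b s) * \1_`[c, +oo[ s) by rewrite -fE1; exact: i1.
have i2' : intble leb (fun s => Im (cexp a b s) * \1_`[c, +oo[ s) by rewrite -fE2; exact: i2.
rewrite /cintegral fE1 fE2.
rewrite (FTC_halfline (fun x _ => c1 x) (fun x _ => (dG x).1) i1' (lim0 _ (fun s => normc_Re _))).
rewrite (FTC_halfline (fun x _ => c2 x) (fun x _ => (dG x).2) i2' (lim0 _ (fun s => normc_Im _))).
rewrite !sub0r -ReN -ImN.
by rewrite {1 2}/G mulNr opprK mulrC; case: (_ * _).
Qed.

(** The Abel kernel: the Fourier transform of [exp (- e |s|)]. *)
Definition abel (e s : R) : R := expR (- (e * `|s|)).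
Lemma abel_ge0 e s : 0 <= abel e s. Proof. exact: expR_ge0. Qed.
Lemma meas_abel e : measurable_fun setT (abel e).
Proof.
apply: continuous_measurable_fun => s.
apply: (@continuous_comp _ _ _ (fun s : R => `|s|) (fun s => expR (- (e * s)))).
  exact: norm_continuous.
exact: expR_cont.
Qed.
Lemma abelE (e t s : R) : (abel e s)%:C * cis (t * s) =
  cexp e t s * (\1_`[0, +oo[ s)%:C + cexp e (- t) (- s) * (\1_`[0, +oo[ (- s))%:C - (\1_[set 0] s)%:C.
Proof.
rewrite !indicE; have [s0|s0|s0] := ltrgtP s 0.
- rewrite (memNset (A := `[0, +oo[)) ?mulr0 ?add0r; last by rewrite /= in_itv/= andbT leNgt s0.
  rewrite mem_set ?mulr1; last by rewrite /= in_itv/= andbT oppr_ge0 ltW.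
  rewrite memNset ?subr0; last by rewrite /= => s00; rewrite s00 ltxx in s0.
  by rewrite /abel /cexp ltr0_norm// mulrNN.
- rewrite mem_set ?mulr1; last by rewrite /= in_itv/= andbT ltW.
  rewrite (memNset (A := `[0, +oo[)) ?mulr0 ?addr0; last by rewrite /= in_itv/= andbT oppr_ge0 leNgt s0.
  rewrite memNset ?subr0; last by rewrite /= => s00; rewrite s00 ltxx in s0.
  by rewrite /abel /cexp gtr0_norm.
- rewrite s0 oppr0 !mem_set//=; last by rewrite in_itv/= lexx.
  by rewrite /abel /cexp normr0 !mulr0 oppr0 expR0 cis0; ring.
Qed.
Lemma cint_point : cintble (fun s : R1 => (\1_[set 0] s : R)%:C) /\
  cint (fun s : R1 => (\1_[set 0] s : R)%:C) = 0.
Proof.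
have e0 : (\int[leb]_s (\1_[set (0:R)] s)%:E = 0)%E.
  by rewrite integral_indic//= setIT lebesgue_measure_set1.
split; last by rewrite cintegralC /Rintegral e0.
apply: (@cint_dom1 _ _ (\1_[set (0:R)])).
- by apply: cmeasurableC; exact: measurable_indic.
- by move=> s; rewrite normcR ger0_norm.
apply/integrableP; split; first by apply/measurable_EFinP; exact: measurable_indic.
rewrite (_ : (fun _ => _) = (fun s : R1 => (\1_[set (0:R)] s)%:E)); last first.
  by apply/funext => s /=; rewrite ger0_norm.
by rewrite e0 ltry.
Qed.

Lemma cintegral_abel (e t : R) : 0 < e ->
  cintble (fun s : R1 => (abel e s)%:C * cis (t * s)) /\
  cint (fun s : R1 => (abel e s)%:C * cis (t * s)) = (2 * e / (e ^+ 2 + t ^+ 2))%:C.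
Proof.
move=> e0; have i1 := cint_cexp t 0 e0; have i2 := cint_cexp (- t) 0 e0.
have i3 := cint_reflect i2; have [i4 z] := cint_point.
have E : (fun s : R1 => (abel e s)%:C * cis (t * s)) = (fun s : R1 =>
  cexp e t s * (\1_`[0, +oo[ s)%:C + cexp e (- t) (- s) * (\1_`[0, +oo[ (- s))%:C - (\1_[set (0:R)] s : R)%:C).
  by apply/funext => s; exact: abelE.
rewrite E; split; first by apply: cintB => //; exact: cintD.
rewrite cintegralB//; last exact: cintD.
rewrite cintegralD// (cintegral_reflect i2) !cintegral_cexp// z subr0.
have ep : e ^+ 2 + t ^+ 2 != 0.
  by rewrite gt_eqF// ltr_wpDr ?sqr_ge0// exprn_gt0.
have c1 : cexp e t 0 = 1 by rewrite /cexp !mulr0 oppr0 expR0 cis0 mulr1.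
have c2 : cexp e (- t) 0 = 1 by rewrite /cexp !mulr0 oppr0 expR0 cis0 mulr1.
have z1 : e%:C - 'i%C * t%:C != 0 :> R[i].
  by apply/eqP => /(congr1 (@Re R)); rewrite !cE; move=> h; lra.
have z2 : e%:C - 'i%C * (- t)%:C != 0 :> R[i].
  by apply/eqP => /(congr1 (@Re R)); rewrite !cE; move=> h; lra.
rewrite c1 c2 !mul1r; apply: (mulfI (mulf_neq0 z1 z2)).
have abV (x y : R[i]) : x != 0 -> y != 0 -> x * y * (x^-1 + y^-1) = y + x by move=> *; field; apply/andP.
rewrite abV//.
by apply: cplxP; rewrite !cE; field.
Qed.

End Exponentials.

Section Inversion1.
Context {R : realType}.
Local Notation leb := (@lebesgue_measure R).
Local Notation Rint := (Rintegral leb setT).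
Local Notation cint := (cintegral leb).
Local Notation cintble := (cintegrable leb).
Local Notation R1 := (measurableTypeR R).

Definition poisson (e t : R) : R := 2 * e / (e ^+ 2 + t ^+ 2).

Lemma poisson_int (e a : R) : 0 < e -> intble leb (fun t => poisson e (t - a)) /\
  Rint (fun t => poisson e (t - a)) = 2 * pi.
Proof.
move=> e0.
have ep t : e ^+ 2 + t ^+ 2 != 0 by rewrite gt_eqF// ltr_wpDr ?sqr_ge0// exprn_gt0.
have cp : continuous (poisson e).
  move=> t; rewrite /poisson; apply: cvgM; first exact: cvg_cst.
  apply: (@cvgV _ _ _ _ (fun t : R => e ^+ 2 + t ^+ 2)) => //.
  by apply: cvgD; [exact: cvg_cst|exact: (@exprn_continuous R 2 t)].
have dF (t : R) : is_derive t 1 (fun t => 2 * atan (t / e)) (poisson e t).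
  have d1 : is_derive t 1 (fun t : R => t / e) e^-1.
    by apply: (is_derive_eq (is_deriveM (is_derive_id _ _) (is_derive_cst e^-1 _ _))); rewrite /GRing.scale/=; ring.
  have d2 : is_derive t 1 (fun t : R => atan (t / e)) ((1 + (t / e) ^+ 2)^-1 * e^-1).
    exact: (is_derive1_comp (is_derive1_atan _) d1).
  apply: (is_derive_eq (is_deriveM (is_derive_cst (2 : R) _ _) d2)).
  rewrite /GRing.scale/= /poisson; field.
  by rewrite ep gt_eqF//= gt_eqF// ltr_wpDr ?sqr_ge0// exprn_gt0.
have p0 t : 0 <= poisson e t.
  by rewrite /poisson divr_ge0 ?mulr_ge0 ?(ltW e0)// addr_ge0 ?sqr_ge0.
have ip : intble leb (poisson e).
  apply: (@intble_ge0_line _ _ (fun t => 2 * atan (t / e)) (2 * pi)) => // n.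
  have := atan_ltpi2 (n.+1%:R / e : R); have := atan_gtNpi2 (- n.+1%:R / e : R).
  by move=> h1 h2; lra.
have [ipa ->] := Rint_translate (- a) ip.
split => //.
have lim : 2 * atan (n.+1%:R / e) @[n --> \oo] --> (pi : R).
  rewrite [X in _ --> X](_ : _ = 2 * (pi / 2)); last by field.
  apply: cvgM; first exact: cvg_cst.
  have h : n.+1%:R / e @[n --> \oo] --> +oo%R.
    apply/cvgryPge => M.
    exists (Num.truncn `|M * e|) => // n /= Nn.
    rewrite ler_pdivlMr// (le_trans (ler_norm _))//.
    by rewrite (le_trans (ltW (truncnS_gt _)))// ler_nat.
  exact: (cvg_comp _ _ h (@cvgy_atan R)).
rewrite (FTC_line (f := poisson e) cp dF ip lim (m := - pi)); first by ring.
under eq_fun do rewrite mulNr atanN mulrN.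
exact: cvgN.
Qed.

Lemma poisson_tail (e t d : R) : 0 < e -> 0 < d -> d <= `|t| -> poisson e t <= 2 * e * (1 + d ^- 2) * w1 t.
Proof.
move=> e0 d0 dt; rewrite /poisson /w1 -!mulrA ler_pM2l// ler_pM2l//.
have t2 : d ^+ 2 <= t ^+ 2 by rewrite -(real_normK (num_real t)) lerXn2r// ?nnegrE// ltW.
have dd : 0 < d ^+ 2 by rewrite exprn_gt0.
have tt := lt_le_trans dd t2.
rewrite ler_pdivlMr; last by rewrite ltr_wpDr ?sqr_ge0.
rewrite mulrC ler_pdivrMr; last by rewrite ltr_wpDr ?sqr_ge0// exprn_gt0.
have h : 1 <= d ^- 2 * t ^+ 2 by rewrite mulrC ler_pdivlMr// mul1r.
have := sqr_ge0 e; have : 0 < d ^- 2 by rewrite invr_gt0.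
by nra.
Qed.

Lemma invn_gt0 (n : nat) : 0 < (n.+1%:R^-1 : R). Proof. by rewrite invr_gt0. Qed.

(** Fourier inversion on the line by Abel summation: smoothing the transform
    by [exp (- e |s|)] turns the inverse transform into a Poisson integral. *)
Lemma fourier_inversion (g : R -> R[i]) (M a : R) :
  cintble (g : R1 -> R[i]) -> (forall t, `N (g t) <= M) ->
  (forall e : R, 0 < e -> exists2 d : R, 0 < d & forall t, `|t - a| < d -> `N (g t - g a) <= e) ->
  let gh := fun s : R1 => cint (fun t : R1 => g t * cis (t * s)) in
  cintble gh ->
  cint (fun s : R1 => gh s * cis (- (s * a))) = (2 * pi)%:C * g a.
Proof.
move=> ig gM ca gh igh.
have mg := cint_meas ig.
have M0 : 0 <= M by apply: le_trans (gM 0); exact: normc_ge0.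
set L := cintegral _ _.
pose A (e : R) := cint (fun s : R1 => (abel e s)%:C * (gh s * cis (- (s * a)))).
have abel1 (e s : R) : 0 < e -> abel e s <= 1.
  by move=> e0; rewrite -expR0 ler_expR oppr_le0 mulr_ge0// ltW.
have mcis : cmeasurable (fun s : R1 => cis (- (s * a))) by exact: meas_cis.
have AL : ccvg (fun n => A n.+1%:R^-1) L.
  have [] := @cint_dct _ _ _ leb (fun n s => (abel n.+1%:R^-1 s)%:C * (gh s * cis (- (s * a))))
     (fun s => gh s * cis (- (s * a))) (fun s => `N (gh s)) => //.
  - move=> n; apply: cmeasurableM; first by apply: cmeasurableC; exact: meas_abel.
    by apply: cmeasurableM => //; exact: cint_meas igh.
  - by apply: cmeasurableM => //; exact: cint_meas igh.
  - move=> s; rewrite /ccvg.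
    have h : abel n.+1%:R^-1 s @[n --> \oo] --> (1 : R).
      rewrite -[X in _ --> X]expR0 /abel.
      have h0 : - (n.+1%:R^-1 * `|s|) @[n --> \oo] --> (0 : R).
        rewrite -oppr0; apply: cvgN; rewrite -[X in _ --> X](mul0r `|s|).
        by apply: cvgM; [exact: cvg_inv0|exact: cvg_cst].
      exact: (cvg_comp _ _ h0 (@continuous_expR R 0)).
    apply: (@cvg_le0 _ _ (fun n => (1 - abel n.+1%:R^-1 s) * `N (gh s))).
      move=> n; rewrite normc_ge0/= -{2}[gh s * _]mul1r -mulrBl normcM.
      rewrite normcM normc_cis mulr1.
      rewrite (_ : (abel n.+1%:R^-1 s)%:C - 1 = (abel n.+1%:R^-1 s - 1)%:C); last by rewrite rmorphB rmorph1.
      by rewrite normcR distrC ger0_norm// subr_ge0 abel1 ?invn_gt0.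
    rewrite -[X in _ --> X](mul0r (`N (gh s))); apply: cvgM; last exact: cvg_cst.
    by rewrite -[X in _ --> X](subrr (1:R)); apply: cvgB => //; exact: cvg_cst.
  - exact: cint_normc.
  - move=> n s; rewrite !normcM normc_cis mulr1 normcR ger0_norm ?abel_ge0//.
    by rewrite ler_piMl ?normc_ge0// abel1 ?invn_gt0.
have AE (e : R) : 0 < e -> A e = cint (fun t : R1 => g t * (poisson e (t - a))%:C).
  move=> e0.
  pose K (p : R1 * R1) : R[i] := g p.1 * (cis (p.1 * p.2) * ((abel e p.2)%:C * cis (- (p.2 * a)))).
  have mK : cmeasurable K.
    apply: cmeasurableM; first by apply: cmeasurable_comp mg.
    apply: cmeasurableM.
      by apply: cmeasurable_cis; apply: measurable_funM.
    apply: cmeasurableM.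
      by apply: cmeasurableC; apply: (measurableT_comp (meas_abel e)).
    by apply: (cmeasurable_comp _ mcis).
  have ia : intble leb (abel e).
    have [h _] := cintegral_abel 0 e0; have := cint_normc h; apply: eq_integrable => // s _ /=.
    by rewrite normcM normc_cis mulr1 normcR ger0_norm ?abel_ge0.
  have := @cfubini R _ _ R1 R1 leb leb K (fun t => `N (g t)) (abel e) mK _ (cint_normc ig) ia.
  move=> F; have {}F := F _; rewrite /A.
  transitivity (cint (fun y : R1 => cint (fun x : R1 => K (x, y)))).
    apply: eq_cintegral => s; rewrite /gh mulrC -mulrA mulrCA [X in _ = X](_ : _ = cint (fun t : R1 => ((abel e s)%:C * cis (- (s * a))) * (g t * cis (t * s)))); last first.
      by apply: eq_cintegral => t; rewrite /K/=; ring.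
    rewrite cintegralZ.
      by ring.
    apply: (cint_dom1 _ _ (cint_normc ig)).
      have mc : cmeasurable (fun t : R1 => cis (t * s)).
        have := @meas_cis R (- s); congr cmeasurable; apply/funext => t.
        by rewrite mulrN opprK.
      exact: (@cmeasurableM R _ R1 _ _ mg mc).
    by move=> t; rewrite normcM normc_cis mulr1.
  rewrite -F.
    apply: eq_cintegral => t; rewrite /K/=.
    have [h1 h2] := cintegral_abel (t - a) e0.
    transitivity (g t * cint (fun s : R1 => (abel e s)%:C * cis ((t - a) * s))); last by rewrite h2.
    rewrite -(cintegralZ (g t) h1); apply: eq_cintegral => s.
    rewrite [(t - a) * s]mulrBl cisD [a * s]mulrC; ring.
  move=> p; rewrite /K !normcM !normc_cis mul1r mulr1 normcR.
  by rewrite ger0_norm ?abel_ge0.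
have Alim : ccvg (fun n => A n.+1%:R^-1) ((2 * pi)%:C * g a).
  apply/cvgr0Pnorm_le => e e0.
  pose e1 := e / (4 * pi + 1).
  have pi0 : 0 < pi :> R := pi_gt0 R.
  have e10 : 0 < e1 by rewrite divr_gt0// addr_gt0// mulr_gt0.
  have [d d0 Hd] := ca e1 e10.
  pose C := 2 * M * (2 * (1 + d ^- 2)).
  have C0 : 0 <= C by rewrite !mulr_ge0// addr_ge0// invr_ge0 exprn_ge0// ltW.
  pose W := Rint (fun t => w1 (t - a)).
  have iw := (Rint_translate (- a) (@intble_w1 R)).1.
  have W0 : 0 <= W by apply: Rint_ge0 => t; exact: w1_ge0.
  have key n : `N (A n.+1%:R^-1 - (2 * pi)%:C * g a) <= e1 * (2 * pi) + n.+1%:R^-1 * (C * W).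
    set ep := n.+1%:R^-1; have ep0 : 0 < ep := invn_gt0 n.
    have [ip pE] := poisson_int a ep0.
    have p0 t : 0 <= poisson ep t.
      by rewrite /poisson divr_ge0 ?mulr_ge0 ?(ltW ep0)// addr_ge0 ?sqr_ge0.
    have mp : measurable_fun setT (fun t : R1 => poisson ep (t - a)) := intble_meas1 ip.
    have i1 : cintble (fun t : R1 => g t * (poisson ep (t - a))%:C).
      apply: (@cint_dom1 _ _ (fun t => M * poisson ep (t - a))); last exact: intbleZ.
        by apply: cmeasurableM => //; exact: cmeasurableC.
      by move=> t; rewrite normcM normcR ger0_norm// ler_wpM2r.
    have i2 : cintble (fun t : R1 => (poisson ep (t - a))%:C).
      by apply: (@cint_dom1 _ _ (fun t => poisson ep (t - a))); [exact: cmeasurableC|move=> t; rewrite normcR ger0_norm|exact: ip].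
    rewrite AE// -pE -cintegralC mulrC -cintegralZ// -cintegralB//; last exact: cintZ.
    have -> : e1 * Rint (fun t => poisson ep (t - a)) + ep * (C * W) =
      Rint (fun t => e1 * poisson ep (t - a) + ep * C * w1 (t - a)).
      rewrite (RintD (intbleZ e1 ip) (intbleZ (ep * C) iw)) (RintZ e1 ip) (RintZ (ep * C) iw).
      by rewrite /W; ring.
    apply: (normc_cintegral_le (cint_meas (cintB i1 (cintZ (g a) i2))) _ (intbleD (intbleZ e1 ip) (intbleZ (ep * C) iw))).
    move=> t; rewrite -mulrBl normcM normcR ger0_norm//.
    have [td|td] := ltP `|t - a| d.
      apply: (@le_trans _ _ (e1 * poisson ep (t - a))); first by rewrite ler_wpM2r// Hd.
      by rewrite lerDl; exact: (mulr_ge0 (mulr_ge0 (ltW ep0) C0) (w1_ge0 _)).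
    apply: (@le_trans _ _ (ep * C * w1 (t - a))); last by rewrite lerDr; exact: (mulr_ge0 (ltW e10) (p0 _)).
    apply: (@le_trans _ _ (2 * M * (2 * ep * (1 + d ^- 2) * w1 (t - a)))); last first.
      by apply: le_of_eq; rewrite /C; ring.
    apply: ler_pM; rewrite ?normc_ge0//; last exact: poisson_tail.
    by apply: le_trans (le_normcB _ _) _; have := gM t; have := gM a; lra.
  have : n.+1%:R^-1 * (C * W) @[n --> \oo] --> (0 : R).
    by rewrite -[X in _ --> X](mul0r (C * W)); apply: cvgM; [exact: cvg_inv0|exact: cvg_cst].
  move=> /cvgr0Pnorm_le/(_ (e / 2) _) []; first by lra.
  move=> N _ HN; exists N => // n Nn; rewrite /= ger0_norm ?normc_ge0//.
  apply: le_trans (key n) _; have := le_trans (ler_norm _) (HN n Nn).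
  suff h : e1 * (2 * pi) <= e / 2.
    by move=> h2; apply: le_trans (lerD h h2) _; rewrite -splitr.
  have q0 : 0 < 4 * pi + 1 :> R by rewrite addr_gt0// mulr_gt0.
  rewrite /e1 mulrAC ler_pdivrMr// -mulrA ler_pM2l//.
  by clear -pi0; lra.
by apply: (ccvg_unique AL Alim).
Qed.

End Inversion1.

(** * The waves exp(isz) and the transforms S and J *)
Section ComplexMorphisms.
Context {R : realType}.
Lemma cJM (z w : R[i]) : (z * w)^* = z^* * w^*.
Proof. by apply: cplxP; rewrite !cE; ring. Qed.
Lemma cJD (z w : R[i]) : (z + w)^* = z^* + w^*.
Proof. by apply: cplxP; rewrite !cE; ring. Qed.
Lemma cJR (a : R) : (a%:C)^* = a%:C.
Proof. by apply: cplxP; rewrite !cE ?oppr0. Qed.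
Lemma RCM (a b : R) : (a * b)%:C = a%:C * b%:C.
Proof. by apply: cplxP; rewrite !cE; ring. Qed.
Lemma RCD (a b : R) : (a + b)%:C = a%:C + b%:C.
Proof. by apply: cplxP; rewrite !cE; ring. Qed.
Lemma RCN (a : R) : (- a)%:C = - a%:C.
Proof. by apply: cplxP; rewrite !cE; ring. Qed.
Lemma RC_neq0 (a : R) : a != 0 -> a%:C != 0.
Proof. by move=> a0; apply/eqP => /(congr1 (@Re R)); rewrite !cE => h; rewrite h eqxx in a0. Qed.
Lemma RCV (a : R) : a != 0 -> (a^-1)%:C = (a%:C)^-1.
Proof.
move=> a0; apply: (mulfI (RC_neq0 a0)); rewrite mulfV ?RC_neq0//.
by rewrite -RCM mulfV.
Qed.
End ComplexMorphisms.

Section Gaussians.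
Context {R : realType}.
Local Notation leb := (@lebesgue_measure R).
Local Notation Rint := (Rintegral leb setT).
Local Notation R1 := (measurableTypeR R).
Local Notation R2 := (measurableTypeR R * measurableTypeR R)%type.
Local Notation leb2 := (prod_sf leb leb).

Lemma gauss_cont (a : R) : continuous (fun x : R => expR (- (a * x ^+ 2))).
Proof.
move=> x; have h : - (a * y ^+ 2) @[y --> x] --> - (a * x ^+ 2).
  by apply: cvgN; apply: cvgM; [exact: cvg_cst|exact: (@exprn_continuous R 2 x)].
exact: (cvg_comp _ _ h (@continuous_expR R _)).
Qed.

Lemma gauss1 (a : R) : 0 < a -> intble leb (fun x => expR (- (a * x ^+ 2))) /\
  Rint (fun x => expR (- (a * x ^+ 2))) = Num.sqrt (pi / a).
Proof.
move=> a0; pose r := Num.sqrt a; have r0 : 0 < r by rewrite sqrtr_gt0.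
have dF : derive1 (fun x : R => r * x) = cst r.
  by apply/funext => x; rewrite derive1E; have [_ ->] := is_deriveM (is_derive_cst r x (1:R)) (is_derive_id x (1:R)); rewrite /GRing.scale/= mulr0 addr0 mulr1.
have := @increasing_ge0_integration_by_substitutionT R (fun x => r * x) (fun x => expR (- x ^+ 2)).
rewrite dF => /(_ _ _ _ _ _ _ _ _ _) E.
have {}E : (\int[leb]_x (expR (- x ^+ 2))%:E = \int[leb]_x (r * expR (- (a * x ^+ 2)))%:E)%E.
  rewrite E.
  - by apply: eq_integral => x _; congr (_%:E); rewrite -[LHS]/(expR (- (r * x) ^+ 2) * r) mulrC exprMn sqr_sqrtr ?ltW.
  - by move=> x y xy; rewrite ltr_pM2l.
  - by move=> x; exact: cvg_cst.
  - exact: is_cvg_cst.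
  - exact: is_cvg_cst.
  - by move=> x; have [] := is_deriveM (is_derive_cst r x (1:R)) (is_derive_id x (1:R)).
  - by under eq_fun do rewrite mulrC; apply: (gt0_cvgMlNy r0); exact: cvg_id.
  - by under eq_fun do rewrite mulrC; apply: (gt0_cvgMly r0); exact: cvg_id.
  - have -> : (fun x : R => expR (- x ^+ 2)) = (fun x : R => expR (- (1 * x ^+ 2))).
      by apply/funext => x; rewrite mul1r.
    exact: gauss_cont.
  - by move=> x; exact: expR_ge0.
have G : (\int[leb]_x (expR (- x ^+ 2))%:E = (Num.sqrt pi)%:E)%E := @integralT_gauss R.
have ge x : 0 <= expR (- (a * x ^+ 2)) :> R by exact: expR_ge0.
have mg : measurable_fun setT (fun x : R1 => expR (- (a * x ^+ 2))).
  by apply: continuous_measurable_fun; exact: gauss_cont.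
have E2 : (\int[leb]_x (expR (- (a * x ^+ 2)))%:E = (Num.sqrt pi / r)%:E)%E.
  have : (r%:E * \int[leb]_x (expR (- (a * x ^+ 2)))%:E = (Num.sqrt pi)%:E)%E.
    rewrite -ge0_integralZl//; last 2 first.
    - exact/measurable_EFinP.
    - by rewrite lee_fin ltW.
    by rewrite -G E.
  by move=> /(congr1 (fun z => ((r^-1)%:E * z)%E)); rewrite muleA -EFinM mulVf ?gt_eqF// mul1e => ->; rewrite -EFinM mulrC.
split; last by rewrite /Rintegral E2 /= -sqrtrV ?ltW// -sqrtrM ?pi_ge0.
apply/integrableP; split; first exact/measurable_EFinP.
rewrite (_ : (fun _ => _) = (fun x : R1 => (expR (- (a * x ^+ 2)))%:E)); last first.
  by apply/funext => x /=; rewrite ger0_norm.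
by rewrite E2 ltry.
Qed.

Lemma gauss2 (a : R) : 0 < a ->
  cintegrable leb2 (fun q : R2 => (expR (- (a * (q.1 ^+ 2 + q.2 ^+ 2))))%:C) /\
  cintegral leb2 (fun q : R2 => (expR (- (a * (q.1 ^+ 2 + q.2 ^+ 2))))%:C) = (pi / a)%:C.
Proof.
move=> a0; have [ig gE] := gauss1 a0.
pose g x : R := expR (- (a * x ^+ 2)).
have mg : measurable_fun setT (g : R1 -> R) by apply: continuous_measurable_fun; exact: gauss_cont.
pose K (q : R2) : R[i] := (g q.1 * g q.2)%:C.
have KE : (fun q : R2 => (expR (- (a * (q.1 ^+ 2 + q.2 ^+ 2))))%:C) = K.
  by apply/funext => q; rewrite /K /g -expRD; congr ((expR _)%:C); ring.
have mK : cmeasurable K.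
  by apply: cmeasurableC; apply: measurable_funM; apply: measurableT_comp.
have Kab q : `N (K q) <= g q.1 * g q.2.
  by rewrite normcR ger0_norm// mulr_ge0// expR_ge0.
rewrite KE; split; first exact: (cint_prod mK Kab ig ig).
rewrite -[LHS](@cfubini1 R _ _ R1 R1 leb leb K g g mK Kab ig ig).
rewrite (_ : (fun _ => _) = (fun x : R1 => (Rint g * g x)%:C)); last first.
  by apply/funext => x; rewrite /K /= cintegralC; congr (_%:C); rewrite RintegralZl// mulrC.
have ig' : intble leb g := ig.
have gE' : Rint g = Num.sqrt (pi / a) := gE.
by rewrite cintegralC (@RintZ R _ R1 leb _ g ig') gE' -expr2 sqr_sqrtr// divr_ge0 ?pi_ge0 ?ltW.
Qed.
End Gaussians.

Section HardyTransforms.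
Context {R : realType}.
Local Notation leb := (@lebesgue_measure R).
Local Notation cint := (cintegral leb).
Local Notation cint3 := (cintegral (leb3 R)).
Local Notation cintble := (cintegrable leb).
Local Notation cintble3 := (cintegrable (leb3 R)).
Local Notation R1 := (measurableTypeR R).
Local Notation R2 := (measurableTypeR R * measurableTypeR R)%type.
Local Notation leb2 := (prod_sf leb leb).
Local Notation leb3s := (prod_sf leb2 leb).
Implicit Types (u w phi : hfun R) (psi : R -> R[i]).

Definition S phi (s : R) : R[i] := cint3 (fun p => phi p * (wav s p)^*).
Definition J psi : hfun R := fun p => cint (fun s : R1 => psi s * wav s p).

Lemma ccont_eps (g : R -> R[i]) (a e : R) : ccont g -> 0 < e ->
  exists2 d : R, 0 < d & forall t, `|t - a| < d -> `N (g t - g a) <= e.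
Proof.
move=> [g1 g2] e0; have e2 : 0 < e / 2 by rewrite divr_gt0.
have /cvgrPdist_lt/(_ _ e2)/nbhs_ballP[d1 /= d10 H1] := g1 a.
have /cvgrPdist_lt/(_ _ e2)/nbhs_ballP[d2 /= d20 H2] := g2 a.
exists (Num.min d1 d2); first by rewrite lt_min d10.
move=> t; rewrite lt_min => /andP[t1 t2].
apply: le_trans (normc_leD _) _; rewrite [e](_ : _ = e / 2 + e / 2); last by field.
rewrite !cE lerD// distrC ltW//; first by apply: H1; rewrite /ball/= distrC.
by apply: H2; rewrite /ball/= distrC.
Qed.

Lemma c0_sqr : c0 * c0 * (2 * pi) = 1 :> R.
Proof.
have p0 : 0 < 2 * pi :> R by rewrite mulr_gt0// pi_gt0.
rewrite /c0 -expr2 exprVn sqr_sqrtr ?ltW// mulVf// gt_eqF//.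
Qed.

Lemma sec_cont phi (q : R * R) : schwartz phi -> ccont (fun s => phi (q, s)).
Proof. by move=> sp; case: q => x y; exact: hasder_cont (schwartz_lines (x, y, 0) sp). Qed.

Lemma fs_inv phi p : schwartz phi -> fourier_s (fun p => (fourier_s phi p)^*) p = (phi p)^*.
Proof.
move=> sp; case: p => q a.
have sf := fs_schwartz sp.
have [C C0 pC] := schwartz_bound sp.
pose g (t : R) := (phi (q, t))^*.
have ig : cintble (g : R1 -> R[i]) by apply: cintJ; exact: schwartz_sec.
have fE s : (fourier_s phi (q, s))^* = c0%:C * cint (fun t : R1 => g t * cis (t * s)).
  rewrite /fourier_s cJM cJR -(cintegralJ (fs_int (q, s) sp)).
  congr (_ * _); apply: eq_cintegral => t.
  by rewrite cJM -cisN opprK mulrC.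
have ghE : (fun s : R1 => cint (fun t : R1 => g t * cis (t * s))) = (fun s => (c0%:C)^-1 * (fourier_s phi (q, s))^*).
  apply/funext => s; rewrite fE mulrA mulVf ?mul1r//.
  by rewrite -normc_eq0 normcR normr_eq0 gt_eqF// c0_gt0.
have igh : cintble (fun s : R1 => cint (fun t : R1 => g t * cis (t * s))).
  by rewrite ghE; apply: cintZ; apply: cintJ; exact: schwartz_sec.
have inv := @fourier_inversion R g C a ig _ _ igh.
rewrite /fourier_s -/c0 /=.
transitivity (c0%:C * (c0%:C * cint (fun s : R1 => cint (fun t : R1 => g t * cis (t * s)) * cis (- (s * a))))).
  congr (_ * _); rewrite -cintegralZ.
    by apply: eq_cintegral => s; rewrite -[LHS]/(cis (- (s * a)) * (fourier_s phi (q, s))^*) fE; ring.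
  apply: (cint_dom1 _ _ (cint_normc igh)).
    by apply: cmeasurableM; [exact: cint_meas igh|exact: meas_cis].
  by move=> s; rewrite normcM normc_cis mulr1.
rewrite inv.
- by rewrite !mulrA -!rmorphM/= c0_sqr mul1r.
- move=> t; rewrite /g normcJ; apply: le_trans (pC _) _; rewrite -[leRHS]mulr1 ler_wpM2l//.
  by rewrite /wt !mulr_ile1 ?mulr_ge0 ?w1_ge0 ?w1_le1.
- by move=> e e0; apply: ccont_eps => //; apply: ccontJ; exact: sec_cont.
Qed.

Lemma meas_pos d (T : measurableType d) (f : T -> R) : measurable_fun setT f -> measurable_fun setT (fun x => pos (f x)).
Proof. by move=> mf; apply: measurable_maxr. Qed.
Lemma meas_r2 : measurable_fun setT (r2 : hmeas R -> R).
Proof.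
by apply: measurable_funD; apply: measurable_funX; do ! apply: measurableT_comp.
Qed.
Lemma meas_wav2 : cmeasurable (fun z : hmeas R * R1 => wav z.2 z.1).
Proof.
have m1 : measurable_fun setT (fun z : hmeas R * R1 => pos z.2) by exact: meas_pos.
apply: cmeasurableM.
  apply: cmeasurableC; apply: (@measurableT_comp _ _ _ _ _ _ (@expR R)) => //.
  apply: measurable_funM; first exact: measurableT_comp.
  by apply: (measurableT_comp meas_r2).
by apply: cmeasurable_cis; apply: measurable_funM => //; do ! apply: measurableT_comp.
Qed.
Lemma meas_wav s : cmeasurable (wav s : hmeas R -> R[i]).
Proof. by apply: (cmeasurable_comp (g := fun p : hmeas R => (p, s)) _ meas_wav2); exact: measurable_pair2. Qed.
Lemma meas_wavs p : cmeasurable (fun s : R1 => wav s p).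
Proof. by apply: (cmeasurable_comp (g := fun s : R1 => (p : hmeas R, s)) _ meas_wav2); exact: measurable_pair1. Qed.

Lemma int_S phi s : cintble3 phi -> cintble3 (fun p => phi p * (wav s p)^*).
Proof.
move=> ip; apply: (cint_dom3 _ _ (cint_normc ip)).
  by apply: cmeasurableM; [exact: cint_meas ip|apply: cmeasurableJ; exact: meas_wav].
by move=> p; rewrite normcM normcJ ler_piMr ?normc_ge0// wav_le1.
Qed.
Lemma S_bound phi s : cintble3 phi ->
  `N (S phi s) <= Rintegral (leb3 R) setT (fun p : hmeas R => `N (phi p)).
Proof.
move=> ip; apply: normc_cintegral_le; [exact: cint_meas (int_S s ip)| |exact: cint_normc].
by move=> p; rewrite normcM normcJ ler_piMr ?normc_ge0// wav_le1.
Qed.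
Lemma int_J psi p : cintble (psi : R1 -> R[i]) -> cintble (fun s : R1 => psi s * wav s p).
Proof.
move=> ip; apply: (cint_dom1 _ _ (cint_normc ip)).
  by apply: cmeasurableM; [exact: cint_meas ip|exact: meas_wavs].
by move=> s; rewrite normcM ler_piMr ?normc_ge0// wav_le1.
Qed.

(** [J] and [S] are adjoint, by Fubini; the joint integrability comes from
    [|e^{isz}| <= 1]. *)
Lemma JS_fubini phi psi : cintble3 phi -> cintble (psi : R1 -> R[i]) ->
  cmeasurable (J psi : hmeas R -> R[i]) /\
  cint3 (fun p => phi p * (J psi p)^*) = cint (fun s : R1 => (psi s)^* * S phi s).
Proof.
move=> ip iq.
pose K (z : hmeas R * R1) : R[i] := phi z.1 * ((psi z.2)^* * (wav z.2 z.1)^*).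
have mK : cmeasurable K.
  apply: cmeasurableM; first by apply: (cmeasurable_comp _ (cint_meas ip)).
  apply: cmeasurableM; last by apply: cmeasurableJ; exact: meas_wav2.
  by apply: cmeasurableJ; apply: (cmeasurable_comp _ (cint_meas iq)).
have Kab z : `N (K z) <= `N (phi z.1) * `N (psi z.2).
  by rewrite /K !normcM !normcJ ler_wpM2l ?normc_ge0// ler_piMr ?normc_ge0 ?wav_le1.
split.
  pose K' (z : hmeas R * R1) : R[i] := psi z.2 * wav z.2 z.1 * (wt z.1)%:C.
  have mK' : cmeasurable K'.
    apply: cmeasurableM; last first.
      by apply: cmeasurableC; apply: measurableT_comp => //; have /measurable_int/measurable_EFinP := @intble_wt R.
    by apply: cmeasurableM; [apply: (cmeasurable_comp _ (cint_meas iq))|exact: meas_wav2].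
  have Kab' z : `N (K' z) <= wt z.1 * `N (psi z.2).
    rewrite /K' normcM normcM normcR (ger0_norm (wt_ge0 _)) [leLHS]mulrC; apply: (ler_wpM2l (wt_ge0 _)).
    by rewrite ler_piMr ?normc_ge0 ?wav_le1.
  have mm := @cmeas_sec1 R _ _ (hmeas R) R1 leb3s leb K' wt (fun s => `N (psi s)) mK' Kab' (@intble_wt R) (cint_normc iq).
  have -> : (J psi : hmeas R -> R[i]) = (fun p : hmeas R => ((wt p)^-1)%:C * cint (fun s : R1 => K' (p, s))).
    apply/funext => p; rewrite /K'/=.
    have -> : (fun s : R1 => psi s * wav s p * (wt p)%:C) = (fun s : R1 => (wt p)%:C * (psi s * wav s p)).
      by apply/funext => s; rewrite mulrC.
    rewrite cintegralZ; last exact: int_J.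
    rewrite mulrA -rmorphM/= mulVf ?mul1r//.
    by rewrite gt_eqF// /wt !mulr_gt0// w1_gt0.
  apply: cmeasurableM => //; apply: cmeasurableC.
  have mwt : measurable_fun setT (wt : hmeas R -> R) by have /measurable_int/measurable_EFinP := @intble_wt R.
  apply: (@measurable_funS _ _ _ _ setT) => //.
  rewrite (_ : (fun _ => _) = (fun p : hmeas R => (1 + p.1.1 ^+ 2) * (1 + p.1.2 ^+ 2) * (1 + p.2 ^+ 2))).
    have sq (f : hmeas R -> R) : measurable_fun setT f -> measurable_fun setT (fun p => 1 + f p ^+ 2).
      by move=> mf; apply: measurable_funD => //; exact: measurable_funX.
    by apply: measurable_funM; [apply: measurable_funM|]; apply: sq => //; exact: measurableT_comp.
  by apply/funext => p; rewrite /wt /w1 !invfM !invrK.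
have := @cfubini R _ _ (hmeas R) R1 leb3s leb K (fun p => `N (phi p)) (fun s => `N (psi s)) mK Kab (cint_normc ip) (cint_normc iq).
move=> F; transitivity (cintegral leb3s (fun x => cint (fun y => K (x, y)))).
  apply: (eq_cintegral leb3s) => p; rewrite -[J psi p]/(cint _) -(cintegralJ (int_J p iq)).
  rewrite -(cintegralZ (phi p) (cintJ (int_J p iq))).
  by apply: eq_cintegral => s; rewrite cJM.
rewrite F; apply: eq_cintegral => s; rewrite -[S phi s]/(cint3 _) -(cintegralZ _ (int_S s ip)).
by apply: eq_cintegral => p; rewrite /K mulrCA.
Qed.
Lemma meas_J psi : cintble (psi : R1 -> R[i]) -> cmeasurable (J psi : hmeas R -> R[i]).
Proof. by move=> ip; have [] := JS_fubini (cint0 (leb3 R)) ip. Qed.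
Lemma J_bound psi p : cintble (psi : R1 -> R[i]) ->
  `N (J psi p) <= Rintegral leb setT (fun s => `N (psi s)).
Proof.
move=> ip; apply: normc_cintegral_le; [exact: cint_meas (int_J p ip)| |exact: cint_normc].
by move=> s; rewrite normcM ler_piMr ?normc_ge0// wav_le1.
Qed.

(** At fixed [(x, y)], [J psi] is an inverse Fourier transform in [s], with
    density [psi (b) e^{- b r2}] at frequency [b]; integrating it against
    [e^{- a r2}] leaves a Gaussian integral over the plane. *)
Lemma J_fourier psi (M C a b : R) : ccont psi -> (forall s, s <= 0 -> psi s = 0) ->
  cintble (psi : R1 -> R[i]) -> (forall s, `N (psi s) <= M) ->
  (forall p, `N (J psi p) <= C * wt p) -> 0 <= a -> 0 < a + pos b ->
  cint3 (fun p => J psi p * ((expR (- a * r2 p))%:C * cis (- (p.2 * b)))) =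
  (2 * pi * (pi / (a + pos b)))%:C * psi b.
Proof.
move=> cp p0 ip pM JC a0 ab0.
have mJ := meas_J ip.
have me : cmeasurable (fun p : hmeas R => (expR (- a * r2 p))%:C * cis (- (p.2 * b))).
  apply: cmeasurableM.
    apply: cmeasurableC; apply: (@measurableT_comp _ _ _ _ _ _ (@expR R)) => //.
    by apply: measurable_funM => //; exact: meas_r2.
  by apply: cmeasurable_cis; apply: measurableT_comp => //; apply: measurable_funM.
have ne (p : heis R) : `N ((expR (- a * r2 p))%:C * cis (- (p.2 * b))) <= 1.
  rewrite normcM normc_cis mulr1 normcR ger0_norm ?expR_ge0// -expR0 ler_expR.
  by rewrite mulNr oppr_le0 mulr_ge0 ?r2_ge0.
have bd (p : heis R) : `N (J psi p * ((expR (- a * r2 p))%:C * cis (- (p.2 * b)))) <= C * wt p.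
  by rewrite normcM; apply: le_trans (JC p); rewrite ler_piMr ?normc_ge0.
rewrite (fubini_s (cmeasurableM mJ me) bd).
have [_ G] := gauss2 ab0.
rewrite RCM mulrAC -G -(cintegralZ _ (gauss2 ab0).1).
apply: (eq_cintegral leb2) => q.
pose g (t : R) := psi t * (expR (- pos t * (q.1 ^+ 2 + q.2 ^+ 2)))%:C.
have cpos : continuous (pos : R -> R).
  by move=> t; apply: continuous_max; [exact: cvg_id|exact: cvg_cst].
have cg : ccont g.
  apply: ccontM => //; apply: ccontR => t.
  have h : - pos y * (q.1 ^+ 2 + q.2 ^+ 2) @[y --> t] --> - pos t * (q.1 ^+ 2 + q.2 ^+ 2).
    by apply: cvgM; [apply: cvgN; exact: cpos|exact: cvg_cst].
  exact: (cvg_comp _ _ h (@continuous_expR R _)).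
have gle t : `N (g t) <= `N (psi t).
  rewrite /g normcM ler_piMr ?normc_ge0// normcR ger0_norm ?expR_ge0// -expR0 ler_expR.
  by rewrite mulNr oppr_le0 mulr_ge0 ?pos_ge0// addr_ge0 ?sqr_ge0.
have ig : cintble (g : R1 -> R[i]) by apply: (cint_dom1 _ gle (cint_normc ip)); exact: ccont_meas.
have ghE : (fun s : R1 => cint (fun t : R1 => g t * cis (t * s))) = (fun s => J psi (q, s)).
  apply/funext => s; apply: eq_cintegral => t; rewrite /g /wav /r2 /=.
  have [t0|t0] := leP t 0; first by rewrite p0 // !mul0r.
  by rewrite pos_id ?(ltW t0)// mulrA.
have iJ : cintble (fun s : R1 => J psi (q, s)).
  apply: (@cint_dom1 _ _ (fun s => C * (w1 q.1 * w1 q.2) * w1 s)).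
  - by apply: (cmeasurable_comp (g := fun s : R1 => (q : R2, s)) _ mJ); exact: measurable_pair1.
  - by move=> s; apply: le_trans (JC _) _; rewrite /wt !mulrA.
  - by apply: intbleZ; exact: intble_w1.
have inv := @fourier_inversion R g M b ig (fun t => le_trans (gle t) (pM t)) (fun e e0 => ccont_eps b cg e0).
rewrite ghE in inv; have {}inv := inv iJ.
transitivity ((expR (- a * (q.1 ^+ 2 + q.2 ^+ 2)))%:C * cint (fun s : R1 => J psi (q, s) * cis (- (s * b)))).
  rewrite -cintegralZ.
    by apply: eq_cintegral => s; rewrite /r2 /=; ring.
  apply: (cint_dom1 _ _ (cint_normc iJ)).
    by apply: cmeasurableM; [exact: cint_meas iJ|exact: meas_cis].
  by move=> s; rewrite normcM normc_cis mulr1.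
rewrite inv /g.
have -> : - ((a + pos b) * (q.1 ^+ 2 + q.2 ^+ 2)) = - a * (q.1 ^+ 2 + q.2 ^+ 2) + - pos b * (q.1 ^+ 2 + q.2 ^+ 2) by ring.
by rewrite expRD !rmorphM/=; ring.
Qed.

End HardyTransforms.

Arguments conjc : simpl never.
(** * The Laplacian on the waves *)
Section IntegrationByParts.
Context {R : realType}.
Local Notation cint3 := (cintegral (leb3 R)).
Implicit Types (u w m phi : hfun R) (v : heis R).

(** Finite sums of products of Schwartz functions form a class stable under
    derivatives, whose elements are therefore Schwartz functions. *)
Inductive psum : hfun R -> Prop :=
| psum1 u w : schwartz u -> schwartz w -> psum (fun p => u p * w p)
| psumD u w : psum u -> psum w -> psum (fun p => u p + w p).

Lemma schwartzMM u w : schwartz u -> schwartz w -> schwartz (fun p => u p * w p).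
Proof.
move=> su sw; apply: (@schwartz_coind _ psum); last exact: psum1.
- move=> _ [] => [{}u {}w {}su {}sw|]; last first.
    move=> a b; move: a b; suff h a : psum a -> rdec a by move=> a b /h ra /h rb; exact: rdecD.
    elim => [x y sx sy|x y _ rx _ ry]; last exact: rdecD.
    have [C C0 xC] := schwartz_bound sx; move=> k; have [D yD] := schwartz_rdec sy k.
    exists (C * D) => p; rewrite normcM mulrCA ler_pM ?normc_ge0//.
      by rewrite mulr_ge0 ?normc_ge0// exprn_ge0// addr_ge0.
    apply: le_trans (xC p) _; rewrite -[leRHS]mulr1 ler_wpM2l// /wt.
    by rewrite !mulr_ile1 ?mulr_ge0 ?w1_ge0 ?w1_le1.
  have [C C0 xC] := schwartz_bound su; move=> k; have [D yD] := schwartz_rdec sw k.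
  exists (C * D) => p; rewrite normcM mulrCA ler_pM ?normc_ge0//.
    by rewrite mulr_ge0 ?normc_ge0// exprn_ge0// addr_ge0.
  apply: le_trans (xC p) _; rewrite -[leRHS]mulr1 ler_wpM2l// /wt.
  by rewrite !mulr_ile1 ?mulr_ge0 ?w1_ge0 ?w1_le1.
- move=> a v sa vD; elim: sa => [x y sx sy|x y _ [x' px dx] _ [y' py dy]].
    exists (fun p => pd v x p * y p + x p * pd v y p).
      by apply: psumD; apply: psum1 => //; exact: schwartz_pd.
    by move=> p; apply: hasderM; exact: schwartz_hasder.
  by exists (fun p => x' p + y' p); [exact: psumD|move=> p; exact: hasderD].
Qed.

Lemma int_parts u m m' v : schwartz u -> mult m -> mult m' -> v \in dirs ->
  (forall p, hasder m p v (m' p)) ->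
  cint3 (fun p => pd v u p * m p) = - cint3 (fun p => u p * m' p).
Proof.
move=> su hm hm' vD dm.
have s1 : schwartz (fun p => m p * u p) by exact: schwartzM.
have s2 : schwartz (fun p => m p * pd v u p) by apply: schwartzM => //; exact: schwartz_pd.
have s3 : schwartz (fun p => m' p * u p) by exact: schwartzM.
have E : (fun p : hmeas R => pd v u p * m p) = (fun p : hmeas R => pd v (fun p => m p * u p) p - m' p * u p).
  apply/funext => p; rewrite (hasder_pd (hasderM (dm p) (schwartz_hasder p su vD))).
  by ring.
have E2 : (fun p : hmeas R => u p * m' p) = (fun p : hmeas R => m' p * u p) by apply/funext => p; rewrite mulrC.
rewrite E E2 (cintegralB (schwartz_int (schwartz_pd s1 vD)) (schwartz_int s3)).
by rewrite int_pd// sub0r.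
Qed.

Lemma int_parts2 u w v : schwartz u -> schwartz w -> v \in dirs ->
  cint3 (fun p => pd v u p * w p) = - cint3 (fun p => u p * pd v w p).
Proof.
move=> su sw vD.
have s1 : schwartz (fun p => u p * w p) by exact: schwartzMM.
have s3 : schwartz (fun p => u p * pd v w p) by apply: schwartzMM => //; exact: schwartz_pd.
have E : (fun p : hmeas R => pd v u p * w p) = (fun p : hmeas R => pd v (fun p => u p * w p) p - u p * pd v w p).
  apply/funext => p; rewrite (hasder_pd (hasderM (schwartz_hasder p su vD) (schwartz_hasder p sw vD))).
  by rewrite addrK.
by rewrite E (cintegralB (schwartz_int (schwartz_pd s1 vD)) (schwartz_int s3)) int_pd// sub0r.
Qed.

Lemma wav_ex (s : R) (p : heis R) : hasder (wav s) p ex ((- 2 * pos s * p.1.1)%:C * wav s p).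
Proof.
apply/hasder_ex.
have dr : is_derive p.1.1 1 (fun t : R => t ^+ 2 + p.1.2 ^+ 2) (2 * p.1.1).
  by apply: (is_derive_eq (is_deriveD (is_derive_sqr _) (is_derive_cst _ _ _))); rewrite addr0.
have := hasder_wavline s dr (is_derive_cst p.2 p.1.1 1).
by move/hasder_eq; apply; rewrite /wav /r2 !rmorphM !rmorphN !rmorph0; ring.
Qed.
Lemma wav_ey (s : R) (p : heis R) : hasder (wav s) p ey ((- 2 * pos s * p.1.2)%:C * wav s p).
Proof.
apply/hasder_ey.
have dr : is_derive p.1.2 1 (fun t : R => p.1.1 ^+ 2 + t ^+ 2) (2 * p.1.2).
  by apply: (is_derive_eq (is_deriveD (is_derive_cst _ _ _) (is_derive_sqr _))); rewrite add0r.
have := hasder_wavline s dr (is_derive_cst p.2 p.1.2 1).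
by move/hasder_eq; apply; rewrite /wav /r2 !rmorphM !rmorphN !rmorph0; ring.
Qed.
Lemma wav_es (s : R) (p : heis R) : hasder (wav s) p es ((pos s)%:C * 'i%C * wav s p).
Proof.
apply/hasder_es.
have := hasder_wavline s (is_derive_cst (r2 p) p.2 1) (is_derive_id p.2 1).
by move/hasder_eq; apply; rewrite /wav /r2 rmorph0 rmorph1; ring.
Qed.

Lemma S_es phi s : schwartz phi -> S (pd es phi) s = 'i%C * (pos s)%:C * S phi s.
Proof.
move=> sp.
have hm : mult (fun p : heis R => (wav s p)^*) by apply: multJ; exact: mult_wav.
have hm' : mult (fun p : heis R => (- 'i%C * (pos s)%:C) * (wav s p)^*) by apply: multM => //; exact: mult_cst.
rewrite /S (int_parts sp hm hm' (@esD R)); last first.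
  move=> p; apply: (hasder_eq (hasderJ (wav_es s p))).
  by apply: cplxP; rewrite !cE; ring.
have i1 : cintegrable (leb3 R) (fun p => phi p * (wav s p)^*) := int_S s (schwartz_int sp).
have E : (fun p : hmeas R => phi p * (- 'i%C * (pos s)%:C * (wav s p)^*)) = (fun p : hmeas R => (- 'i%C * (pos s)%:C) * (phi p * (wav s p)^*)).
  by apply/funext => p; ring.
by rewrite E (cintegralZ _ i1); ring.
Qed.

Lemma S_Z c phi s : schwartz phi -> S (fun p => c * phi p) s = c * S phi s.
Proof.
move=> sp; have i1 := int_S s (schwartz_int sp).
rewrite /S -(cintegralZ c i1); apply: (eq_cintegral (leb3 R)) => p.
by rewrite mulrA.
Qed.
Lemma S_D phi psi s : schwartz phi -> schwartz psi ->
  S (fun p => phi p + psi p) s = S phi s + S psi s.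
Proof.
move=> sp sq; rewrite /S -(cintegralD (int_S s (schwartz_int sp)) (int_S s (schwartz_int sq))).
by apply: (eq_cintegral (leb3 R)) => p; rewrite mulrDl.
Qed.

Lemma schwartz_Ds u : schwartz u -> schwartz (Ds u).
Proof. by move=> su; apply: schwartzZ; exact: schwartz_pd su (@esD R). Qed.
Lemma mult_r2 : mult (fun p : heis R => (r2 p)%:C).
Proof.
have -> : (fun p : heis R => (r2 p)%:C) = (fun p => (p.1.1)%:C * (p.1.1)%:C + (p.1.2)%:C * (p.1.2)%:C).
  by apply/funext => p; rewrite /r2 !expr2 RCD !RCM.
by apply: multD; apply: multM; (exact: mult_x || exact: mult_y).
Qed.
Lemma schwartz_Lap u : schwartz u -> schwartz (Lap u).
Proof.
move=> su; have h v : v \in dirs -> schwartz (pd v (pd v u)).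
  by move=> vD; apply: schwartz_pd => //; exact: schwartz_pd.
apply: schwartzD; last by apply: (schwartzM mult_r2); exact: h (@esD R).
by apply: schwartzZ; apply: schwartzD; [exact: h (@exD R)|exact: h (@eyD R)].
Qed.

Lemma S_Ds u s : schwartz u -> S (Ds u) s = (pos s)%:C * S u s.
Proof.
move=> su; rewrite S_Z ?S_es//; last exact: schwartz_pd su (@esD R).
by apply: cplxP; rewrite !cE; ring.
Qed.

Lemma S_pdxx (v : heis R) (c : heis R -> R) s u : schwartz u -> v \in dirs ->
  mult (fun p => (c p)%:C) -> (forall p, hasder (fun p => (c p)%:C) p v 1) ->
  (forall p, hasder (wav s) p v ((- 2 * pos s * c p)%:C * wav s p)) ->
  S (pd v (pd v u)) s = - (2 * pos s)%:C * S u s + (4 * pos s ^+ 2)%:C * S (fun p => (c p)%:C * (c p)%:C * u p) s.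
Proof.
move=> su vD mc dc dw.
have s1 := schwartz_pd su vD.
have mw : mult (fun p : heis R => (wav s p)^*) by apply: multJ; exact: mult_wav.
have m1 : mult (fun p : heis R => (- 2 * pos s)%:C * ((c p)%:C * (wav s p)^*)).
  by apply: multM; [exact: mult_cst|exact: multM].
have m2 : mult (fun p : heis R => (- 2 * pos s)%:C * (wav s p)^* + (4 * pos s ^+ 2)%:C * ((c p)%:C * (c p)%:C * (wav s p)^*)).
  by apply: multD; apply: multM; rewrite ?(multM, mult_cst)//; [exact: mult_cst|exact: mult_cst|apply: multM => //; exact: multM].
rewrite /S (int_parts s1 mw m1 vD); last first.
  by move=> p; apply: (hasder_eq (hasderJ (dw p))); rewrite (cJM _%:C (wav s p)) cJR (RCM (- 2 * pos s)) -mulrA.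
rewrite (int_parts su m1 m2 vD); last first.
  move=> p; apply: (hasder_eq (hasderM (hasder_cst _ _ _) (hasderM (dc p) (hasderJ (dw p))))).
  have -> : (4 * pos s ^+ 2)%:C = (- 2 * pos s)%:C * (- 2 * pos s)%:C :> R[i].
    by rewrite -RCM; congr (_%:C); ring.
  rewrite (cJM _%:C (wav s p)) cJR (RCM (- 2 * pos s) (c p)).
  move: ((- 2 * pos s)%:C) ((wav s p)^*) ((c p)%:C) => k w x.
  by ring.
rewrite opprK -/(S u s).
have sc : schwartz (fun p => (c p)%:C * (c p)%:C * u p) by apply: schwartzM => //; exact: multM.
have i1 := int_S s (schwartz_int su); have i2 := int_S s (schwartz_int sc).
rewrite /S -(cintegralZ _ i1) -(cintegralZ _ i2) -(cintegralD (cintZ _ i1) (cintZ _ i2)).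
apply: (eq_cintegral (leb3 R)) => p.
have -> : (- 2 * pos s)%:C = - (2 * pos s)%:C :> R[i] by rewrite mulNr RCN.
move: (2 * pos s)%:C (4 * _)%:C (_^*) (u p) (c p)%:C => k l w x y.
by ring.
Qed.

(** Each [d_x^2], [d_y^2] brings down [(2 s x)^2 - 2 s] and its analogue in [y],
    and [(x^2 + y^2) d_s^2] brings down [- s^2 (x^2 + y^2)]: the quadratic terms
    cancel, because [e^{isz}] is an eigenfunction of [- Lap]. *)
Lemma S_Lap u s : schwartz u -> S (fun p => - Lap u p) s = (pos s)%:C * S u s.
Proof.
move=> su.
have h v : v \in dirs -> schwartz (pd v (pd v u)).
  by move=> vD; apply: schwartz_pd => //; exact: schwartz_pd.
have hx := h _ (@exD R); have hy := h _ (@eyD R); have hs := h _ (@esD R).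
have sx : schwartz (fun p => (p.1.1)%:C * (p.1.1)%:C * u p) by apply: schwartzM => //; apply: multM; exact: mult_x.
have sy : schwartz (fun p => (p.1.2)%:C * (p.1.2)%:C * u p) by apply: schwartzM => //; apply: multM; exact: mult_y.
have sr : schwartz (fun p => (r2 p)%:C * pd es (pd es u) p) by exact: schwartzM mult_r2 _.
have dx (p : heis R) : hasder (fun p : heis R => (p.1.1)%:C) p ex 1.
  by apply/hasder_ex; apply: (hasderR (is_derive_id _ _)).
have dy (p : heis R) : hasder (fun p : heis R => (p.1.2)%:C) p ey 1.
  by apply/hasder_ey; apply: (hasderR (is_derive_id _ _)).
have ds (p : heis R) : hasder (fun p : heis R => (r2 p)%:C) p es 0.
  by apply/hasder_es; exact: (hasder_cst (r2 p)%:C p.2 1).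
have -> : (fun p => - Lap u p) = (fun p => (- 4^-1)%:C * (pd ex (pd ex u) p + pd ey (pd ey u) p) + (-1) * ((r2 p)%:C * pd es (pd es u) p)).
  by apply/funext => p; rewrite /Lap -/(r2 p) opprD mulN1r RCN mulNr.
rewrite S_D; [|exact: schwartzZ _ (schwartzD hx hy)|exact: schwartzZ].
rewrite S_Z; last exact: schwartzD.
rewrite S_Z// S_D//.
have Ex := @S_pdxx ex (fun p => p.1.1) s u su (@exD R) (mult_x (R := R)) dx (wav_ex s).
have Ey := @S_pdxx ey (fun p => p.1.2) s u su (@eyD R) (mult_y (R := R)) dy (wav_ey s).
have mw : mult (fun p : heis R => (wav s p)^*) by apply: multJ; exact: mult_wav.
have mrw : mult (fun p : heis R => (r2 p)%:C * (wav s p)^*) by apply: multM => //; exact: mult_r2.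
have Es : S (fun p => (r2 p)%:C * pd es (pd es u) p) s = - (pos s ^+ 2)%:C * (S (fun p => (p.1.1)%:C * (p.1.1)%:C * u p) s + S (fun p => (p.1.2)%:C * (p.1.2)%:C * u p) s).
  have E1 w : schwartz w -> S (fun p => (r2 p)%:C * pd es w p) s = 'i%C * (pos s)%:C * S (fun p => (r2 p)%:C * w p) s.
    move=> sw; rewrite -S_es; last exact: schwartzM mult_r2 _.
    apply: (eq_cintegral (leb3 R)) => p; congr (_ * _).
    rewrite (hasder_pd (hasderM (ds p) (schwartz_hasder p sw (@esD R)))).
    by rewrite mul0r add0r.
  rewrite E1; last exact: schwartz_pd su (@esD R).
  rewrite E1// -S_D// mulrA; congr (_ * _); first by apply: cplxP; rewrite !cE; ring.
  by apply: (eq_cintegral (leb3 R)) => p; rewrite /r2 !expr2 RCD !RCM; ring.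
set A := S (fun p => (p.1.1)%:C * (p.1.1)%:C * u p) s in Ex Es *.
set B := S (fun p => (p.1.2)%:C * (p.1.2)%:C * u p) s in Ey Es *.
transitivity ((- 4^-1)%:C * ((- (2 * pos s)%:C * S u s + (4 * pos s ^+ 2)%:C * A) + (- (2 * pos s)%:C * S u s + (4 * pos s ^+ 2)%:C * B)) + -1 * (- (pos s ^+ 2)%:C * (A + B))).
  by congr (_ * (_ + _) + -1 * _); [exact: Ex|exact: Ey|exact: Es].
move: (S u s) (A) (B) => D {}A {}B {Ex Ey Es}.
have -> : (- 4^-1)%:C = - (4^-1)%:C :> R[i] by rewrite RCN.
have -> : (4 * pos s ^+ 2)%:C = 4 * (pos s ^+ 2)%:C :> R[i] by rewrite RCM rmorph_nat.
have -> : (2 * pos s)%:C = 2 * (pos s)%:C :> R[i] by rewrite RCM rmorph_nat.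
have -> : (4^-1)%:C = 4^-1 :> R[i] by rewrite RCV ?pnatr_eq0// rmorph_nat.
by field.
Qed.

End IntegrationByParts.

(** * Profiles of the elements of V0plus *)
Section Profiles.
Context {R : realType}.
Local Notation leb := (@lebesgue_measure R).
Local Notation cint := (cintegral leb).
Local Notation cint3 := (cintegral (leb3 R)).
Local Notation cintble := (cintegrable leb).
Local Notation cintble3 := (cintegrable (leb3 R)).
Local Notation R1 := (measurableTypeR R).
Local Notation R2 := (measurableTypeR R * measurableTypeR R)%type.
Local Notation leb2 := (prod_sf leb leb).
Local Notation leb3s := (prod_sf leb2 leb).
Implicit Types (u w phi h : hfun R) (psi : R -> R[i]).

Definition prof psi := [/\ ccont psi, forall s, s <= 0 -> psi s = 0 &
  exists2 C, 0 <= C & forall s, `N (psi s) <= C * w1 s].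

Lemma prof_int psi : prof psi -> cintble (psi : R1 -> R[i]).
Proof.
move=> [cp _ [C C0 pC]]; apply: (@cint_dom1 _ _ (fun s => C * w1 s)) => //; first exact: ccont_meas.
by apply: intbleZ; exact: intble_w1.
Qed.

(** A product of waves is the wave of the summed frequencies, so that [e^{isz}]
    shifts the frequency of [J psi] by [s]. *)
Lemma J_triple psi s t : prof psi -> schwartz (J psi) -> 0 <= s -> 0 < t ->
  cint3 (fun p => J psi p * wav s p * (wav t p)^*) = (pi ^+ 2 / t)%:C * psi (t - s).
Proof.
move=> pp sJ s0 t0; have ip := prof_int pp; case: pp => cp p0 [M M0 pM].
have [C C0 JC] := schwartz_bound sJ.
have pM' x : `N (psi x) <= M by apply: le_trans (pM x) _; rewrite ler_piMr// w1_le1.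
have h0 : 0 < (s + t) + pos (t - s).
  by rewrite ltr_wpDr ?pos_ge0// ltr_wpDl.
have := J_fourier cp p0 ip pM' JC (addr_ge0 s0 (ltW t0)) h0.
rewrite (_ : (fun p : hmeas R => _) = (fun p => J psi p * wav s p * (wav t p)^*)); last first.
  apply/funext => p; rewrite -mulrA; congr (_ * _).
  rewrite /wav !pos_id ?(ltW t0)// cJM cJR -cisN.
  rewrite (_ : - (p.2 * (t - s)) = s * p.2 + - (t * p.2)); last by ring.
  rewrite (_ : - (s + t) * r2 p = - s * r2 p + - t * r2 p); last by ring.
  by rewrite expRD cisD RCM; ring.
move=> ->; have [ts|ts] := leP (t - s) 0; first by rewrite p0// !mulr0.
congr (_%:C * _); rewrite pos_id ?(ltW ts)//; field.
by rewrite gt_eqF//= gt_eqF// (_ : _ + _ = 2 * t) ?mulr_gt0//; ring.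
Qed.

Lemma S_J psi t : prof psi -> schwartz (J psi) -> 0 < t -> S (J psi) t = (pi ^+ 2 / t)%:C * psi t.
Proof.
move=> pp sJ t0; rewrite -[X in psi X]subr0 -(J_triple pp sJ (lexx 0) t0).
apply: (eq_cintegral (leb3 R)) => p; congr (_ * _).
by rewrite /wav pos_id// oppr0 !mul0r expR0 cis0 !mulr1.
Qed.

(** [S phi] is a Gaussian average of the partial Fourier transform of [phi]:
    this is the dual form of the definition of [V0plus]. *)
Lemma S_fs phi s : schwartz phi -> 0 <= s ->
  S phi s = (c0^-1)%:C * cintegral leb2 (fun q : R2 => (expR (- s * (q.1 ^+ 2 + q.2 ^+ 2)))%:C * fourier_s phi (q, s)).
Proof.
move=> sp s0; have [C C0 pC] := schwartz_bound sp; have [D D0 fD] := schwartz_bound (fs_schwartz sp).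
have b (p : heis R) : `N (phi p * (wav s p)^*) <= C * wt p.
  by rewrite normcM normcJ; apply: le_trans (pC p); rewrite ler_piMr ?normc_ge0 ?wav_le1.
have mm : cmeasurable (fun p : hmeas R => phi p * (wav s p)^*) := cint_meas (int_S s (schwartz_int sp)).
rewrite /S (fubini_s mm b).
have me : cmeasurable (fun q : R2 => (expR (- s * (q.1 ^+ 2 + q.2 ^+ 2)))%:C * fourier_s phi (q, s)).
  apply: cmeasurableM.
    apply: cmeasurableC; apply: (@measurableT_comp _ _ _ _ _ _ (@expR R)) => //.
    apply: measurable_funM => //; apply: measurable_funD; apply: measurable_funX => //.
  by apply: (cmeasurable_comp (g := fun q : R2 => (q, s : R1)) _ (schwartz_meas (fs_schwartz sp))); exact: measurable_pair2.
have i1 : cintegrable leb2 (fun q : R2 => (expR (- s * (q.1 ^+ 2 + q.2 ^+ 2)))%:C * fourier_s phi (q, s)).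
  apply: (cint_dom me _ (intbleZ (D * w1 s) (@intble_w1w1 R))) => q.
  rewrite normcM normcR ger0_norm ?expR_ge0//.
  apply: (@le_trans _ _ (`N (fourier_s phi (q, s)))).
    rewrite ler_piMl ?normc_ge0// -expR0 ler_expR mulNr oppr_le0 mulr_ge0// addr_ge0 ?sqr_ge0//.
  by apply: le_trans (fD _) _; rewrite /wt/=; apply: le_of_eq; ring.
rewrite -(cintegralZ _ i1); apply: (eq_cintegral leb2) => q.
rewrite /fourier_s -/c0 [X in _ = X](_ : _ = (expR (- s * (q.1 ^+ 2 + q.2 ^+ 2)))%:C * cint (fun s0 : R1 => cis (- (s0 * s)) * phi (q, s0))); last first.
  have c00 : (c0^-1)%:C * c0%:C = 1 :> R[i] by rewrite -RCM mulVf// gt_eqF// c0_gt0.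
  by rewrite [LHS](mulrCA) [(c0^-1)%:C * _]mulrA c00 mul1r.
rewrite -(cintegralZ _ (fs_int (q, s) sp)); apply: eq_cintegral => t.
rewrite /wav pos_id// cJM cJR -cisN /r2 /= [s * t]mulrC.
by ring.
Qed.

Lemma cintegral_off0 (u : R1 -> R[i]) (c : R[i]) : cintble u ->
  cintble (fun s : R1 => u s - c * (\1_[set (0:R)] s : R)%:C) /\
  cint (fun s : R1 => u s - c * (\1_[set (0:R)] s : R)%:C) = cint u.
Proof.
move=> iu; have [i0 z0] := @cint_point R; split; first exact: (cintB iu (cintZ c i0)).
by rewrite (cintegralB iu (cintZ c i0)) (cintegralZ c i0) z0 mulr0 subr0.
Qed.

(** By duality only the Gaussian averages of the partial Fourier transform of
    [phi] are seen by an element of [V0plus], and these are [S phi]. *)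
Lemma V0_profile h : V0plus h -> exists2 g : R -> R[i], forall s, s <= 0 -> g s = 0 &
  forall phi, schwartz phi ->
   cintble (fun s : R1 => g s * (S phi s)^*) /\
   cint3 (fun p => h p * (phi p)^*) = cint (fun s : R1 => g s * (S phi s)^*).
Proof.
move=> [f mf Hf].
pose g0 s : R[i] := if 0 <= s then (((Num.sqrt pi)^-1 * c0)%:C) * f s else 0.
pose g s : R[i] := g0 s - g0 0 * (\1_[set (0:R)] s : R)%:C.
exists g.
  move=> s; rewrite le_eqVlt => /orP[/eqP ->|s0]; rewrite /g indicE.
    by rewrite mem_set//= mulr1 subrr.
  rewrite memNset/=; last by move=> s00; rewrite s00 ltxx in s0.
  by rewrite mulr0 subr0 /g0 leNgt s0.
move=> phi sp.
have sf := fs_schwartz sp; have sfJ := schwartzJ sf.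
have [i1 E1] := Hf _ sfJ.
have E2 : cint3 (fun p => h p * (phi p)^*) = cint3 (fun p => gauss_profile f p * (fourier_s phi p)^*).
  by rewrite -E1; apply: (eq_cintegral (leb3 R)) => p; rewrite fs_inv.
have [D D0 fD] := schwartz_bound sf.
pose G (s : R) : R2 -> R[i] := fun q => (expR (- s * (q.1 ^+ 2 + q.2 ^+ 2)))%:C * fourier_s phi (q, s).
have iG s : 0 <= s -> cintegrable leb2 (G s).
  move=> s0.
  have me : cmeasurable (G s).
    apply: cmeasurableM.
      apply: cmeasurableC; apply: (@measurableT_comp _ _ _ _ _ _ (@expR R)) => //.
      apply: measurable_funM => //; apply: measurable_funD; apply: measurable_funX => //.
    by apply: (cmeasurable_comp (g := fun q : R2 => (q, s : R1)) _ (schwartz_meas sf)); exact: measurable_pair2.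
  apply: (cint_dom me _ (intbleZ (D * w1 s) (@intble_w1w1 R))) => q.
  rewrite /G normcM normcR ger0_norm ?expR_ge0//.
  apply: (@le_trans _ _ (`N (fourier_s phi (q, s)))).
    rewrite ler_piMl ?normc_ge0// -expR0 ler_expR mulNr oppr_le0 mulr_ge0// addr_ge0 ?sqr_ge0//.
  by apply: le_trans (fD _) _; rewrite /wt/=; apply: le_of_eq; ring.
have KE s : (fun q : R2 => gauss_profile f (q, s) * (fourier_s phi (q, s))^*) =
   (fun q : R2 => (if 0 <= s then (Num.sqrt pi)^-1%:C * f s else 0) * (if 0 <= s then (G s q)^* else 0)).
  apply/funext => q; rewrite /gauss_profile /=; case: ifP => s0; last by rewrite !mul0r.
  rewrite /G (cJM _ (fourier_s phi (q, s))) cJR RCM.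
  rewrite (_ : - (q.1 ^+ 2 + q.2 ^+ 2) * s = - s * (q.1 ^+ 2 + q.2 ^+ 2)); last by ring.
  by ring.
have iGJ s : cintegrable leb2 (fun q : R2 => if 0 <= s then (G s q)^* else 0).
  by have [s0|_] := boolP (0 <= s); [exact: cintJ (iG s s0)|exact: cint0].
have secs s : cintegrable leb2 (fun q : R2 => gauss_profile f (q, s) * (fourier_s phi (q, s))^*).
  by rewrite KE; exact: cintZ _ (iGJ s).
have [i2 E3] := @cfubini_gen R _ _ R2 R1 leb2 leb (fun p => gauss_profile f p * (fourier_s phi p)^*) i1 secs.
have E4 : (fun s : R1 => cintegral leb2 (fun q : R2 => gauss_profile f (q, s) * (fourier_s phi (q, s))^*)) = (fun s : R1 => g0 s * (S phi s)^*).
  apply/funext => s; rewrite KE (cintegralZ _ (iGJ s)) /g0.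
  case: ifP => s0; last by rewrite !mul0r.
  rewrite (cintegralJ (iG s s0)) S_fs// cJM cJR RCM -/(G s).
  have c00 : c0%:C * (c0^-1)%:C = 1 :> R[i] by rewrite -RCM mulfV// gt_eqF// c0_gt0.
  move: (cintegral leb2 (G s))^* (f s) ((Num.sqrt pi)^-1)%:C => I F P.
  by rewrite -[LHS]mulr1 -c00; move: c0%:C (c0^-1)%:C => x y; ring.
rewrite E4 in i2 E3.
have [i5 E5] := cintegral_off0 (g0 0 * (S phi 0)^*) i2.
have E6 : (fun s : R1 => g0 s * (S phi s)^* - g0 0 * (S phi 0)^* * (\1_[set (0:R)] s : R)%:C) = (fun s : R1 => g s * (S phi s)^*).
  apply/funext => s; rewrite /g indicE; have [->|s0] := eqVneq s 0.
    by rewrite mem_set//= !mulr1 !subrr mul0r.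
  by rewrite memNset/= ?mulr0 ?subr0//; apply/eqP.
by rewrite -E6; split => //; rewrite E5 E3 E2.
Qed.

Lemma int_psiS phi psi : cintble3 phi -> cintble (psi : R1 -> R[i]) ->
  cintble (fun s : R1 => (psi s)^* * S phi s).
Proof.
move=> ip iq; pose K (z : hmeas R * R1) : R[i] := phi z.1 * ((psi z.2)^* * (wav z.2 z.1)^*).
have mK : cmeasurable K.
  apply: cmeasurableM; first by apply: (cmeasurable_comp _ (cint_meas ip)).
  apply: cmeasurableM; last by apply: cmeasurableJ; exact: meas_wav2.
  by apply: cmeasurableJ; apply: (cmeasurable_comp _ (cint_meas iq)).
have Kab z : `N (K z) <= `N (phi z.1) * `N (psi z.2).
  by rewrite /K !normcM !normcJ ler_wpM2l ?normc_ge0// ler_piMr ?normc_ge0 ?wav_le1.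
have := @cint_iter2 R _ _ (hmeas R) R1 leb3s leb K (fun p => `N (phi p)) (fun s => `N (psi s)) mK Kab (cint_normc ip) (cint_normc iq).
congr cintegrable; apply/funext => s; rewrite /K /S -(cintegralZ _ (int_S s ip)).
by apply: (eq_cintegral (leb3 R)) => p; rewrite mulrCA.
Qed.

Lemma JS_fubini' phi psi : cintble3 phi -> cintble (psi : R1 -> R[i]) ->
  cint3 (fun p => phi p * J psi p) = cint (fun s : R1 => psi s * (S (fun p => (phi p)^*) s)^*).
Proof.
move=> ip iq; have [_ E] := JS_fubini (cintJ ip) iq.
have iS : cintble (fun s : R1 => (psi s)^* * S (fun p => (phi p)^*) s) := int_psiS (cintJ ip) iq.
have iA : cintble3 (fun p => (phi p)^* * (J psi p)^*).
  apply: (cint_dom3 _ _ (intbleZ (Rintegral leb setT (fun s => `N (psi s))) (cint_normc ip))).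
    by apply: cmeasurableM; apply: cmeasurableJ; [exact: cint_meas ip|exact: meas_J].
  by move=> p; rewrite normcM !normcJ mulrC ler_wpM2r ?normc_ge0// J_bound.
transitivity ((cint3 (fun p => (phi p)^* * (J psi p)^*))^*).
  rewrite -(cintegralJ iA); apply: (eq_cintegral (leb3 R)) => p.
  by rewrite cJM !conjcK.
rewrite E -(cintegralJ iS); apply: eq_cintegral => s.
by rewrite cJM conjcK.
Qed.

(** The profile in the sense of [gauss_profile] is [psi] up to a constant. *)
Lemma V0plus_J psi : prof psi -> V0plus (J psi).
Proof.
move=> pp; have ip := prof_int pp; case: pp => cp p0 [M M0 pM].
exists (fun s => (c0^-1 * Num.sqrt pi)%:C * psi s).
  by apply: cmeasurableM; [exact: cmeasurable_cst|exact: ccont_meas].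
move=> phi sp; have [C C0 pC] := schwartz_bound sp.
have sf := fs_schwartz sp.
pose K (p : hmeas R) : R[i] := gauss_profile (fun s => (c0^-1 * Num.sqrt pi)%:C * psi s) p * phi p.
have KE : K = (fun p : hmeas R => (c0^-1)%:C * psi p.2 * ((expR (- pos p.2 * r2 p))%:C * phi p)).
  apply/funext => p; rewrite /K /gauss_profile; case: ifP => s0; last first.
    by rewrite p0 ?mulr0 ?mul0r//; rewrite ltW// ltNge s0.
  rewrite pos_id// -/(r2 p) (_ : - r2 p * p.2 = - p.2 * r2 p); last by ring.
  have sp0 : (Num.sqrt pi)%:C != 0 :> R[i] by apply: RC_neq0; rewrite gt_eqF// sqrtr_gt0 pi_gt0.
  have -> : ((Num.sqrt pi)^-1 * expR (- p.2 * r2 p))%:C = ((Num.sqrt pi)%:C)^-1 * (expR (- p.2 * r2 p))%:C :> R[i].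
    by rewrite RCM RCV// gt_eqF// sqrtr_gt0 pi_gt0.
  have sV := mulfV sp0; rewrite (RCM c0^-1).
  set a := (c0^-1)%:C; set b := (Num.sqrt pi)%:C in sV *; set e := (expR _)%:C.
  by rewrite -[RHS]mulr1 -sV; ring.
have mK : cmeasurable K.
  have m1 : cmeasurable (fun p : hmeas R => psi p.2).
    exact: (@cmeasurable_comp R _ R1 _ (hmeas R) (fun p => p.2) psi measurable_snd (ccont_meas cp)).
  have m2 : cmeasurable (fun p : hmeas R => (expR (- pos p.2 * r2 p))%:C).
    apply: cmeasurableC; apply: (@measurableT_comp _ _ _ _ _ _ (@expR R)) => //.
    apply: measurable_funM; last exact: meas_r2.
    by apply: measurableT_comp => //; exact: meas_pos.
  have mc : cmeasurable (fun _ : hmeas R => (c0^-1)%:C : R[i]) by exact: cmeasurable_cst.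
  have m3 : cmeasurable (fun p : hmeas R => (c0^-1)%:C * psi p.2) := cmeasurableM mc m1.
  have m4 : cmeasurable (fun p : hmeas R => (expR (- pos p.2 * r2 p))%:C * phi p) := cmeasurableM m2 (schwartz_meas sp).
  by rewrite KE; exact: (cmeasurableM m3 m4).
have ee p : `N ((expR (- pos p.2 * r2 p))%:C) <= 1 :> R.
  by rewrite normcR ger0_norm ?expR_ge0// -expR0 ler_expR mulNr oppr_le0 mulr_ge0 ?pos_ge0 ?r2_ge0.
have bK p : `N (K p) <= c0^-1 * M * C * wt p.
  have e1 : `N ((expR (- pos p.2 * r2 p))%:C * phi p) <= C * wt p.
    by rewrite normcM; apply: le_trans (pC p); rewrite ler_piMl ?normc_ge0.
  have e2 : `N (psi p.2) <= M by apply: le_trans (pM _) _; rewrite ler_piMr// w1_le1.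
  have c00 : 0 <= c0^-1 :> R by rewrite invr_ge0 ltW// c0_gt0.
  rewrite KE normcM (normcM (c0^-1)%:C) normcR (ger0_norm c00) -!mulrA.
  apply: (ler_wpM2l c00); exact: (ler_pM (normc_ge0 _) (normc_ge0 _) e2 e1).
split; first by apply: (cint_dom3 mK bK); exact: (intbleZ _ (@intble_wt R)).
have -> : cint3 (fun p => J psi p * fourier_s phi p) = cint3 (fun p => fourier_s phi p * J psi p).
  by apply: (eq_cintegral (leb3 R)) => p; rewrite mulrC.
rewrite (JS_fubini' (schwartz_int sf) ip) (fubini_q mK bK).
apply: eq_cintegral => s; rewrite KE /=.
have [s0|s0] := leP s 0.
  rewrite p0// mul0r -[LHS](cintegral0 leb2); apply: (eq_cintegral leb2) => q.
  by rewrite mulr0 mul0r.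
have fJ : schwartz (fun p => (fourier_s phi p)^*) := schwartzJ sf.
rewrite S_fs ?(ltW s0)//.
have iq : cintegrable leb2 (fun q : R2 => (expR (- pos s * (q.1 ^+ 2 + q.2 ^+ 2)))%:C * phi (q, s)).
  apply: (cint_dom _ _ (intbleZ (C * w1 s) (@intble_w1w1 R))).
    apply: cmeasurableM.
      apply: cmeasurableC; apply: (@measurableT_comp _ _ _ _ _ _ (@expR R)) => //.
      apply: measurable_funM => //; apply: measurable_funD; apply: measurable_funX => //.
    by apply: (cmeasurable_comp (g := fun q : R2 => (q, s : R1)) _ (schwartz_meas sp)); exact: measurable_pair2.
  move=> q; rewrite normcM; apply: (@le_trans _ _ (`N (phi (q, s)))).
    by rewrite ler_piMl ?normc_ge0//; have := ee (q, s).
  by apply: le_trans (pC _) _; rewrite /wt/=; apply: le_of_eq; ring.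
transitivity ((c0^-1)%:C * psi s * cintegral leb2 (fun q : R2 => (expR (- pos s * (q.1 ^+ 2 + q.2 ^+ 2)))%:C * phi (q, s))); last by rewrite -(cintegralZ _ iq).
set I := (X in (_ * X)^*); set I2 := cintegral leb2 _.
have -> : I = I2^*.
  rewrite /I2 -(cintegralJ iq); apply: (eq_cintegral leb2) => q.
  by rewrite (fs_inv (q, s) sp) (cJM _%:C (phi (q, s))) cJR pos_id ?ltW.
by rewrite cJM cJR conjcK mulrCA mulrA.
Qed.

End Profiles.

(** * Profiles that give Schwartz functions *)
Section FlatFunctions.
Context {R : realType}.
Local Notation leb := (@lebesgue_measure R).
Local Notation R1 := (measurableTypeR R).
Implicit Types (F G : R -> R[i]).

Lemma derive_zero (f : R -> R) (s C : R) : s <= 0 -> (forall t, `|f t| <= C * pos t ^+ 2) ->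
  is_derive s 1 f 0.
Proof.
move=> s0 fC.
have C0 : 0 <= C.
  have := fC 1; rewrite pos_id// expr1n mulr1; apply: le_trans; exact: normr_ge0.
have fs : f s = 0.
  by apply/eqP; rewrite -normr_le0; apply: le_trans (fC s) _; rewrite pos_neg// expr0n mulr0.
have h : h^-1 *: ((f \o shift s) (h *: 1) - f s) @[h --> (0 : R)^'] --> (0 : R).
  apply/cvgr0Pnorm_le => e e0.
  have e1 : 0 < e / (C + 1) by rewrite divr_gt0// ltr_wpDl.
  near=> h.
  have hn : `|h| <= e / (C + 1) by near: h; exact: dnbhs0_le.
  rewrite fs subr0 /= /GRing.scale/= mulr1 normrM normfV.
  have [->|h0] := eqVneq h 0; first by rewrite normr0 invr0 mul0r ltW.
  rewrite mulrC ler_pdivrMr ?normr_gt0//.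
  apply: le_trans (fC _) _.
  have p1 : pos (h + s) <= `|h|.
    rewrite /pos ge_max normr_ge0 andbT; apply: le_trans (ler_norm h).
    by rewrite -[leRHS]addr0 lerD2l.
  have p2 : pos (h + s) ^+ 2 <= `|h| * `|h|.
    by rewrite -expr2 lerXn2r ?nnegrE ?pos_ge0.
  apply: (@le_trans _ _ (C * (`|h| * `|h|))); first by rewrite ler_wpM2l.
  rewrite mulrA ler_wpM2r//.
  apply: (@le_trans _ _ ((C + 1) * `|h|)); first by rewrite ler_wpM2r// lerDl.
  by rewrite mulrC -ler_pdivlMr// ltr_wpDl.
split; first by apply/cvg_ex; exists 0.
exact: cvg_lim h.
Unshelve. all: by end_near.
Qed.

Lemma hasder_zero F (s C : R) : s <= 0 -> (forall t, `N (F t) <= C * pos t ^+ 2) -> hasder F s 1 0.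
Proof.
move=> s0 FC; split; apply: (derive_zero s0 (C := C)) => t; apply: le_trans (FC t).
  exact: normc_Re.
exact: normc_Im.
Qed.

Lemma hasder_near F G (s : R) l : 0 < s -> (forall t, 0 < t -> F t = G t) ->
  hasder G s 1 l -> hasder F s 1 l.
Proof.
move=> s0 FG [h1 h2].
have n : \forall t \near s, 0 < t by exact: lt_nbhsr.
split; apply: near_eq_is_derive; try exact: h1; try exact: h2.
  by near=> t; rewrite FG//; near: t.
by near=> t; rewrite FG//; near: t.
Unshelve. all: by end_near.
Qed.

Lemma expR_power (y : R) n : 0 <= y -> y ^+ n <= n`!%:R * expR y.
Proof.
move=> y0; case: n => [|n]; first by rewrite expr0 mul1r -expR0 ler_expR.
have := expR_ge1Dxn n y0; rewrite -lerBrDl => h.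
have f0 : 0 < n.+1`!%:R :> R by rewrite ltr0n fact_gt0.
rewrite mulrC -ler_pdivrMr//; apply: le_trans h _; by rewrite gerBl.
Qed.

(** Functions on the line that vanish for [s <= 0] together with all their
    derivatives, and decay rapidly at infinity. *)
Definition flat_closed (X : (R -> R[i]) -> Prop) := forall F, X F ->
  [/\ forall s, s <= 0 -> F s = 0, exists C, forall s, `N (F s) <= C,
      exists2 G, X G & forall s, (pos s)%:C * F s = G s,
      exists2 G, X G & forall s, F s = (pos s)%:C * G s &
      exists2 G, X G & forall s, hasder F s 1 (G s)].
Definition flat F := exists2 X, X F & flat_closed X.

Lemma flat_cl : flat_closed flat.
Proof.
move=> F [X XF cX]; have [h1 h2 [A XA hA] [B XB hB] [D XD hD]] := cX F XF.
by split => //; [exists A|exists B|exists D] => //; exists X.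
Qed.

Lemma flat_power F k : flat F -> exists2 C, 0 <= C & forall s : R, 0 < s -> (s + s^-1) ^+ k * `N (F s) <= C.
Proof.
elim: k F => [|k IH] F fF; have [h1 [C hC] [A XA hA] [B XB hB] _] := flat_cl fF.
  exists C; first by apply: le_trans (hC 0); exact: normc_ge0.
  by move=> s _; rewrite expr0 mul1r.
have [a a0 ha] := IH A XA; have [b b0 hb] := IH B XB.
exists (a + b); first exact: addr_ge0.
move=> s s0; apply: le_trans (lerD (ha s s0) (hb s s0)).
rewrite -mulrDr exprSr -mulrA; apply: ler_wpM2l.
  by rewrite exprn_ge0// addr_ge0 ?invr_ge0 ?(ltW s0).
have EA : `N (A s) = s * `N (F s) by rewrite -hA normcM normcR pos_id ?ltW// gtr0_norm.
have EB : `N (B s) = s^-1 * `N (F s).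
  by rewrite hB normcM normcR pos_id ?ltW// gtr0_norm// mulKf ?gt_eqF.
by rewrite EA EB mulrDl.
Qed.

Lemma one_le_sinv (s : R) : 0 < s -> 1 <= s + s^-1.
Proof.
move=> s0; have [s1|s1] := leP 1 s; first by rewrite ler_wpDr// invr_ge0 ltW.
by rewrite ler_wpDl ?(ltW s0)// invf_ge1 ?(ltW s1).
Qed.
Lemma sqr_le_sinv (s : R) : 0 < s -> 1 + s ^+ 2 <= (s + s^-1) ^+ 2.
Proof.
move=> s0; have h : s * s^-1 = 1 by rewrite mulfV// gt_eqF.
have := sqr_ge0 (s^-1); rewrite sqrrD h; lra.
Qed.

Lemma flat_prof F : flat F -> prof F.
Proof.
move=> fF; have [h1 _ _ _ [D XD hD]] := flat_cl fF.
split => //; first exact: hasder_cont hD.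
have [C C0 hC] := flat_power 2 fF; exists C => // s.
have [s0|s0] := leP s 0; first by rewrite h1// Normc.normc0 mulr_ge0 ?w1_ge0.
rewrite /w1 ler_pdivlMr; last by rewrite ltr_wpDr ?sqr_ge0.
apply: le_trans (hC s s0); rewrite mulrC ler_wpM2r ?normc_ge0//.
exact: sqr_le_sinv.
Qed.

Inductive xypol : hfun R -> Prop :=
| xp_cst c : xypol (fun=> c)
| xp_x : xypol (fun p => (p.1.1)%:C)
| xp_y : xypol (fun p => (p.1.2)%:C)
| xpD m n : xypol m -> xypol n -> xypol (fun p => m p + n p)
| xpM m n : xypol m -> xypol n -> xypol (fun p => m p * n p).

Lemma xypol_growth m : xypol m -> exists2 C, 0 <= C & exists k, forall p, `N (m p) <= C * (1 + r2 p) ^+ k.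
Proof.
have one p : 1 <= 1 + r2 p :> R by rewrite lerDl r2_ge0.
have sq (a b : R) : 0 <= b -> `|a| <= 1 * (1 + (a ^+ 2 + b)) ^+ 1.
  move=> b0; rewrite mul1r expr1; have := sqr_ge0 (`|a| - 1); rewrite sqrrB real_normK ?num_real//.
  by have := normr_ge0 a; lra.
elim => [c| | |m1 m2 _ [C1 C10 [k1 h1]] _ [C2 C20 [k2 h2]]|m1 m2 _ [C1 C10 [k1 h1]] _ [C2 C20 [k2 h2]]].
- by exists (`N c); [exact: normc_ge0|exists 0 => p; rewrite expr0 mulr1].
- by exists 1 => //; exists 1 => p; rewrite normcR; apply: sq; exact: sqr_ge0.
- by exists 1 => //; exists 1 => p; rewrite normcR /r2 [p.1.1 ^+ 2 + _]addrC; apply: sq; exact: sqr_ge0.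
- exists (C1 + C2); first exact: addr_ge0.
  exists (k1 + k2)%N => p; apply: le_trans (le_normcD _ _) _.
  rewrite mulrDl lerD//; [apply: le_trans (h1 p) _|apply: le_trans (h2 p) _]; rewrite ler_wpM2l//.
    by apply: ler_weXn2l => //; exact: leq_addr.
  by apply: ler_weXn2l => //; exact: leq_addl.
- exists (C1 * C2); first exact: mulr_ge0.
  exists (k1 + k2)%N => p; rewrite normcM exprD mulrACA.
  by apply: ler_pM; rewrite ?normc_ge0.
Qed.

Lemma xypol_x m : xypol m -> exists2 m', xypol m' & forall p, hasder m p ex (m' p).
Proof.
elim => [c| | |m1 m2 _ [n1 x1 h1] _ [n2 x2 h2]|m1 m2 hm1 [n1 x1 h1] hm2 [n2 x2 h2]].
- by exists (fun=> 0); [exact: xp_cst|move=> p; exact: hasder_cst].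
- exists (fun=> 1); first exact: xp_cst.
  by move=> p; apply/hasder_ex; apply: (hasderR (is_derive_id _ _)).
- exists (fun=> 0); first exact: xp_cst.
  by move=> p; apply/hasder_ex; exact: (hasder_cst (p.1.2)%:C p.1.1 1).
- by exists (fun p => n1 p + n2 p); [exact: xpD|move=> p; exact: hasderD].
- exists (fun p => n1 p * m2 p + m1 p * n2 p); first by apply: xpD; exact: xpM.
  by move=> p; exact: hasderM.
Qed.
Lemma xypol_y m : xypol m -> exists2 m', xypol m' & forall p, hasder m p ey (m' p).
Proof.
elim => [c| | |m1 m2 _ [n1 x1 h1] _ [n2 x2 h2]|m1 m2 hm1 [n1 x1 h1] hm2 [n2 x2 h2]].
- by exists (fun=> 0); [exact: xp_cst|move=> p; exact: hasder_cst].
- exists (fun=> 0); first exact: xp_cst.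
  by move=> p; apply/hasder_ey; exact: (hasder_cst (p.1.1)%:C p.1.2 1).
- exists (fun=> 1); first exact: xp_cst.
  by move=> p; apply/hasder_ey; apply: (hasderR (is_derive_id _ _)).
- by exists (fun p => n1 p + n2 p); [exact: xpD|move=> p; exact: hasderD].
- exists (fun p => n1 p * m2 p + m1 p * n2 p); first by apply: xpD; exact: xpM.
  by move=> p; exact: hasderM.
Qed.
Lemma xypol_s m (p : heis R) t : xypol m -> m (p.1, t) = m p.
Proof. by elim => [c| | |m1 m2 _ h1 _ h2|m1 m2 _ h1 _ h2] //=; rewrite ?h1 ?h2. Qed.

Definition decay (p : heis R) : R[i] := (expR (- pos p.2 * r2 p))%:C.

(** Products of a flat profile, a polynomial and [exp (- s (x^2 + y^2))]: a class
    stable under the partial derivatives. *)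
Inductive wfl : hfun R -> Prop :=
| wfl1 F m : flat F -> xypol m -> wfl (fun p => m p * (decay p * F p.2))
| wflD u w : wfl u -> wfl w -> wfl (fun p => u p + w p).

Lemma one_norm_le (p : heis R) : 1 + `|p| <= 3 * ((1 + r2 p) * (1 + p.2 ^+ 2)).
Proof.
have h (a : R) : `|a| <= (1 + a ^+ 2) / 2.
  by have := sqr_ge0 (`|a| - 1); rewrite sqrrB real_normK ?num_real//; lra.
have := norm_sum p; have := h p.1.1; have := h p.1.2; have := h p.2.
have a0 := sqr_ge0 p.1.1; have b0 := sqr_ge0 p.1.2; have c0 := sqr_ge0 p.2.
have : 0 <= r2 p * p.2 ^+ 2 by rewrite mulr_ge0 ?r2_ge0.
by rewrite /r2; lra.
Qed.

Lemma decay_power n : exists2 K : R, 0 <= K & forall p : heis R, 0 < p.2 ->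
  (1 + r2 p) ^+ n * `N (decay p) <= K * (p.2 + p.2^-1) ^+ n.
Proof.
exists (n`!%:R * expR 1); first by rewrite mulr_ge0// expR_ge0.
move=> p s0; set s := p.2 in s0 *.
have b1 := one_le_sinv s0; set b := s + s^-1 in b1 *; have b0 : 0 < b := lt_le_trans ltr01 b1.
have bV : b^-1 <= s.
  rewrite -[leRHS]invrK lef_pV2 ?posrE ?invr_gt0//.
  by rewrite /b lerDr ltW.
have r0 := r2_ge0 p.
have y0 : 0 <= b^-1 * (1 + r2 p) by rewrite mulr_ge0 ?invr_ge0 ?(ltW b0)// addr_ge0.
have := expR_power n y0; rewrite exprMn exprVn mulrC ler_pdivrMr ?exprn_gt0// => h.
rewrite /decay normcR ger0_norm ?expR_ge0// pos_id ?(ltW s0)//.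
have e0 := expR_ge0 (- s * r2 p).
apply: le_trans (ler_wpM2r e0 h) _.
rewrite mulrAC ler_wpM2r ?exprn_ge0 ?(ltW b0)// -mulrA ler_wpM2l//.
rewrite -expRD ler_expR mulrDr mulr1.
have : b^-1 <= 1 by rewrite invf_le1.
have : b^-1 * r2 p <= s * r2 p by rewrite ler_wpM2r.
by lra.
Qed.

Lemma wfl_rdec u : wfl u -> rdec u.
Proof.
elim => [F m fF xm|*]; last exact: rdecD.
move=> k; have [C C0 [j mC]] := xypol_growth xm.
have [K K0 hK] := decay_power (k + j).
have [D D0 hD] := flat_power (k + j + 2 * k) fF.
exists (3 ^+ k * C * K * D) => p.
have [s0|s0] := leP p.2 0.
  have [-> // _ _ _ _] := flat_cl fF; rewrite !mulr0 Normc.normc0 mulr0.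
  by rewrite !mulr_ge0// exprn_ge0.
have a1 : 0 <= 1 + r2 p by rewrite addr_ge0 ?r2_ge0.
have a2 : 0 <= 1 + p.2 ^+ 2 by rewrite addr_ge0 ?sqr_ge0.
have q1 := one_le_sinv s0; set b := p.2 + p.2^-1 in q1 *.
have b0 : 0 <= b := le_trans ler01 q1.
have h1 : (1 + `|p|) ^+ k <= 3 ^+ k * ((1 + r2 p) ^+ k * b ^+ (2 * k)).
  apply: (@le_trans _ _ ((3 * ((1 + r2 p) * (1 + p.2 ^+ 2))) ^+ k)).
    by rewrite lerXn2r ?nnegrE ?addr_ge0 ?mulr_ge0//; exact: one_norm_le.
  rewrite !exprMn ler_wpM2l ?exprn_ge0// ler_wpM2l ?exprn_ge0// exprM.
  by rewrite lerXn2r ?nnegrE ?exprn_ge0//; exact: sqr_le_sinv.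
rewrite normcM (normcM (decay p) (F p.2)).
have n0 z := @normc_ge0 R z.
apply: (@le_trans _ _ (3 ^+ k * ((1 + r2 p) ^+ k * b ^+ (2 * k)) * (C * (1 + r2 p) ^+ j * (`N (decay p) * `N (F p.2))))).
  apply: ler_pM; [by rewrite exprn_ge0// addr_ge0|by rewrite !mulr_ge0 ?n0|exact: h1|].
  by apply: ler_wpM2r; [rewrite mulr_ge0 ?n0|exact: mC].
apply: (@le_trans _ _ (3 ^+ k * C * (b ^+ (2 * k) * `N (F p.2)) * ((1 + r2 p) ^+ (k + j) * `N (decay p)))).
  by apply: le_of_eq; rewrite exprD; ring.
apply: (@le_trans _ _ (3 ^+ k * C * (b ^+ (2 * k) * `N (F p.2)) * (K * b ^+ (k + j)))).
  by rewrite ler_wpM2l ?hK// !mulr_ge0 ?exprn_ge0 ?n0.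
apply: (@le_trans _ _ (3 ^+ k * C * K * (b ^+ (k + j + 2 * k) * `N (F p.2)))).
  by apply: le_of_eq; rewrite !exprD; ring.
by rewrite ler_wpM2l ?hD// !mulr_ge0 ?exprn_ge0.
Qed.

Lemma decay_ex p : hasder decay p ex (- (2 * pos p.2 * p.1.1)%:C * decay p).
Proof.
apply/hasder_ex.
have d1 : is_derive p.1.1 1 (fun t : R => - pos p.2 * (t ^+ 2 + p.1.2 ^+ 2)) (- (2 * pos p.2 * p.1.1)).
  apply: (is_derive_eq (is_deriveM (is_derive_cst (- pos p.2) _ _) (is_deriveD (is_derive_sqr _) (is_derive_cst _ _ _)))).
  by rewrite /GRing.scale/=; ring.
apply: (hasder_eq (hasderR (is_derive1_comp (is_derive_expR _) d1))).
by rewrite -RCN -RCM; congr (_%:C); rewrite mulrC.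
Qed.
Lemma decay_ey p : hasder decay p ey (- (2 * pos p.2 * p.1.2)%:C * decay p).
Proof.
apply/hasder_ey.
have d1 : is_derive p.1.2 1 (fun t : R => - pos p.2 * (p.1.1 ^+ 2 + t ^+ 2)) (- (2 * pos p.2 * p.1.2)).
  apply: (is_derive_eq (is_deriveM (is_derive_cst (- pos p.2) _ _) (is_deriveD (is_derive_cst _ _ _) (is_derive_sqr _)))).
  by rewrite /GRing.scale/=; ring.
apply: (hasder_eq (hasderR (is_derive1_comp (is_derive_expR _) d1))).
by rewrite -RCN -RCM; congr (_%:C); rewrite mulrC.
Qed.
Lemma decay_le1 p : `N (decay p) <= 1.
Proof. by rewrite normcR ger0_norm ?expR_ge0// -expR0 ler_expR mulNr oppr_le0 mulr_ge0 ?pos_ge0 ?r2_ge0. Qed.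

Lemma wfl_hasder u v : wfl u -> v \in dirs -> exists2 u', wfl u' & forall p, hasder u p v (u' p).
Proof.
move=> wu; rewrite !inE => vD; elim: wu => [F m fF xm|u1 u2 _ [w1 h1 d1] _ [w2 h2 d2]]; last first.
  by exists (fun p => w1 p + w2 p); [exact: wflD|move=> p; exact: hasderD].
have [z [C hC] [A XA hA] [B XB hB] [D XD hD]] := flat_cl fF.
case/or3P: vD => /eqP ->.
- have [m' xm' hm'] := xypol_x xm.
  exists (fun p => m' p * (decay p * F p.2) + ((- 2)%:C * ((p.1.1)%:C * m p)) * (decay p * A p.2)).
    apply: wflD; apply: wfl1 => //; apply: xpM; first exact: xp_cst.
    by apply: xpM => //; exact: xp_x.
  move=> p; have dF : hasder (fun p : heis R => F p.2) p ex 0.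
    by apply/hasder_ex; exact: (hasder_cst (F p.2) p.1.1 1).
  apply: (hasder_eq (hasderM (hm' p) (hasderM (decay_ex p) dF))).
  rewrite -hA !RCM RCN rmorph_nat; move: (decay p) (F p.2) (m p) (m' p) (pos _)%:C (p.1.1)%:C => *.
  by ring.
- have [m' xm' hm'] := xypol_y xm.
  exists (fun p => m' p * (decay p * F p.2) + ((- 2)%:C * ((p.1.2)%:C * m p)) * (decay p * A p.2)).
    apply: wflD; apply: wfl1 => //; apply: xpM; first exact: xp_cst.
    by apply: xpM => //; exact: xp_y.
  move=> p; have dF : hasder (fun p : heis R => F p.2) p ey 0.
    by apply/hasder_ey; exact: (hasder_cst (F p.2) p.1.2 1).
  apply: (hasder_eq (hasderM (hm' p) (hasderM (decay_ey p) dF))).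
  rewrite -hA !RCM RCN rmorph_nat; move: (decay p) (F p.2) (m p) (m' p) (pos _)%:C (p.1.2)%:C => *.
  by ring.
- exists (fun p => (- 1 * ((p.1.1)%:C * (p.1.1)%:C + (p.1.2)%:C * (p.1.2)%:C) * m p) * (decay p * F p.2) + m p * (decay p * D p.2)).
    apply: wflD; apply: wfl1 => //; apply: xpM => //; apply: xpM; first exact: xp_cst.
    by apply: xpD; apply: xpM; (exact: xp_x || exact: xp_y).
  move=> p; apply/hasder_es.
  have [s0|s0] := leP p.2 0.
    have [zD _ _ _ _] := flat_cl XD.
    rewrite z// zD// !mulr0 addr0.
    have [_ _ _ [E XE hE] _] := flat_cl XB; have [_ [c hc] _ _ _] := flat_cl XE.
    apply: (hasder_zero s0 (C := `N (m p) * c)) => t.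
    rewrite /sline normcM (normcM (decay _) (F _)) -mulrA.
    have -> : m (p.1.1, p.1.2, t) = m p by rewrite -(xypol_s p t xm); case: p {s0} => -[].
    rewrite ler_wpM2l ?normc_ge0//.
    apply: (@le_trans _ _ (`N (F t))); first by rewrite ler_piMl ?normc_ge0 ?decay_le1.
    rewrite hB hE !normcM normcR ger0_norm ?pos_ge0// mulrA -expr2 mulrC.
    by rewrite ler_wpM2r ?sqr_ge0 ?hc.
  have d1 : is_derive p.2 1 (fun t : R => - t * r2 p) (- r2 p).
    apply: (is_derive_eq (is_deriveM (is_deriveN (is_derive_id _ _)) (is_derive_cst (r2 p) _ _))).
    by rewrite /GRing.scale/=; ring.
  apply: (hasder_near s0 (G := fun t => m p * ((expR (- t * r2 p))%:C * F t))).
    move=> t t0; rewrite /sline.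
    have -> : m (p.1.1, p.1.2, t) = m p by rewrite -(xypol_s p t xm); case: p {s0 d1} => -[].
    by rewrite /decay /r2 /= pos_id ?ltW.
  apply: (hasder_eq (hasderM (hasder_cst (m p) _ _) (hasderM (hasderR (is_derive1_comp (is_derive_expR _) d1)) (hD p.2)))).
  have -> : (p.1.1)%:C * (p.1.1)%:C + (p.1.2)%:C * (p.1.2)%:C = (r2 p)%:C :> R[i] by rewrite /r2 !expr2 RCD !RCM.
  rewrite /decay pos_id ?(ltW s0)// RCM RCN.
  move: (expR _)%:C (m p) (F p.2) (D p.2) (r2 p)%:C => *; ring.
Qed.

(** The function [F (s) exp (- s (x^2 + y^2))] is smooth across [s = 0] because
    [F] is flat there, and decays rapidly because [exp (- s (x^2 + y^2))] is
    compensated by powers of [1/s]; [J F] is its partial Fourier transform. *)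
Lemma flat_J F : flat F -> schwartz (J F).
Proof.
move=> fF; have [z _ _ _ _] := flat_cl fF; have pF := flat_prof fF.
pose u : hfun R := fun p => 1 * (decay p * F p.2).
have su : schwartz u.
  apply: (@schwartz_coind _ wfl); [exact: wfl_rdec|exact: wfl_hasder|].
  by apply: wfl1 => //; exact: xp_cst.
have -> : J F = (fun p => (c0^-1)%:C * (fourier_s (fun p => (u p)^*) p)^*).
  apply/funext => -[q t]; have suJ := schwartzJ su.
  have fE : fourier_s (fun p => (u p)^*) (q, t) = c0%:C * cintegral leb (fun s : R1 => cis (- (s * t)) * (u (q, s))^*) by [].
  rewrite fE cJM cJR mulrA -RCM mulVf ?gt_eqF ?c0_gt0// mul1r.
  rewrite -(cintegralJ (fs_int (q, t) suJ)); apply: eq_cintegral => s.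
  rewrite (cJM (cis _) (u (q, s))^*) conjcK -cisN opprK /u mul1r /decay.
  have [s0|s0] := leP s 0; first by rewrite z// mul0r !mulr0.
  rewrite /wav pos_id ?(ltW s0)// /r2 /=; move: (expR _)%:C (cis _) (F s) => *.
  by ring.
by apply: schwartzZ; apply: schwartzJ; apply: fs_schwartz; exact: schwartzJ.
Qed.

(** Cutting off at [s = 0] by [exp (- e / s)]. *)
Definition eta (e : R) (k : nat) (s : R) : R := if 0 < s then expR (- (e / s)) * s^-1 ^+ k else 0.

Lemma eta_ge0 e k s : 0 <= eta e k s.
Proof. by rewrite /eta; case: ifP => // s0; rewrite mulr_ge0 ?expR_ge0 ?exprn_ge0 ?invr_ge0 ?ltW. Qed.
Lemma eta_bound e k : 0 < e -> exists2 C, 0 <= C & forall s, eta e k s <= C.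
Proof.
move=> e0; exists (k`!%:R / e ^+ k); first by rewrite divr_ge0 ?exprn_ge0 ?ltW.
move=> s; rewrite /eta; case: ifP => s0; last by rewrite divr_ge0 ?exprn_ge0 ?ltW.
have y0 : 0 <= e / s by rewrite divr_ge0 ?ltW.
have := expR_power k y0; rewrite exprMn => h.
rewrite ler_pdivlMr ?exprn_gt0// -mulrA [_ * e ^+ k]mulrC.
by rewrite expRN [leLHS]mulrC ler_pdivrMr ?expR_gt0.
Qed.
Lemma etaS e k s : eta e k s = pos s * eta e k.+1 s.
Proof.
rewrite /eta; case: ifP => s0; last by rewrite mulr0.
by rewrite pos_id ?ltW// exprS; field; rewrite gt_eqF.
Qed.

(** Classes of functions on [s > 0] stable by derivation and by multiplication
    by [s], and made of bounded functions. *)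
Definition tame (X : (R -> R[i]) -> Prop) := forall G, X G ->
  [/\ exists C, forall s, 0 < s -> `N (G s) <= C,
      exists2 H, X H & forall s, 0 < s -> hasder G s 1 (H s) &
      exists2 H, X H & forall s, 0 < s -> s%:C * G s = H s].

(** The functions [exp (- e / s) s^{-k} G (s)] with [G] tame. *)
Inductive efl (X : (R -> R[i]) -> Prop) (e : R) : (R -> R[i]) -> Prop :=
| efl1 c G k : X G -> efl X e (fun s => (c * eta e k s)%:C * G s)
| eflD F1 F2 : efl X e F1 -> efl X e F2 -> efl X e (fun s => F1 s + F2 s).

Lemma efl_bound X e F : 0 < e -> tame X -> efl X e F -> exists C, forall s, `N (F s) <= C.
Proof.
move=> e0 tX; elim => [c G k XG|F1 F2 _ [C1 h1] _ [C2 h2]]; last first.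
  by exists (C1 + C2) => s; apply: le_trans (le_normcD _ _) _; exact: lerD.
have [[C hC] _ _] := tX G XG; have [K K0 hK] := eta_bound k e0.
exists (`|c| * K * C) => s; rewrite normcM normcR normrM (ger0_norm (eta_ge0 _ _ _)).
have [s0|s0] := ltP 0 s; last first.
  rewrite /eta ltNge s0/= mulr0 mul0r !mulr_ge0//.
  by have := hC 1 ltr01; apply: le_trans; exact: normc_ge0.
by apply: ler_pM; rewrite ?normc_ge0 ?hC ?mulr_ge0 ?eta_ge0// ler_wpM2l.
Qed.

Lemma efl_div X e F : efl X e F -> exists2 G, efl X e G & forall s, F s = (pos s)%:C * G s.
Proof.
elim => [c G k XG|F1 F2 _ [G1 e1 h1] _ [G2 e2 h2]].
  exists (fun s => (c * eta e k.+1 s)%:C * G s); first exact: efl1.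
  by move=> s; rewrite [RHS]mulrA -RCM; congr (_%:C * _); rewrite [in LHS]etaS; ring.
by exists (fun s => G1 s + G2 s); [exact: eflD|move=> s; rewrite h1 h2 mulrDr].
Qed.

Lemma efl_flat X e F : 0 < e -> tame X -> efl X e F -> flat F.
Proof.
move=> e0 tX eF; exists (efl X e) => // {eF}F eF.
have z : forall s, s <= 0 -> F s = 0.
  elim: eF => [c G k XG s s0|F1 F2 _ h1 _ h2 s s0]; last by rewrite h1// h2// addr0.
  by rewrite /eta ltNge s0/= mulr0 mul0r.
split => //; first exact: efl_bound eF.
- elim: eF {z} => [c G k XG|F1 F2 _ [G1 e1 h1] _ [G2 e2 h2]]; last first.
    by exists (fun s => G1 s + G2 s); [exact: eflD|move=> s; rewrite mulrDr h1 h2].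
  have [_ _ [H XH hH]] := tX G XG.
  exists (fun s => (c * eta e k s)%:C * H s); first exact: efl1.
  move=> s; have [s0|s0] := ltP 0 s; first by rewrite pos_id ?(ltW s0)// mulrCA hH.
  by rewrite pos_neg// mul0r /eta ltNge s0/= mulr0 mul0r.
- exact: efl_div.
have zero F0 : efl X e F0 -> forall s, s <= 0 -> hasder F0 s 1 0.
  move=> h s s0; have [G1 g1 h1] := efl_div h; have [G2 g2 h2] := efl_div g1.
  have [C hC] := efl_bound e0 tX g2.
  apply: (hasder_zero s0 (C := C)) => t; rewrite h1 h2 mulrA -RCM normcM normcR -expr2.
  by rewrite ger0_norm ?sqr_ge0// mulrC ler_wpM2r ?sqr_ge0.
suff [G eG hG] : exists2 G, efl X e G & forall s, 0 < s -> hasder F s 1 (G s).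
  exists G => // s; have [s0|s0] := ltP 0 s; first exact: hG.
  have -> : G s = 0.
    elim: eG s0 {hG} => [c H k XH s0|F1 F2 _ h1 _ h2 s0]; last by rewrite h1// h2// addr0.
    by rewrite /eta ltNge s0/= mulr0 mul0r.
  exact: zero.
elim: eF {z} => [c G k XG|F1 F2 _ [G1 e1 h1] _ [G2 e2 h2]]; last first.
  by exists (fun s => G1 s + G2 s); [exact: eflD|move=> s s0; exact: hasderD (h1 s s0) (h2 s s0)].
have [_ [H XH hH] _] := tX G XG.
exists (fun s => ((- c * k%:R) * eta e k.+1 s)%:C * G s + ((c * e * eta e k.+2 s)%:C * G s + (c * eta e k s)%:C * H s)).
  by apply: eflD; first exact: efl1; apply: eflD; exact: efl1.
move=> s s0; have sn : s != 0 by rewrite gt_eqF.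
have dV : is_derive s 1 (fun t : R => t^-1) (- s^-1 ^+ 2).
  by apply: (is_derive_eq (is_deriveV sn (is_derive_id s 1))); rewrite /GRing.scale/= mulr1 exprVn.
have d1 : is_derive s 1 (fun t : R => - (e / t)) (e * s^-1 ^+ 2).
  apply: (is_derive_eq (is_deriveN (is_deriveM (is_derive_cst e _ _) dV))).
  by rewrite /GRing.scale/=; ring.
have d2 : is_derive s 1 (fun t : R => t^-1 ^+ k) (- (k%:R * s^-1 ^+ k.+1)).
  have := @is_deriveX _ _ (fun t : R => t^-1) k s 1 _ dV.
  rewrite exprfctE => /is_derive_eq; apply; rewrite /GRing.scale/=.
  by case: k => [|k]; rewrite ?mul0r ?oppr0// !exprS expr0; ring.
have d3 : is_derive s 1 (fun t : R => c * (expR (- (e / t)) * t^-1 ^+ k))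
   ((- c * k%:R) * eta e k.+1 s + c * e * eta e k.+2 s).
  apply: (is_derive_eq (is_deriveM (is_derive_cst c _ _) (is_deriveM (is_derive1_comp (is_derive_expR _) d1) d2))).
  by rewrite /GRing.scale/= /eta s0 !exprS; ring.
apply: (hasder_near s0 (G := fun t => (c * (expR (- (e / t)) * t^-1 ^+ k))%:C * G t)).
  by move=> t t0; rewrite /eta t0.
apply: (hasder_eq (hasderM (hasderR d3) (hH s s0))).
rewrite RCD mulrDl addrA; congr (_ + _ * _); congr (_%:C).
by rewrite /eta s0.
Qed.

End FlatFunctions.

(** * Hardy coefficients of Schwartz functions *)
Section FrequencySide.
Context {R : realType}.
Local Notation leb := (@lebesgue_measure R).
Local Notation R1 := (measurableTypeR R).
Local Notation leb2 := (prod_sf leb leb).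
Local Notation leb3s := (prod_sf leb2 leb).
Implicit Types (u w v phi : hfun R) (psi F G : R -> R[i]).

Lemma hasder_S phi (s : R) : schwartz phi -> 0 < s ->
  hasder (S phi) s 1 (S (fun p => (- (r2 p)%:C - 'i%C * (p.2)%:C) * phi p) s).
Proof.
move=> sp s0.
have mm : mult (fun p : heis R => - (r2 p)%:C - 'i%C * (p.2)%:C).
  have -> : (fun p : heis R => - (r2 p)%:C - 'i%C * (p.2)%:C) = (fun p : heis R => -1 * (r2 p)%:C + (- 'i%C) * (p.2)%:C).
    by apply/funext => p; rewrite mulN1r mulNr.
  by apply: multD; apply: multM; (exact: mult_cst || exact: mult_r2 || exact: mult_s).
have sq := schwartzM mm sp.
have aa : 0 < s < s + 1 by rewrite s0/=; lra.
have h := @hasder_under R _ _ leb3s (fun x p => phi p * (wav x p)^*)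
  (fun x p => (- (r2 p)%:C - 'i%C * (p.2)%:C) * phi p * (wav x p)^*)
  (fun p => `N ((- (r2 p)%:C - 'i%C * (p.2)%:C) * phi p)) s 0 (s + 1) aa.
apply: h.
- by move=> x _; exact: int_S x (schwartz_int sp).
- move=> x p /andP[x0 _].
  have d1 : is_derive x 1 (fun t : R => - t * r2 p) (- r2 p).
    apply: (is_derive_eq (is_deriveM (is_deriveN (is_derive_id _ _)) (is_derive_cst (r2 p) _ _))).
    by rewrite /GRing.scale/=; ring.
  have d2 : is_derive x 1 (fun t : R => t * p.2) p.2.
    apply: (is_derive_eq (is_deriveM (is_derive_id _ _) (is_derive_cst p.2 _ _))).
    by rewrite /GRing.scale/=; ring.
  apply: (hasder_near x0 (G := fun t => phi p * ((expR (- t * r2 p))%:C * cis (t * p.2))^*)).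
    by move=> t t0; rewrite /wav pos_id ?(ltW t0).
  apply: (hasder_eq (hasderM (hasder_cst (phi p) _ _) (hasderJ (hasderM (hasderR (is_derive1_comp (is_derive_expR _) d1)) (hasder_cis d2))))).
  rewrite /comp /wav pos_id ?(ltW x0)// RCM RCN.
  move: (expR (- x * r2 p))%:C (cis (x * p.2)) (phi p) (r2 p) p.2 => e c f r t.
  rewrite !(cJM, cJD); have -> : (- r%:C)^* = - r%:C :> R[i] by rewrite -RCN cJR.
  have -> : ('i%C : R[i])^* = - 'i%C by apply: cplxP; rewrite !cE ?oppr0.
  rewrite !cJR; move: r%:C t%:C (expR (- x * r))%:C (cis (x * t))^* 'i%C => *; ring.
- move=> x p _; rewrite normcM normcJ ler_piMr ?normc_ge0//; exact: wav_le1.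
- exact: cint_normc (schwartz_int sq).
Qed.

(** The Hardy coefficients of Schwartz functions are smooth on [s > 0]: a
    derivative in [s] multiplies [phi] by a polynomial. *)
Lemma tame_S : tame (fun G => exists2 phi, schwartz phi & G = S phi).
Proof.
move=> _ [phi sp ->]; split.
- by exists (Rintegral (leb3 R) setT (fun p : hmeas R => `N (phi p))) => s _; apply: S_bound; exact: schwartz_int.
- exists (S (fun p => (- (r2 p)%:C - 'i%C * (p.2)%:C) * phi p)); last by move=> s s0; exact: hasder_S.
  exists (fun p => (- (r2 p)%:C - 'i%C * (p.2)%:C) * phi p) => //; apply: schwartzM => //.
  have -> : (fun p : heis R => - (r2 p)%:C - 'i%C * (p.2)%:C) = (fun p : heis R => -1 * (r2 p)%:C + (- 'i%C) * (p.2)%:C).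
    by apply/funext => p; rewrite mulN1r mulNr.
  by apply: multD; apply: multM; (exact: mult_cst || exact: mult_r2 || exact: mult_s).
- exists (S (Ds phi)); first by exists (Ds phi) => //; exact: schwartz_Ds.
  by move=> s s0; rewrite S_Ds// pos_id// ltW.
Qed.

Inductive pexp : (R -> R[i]) -> Prop :=
| pexp1 (c : R) k : pexp (fun s => (c * s ^+ k * expR (- s))%:C)
| pexpD F G : pexp F -> pexp G -> pexp (fun s => F s + G s).

Lemma tame_exp : tame pexp.
Proof.
move=> F; elim => [c k|F1 F2 _ [[C1 h1] [A1 a1 b1] [D1 d1 e1]] _ [[C2 h2] [A2 a2 b2] [D2 d2 e2]]]; last first.
  split.
  - by exists (C1 + C2) => s s0; apply: le_trans (le_normcD _ _) _; apply: lerD; [exact: h1|exact: h2].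
  - by exists (fun s => A1 s + A2 s); [exact: pexpD|move=> s s0; exact: hasderD (b1 s s0) (b2 s s0)].
  - by exists (fun s => D1 s + D2 s); [exact: pexpD|move=> s s0; rewrite mulrDr e1// e2].
split.
- exists (`|c| * k`!%:R) => s s0; rewrite normcR -mulrA normrM ler_wpM2l//.
  rewrite ger0_norm; last by rewrite mulr_ge0 ?expR_ge0 ?exprn_ge0 ?(ltW s0).
  by rewrite expRN ler_pdivrMr ?expR_gt0// expR_power// ltW.
- exists (fun s => ((c * k%:R) * s ^+ k.-1 * expR (- s))%:C + (- c * s ^+ k * expR (- s))%:C).
    by apply: pexpD; exact: pexp1.
  move=> s s0.
  have d1 : is_derive s 1 (fun t : R => - t) (-1) by exact: (is_deriveN (is_derive_id _ _)).
  have d2 : is_derive s 1 (fun t : R => t ^+ k) (k%:R * s ^+ k.-1).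
    have := @is_deriveX _ _ (fun t : R => t) k s 1 1 (is_derive_id _ _).
    by rewrite exprfctE => /is_derive_eq; apply; rewrite /GRing.scale/= mulr1.
  have d3 : is_derive s 1 (fun t : R => c * t ^+ k) (c * (k%:R * s ^+ k.-1)).
    by apply: (is_derive_eq (is_deriveM (is_derive_cst c _ _) d2)); rewrite /GRing.scale/=; ring.
  apply: (hasder_eq (hasderR (is_deriveM d3 (is_derive1_comp (is_derive_expR _) d1)))).
  by rewrite -RCD; congr (_%:C); rewrite /GRing.scale/=; ring.
- exists (fun s => (c * s ^+ k.+1 * expR (- s))%:C); first exact: pexp1.
  by move=> s s0; rewrite -RCM; congr (_%:C); rewrite exprS; ring.
Qed.

Lemma cont_glue (f : R -> R) (C : R) : (forall s, 0 < s -> derivable f s 1) -> (forall s, `|f s| <= C * pos s) -> continuous f.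
Proof.
move=> df fC s; have [s0|s0] := ltP 0 s.
  by apply: differentiable_continuous; apply/derivable1_diffP; exact: df.
have C0 : 0 <= C by have := fC 1; rewrite pos_id// mulr1; apply: le_trans; exact: normr_ge0.
have fs : f s = 0 by apply/eqP; rewrite -normr_le0; apply: le_trans (fC s) _; rewrite pos_neg// mulr0.
apply/cvgrPdist_le => e e0; rewrite fs; near=> t; rewrite sub0r normrN.
apply: le_trans (fC t) _.
have tn : `|s - t| <= e / (C + 1).
  near: t; apply/nbhs_ballP; exists (e / (C + 1)); first by rewrite /= divr_gt0// ltr_wpDl.
  by move=> t /= /ltW.
have p1 : pos t <= `|s - t|.
  rewrite /pos ge_max normr_ge0 andbT distrC; apply: le_trans (ler_norm _); lra.
apply: (@le_trans _ _ ((C + 1) * (e / (C + 1)))); last by rewrite mulrC divfK// gt_eqF// ltr_wpDl.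
apply: ler_pM; rewrite ?pos_ge0 ?lerDl//; exact: le_trans p1 tn.
Unshelve. all: by end_near.
Qed.

(** These are the coefficients of [- Lap w] as well; unlike [S w] they vanish at
    [s = 0]. *)
Definition chi w : R -> R[i] := S (Ds w).

Lemma chiE w s : schwartz w -> chi w s = (pos s)%:C * S w s.
Proof. exact: S_Ds. Qed.
Lemma chi_Lap w s : schwartz w -> S (fun p => - Lap w p) s = chi w s.
Proof. by move=> sw; rewrite S_Lap// chiE. Qed.

Lemma chi_prof w : schwartz w -> prof (chi w).
Proof.
move=> sw; have sD := schwartz_Ds sw; have sD3 := schwartz_Ds (schwartz_Ds sD).
have bd phi : schwartz phi -> exists2 C, 0 <= C & forall s, `N (S phi s) <= C.
  move=> sp; exists (Rintegral (leb3 R) setT (fun p : hmeas R => `N (phi p))).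
    by apply: Rint_ge0 => p; exact: normc_ge0.
  by move=> s; apply: S_bound; exact: schwartz_int.
have [C C0 hC] := bd _ sw; have [D D0 hD] := bd _ sD; have [E E0 hE] := bd _ sD3.
have lin s : `N (chi w s) <= C * pos s.
  by rewrite chiE// normcM normcR ger0_norm ?pos_ge0// mulrC ler_wpM2r ?pos_ge0.
split.
- split; apply: (@cont_glue _ C).
  + by move=> s s0; have [[]] := hasder_S sD s0.
  + by move=> s; apply: le_trans (normc_Re _) (lin s).
  + by move=> s s0; have [_ []] := hasder_S sD s0.
  + by move=> s; apply: le_trans (normc_Im _) (lin s).
- by move=> s s0; rewrite chiE// pos_neg// mul0r.
- exists (D + E); first exact: addr_ge0.
  move=> s; have [s0|s0] := leP s 0.
    by rewrite chiE// pos_neg// mul0r Normc.normc0 mulr_ge0 ?w1_ge0 ?addr_ge0.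
  rewrite /w1 ler_pdivlMr; last by rewrite ltr_wpDr ?sqr_ge0.
  rewrite mulrDr mulr1; apply: lerD; first exact: hD.
  have := hE s; rewrite S_Ds; last exact: schwartz_Ds.
  rewrite S_Ds// -/(chi w) mulrA -RCM pos_id ?(ltW s0)// normcM normcR -expr2 ger0_norm ?sqr_ge0//.
  by rewrite mulrC.
Qed.

(** By [S_J], the factor [pi ^- 2] makes [J (cutoff w e)] the projection of [w],
    up to the cut-off. *)
Definition cutoff w (e : R) : R -> R[i] := fun s => (pi ^- 2 * eta e 0 s)%:C * chi w s.

Lemma eta_le1 (e s : R) : 0 < e -> eta e 0 s <= 1.
Proof.
move=> e0; rewrite /eta expr0 mulr1; case: ifP => // s0.
by rewrite -expR0 ler_expR oppr_le0 divr_ge0// ltW.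
Qed.
Lemma eta_mono (e e' s : R) : 0 < e' -> e' <= e -> eta e 0 s <= eta e' 0 s.
Proof.
move=> e0 ee; rewrite /eta !expr0 !mulr1; case: ifP => // s0.
by rewrite ler_expR lerN2 ler_pM2r// invr_gt0.
Qed.
Lemma cvg_eta (s : R) : 0 < s -> eta n.+1%:R^-1 0 s @[n --> \oo] --> (1 : R).
Proof.
move=> s0; rewrite /eta s0.
have h : - (n.+1%:R^-1 / s) @[n --> \oo] --> (0 : R).
  rewrite -oppr0; apply: cvgN; rewrite -[X in _ --> X](mul0r (s^-1)).
  by apply: cvgM; [exact: cvg_inv0|exact: cvg_cst].
under eq_fun do rewrite expr0 mulr1.
have := cvg_comp _ _ h (@continuous_expR R 0); rewrite expR0; exact.
Qed.
Lemma meas_eta (e : R) : 0 < e -> measurable_fun setT (eta e 0 : R1 -> R).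
Proof.
move=> e0; have F : flat (fun s : R => (1 * eta e 1 s)%:C * (1 * s ^+ 0 * expR (- s))%:C).
  by apply: (efl_flat e0 tame_exp); apply: efl1; exact: pexp1.
have [[c1 _] _ _] := flat_prof F.
have -> : eta e 0 = (fun s : R => (s * expR s) * Re ((1 * eta e 1 s)%:C * (1 * s ^+ 0 * expR (- s))%:C)).
  apply/funext => s; rewrite -RCM ReC etaS expr0 !mul1r expRN.
  have [s0|s0] := ltP 0 s; first by rewrite pos_id ?(ltW s0)//; field; rewrite gt_eqF// expR_gt0.
  by rewrite /eta ltNge s0/= !(mul0r, mulr0).
apply: measurable_funM; last exact: continuous_measurable_fun.
by apply: measurable_funM => //; exact: continuous_measurable_fun (@continuous_expR R).
Qed.

Lemma flat_cutoff w e : schwartz w -> 0 < e -> flat (cutoff w e).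
Proof.
move=> sw e0; apply: (efl_flat e0 tame_S); apply: efl1.
by exists (Ds w) => //; exact: schwartz_Ds.
Qed.

Lemma flatB F G : flat F -> flat G -> flat (fun s => F s - G s).
Proof.
move=> fF fG; exists (fun H => exists F1 F2, [/\ flat F1, flat F2 & H = (fun s => F1 s - F2 s)]).
  by exists F, G.
move=> _ [F1 [F2 [f1 f2 ->]]].
have [z1 [C1 h1] [A1 a1 b1] [D1 d1 g1] [E1 k1 l1]] := flat_cl f1.
have [z2 [C2 h2] [A2 a2 b2] [D2 d2 g2] [E2 k2 l2]] := flat_cl f2.
split.
- by move=> s s0; rewrite z1// z2// subr0.
- by exists (C1 + C2) => s; apply: le_trans (le_normcB _ _) _; exact: lerD.
- by exists (fun s => A1 s - A2 s); [exists A1, A2|move=> s; rewrite mulrBr b1 b2].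
- by exists (fun s => D1 s - D2 s); [exists D1, D2|move=> s; rewrite mulrBr -g1 -g2].
- by exists (fun s => E1 s - E2 s); [exists E1, E2|move=> s; exact: hasderD (l1 s) (hasderN (l2 s))].
Qed.

Lemma S_cutoff w e s : schwartz w -> 0 < e -> 0 < s -> S (J (cutoff w e)) s = (eta e 0 s)%:C * S w s.
Proof.
move=> sw e0 s0; have fc := flat_cutoff sw e0.
rewrite (S_J (flat_prof fc) (flat_J fc) s0) /cutoff chiE// pos_id ?(ltW s0)//.
have p0 : (pi : R) ^+ 2 != 0 by rewrite gt_eqF// exprn_gt0// pi_gt0.
rewrite !mulrA -!RCM; congr (_%:C * _); move: ((pi : R) ^+ 2) p0 (eta e 0 s) => P P0 x; field.
by rewrite P0 gt_eqF.
Qed.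

End FrequencySide.

(** * The energy inner product *)
Section EnergyForm.
Context {R : realType}.
Local Notation leb := (@lebesgue_measure R).
Local Notation cint3 := (cintegral (leb3 R)).
Local Notation cintble3 := (cintegrable (leb3 R)).
Local Notation R1 := (measurableTypeR R).
Local Notation leb2 := (prod_sf leb leb).
Local Notation leb3s := (prod_sf leb2 leb).
Implicit Types (u w v phi : hfun R) (psi F G : R -> R[i]).

Definition grad u v : hfun R := fun p =>
  (4^-1)%:C * (pd ex u p * (pd ex v p)^* + pd ey u p * (pd ey v p)^*) + (r2 p)%:C * (pd es u p * (pd es v p)^*).

Lemma pdJ (v : heis R) u p : schwartz u -> v \in dirs -> pd v (fun p => (u p)^*) p = (pd v u p)^*.
Proof. by move=> su vD; apply: hasder_pd; apply: hasderJ; exact: schwartz_hasder. Qed.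

Lemma schwartz_grad u v : schwartz u -> schwartz v -> schwartz (grad u v).
Proof.
move=> su sv; have h d : d \in dirs -> schwartz (fun p => pd d u p * (pd d v p)^*).
  by move=> dD; apply: schwartzMM; [exact: schwartz_pd|apply: schwartzJ; exact: schwartz_pd].
apply: schwartzD; first by apply: schwartzZ; apply: schwartzD; [exact: h (@exD R)|exact: h (@eyD R)].
by apply: (schwartzM mult_r2); exact: h (@esD R).
Qed.

(** The form is brought to the symmetric expression of the Dirichlet integral. *)
Lemma dotS_grad u v : schwartz u -> schwartz v -> dotS u v = Re (cint3 (grad u v)).
Proof.
move=> su sv; rewrite /dotS /rpair; congr Re.
have sJ := schwartzJ sv.
have sp d : d \in dirs -> schwartz (pd d (pd d u)) by move=> dD; do 2 apply: schwartz_pd => //.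
have IBP d : d \in dirs -> cint3 (fun p => pd d (pd d u) p * (v p)^*) = - cint3 (fun p => pd d u p * (pd d v p)^*).
  move=> dD; apply: (etrans (int_parts2 (schwartz_pd su dD) sJ dD)); apply: (congr1 (fun z : R[i] => - z)).
  by apply: (eq_cintegral (leb3 R)) => p; rewrite pdJ.
have sr : schwartz (fun p => (r2 p)%:C * (v p)^*) by exact: schwartzM mult_r2 _.
have dr (p : heis R) : hasder (fun p : heis R => (r2 p)%:C) p es 0.
  by apply/hasder_es; exact: (hasder_cst (r2 p)%:C p.2 1).
have IBPs : cint3 (fun p => pd es (pd es u) p * ((r2 p)%:C * (v p)^*)) = - cint3 (fun p => pd es u p * ((r2 p)%:C * (pd es v p)^*)).
  apply: (etrans (int_parts2 (schwartz_pd su (@esD R)) sr (@esD R))); apply: (congr1 (fun z : R[i] => - z)).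
  apply: (eq_cintegral (leb3 R)) => p; congr (_ * _).
  rewrite (hasder_pd (hasderM (dr p) (hasderJ (schwartz_hasder p sv (@esD R))))).
  by rewrite mul0r add0r.
have i1 d : d \in dirs -> cintble3 (fun p => pd d (pd d u) p * (v p)^*).
  by move=> dD; apply: schwartz_int; apply: schwartzMM => //; exact: sp.
have i2 : cintble3 (fun p => pd es (pd es u) p * ((r2 p)%:C * (v p)^*)).
  by apply: schwartz_int; apply: schwartzMM => //; exact: sp (@esD R).
have j1 d : d \in dirs -> cintble3 (fun p => pd d u p * (pd d v p)^*).
  by move=> dD; apply: schwartz_int; apply: schwartzMM; [exact: schwartz_pd|apply: schwartzJ; exact: schwartz_pd].
have j2 : cintble3 (fun p => pd es u p * ((r2 p)%:C * (pd es v p)^*)).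
  apply: schwartz_int; apply: schwartzMM; first exact: schwartz_pd su (@esD R).
  by apply: (schwartzM mult_r2); apply: schwartzJ; exact: schwartz_pd sv (@esD R).
have xD := @exD R; have yD := @eyD R.
pose Ix := cint3 (fun p => pd ex (pd ex u) p * (v p)^*).
pose Iy := cint3 (fun p => pd ey (pd ey u) p * (v p)^*).
pose Is := cint3 (fun p => pd es (pd es u) p * ((r2 p)%:C * (v p)^*)).
pose Jx := cint3 (fun p => pd ex u p * (pd ex v p)^*).
pose Jy := cint3 (fun p => pd ey u p * (pd ey v p)^*).
pose Js := cint3 (fun p => pd es u p * ((r2 p)%:C * (pd es v p)^*)).
transitivity (- (4^-1)%:C * (Ix + Iy) - Is).
  have iD := cintD (i1 _ xD) (i1 _ yD).
  have A := cintegralB (cintZ (- (4^-1)%:C) iD) i2.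
  have B := cintegralZ (- (4^-1)%:C) iD; have C := cintegralD (i1 _ xD) (i1 _ yD).
  have D : cint3 (fun p => - Lap u p * (v p)^*) = cint3 (fun p : hmeas R => - (4^-1)%:C * (pd ex (pd ex u) p * (v p)^* + pd ey (pd ey u) p * (v p)^*) - pd es (pd es u) p * ((r2 p)%:C * (v p)^*)).
    apply: (eq_cintegral (leb3 R)) => p; rewrite /Lap -/(r2 p).
    by move: (pd ex (pd ex u) p) (pd ey (pd ey u) p) (pd es (pd es u) p) (v p)^* (r2 p)%:C (4^-1)%:C => *; ring.
  apply: (etrans D); apply: (etrans A); apply: (congr1 (fun z => z - Is)).
  by apply: (etrans B); apply: (congr1 (fun z => - (4^-1)%:C * z)); exact: C.
transitivity ((4^-1)%:C * (Jx + Jy) + Js).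
  have Ex : Ix = - Jx := IBP _ xD; have Ey : Iy = - Jy := IBP _ yD; have Es : Is = - Js := IBPs.
  rewrite Ex Ey Es; move: (4^-1)%:C Jx Jy Js {Ex Ey Es} => *; ring.
have jD := cintD (j1 _ xD) (j1 _ yD).
have A := cintegralD (cintZ (4^-1)%:C jD) j2.
have B := cintegralZ (4^-1)%:C jD; have C := cintegralD (j1 _ xD) (j1 _ yD).
transitivity ((4^-1)%:C * cint3 (fun p : hmeas R => pd ex u p * (pd ex v p)^* + pd ey u p * (pd ey v p)^*) + Js).
  by apply: (congr1 (fun z => (4^-1)%:C * z + Js)); apply: esym; exact: C.
transitivity (cint3 (fun p : hmeas R => (4^-1)%:C * (pd ex u p * (pd ex v p)^* + pd ey u p * (pd ey v p)^*)) + Js).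
  by apply: (congr1 (fun z => z + Js)); apply: esym; exact: B.
apply: (etrans (esym A)).
by apply: (eq_cintegral (leb3 R)) => p; rewrite /grad; congr (_ + _); rewrite mulrCA.
Qed.

Lemma dotSC u v : schwartz u -> schwartz v -> dotS u v = dotS v u.
Proof.
move=> su sv; apply: (etrans (dotS_grad su sv)); apply: esym; apply: (etrans (dotS_grad sv su)).
apply: (etrans (esym (ReJ _))); congr Re.
apply: (etrans (esym (cintegralJ (schwartz_int (schwartz_grad sv su))))).
apply: (eq_cintegral (leb3 R)) => p; rewrite /grad.
move: (pd ex u p) (pd ey u p) (pd es u p) (pd ex v p) (pd ey v p) (pd es v p) => a b c d e f.
rewrite !(cJD, cJM, cJR, conjcK); move: a b c d^* e^* f^* (4^-1)%:C (r2 p)%:C => *; ring.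
Qed.

Lemma dotS_ge0 u : schwartz u -> 0 <= dotS u u.
Proof.
move=> su; apply: (@le_trans _ _ (Re (cint3 (grad u u)))); last first.
  by apply: le_of_eq; apply: esym; exact: dotS_grad.
apply: (@Rint_ge0 _ _ _ leb3s) => p; rewrite /grad.
move: (pd ex u p) (pd ey u p) (pd es u p) => a b c.
rewrite !mulcJ -!RCD -!RCM -RCD ReC.
by rewrite addr_ge0// mulr_ge0 ?r2_ge0 ?sqr_ge0// ?addr_ge0 ?sqr_ge0.
Qed.

Lemma LapB u v p : schwartz u -> schwartz v -> Lap (fun p => u p - v p) p = Lap u p - Lap v p.
Proof.
move=> su sv; have h d : d \in dirs -> pd d (pd d (fun p => u p - v p)) p = pd d (pd d u) p - pd d (pd d v) p.
  move=> dD; have -> : pd d (fun p => u p - v p) = (fun p => pd d u p - pd d v p).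
    by apply/funext => q; apply: hasder_pd; apply: hasderD; [|apply: hasderN]; exact: schwartz_hasder.
  apply: hasder_pd; apply: hasderD; [|apply: hasderN]; apply: schwartz_hasder => //; exact: schwartz_pd.
rewrite /Lap !h; [|exact: esD|exact: eyD|exact: exD].
move: (pd ex (pd ex u) p) (pd ey (pd ey u) p) (pd es (pd es u) p) (pd ex (pd ex v) p) (pd ey (pd ey v) p) (pd es (pd es v) p) (4^-1)%:C ((p.1.1 ^+ 2 + p.1.2 ^+ 2)%:C) => *; ring.
Qed.

Lemma rpairBl u v w : cintble3 (fun p => u p * (w p)^*) -> cintble3 (fun p => v p * (w p)^*) ->
  rpair (fun p => u p - v p) w = rpair u w - rpair v w.
Proof.
move=> i1 i2; rewrite /rpair -ReN -ReD -(cintegralB i1 i2); congr Re.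
by apply: (eq_cintegral (leb3 R)) => p; rewrite mulrBl.
Qed.

Lemma schwartz_LapN u : schwartz u -> schwartz (fun p => - Lap u p).
Proof. by move=> su; apply: schwartzN; exact: schwartz_Lap. Qed.

Lemma dotSBl u v w : schwartz u -> schwartz v -> schwartz w ->
  dotS (fun p => u p - v p) w = dotS u w - dotS v w.
Proof.
move=> su sv sw; have h x : schwartz x -> cintble3 (fun p => - Lap x p * (w p)^*).
  by move=> sx; apply: schwartz_int; apply: schwartzMM; [exact: schwartz_LapN|exact: schwartzJ].
rewrite /dotS -(rpairBl (h _ su) (h _ sv)) /rpair; congr Re.
by apply: (eq_cintegral (leb3 R)) => p; rewrite LapB// opprB opprK addrC.
Qed.
Lemma dotSBr u v w : schwartz u -> schwartz v -> schwartz w ->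
  dotS w (fun p => u p - v p) = dotS w u - dotS w v.
Proof.
move=> su sv sw; apply: (etrans (dotSC sw (schwartzB su sv))).
apply: (etrans (dotSBl su sv sw)).
by congr (_ - _); [exact: dotSC su sw|exact: dotSC sv sw].
Qed.

Lemma dotSZ (c : R) u v : schwartz u -> schwartz v -> dotS (fun p => c%:C * u p) v = c * dotS u v.
Proof.
move=> su sv.
have i1 : cintble3 (fun p => - Lap u p * (v p)^*).
  by apply: schwartz_int; apply: schwartzMM; [exact: schwartz_LapN|exact: schwartzJ].
rewrite /dotS /rpair.
have -> : c * Re (cint3 (fun p => - Lap u p * (v p)^*)) = Re (c%:C * cint3 (fun p => - Lap u p * (v p)^*)).
  by rewrite ReM ReC ImC mul0r subr0.
rewrite -(cintegralZ _ i1); congr Re; apply: (eq_cintegral (leb3 R)) => p.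
have h d : d \in dirs -> pd d (pd d (fun p => c%:C * u p)) p = c%:C * pd d (pd d u) p.
  move=> dD; have -> : pd d (fun p => c%:C * u p) = (fun p => c%:C * pd d u p).
    by apply/funext => q; exact: pdZ.
  by apply: pdZ => //; exact: schwartz_pd.
rewrite /Lap !h; [|exact: esD|exact: eyD|exact: exD].
move: (pd ex (pd ex u) p) (pd ey (pd ey u) p) (pd es (pd es u) p) (4^-1)%:C c%:C (v p)^* ((p.1.1 ^+ 2 + p.1.2 ^+ 2)%:C) => *; ring.
Qed.

Lemma dotS_J w psi : schwartz w -> prof psi ->
  dotS w (J psi) = Re (cintegral leb (fun s : R1 => (psi s)^* * chi w s)).
Proof.
move=> sw pp; rewrite /dotS /rpair; congr Re.
have [_ ->] := JS_fubini (schwartz_int (schwartz_LapN sw)) (prof_int pp).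
by apply: eq_cintegral => s; rewrite chi_Lap.
Qed.

End EnergyForm.

(** Sealing the form keeps its integral from being unfolded. *)
HB.lock Definition en (R : realType) (u v : hfun R) : R := dotS u v.

Section EnergyInnerProduct.
Context {R : realType}.
Implicit Types (u w v phi : hfun R).
Lemma enE u v : en u v = dotS u v. Proof. by rewrite en.unlock. Qed.
Lemma enC u v : schwartz u -> schwartz v -> en u v = en v u.
Proof. by rewrite en.unlock; exact: dotSC. Qed.
Lemma en_ge0 u : schwartz u -> 0 <= en u u.
Proof. by rewrite en.unlock; exact: dotS_ge0. Qed.
Lemma enBl u v w : schwartz u -> schwartz v -> schwartz w ->
  en (fun p => u p - v p) w = en u w - en v w.
Proof. by rewrite en.unlock; exact: dotSBl. Qed.
Lemma enBr u v w : schwartz u -> schwartz v -> schwartz w ->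
  en w (fun p => u p - v p) = en w u - en w v.
Proof. by rewrite en.unlock; exact: dotSBr. Qed.
Lemma enZ (c : R) u v : schwartz u -> schwartz v -> en (fun p => c%:C * u p) v = c * en u v.
Proof. by rewrite en.unlock; exact: dotSZ. Qed.
Lemma en_sqB u v : schwartz u -> schwartz v ->
  en (fun p => u p - v p) (fun p => u p - v p) = en u u - 2 * en u v + en v v.
Proof.
move=> su sv; have sB := schwartzB su sv.
by rewrite enBl// !enBr// (enC sv su); ring.
Qed.
Lemma en_CS u v : schwartz u -> schwartz v -> en u v ^+ 2 <= en u u * en v v.
Proof.
move=> su sv; set a := en u u; set b := en u v; set c := en v v.
have key (t : R) : 0 <= a - 2 * (t * b) + t ^+ 2 * c.
  have st : schwartz (fun p => t%:C * v p) by exact: schwartzZ.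
  have := en_ge0 (schwartzB su st); rewrite en_sqB//.
  have -> : en u (fun p => t%:C * v p) = t * b by rewrite enC// enZ// (enC sv su).
  have -> : en (fun p => t%:C * v p) (fun p => t%:C * v p) = t ^+ 2 * c.
    by rewrite enZ// enC// enZ// mulrA -expr2.
  by [].
have a0 : 0 <= a := en_ge0 su; have c0 : 0 <= c := en_ge0 sv.
have [cz|cp] := eqVneq c 0.
  rewrite cz mulr0; have [->|bn] := eqVneq b 0; first by rewrite expr0n.
  have := key ((a + 1) / (2 * b)); rewrite cz mulr0 addr0.
  have -> : 2 * ((a + 1) / (2 * b) * b) = a + 1 by field.
  by move: a0; clear; move: a => a; lra.
have c1 : 0 < c by rewrite lt_def cp.
have := key (b / c).
have -> : a - 2 * (b / c * b) + (b / c) ^+ 2 * c = (a * c - b ^+ 2) / c by field.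
by rewrite pmulr_lge0 ?invr_gt0// subr_ge0.
Qed.
Lemma en_J w psi : schwartz w -> prof psi ->
  en w (J psi) = Re (cintegral (@lebesgue_measure R) (fun s : measurableTypeR R => (psi s)^* * chi w s)).
Proof. by rewrite en.unlock; exact: dotS_J. Qed.
End EnergyInnerProduct.

Lemma eq_intble (R : realType) d (T : measurableType d) (mu : {measure set T -> \bar R}) (f g : T -> R) :
  f =1 g -> intble mu f -> intble mu g.
Proof. by move=> /funext ->. Qed.
Lemma cvg_eq (R : realType) (u_ v_ : nat -> R) (l : R) : u_ =1 v_ -> v_ @ \oo --> l -> u_ @ \oo --> l.
Proof. by move=> /funext ->. Qed.
Lemma sqNN (R : realType) (a : R) (z w : R[i]) : 0 <= a ^+ 2 * (`N z * `N w).
Proof. by apply: mulr_ge0; [exact: sqr_ge0|apply: mulr_ge0; exact: normc_ge0]. Qed.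

Lemma ccvg0D (R : realType) (A B : nat -> R[i]) : ccvg A 0 -> ccvg B 0 -> ccvg (fun n => A n + B n) 0.
Proof.
move=> a b; apply: (@cvg_le0 _ _ (fun n => `N (A n - 0) + `N (B n - 0))).
  by move=> n; rewrite normc_ge0 !subr0 le_normcD.
by rewrite -[X in _ --> X](addr0 (0 : R)); exact: cvgD.
Qed.

Lemma ae_eq_imp (R : realType) d (T : measurableType d) (mu : {measure set T -> \bar R}) (V : Type) (u v : T -> V) (F G : T -> \bar R) :
  (\forall p \ae mu, u p = v p) -> (forall p, u p = v p -> F p = G p) -> ae_eq mu setT F G.
Proof. by move=> uv FG; move: uv; apply: filterS => p e _; exact: FG. Qed.

(** * Convergence in Lebesgue spaces *)
Section Lebesgue.
Context {R : realType}.
Local Notation leb := (@lebesgue_measure R).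
Local Notation Rint3 := (Rintegral (leb3 R) setT).
Local Notation intble3 F := (intble (leb3 R) F).
Local Notation leb3s := (prod_sf (prod_sf leb leb) leb).
Implicit Types u v : hfun R.

Lemma Lp_pow n u : (0 < n)%N ->
  (Lpnorm n%:R u `^ n%:R)%E = (\int[leb3 R]_p ((`N (u p)) ^+ n)%:E)%E.
Proof.
move=> n0; rewrite /Lpnorm powR_Lnorm ?pnatr_eq0 -?lt0n//.
apply: eq_integral => p _; rewrite /= ger0_norm ?normc_ge0//.
by rewrite powR_mulrn ?normc_ge0.
Qed.

Lemma Npow_meas n u : cmeasurable (u : hmeas R -> R[i]) -> measurable_fun setT (fun p : hmeas R => `N (u p) ^+ n).
Proof. by move=> mu_; apply: measurable_funX; exact: measurable_normc. Qed.

Lemma Npow_abs n u : (\int[leb3 R]_p (`|(`N (u p)) ^+ n|)%:E)%E = (\int[leb3 R]_p ((`N (u p)) ^+ n)%:E)%E.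
Proof. by apply: eq_integral => p _; rewrite ger0_norm// exprn_ge0// normc_ge0. Qed.

Lemma Lp_intble n u : (0 < n)%N -> cmeasurable (u : hmeas R -> R[i]) ->
  (Lpnorm n%:R u < +oo)%E -> intble3 (fun p : hmeas R => `N (u p) ^+ n).
Proof.
move=> n0 mu_ Lu; apply/integrableP; split; first by apply/measurable_EFinP; exact: Npow_meas.
by rewrite Npow_abs -Lp_pow//; exact: poweR_lty.
Qed.

Lemma Lp_val n u : (0 < n)%N -> intble3 (fun p : hmeas R => `N (u p) ^+ n) ->
  exists x : R, [/\ 0 <= x, Lpnorm n%:R u = x%:E & x ^+ n = Rint3 (fun p : hmeas R => `N (u p) ^+ n)].
Proof.
move=> n0 iu.
have L0 : (0 <= Lpnorm n%:R u)%E by exact: Lnorm_ge0.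
have fin : (\int[leb3 R]_p ((`N (u p)) ^+ n)%:E < +oo)%E.
  by rewrite -Npow_abs; have /integrableP[] := iu.
have Lfin : (Lpnorm n%:R u < +oo)%E.
  by apply: (@lty_poweRy _ _ n%:R); [rewrite pnatr_eq0 -lt0n|rewrite Lp_pow].
have Lf : (Lpnorm n%:R u)%E \is a fin_num by rewrite ge0_fin_numE.
exists (fine (Lpnorm n%:R u)); split.
- exact: fine_ge0.
- by rewrite fineK.
- rewrite /Rintegral -Lp_pow// -{2}(fineK Lf) poweR_EFin /= powR_mulrn//; exact: fine_ge0.
Qed.

Lemma inL2P u : inL2 u <-> cmeasurable (u : hmeas R -> R[i]) /\ intble3 (fun p : hmeas R => `N (u p) ^+ 2).
Proof.
split => -[mu_ h]; split => //; first exact: (Lp_intble (n := 2)).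
by have [x [_ -> _]] := Lp_val (n := 2) isT h; exact: ltry.
Qed.

Lemma L4_cvg (d : nat -> hfun R) : (forall n, cmeasurable (d n : hmeas R -> R[i])) ->
  (fun n => Lpnorm 4 (d n)) @ \oo --> (0%E : \bar R) ->
  forall e : R, 0 < e -> exists N, forall n, (N <= n)%N ->
   intble3 (fun p : hmeas R => `N (d n p) ^+ 4) /\
   Rint3 (fun p : hmeas R => `N (d n p) ^+ 4) <= e.
Proof.
move=> md Ld e e0.
pose k := Num.min e 1; have k0 : 0 < k by rewrite lt_min e0 ltr01.
have h : nbhs (0%E : \bar R) [set x | (x < k%:E)%E].
  by apply: open_nbhs_nbhs; split => //=; exact: open_ereal_lt_ereal.
have [N _ HN] := Ld _ h; exists N => n Nn; have Lk : (Lpnorm 4 (d n) < k%:E)%E := HN n Nn.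
have iu : intble3 (fun p : hmeas R => `N (d n p) ^+ 4).
  by apply: (Lp_intble (n := 4)) => //; apply: lt_trans Lk _; exact: ltry.
split => //; have [x [x0 Lx <-]] := Lp_val (n := 4) isT iu.
have {}Lk : x < k by move: Lk; rewrite [X in (X < _)%E]Lx lte_fin.
have k1 : k <= 1 by rewrite ge_min lexx orbT.
have ke : k <= e by rewrite ge_min lexx.
apply: le_trans ke; apply: le_trans (ltW Lk).
by rewrite exprS ler_piMr// exprn_ile1// ltW// (lt_le_trans Lk).
Qed.

Lemma L4_cvgI (d : nat -> hfun R) : (forall n, intble3 (fun p : hmeas R => `N (d n p) ^+ 4)) ->
  (fun n => Rint3 (fun p : hmeas R => `N (d n p) ^+ 4)) @ \oo --> (0 : R) ->
  (fun n => Lpnorm 4 (d n)) @ \oo --> (0%E : \bar R).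
Proof.
move=> id Id.
have E n : Lpnorm 4 (d n) = (fine (Lpnorm 4 (d n)))%:E.
  by have [x [x0 -> _]] := Lp_val (n := 4) isT (id n).
under eq_fun do rewrite E.
apply: cvg_EFin; first by near=> n.
apply/cvgr0Pnorm_le => e e0.
have e4 : 0 < e ^+ 4 by rewrite exprn_gt0.
have /cvgr0Pnorm_le/(_ _ e4) := Id.
apply: filterS => n /=; have [x [x0 Lx <-]] := Lp_val (n := 4) isT (id n).
rewrite [Lpnorm 4 _]Lx /= !ger0_norm ?exprn_ge0//.
by rewrite ler_pXn2r// nnegrE ltW.
Unshelve. all: by end_near.
Qed.

Lemma cvg_ub (u_ : nat -> R) (l M : R) : u_ @ \oo --> l -> (forall n, u_ n <= M) -> l <= M.
Proof.
move=> ul uM; rewrite -(cvg_lim _ ul)//; apply: limr_le; first by apply/cvg_ex; exists l.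
by near=> n; exact: uM.
Unshelve. all: by end_near.
Qed.

Lemma ccvg_normc2 (z_ : nat -> R[i]) (a z : R[i]) : ccvg z_ z -> `N (a - z_ n) ^+ 2 @[n --> \oo] --> `N (a - z) ^+ 2.
Proof.
move=> /ccvgP[h1 h2]; rewrite normcE2 !cE; under eq_fun do rewrite normcE2 !cE.
by apply: cvgD; rewrite expr2; under eq_fun do rewrite expr2; apply: cvgM; apply: cvgB => //; exact: cvg_cst.
Qed.

(** Used to replace a projection, which is defined up to a null set, by an
    explicit representative. *)
Lemma cintegral_L2eq (f u v : hfun R) : cmeasurable (f : hmeas R -> R[i]) ->
  cmeasurable (u : hmeas R -> R[i]) -> cmeasurable (v : hmeas R -> R[i]) ->
  Rint3 (fun p : hmeas R => `N (u p - v p) ^+ 2) = 0 ->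
  intble3 (fun p : hmeas R => `N (u p - v p) ^+ 2) ->
  cintegral (leb3 R) (fun p => f p * (u p)^*) = cintegral (leb3 R) (fun p => f p * (v p)^*).
Proof.
move=> mf mu_ mv z iz.
have md := cmeasurableB mu_ mv.
have z2 : (\int[leb3s]_p (`|(`N (u p - v p) ^+ 2)%:E|) = 0)%E.
  have : (\int[leb3s]_p (`N (u p - v p) ^+ 2)%:E \is a fin_num)%E by exact: integrable_fin_num iz.
  move=> /fineK h; transitivity (\int[leb3s]_p (`N (u p - v p) ^+ 2)%:E)%E.
    by apply: eq_integral => p _; rewrite gee0_abs// lee_fin sqr_ge0.
  by rewrite -h; apply: (congr1 EFin); exact: z.
have mz : measurable_fun setT (fun p : hmeas R => (`N (u p - v p) ^+ 2)%:E).
  by apply/measurable_EFinP; exact: normc2_meas.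
have /(_ z2) ae := (@ae_eq_integral_abs _ _ _ leb3s setT measurableT _ mz).1.
have uv : \forall p \ae leb3s, u p = v p.
  move: ae; apply: filterS => p /(_ I) /= [] /eqP; rewrite sqrf_eq0 => /eqP.
  by move=> /eqP; rewrite normc_eq0 subr_eq0 => /eqP.
have m1 := cmeasurableM mf (cmeasurableJ mu_); have m2 := cmeasurableM mf (cmeasurableJ mv).
rewrite /cintegral /Rintegral; congr (fine _ +i* fine _); apply: (@ae_eq_integral _ _ _ leb3s) => //.
- by apply/measurable_EFinP; exact: m1.1.
- by apply/measurable_EFinP; exact: m2.1.
- by apply: (ae_eq_imp uv) => p e; rewrite e.
- by apply/measurable_EFinP; exact: m1.2.
- by apply/measurable_EFinP; exact: m2.2.
- by apply: (ae_eq_imp uv) => p e; rewrite e.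
Qed.

End Lebesgue.

(** * The orthogonal projection onto V0plus *)
Section Projection.
Context {R : realType}.
Local Notation leb := (@lebesgue_measure R).
Local Notation Rint := (Rintegral leb setT).
Local Notation Rint3 := (Rintegral (leb3 R) setT).
Local Notation cint := (cintegral leb).
Local Notation cint3 := (cintegral (leb3 R)).
Local Notation cintble3 := (cintegrable (leb3 R)).
Local Notation intble3 F := (intble (leb3 R) F).
Local Notation R1 := (measurableTypeR R).
Local Notation leb2 := (prod_sf leb leb).
Local Notation leb3s := (prod_sf leb2 leb).
Implicit Types (u w v phi : hfun R) (psi F G : R -> R[i]).

Lemma prof_Z c psi : prof psi -> prof (fun s => c * psi s).
Proof.
move=> [cp z [C C0 pC]]; split.
- by apply: ccontM => //; exact: ccont_cst.
- by move=> s s0; rewrite z// mulr0.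
- exists (`N c * C); first by rewrite mulr_ge0// normc_ge0.
  by move=> s; rewrite normcM -mulrA ler_wpM2l// normc_ge0.
Qed.

Lemma prof_sq psi : prof psi -> intble leb (fun s => `N (psi s) ^+ 2).
Proof.
move=> pp; have mp := cint_meas (prof_int pp); case: pp => cp z [C C0 pC].
apply: (@intble_le R _ R1 leb _ (fun s => C ^+ 2 * w1 s)).
- exact: normc2_meas mp.
- move=> s; rewrite ger0_norm ?sqr_ge0//.
  apply: (@le_trans _ _ ((C * w1 s) ^+ 2)).
    by rewrite lerXn2r ?nnegrE ?normc_ge0// mulr_ge0// w1_ge0.
  by rewrite exprMn ler_wpM2l ?sqr_ge0// expr2 ler_piMr ?w1_ge0 ?w1_le1.
- by apply: intbleZ; exact: intble_w1.
Qed.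

Lemma chiS_int w : schwartz w -> intble leb (fun s => `N (chi w s) * `N (S w s)).
Proof.
move=> sw; have := cint_normc (int_psiS (schwartz_int sw) (prof_int (chi_prof sw))).
apply: eq_intble => s.
by rewrite normcM normcJ.
Qed.

Lemma ipi0 : 0 <= pi ^- 2 :> R.
Proof. by rewrite invr_ge0 sqr_ge0. Qed.

Lemma etaN_ge0 (e s : R) (z : R[i]) : 0 <= pi ^- 2 * eta e 0 s * `N z ^+ 2.
Proof. by rewrite mulr_ge0 ?sqr_ge0// mulr_ge0 ?ipi0 ?eta_ge0. Qed.

Lemma meas_eta_sq w e : schwartz w -> 0 < e -> measurable_fun setT (fun s : R1 => pi ^- 2 * eta e 0 s * `N (chi w s) ^+ 2).
Proof.
move=> sw e0; apply: measurable_funM; last exact: normc2_meas (cint_meas (prof_int (chi_prof sw))).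
by apply: measurable_funM => //; exact: meas_eta.
Qed.

(** Expand the energy of [w - J (cutoff w e)], which is nonnegative, and let [e]
    tend to 0: this is Bessel's inequality for the Hardy part of [w]. *)
Lemma chi_energy w : schwartz w -> pi ^- 2 * Rint (fun s => `N (chi w s) ^+ 2) <= en w w.
Proof.
move=> sw; have pc := chi_prof sw; have mc := cint_meas (prof_int pc).
have iq := prof_sq pc.
pose e_ (n : nat) : R := n.+1%:R^-1.
have e0 n : 0 < e_ n := @invn_gt0 R n.
have [_] : intble leb (fun s => pi ^- 2 * `N (chi w s) ^+ 2) /\
   Rint (fun s => pi ^- 2 * eta (e_ n) 0 s * `N (chi w s) ^+ 2) @[n --> \oo] --> Rint (fun s => pi ^- 2 * `N (chi w s) ^+ 2).
  apply: (@Rint_dct R _ R1 leb (fun n s => pi ^- 2 * eta (e_ n) 0 s * `N (chi w s) ^+ 2) _ (fun s => pi ^- 2 * `N (chi w s) ^+ 2)).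
  - by move=> n; exact: meas_eta_sq.
  - by apply: measurable_funM => //; exact: normc2_meas mc.
  - move=> s; have [s0|s0] := ltP 0 s; last first.
      by case: pc => _ -> // _; rewrite Normc.normc0 expr0n/= mulr0; under eq_fun do rewrite mulr0; exact: cvg_cst.
    rewrite -[X in X * `N _ ^+ 2]mulr1; apply: cvgM; last exact: cvg_cst.
    by apply: cvgM; [exact: cvg_cst|exact: cvg_eta].
  - exact: intbleZ.
  - move=> n s; rewrite (ger0_norm (etaN_ge0 _ _ _)).
    by rewrite ler_wpM2r ?sqr_ge0// ler_piMr ?ipi0 ?eta_le1.
rewrite (RintZ (pi ^- 2) iq) => lim; apply: (cvg_ub lim) => n.
set e := e_ n; have ee : 0 < e := e0 n.
have fc := flat_cutoff sw ee; have sJ := flat_J fc; have pcut := flat_prof fc.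
set a := Rintegral _ _ _.
have E1 : en w (J (cutoff w e)) = a.
  rewrite en_J// (_ : (fun s : R1 => _) = (fun s : R1 => (pi ^- 2 * eta e 0 s * `N (chi w s) ^+ 2)%:C)); last first.
    by apply/funext => s; rewrite /cutoff (cJM _%:C (chi w s)) cJR -mulrA [(chi w s)^* * _]mulrC mulcJ -RCM.
  by rewrite cintegralC ReC.
have E2 : en (J (cutoff w e)) (J (cutoff w e)) = Rint (fun s => eta e 0 s * (pi ^- 2 * eta e 0 s * `N (chi w s) ^+ 2)).
  rewrite en_J// (_ : (fun s : R1 => _) = (fun s : R1 => (eta e 0 s * (pi ^- 2 * eta e 0 s * `N (chi w s) ^+ 2))%:C)); last first.
    apply/funext => s; have -> : chi (J (cutoff w e)) s = (eta e 0 s)%:C * chi w s.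
      rewrite !chiE//; have [s0|s0] := ltP 0 s; first by rewrite S_cutoff// mulrCA.
      by rewrite pos_neg// !mul0r mulr0.
    rewrite /cutoff (cJM _%:C (chi w s)) cJR.
    transitivity ((eta e 0 s)%:C * ((pi ^- 2 * eta e 0 s)%:C * (chi w s * (chi w s)^*))).
      by move: (chi w s) (chi w s)^* (eta e 0 s)%:C (pi ^- 2 * eta e 0 s)%:C => *; ring.
    by rewrite mulcJ -!RCM.
  by rewrite cintegralC ReC.
have ia : intble leb (fun s => pi ^- 2 * eta e 0 s * `N (chi w s) ^+ 2).
  apply: (@intble_le R _ R1 leb _ (fun s => pi ^- 2 * `N (chi w s) ^+ 2)); last exact: intbleZ.
    exact: meas_eta_sq.
  move=> s; rewrite (ger0_norm (etaN_ge0 _ _ _)).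
  by rewrite ler_wpM2r ?sqr_ge0// ler_piMr ?ipi0 ?eta_le1.
have x0 s : 0 <= pi ^- 2 * eta e 0 s * `N (chi w s) ^+ 2 := etaN_ge0 e s _.
have ib : intble leb (fun s => eta e 0 s * (pi ^- 2 * eta e 0 s * `N (chi w s) ^+ 2)).
  apply: (@intble_le R _ R1 leb _ _ _ _ ia).
    by apply: measurable_funM; [exact: meas_eta|exact: meas_eta_sq].
  by move=> s; rewrite (ger0_norm (mulr_ge0 (eta_ge0 _ _ _) (x0 s))) ler_piMl// eta_le1.
have E3 : Rint (fun s => eta e 0 s * (pi ^- 2 * eta e 0 s * `N (chi w s) ^+ 2)) <= a.
  by apply: (Rint_le ib ia) => s; rewrite ler_piMl// eta_le1.
have := en_ge0 (schwartzB sw sJ); rewrite en_sqB// E1 E2; move: E3; set b := Rintegral _ _ _; lra.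
Qed.

(** The profile of the projection of [w] onto [V0plus]. *)
Definition bar w : R -> R[i] := fun s => (pi ^- 2)%:C * chi w s.
Lemma bar_prof w : schwartz w -> prof (bar w).
Proof. by move=> sw; apply: prof_Z; exact: chi_prof. Qed.

Lemma cvg_eta_seq (e_ : nat -> R) s : (forall n, 0 < e_ n) -> e_ @ \oo --> (0 : R) -> 0 < s -> eta (e_ n) 0 s @[n --> \oo] --> (1 : R).
Proof.
move=> e0 el s0; rewrite /eta s0.
have h : - (e_ n / s) @[n --> \oo] --> (0 : R).
  rewrite -oppr0; apply: cvgN; rewrite -[X in _ --> X](mul0r (s^-1)).
  by apply: cvgM; [exact: el|exact: cvg_cst].
under eq_fun do rewrite expr0 mulr1.
have := cvg_comp _ _ h (@continuous_expR R 0); rewrite expR0; exact.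
Qed.

Lemma J_cvg w (e_ : nat -> R) p : schwartz w -> (forall n, 0 < e_ n) -> e_ @ \oo --> (0 : R) ->
  ccvg (fun n => J (cutoff w (e_ n)) p) (J (bar w) p).
Proof.
move=> sw e0 el; have pc := chi_prof sw; have ic := prof_int pc.
have [] := @cint_dct R _ R1 leb (fun n s => cutoff w (e_ n) s * wav s p) (fun s => bar w s * wav s p) (fun s => pi ^- 2 * `N (chi w s)) => //.
- by move=> n; have := int_J p (prof_int (flat_prof (flat_cutoff sw (e0 n)))) => /cint_meas.
- exact: cint_meas (int_J p (prof_int (bar_prof sw))).
- move=> s; have [s0|s0] := ltP 0 s; last first.
    rewrite /ccvg; have z : chi w s = 0 by case: pc => _ -> .
    apply: (@cvg_eq _ _ (fun=> 0)); last exact: cvg_cst.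
    by move=> n; rewrite /cutoff /bar z !mulr0 !mul0r subr0 Normc.normc0.
  have h := cvg_eta_seq e0 el s0.
  have E n : `N (cutoff w (e_ n) s * wav s p - bar w s * wav s p) = (1 - eta (e_ n) 0 s) * `N (bar w s * wav s p).
    have -> : cutoff w (e_ n) s * wav s p - bar w s * wav s p = - ((1 - eta (e_ n) 0 s)%:C * (bar w s * wav s p)).
      rewrite /cutoff /bar !RCM; have -> : (1 - eta (e_ n) 0 s)%:C = 1 - (eta (e_ n) 0 s)%:C :> R[i] by rewrite rmorphB rmorph1.
      move: (wav s p) (chi w s) (eta _ _ _)%:C (pi ^- 2)%:C => *; ring.
    by rewrite normcN normcM normcR ger0_norm// subr_ge0 eta_le1.
  apply: (cvg_eq E); rewrite -[X in _ --> X](mul0r (`N (bar w s * wav s p))); apply: cvgM; last exact: cvg_cst.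
  by rewrite -[X in _ --> X](subrr (1 : R)); apply: cvgB => //; exact: cvg_cst.
- by apply: intbleZ; exact: cint_normc.
- move=> n s; rewrite normcM; apply: (@le_trans _ _ (`N (cutoff w (e_ n) s))).
    by rewrite ler_piMr ?normc_ge0// wav_le1.
  rewrite /cutoff normcM normcR ger0_norm ?mulr_ge0 ?ipi0 ?eta_ge0//.
  by rewrite ler_wpM2r ?normc_ge0// ler_piMr ?ipi0 ?eta_le1.
Qed.

(** An upper bound for the error made by the cut-off, in [L^2]. *)
Definition tau w (e : R) : R := pi ^- 2 * Rint (fun s => (1 - eta e 0 s) ^+ 2 * (`N (chi w s) * `N (S w s))).

Lemma chiS_meas w : schwartz w -> measurable_fun setT (fun s : R1 => `N (chi w s) * `N (S w s)).
Proof. by move=> sw; exact: intble_meas1 (chiS_int sw). Qed.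

Lemma eta1_sq (e s : R) : 0 < e -> (1 - eta e 0 s) ^+ 2 <= 1.
Proof.
move=> e0; have h1 := eta_le1 s e0; have h2 := eta_ge0 e 0 s.
by rewrite expr2 mulr_ile1 ?subr_ge0// gerBl.
Qed.

Lemma tau_int w e : schwartz w -> 0 < e -> intble leb (fun s => (1 - eta e 0 s) ^+ 2 * (`N (chi w s) * `N (S w s))).
Proof.
move=> sw e0; apply: (@intble_le R _ R1 leb _ _ _ _ (chiS_int sw)).
  apply: measurable_funM; last exact: chiS_meas.
  by apply: measurable_funX; apply: measurable_funB => //; exact: meas_eta.
move=> s; rewrite (ger0_norm (sqNN _ _ _)).
by rewrite ler_piMl ?mulr_ge0 ?normc_ge0// eta1_sq.
Qed.

Lemma tau_ge0 w e : 0 <= tau w e.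
Proof. by apply: mulr_ge0; [exact: ipi0|apply: Rint_ge0 => s; exact: sqNN]. Qed.

Lemma tau_cvg w (e_ : nat -> R) : schwartz w -> (forall n, 0 < e_ n) -> e_ @ \oo --> (0 : R) ->
  tau w (e_ n) @[n --> \oo] --> (0 : R).
Proof.
move=> sw e0 el; rewrite -[X in _ --> X](mulr0 (pi ^- 2)); apply: cvgM; first exact: cvg_cst.
have [_] : intble leb (fun=> 0 : R) /\
  Rint (fun s => (1 - eta (e_ n) 0 s) ^+ 2 * (`N (chi w s) * `N (S w s))) @[n --> \oo] --> Rint (fun=> 0 : R).
  apply: (@Rint_dct R _ R1 leb (fun n s => (1 - eta (e_ n) 0 s) ^+ 2 * (`N (chi w s) * `N (S w s))) (fun=> 0) (fun s => `N (chi w s) * `N (S w s))).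
  - by move=> n; exact: intble_meas1 (tau_int sw (e0 n)).
  - exact: measurable_cst.
  - move=> s; have [s0|s0] := ltP 0 s; last first.
      have z : chi w s = 0 by case: (chi_prof sw) => _ ->.
      apply: (@cvg_eq _ _ (fun=> 0)); last exact: cvg_cst.
      by move=> n; rewrite z Normc.normc0 mul0r mulr0.
    rewrite -[X in _ --> X](mul0r (`N (chi w s) * `N (S w s))); apply: cvgM; last exact: cvg_cst.
    have h : 1 - eta (e_ n) 0 s @[n --> \oo] --> (0 : R).
      by rewrite -[X in _ --> X](subrr (1 : R)); apply: cvgB; [exact: cvg_cst|exact: cvg_eta_seq].
    by rewrite -[X in _ --> X](mul0r (0 : R)); exact: cvgM.
  - exact: chiS_int.
  - move=> n s; rewrite (ger0_norm (sqNN _ _ _)).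
    by rewrite ler_piMl ?mulr_ge0 ?normc_ge0// eta1_sq.
by rewrite (_ : Rint (fun=> 0) = 0)// Rintegral_cst// mul0r.
Qed.

Lemma schwartz_sq u : schwartz u -> intble3 (fun p : hmeas R => `N (u p) ^+ 2).
Proof.
move=> su; have := cint_normc (schwartz_int (schwartzMM su su)).
apply: eq_intble => p.
by rewrite normcM expr2.
Qed.

Lemma L2_diff w e e' : schwartz w -> 0 < e -> 0 < e' ->
  Rint3 (fun p : hmeas R => `N (J (cutoff w e) p - J (cutoff w e') p) ^+ 2) =
  pi ^- 2 * Rint (fun s => (eta e 0 s - eta e' 0 s) ^+ 2 * (`N (chi w s) * `N (S w s))).
Proof.
move=> sw e0 e0'; have f1 := flat_cutoff sw e0; have f2 := flat_cutoff sw e0'.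
have s1 := flat_J f1; have s2 := flat_J f2; have sd := schwartzB s1 s2.
have i1 := prof_int (flat_prof f1); have i2 := prof_int (flat_prof f2).
have pd := flat_prof (flatB f1 f2).
have [_ E] := JS_fubini (schwartz_int sd) (prof_int pd).
have JE : J (fun s => cutoff w e s - cutoff w e' s) = (fun p => J (cutoff w e) p - J (cutoff w e') p).
  apply/funext => p; rewrite /J -(cintegralB (int_J p i1) (int_J p i2)).
  by apply: eq_cintegral => s; rewrite mulrBl.
rewrite JE in E.
have SE s : 0 < s -> S (fun p => J (cutoff w e) p - J (cutoff w e') p) s = (eta e 0 s - eta e' 0 s)%:C * S w s.
  move=> s0; have s2N : schwartz (fun p => -1 * J (cutoff w e') p) by exact: schwartzZ.
  have -> : (fun p => J (cutoff w e) p - J (cutoff w e') p) = (fun p => J (cutoff w e) p + -1 * J (cutoff w e') p).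
    by apply/funext => p; rewrite mulN1r.
  apply: (etrans (S_D s s1 s2N)).
  apply: (etrans (congr2 +%R (S_cutoff sw e0 s0) (etrans (S_Z (-1) s s2) (congr1 ( *%R (-1)) (S_cutoff sw e0' s0))))).
  rewrite RCD RCN.
  by move: (S w s) (eta e 0 s)%:C (eta e' 0 s)%:C => *; ring.
have E1 : (fun p : hmeas R => (J (cutoff w e) p - J (cutoff w e') p) * (J (cutoff w e) p - J (cutoff w e') p)^*) = (fun p : hmeas R => (`N (J (cutoff w e) p - J (cutoff w e') p) ^+ 2)%:C).
  by apply/funext => p; rewrite mulcJ.
have iS : intble leb (fun s => (eta e 0 s - eta e' 0 s) ^+ 2 * (`N (chi w s) * `N (S w s))).
  apply: (@intble_le R _ R1 leb _ _ _ _ (chiS_int sw)).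
    apply: measurable_funM; last exact: chiS_meas.
    by apply: measurable_funX; apply: measurable_funB; exact: meas_eta.
  move=> s; rewrite (ger0_norm (sqNN _ _ _)).
  rewrite ler_piMl ?mulr_ge0 ?normc_ge0//.
  have := eta_le1 s e0; have := eta_ge0 e 0 s; have := eta_le1 s e0'; have := eta_ge0 e' 0 s.
  by move: (eta _ _ _) (eta _ _ _) => x y *; rewrite expr2; nra.
have E2 : (fun s : R1 => (cutoff w e s - cutoff w e' s)^* * S (fun p => J (cutoff w e) p - J (cutoff w e') p) s) = (fun s : R1 => (pi ^- 2 * ((eta e 0 s - eta e' 0 s) ^+ 2 * (`N (chi w s) * `N (S w s))))%:C).
  apply/funext => s; have -> : cutoff w e s - cutoff w e' s = (pi ^- 2 * (eta e 0 s - eta e' 0 s))%:C * chi w s.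
    by rewrite /cutoff -mulrBl -RCN -RCD -mulrBr.
  have [s0|s0] := ltP 0 s; last first.
    have -> : chi w s = 0 by case: (chi_prof sw) => _ ->.
    rewrite Normc.normc0 !(mul0r, mulr0) (_ : (0 : R[i])^* = 0) ?mul0r//.
    by apply: cplxP; rewrite !cE ?oppr0.
  rewrite (SE s s0) (cJM _%:C (chi w s)) cJR chiE// pos_id ?(ltW s0)// (cJM s%:C (S w s)) cJR.
  rewrite normcM normcR gtr0_norm//.
  have -> : (pi ^- 2 * ((eta e 0 s - eta e' 0 s) ^+ 2 * (s * `N (S w s) * `N (S w s))))%:C =
    (pi ^- 2 * (eta e 0 s - eta e' 0 s) * (eta e 0 s - eta e' 0 s) * s)%:C * (S w s * (S w s)^*) :> R[i].
    by rewrite mulcJ -RCM; congr (_%:C); ring.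
  by rewrite !RCM; move: (S w s) (S w s)^* s%:C (pi ^- 2)%:C (_ - _)%:C => *; ring.
rewrite E1 E2 !cintegralC (RintZ (pi ^- 2) iS) in E.
by move: E => /(congr1 (@Re R)); rewrite !ReC.
Qed.

(** [L2_diff] compares two cut-offs; let one of them tend to 0 and use Fatou. *)
Lemma L2_cutoff w e : schwartz w -> 0 < e ->
  intble3 (fun p : hmeas R => `N (J (cutoff w e) p - J (bar w) p) ^+ 2) /\
  Rint3 (fun p : hmeas R => `N (J (cutoff w e) p - J (bar w) p) ^+ 2) <= tau w e.
Proof.
move=> sw e0.
pose e_ (n : nat) : R := n.+1%:R^-1 * e.
have e_0 n : 0 < e_ n by rewrite mulr_gt0// invn_gt0.
have e_e n : e_ n <= e by rewrite ler_piMl ?(ltW e0)// invf_le1// ler1n.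
have el : e_ @ \oo --> (0 : R).
  by rewrite -[X in _ --> X](mul0r e); apply: cvgM; [exact: cvg_inv0|exact: cvg_cst].
have sJ n : schwartz (J (cutoff w (e_ n))) by apply: flat_J; exact: flat_cutoff.
have s0 : schwartz (J (cutoff w e)) by apply: flat_J; exact: flat_cutoff.
apply: (@Rint_fatou R _ (hmeas R) leb3s (fun n p => `N (J (cutoff w e) p - J (cutoff w (e_ n)) p) ^+ 2)).
- by move=> n; exact: schwartz_sq (schwartzB s0 (sJ n)).
- apply: normc2_meas; apply: cmeasurableB; first exact: schwartz_meas.
  exact: meas_J (prof_int (bar_prof sw)).
- by move=> n p; exact: sqr_ge0.
- by move=> p; apply: ccvg_normc2; exact: J_cvg.
- move=> n; rewrite (L2_diff sw e0 (e_0 n)); apply: (ler_wpM2l ipi0).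
  have iT := tau_int sw e0.
  have b s : (eta e 0 s - eta (e_ n) 0 s) ^+ 2 <= (1 - eta e 0 s) ^+ 2.
    have := eta_le1 s (e_0 n); have := eta_mono s (e_0 n) (e_e n).
    move: (eta e 0 s) (eta (e_ n) 0 s) => x y xy y1.
    have -> : (x - y) ^+ 2 = (y - x) ^+ 2 by ring.
    by rewrite lerXn2r ?nnegrE ?subr_ge0 ?lerB//; exact: le_trans xy y1.
  have b2 s : (eta e 0 s - eta (e_ n) 0 s) ^+ 2 * (`N (chi w s) * `N (S w s)) <= (1 - eta e 0 s) ^+ 2 * (`N (chi w s) * `N (S w s)).
    by rewrite ler_wpM2r ?mulr_ge0 ?normc_ge0.
  apply: (Rint_le _ iT b2).
  apply: (@intble_le R _ R1 leb _ _ _ _ iT).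
    apply: measurable_funM; last exact: chiS_meas.
    by apply: measurable_funX; apply: measurable_funB; exact: meas_eta.
  by move=> s; rewrite (ger0_norm (sqNN _ _ _)).
Qed.

Lemma sq_bar w : schwartz w -> intble3 (fun p : hmeas R => `N (J (bar w) p) ^+ 2).
Proof.
move=> sw; have e0 : 0 < 1 :> R by [].
have s0 : schwartz (J (cutoff w 1)) by apply: flat_J; exact: flat_cutoff.
have mJ : cmeasurable (J (bar w) : hmeas R -> R[i]) := meas_J (prof_int (bar_prof sw)).
have m1 : cmeasurable (fun p : hmeas R => J (bar w) p - J (cutoff w 1) p) := cmeasurableB mJ (schwartz_meas s0).
have i1 : intble3 (fun p : hmeas R => `N (J (bar w) p - J (cutoff w 1) p) ^+ 2).
  have [h _] := L2_cutoff sw e0; apply: eq_intble h => p.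
  by move: (J (bar w) p) (J (cutoff w 1) p) => a b; rewrite -normcN opprB.
have := @intble_sqD R _ (hmeas R) leb3s _ _ m1 (schwartz_meas s0) i1 (schwartz_sq s0).
by apply: eq_intble => p; rewrite subrK.
Qed.

(** Test against [v] with profile [g]: the pairing of [w - J (cutoff w e)] is the
    integral of [(1 - exp (- e / s)) g conj(S w)] by [V0_profile] and [S_cutoff],
    and tends to 0 with [e]. *)
Lemma proj_exists w : schwartz w -> is_proj0 w (J (bar w)).
Proof.
move=> sw; have mJ : cmeasurable (J (bar w) : hmeas R -> R[i]) := meas_J (prof_int (bar_prof sw)).
split.
- by apply/inL2P; split => //; exact: sq_bar.
- by apply: V0plus_J; exact: bar_prof.
move=> v /inL2P[mv iv] Vv; have [g g0 Hg] := V0_profile Vv.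
pose e_ (n : nat) : R := n.+1%:R^-1.
have e0 n : 0 < e_ n := @invn_gt0 R n.
have el : e_ @ \oo --> (0 : R) := @cvg_inv0 R.
set I := cintegral _ _.
have sJ n : schwartz (J (cutoff w (e_ n))) by apply: flat_J; exact: flat_cutoff.
pose A n := cint3 (fun p => (w p - J (cutoff w (e_ n)) p) * (v p)^*).
pose B n := cint3 (fun p => (J (cutoff w (e_ n)) p - J (bar w) p) * (v p)^*).
have mvJ := cmeasurableJ mv.
have ivJ : intble3 (fun p : hmeas R => `N ((v p)^*) ^+ 2).
  by apply: eq_intble iv => p; rewrite normcJ.
have iA n : cintble3 (fun p => (w p - J (cutoff w (e_ n)) p) * (v p)^*).
  have sB := schwartzB sw (sJ n).
  exact: (@cint_sqM R _ (hmeas R) leb3s _ _ (schwartz_meas sB) mvJ (schwartz_sq sB) ivJ).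
have mB n : cmeasurable (fun p : hmeas R => J (cutoff w (e_ n)) p - J (bar w) p) := cmeasurableB (schwartz_meas (sJ n)) mJ.
have iB n : cintble3 (fun p => (J (cutoff w (e_ n)) p - J (bar w) p) * (v p)^*).
  exact: (@cint_sqM R _ (hmeas R) leb3s _ _ (mB n) mvJ (L2_cutoff sw (e0 n)).1 ivJ).
have IE n : I = A n + B n.
  rewrite /A /B -(cintegralD (iA n) (iB n)); apply: (eq_cintegral (leb3 R)) => p.
  by rewrite -mulrDl addrA subrK.
have Blim : ccvg B 0.
  rewrite /ccvg; set V := Rint3 (fun p : hmeas R => `N ((v p)^*) ^+ 2).
  have V0 : 0 <= V by apply: (@Rint_ge0 _ _ _ leb3s) => p; exact: sqr_ge0.
  have lim : tau w (e_ n) * V @[n --> \oo] --> (0 : R).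
    by rewrite -[X in _ --> X](mul0r V); apply: cvgM; [exact: tau_cvg|exact: cvg_cst].
  apply/cvgr0Pnorm_le => e ep.
  have e2 : 0 < e ^+ 2 by rewrite exprn_gt0.
  have /cvgr0Pnorm_le/(_ _ e2) := lim; apply: filterS => n.
  rewrite (ger0_norm (mulr_ge0 (tau_ge0 _ _) V0)) subr0 (ger0_norm (normc_ge0 _)) => h.
  rewrite -(@ler_pXn2r _ 2)// ?nnegrE ?normc_ge0 ?(ltW ep)//; apply: le_trans h.
  apply: le_trans (@CauchySchwarzC R _ (hmeas R) leb3s _ _ (mB n) mvJ (L2_cutoff sw (e0 n)).1 ivJ) _.
  by rewrite ler_wpM2r//; exact: (L2_cutoff sw (e0 n)).2.
have Alim : ccvg A 0.
  have [ig _] := Hg w sw.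
  have AE n : (A n)^* = cint (fun s : R1 => (1 - eta (e_ n) 0 s)%:C * (g s * (S w s)^*)).
    have sB := schwartzB sw (sJ n); have [_ E] := Hg _ sB.
    rewrite /A -(cintegralJ (iA n)).
    have -> : cint3 (fun p => ((w p - J (cutoff w (e_ n)) p) * (v p)^*)^*) = cint3 (fun p => v p * (w p - J (cutoff w (e_ n)) p)^*).
      by apply: (eq_cintegral (leb3 R)) => p; rewrite (cJM (_ - _) (v p)^*) conjcK mulrC.
    rewrite E; apply: eq_cintegral => s; have [s0|s0] := ltP 0 s; last by rewrite g0// !mul0r mulr0.
    have s2N : schwartz (fun p => -1 * J (cutoff w (e_ n)) p) by exact: schwartzZ.
    have -> : S (fun p => w p - J (cutoff w (e_ n)) p) s = (1 - eta (e_ n) 0 s)%:C * S w s.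
      have -> : (fun p => w p - J (cutoff w (e_ n)) p) = (fun p => w p + -1 * J (cutoff w (e_ n)) p).
        by apply/funext => p; rewrite mulN1r.
      apply: (etrans (S_D s sw s2N)).
      apply: (etrans (congr2 +%R (erefl _) (etrans (S_Z (-1) s (sJ n)) (congr1 ( *%R (-1)) (S_cutoff sw (e0 n) s0))))).
      rewrite RCD RCN rmorph1.
      by move: (S w s) (eta _ 0 s)%:C => *; ring.
    by rewrite (cJM _%:C (S w s)) cJR mulrCA.
  have [_] : cintegrable leb (fun _ : R1 => 0 : R[i]) /\ ccvg (fun n => cint (fun s : R1 => (1 - eta (e_ n) 0 s)%:C * (g s * (S w s)^*))) (cint (fun _ : R1 => 0 : R[i])).
    apply: (@cint_dct R _ R1 leb (fun n s => (1 - eta (e_ n) 0 s)%:C * (g s * (S w s)^*)) (fun s => 0) (fun s => `N (g s * (S w s)^*))).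
    + move=> n; apply: cmeasurableM; last exact: cint_meas ig.
      by apply: cmeasurableC; apply: measurable_funB => //; exact: meas_eta.
    + exact: cmeasurable_cst.
    + move=> s; rewrite /ccvg; have [s0|s0] := ltP 0 s; last first.
        apply: (@cvg_eq _ _ (fun=> 0)); last exact: cvg_cst.
        by move=> n; rewrite g0// mul0r mulr0 subr0 Normc.normc0.
      have E n : `N ((1 - eta (e_ n) 0 s)%:C * (g s * (S w s)^*) - 0) = (1 - eta (e_ n) 0 s) * `N (g s * (S w s)^*).
        by rewrite subr0 normcM normcR ger0_norm// subr_ge0 eta_le1.
      apply: (cvg_eq E); rewrite -[X in _ --> X](mul0r (`N (g s * (S w s)^*))); apply: cvgM; last exact: cvg_cst.
      by rewrite -[X in _ --> X](subrr (1 : R)); apply: cvgB; [exact: cvg_cst|exact: cvg_eta_seq].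
    + exact: cint_normc ig.
    + move=> n s; rewrite normcM normcR ger0_norm ?subr_ge0 ?eta_le1//.
      by rewrite ler_piMl ?normc_ge0// gerBl eta_ge0.
  rewrite (cintegral0 leb); apply: cvg_eq => n.
  by rewrite -AE !subr0 normcJ.
have : ccvg (fun n => A n + B n) 0.
  exact: ccvg0D Alim Blim.
have : ccvg (fun n => A n + B n) I.
  apply: (@cvg_eq _ _ (fun=> 0)); last exact: cvg_cst.
  by move=> n; rewrite -IE subrr Normc.normc0.
by move=> h1 h2; exact: ccvg_unique h1 h2.
Qed.

Lemma V0plusB u v : V0plus u -> V0plus v ->
  (forall phi, schwartz phi -> cintble3 (fun p => u p * phi p) /\ cintble3 (fun p => v p * phi p)) ->
  V0plus (fun p => u p - v p).
Proof.
move=> [f mf Hf] [g mg Hg] ii; exists (fun s => f s - g s); first exact: cmeasurableB.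
have E p : gauss_profile (fun s => f s - g s) p = gauss_profile f p - gauss_profile g p.
  by rewrite /gauss_profile; case: ifP => _; rewrite ?subr0// mulrBl.
move=> phi sp; have [i1 e1] := Hf phi sp; have [i2 e2] := Hg phi sp.
have [j1 j2] := ii _ (fs_schwartz sp).
have -> : (fun p : hmeas R => gauss_profile (fun s => f s - g s) p * phi p) = (fun p : hmeas R => gauss_profile f p * phi p - gauss_profile g p * phi p).
  by apply/funext => p; rewrite E mulrBl.
split; first exact: cintB i1 i2.
rewrite (cintegralB i1 i2) -e1 -e2 -(cintegralB j1 j2); apply: (eq_cintegral (leb3 R)) => p.
by rewrite mulrBl.
Qed.

(** Two projections of [w] differ by an element of [V0plus] that is orthogonal to
    itself, hence they agree almost everywhere. *)
Lemma rpair_Pi0 (f : hfun R) w : schwartz w -> cmeasurable (f : hmeas R -> R[i]) ->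
  rpair f (Pi0 w) = rpair f (J (bar w)).
Proof.
move=> sw mf.
have H2 := proj_exists sw; have H1 : is_proj0 w (Pi0 w).
  by rewrite /Pi0; case: xgetP => [p -> //|/(_ _ H2)].
case: H1 => /inL2P[m1 i1] V1 o1; case: H2 => /inL2P[m2 i2] V2 o2.
have iw := schwartz_sq sw; have mw := schwartz_meas sw.
set q := Pi0 w in m1 i1 V1 o1 *; set r := J (bar w) in m2 i2 V2 o2 *.
have md : cmeasurable (fun p : hmeas R => q p - r p) := cmeasurableB m1 m2.
have sqN u : cmeasurable (u : hmeas R -> R[i]) -> intble3 (fun p : hmeas R => `N (u p) ^+ 2) ->
   cmeasurable (fun p : hmeas R => - u p) /\ intble3 (fun p : hmeas R => `N (- u p) ^+ 2).
  move=> mu_ iu; split; first exact: cmeasurableN.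
  by apply: eq_intble iu => p; rewrite normcN.
have sqB u v : cmeasurable (u : hmeas R -> R[i]) -> intble3 (fun p : hmeas R => `N (u p) ^+ 2) ->
   cmeasurable (v : hmeas R -> R[i]) -> intble3 (fun p : hmeas R => `N (v p) ^+ 2) ->
   intble3 (fun p : hmeas R => `N (u p - v p) ^+ 2).
  move=> mu_ iu mv iv; have [mN iN] := sqN v mv iv.
  exact: (@intble_sqD R _ (hmeas R) leb3s _ _ mu_ mN iu iN).
have id := sqB _ _ m1 i1 m2 i2.
have L2 : inL2 (fun p => q p - r p) by apply/inL2P.
have V : V0plus (fun p => q p - r p).
  apply: V0plusB => // phi sp; have mp := schwartz_meas sp; have ip := schwartz_sq sp.
  by split; [exact: (@cint_sqM R _ (hmeas R) leb3s _ _ m1 mp i1 ip)|exact: (@cint_sqM R _ (hmeas R) leb3s _ _ m2 mp i2 ip)].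
have mdJ := cmeasurableJ md.
have idJ : intble3 (fun p : hmeas R => `N ((q p - r p)^*) ^+ 2).
  by apply: eq_intble id => p; rewrite normcJ.
have j1 := @cint_sqM R _ (hmeas R) leb3s _ _ (cmeasurableB mw m1) mdJ (sqB _ _ mw iw m1 i1) idJ.
have j2 := @cint_sqM R _ (hmeas R) leb3s _ _ (cmeasurableB mw m2) mdJ (sqB _ _ mw iw m2 i2) idJ.
have z : cint3 (fun p : hmeas R => (`N (q p - r p) ^+ 2)%:C) = 0.
  transitivity (cint3 (fun p => (w p - r p) * (q p - r p)^*) - cint3 (fun p => (w p - q p) * (q p - r p)^*)).
    apply: etrans (cintegralB j2 j1); apply: (eq_cintegral (leb3 R)) => p.
    rewrite -mulcJ; move: ((q p - r p)^*) => z; ring.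
  by rewrite (o1 _ L2 V) (o2 _ L2 V) subrr.
have {}z : Rint3 (fun p : hmeas R => `N (q p - r p) ^+ 2) = 0.
  by move: z; rewrite cintegralC => /(congr1 (@Re R)); rewrite ReC.
by rewrite /rpair (cintegral_L2eq mf m1 m2 z id).
Qed.

End Projection.

(** * A Hardy type inequality on the half-line *)
Section HalfLine.
Context {R : realType}.
Local Notation leb := (@lebesgue_measure R).
Local Notation Rint := (Rintegral leb setT).
Local Notation R1 := (measurableTypeR R).
Implicit Types (f g volt B : R -> R) (s t x y : R).

Lemma derive_near f g (s l : R) : 0 < s -> (forall t, 0 < t -> f t = g t) ->
  is_derive s 1 g l -> is_derive s 1 f l.
Proof.
move=> s0 fg h; have n : \forall t \near s, 0 < t by exact: lt_nbhsr.
apply: (near_eq_is_derive _ h).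
by near=> t; rewrite fg//; near: t.
Unshelve. all: by end_near.
Qed.

Lemma derive_eqR f (s l l' : R) : is_derive s 1 f l -> l = l' -> is_derive s 1 f l'.
Proof. by move=> h <-. Qed.

Lemma derM f g (s a b : R) : is_derive s 1 f a -> is_derive s 1 g b ->
  is_derive s 1 (fun t => f t * g t) (a * g s + f s * b).
Proof.
move=> h1 h2; apply: (is_derive_eq (is_deriveM h1 h2)).
by rewrite /GRing.scale/=; ring.
Qed.
Lemma derD f g (s a b : R) : is_derive s 1 f a -> is_derive s 1 g b ->
  is_derive s 1 (fun t => f t + g t) (a + b).
Proof. by move=> h1 h2; exact: is_deriveD. Qed.
Lemma derZ (k : R) f (s a : R) : is_derive s 1 f a -> is_derive s 1 (fun t => k * f t) (k * a).
Proof. by move=> h; apply: (derive_eqR (derM (is_derive_cst k s 1) h)); rewrite mul0r add0r. Qed.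
Lemma derV (s : R) : 0 < s -> is_derive s 1 (fun t : R => t^-1) (- s^-1 ^+ 2).
Proof.
move=> s0; have sn : s != 0 by rewrite gt_eqF.
by apply: (is_derive_eq (is_deriveV sn (is_derive_id s 1))); rewrite /GRing.scale/= mulr1 exprVn.
Qed.
Lemma der_exp (k s : R) : is_derive s 1 (fun t : R => expR (k * t)) (k * expR (k * s)).
Proof.
have d1 : is_derive s 1 (fun t : R => k * t) k.
  by apply: (derive_eqR (derZ k (is_derive_id s 1))); rewrite mulr1.
by apply: (derive_eqR (is_derive1_comp (is_derive_expR _) d1)); rewrite mulrC.
Qed.
Lemma der_cont f (s l : R) : is_derive s 1 f l -> {for s, continuous f}.
Proof. by move=> [d _]; apply: differentiable_continuous; apply/derivable1_diffP. Qed.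

Lemma Rint_expR (a c : R) : 0 < a ->
  Rint (fun s => expR (- (a * s)) * \1_`[c, +oo[ s) = expR (- (a * c)) / a.
Proof.
move=> a0; have l : - a^-1 * expR (- (a * (c + n.+1%:R))) @[n --> \oo] --> (0 : R).
  by rewrite -[X in _ --> X](mulr0 (- a^-1)); apply: cvgM; [exact: cvg_cst|exact: cvg_expRn].
have d x : is_derive x 1 (fun s => - a^-1 * expR (- (a * s))) (expR (- (a * x))).
  have := derZ (- a^-1) (der_exp (- a) x).
  have -> : (fun t => - a^-1 * expR (- a * t)) = (fun s => - a^-1 * expR (- (a * s))).
    by apply/funext => t; congr (_ * expR _); rewrite mulNr.
  move/derive_eqR; apply; rewrite (_ : - a * x = - (a * x)) ?mulNr//.
  by move: (expR _) => z; field; rewrite gt_eqF.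
rewrite (FTC_halfline (fun x _ => @expR_cont R a x) (fun x _ => d x) (intble_expR c a0) l).
by rewrite sub0r mulNr opprK mulrC.
Qed.

Lemma Rint_abs f : intble leb f -> `|Rint f| <= Rint (fun s => `|f s|).
Proof. by move=> fi; exact: le_normr_Rintegral. Qed.

Definition prim g (t : R) : R := Rint (fun s => g s * \1_`[0, t] s).

Lemma seg_int g (t : R) : continuous g -> intble leb (fun s => g s * \1_`[0, t] s).
Proof.
move=> cg; have fE : (fun x => g x * \1_`[0, t] x) = g \_ `[0, t].
  by apply/funext => x; rewrite patchE indicE; case: ifPn; rewrite ?mulr1 ?mulr0.
have ifab : leb.-integrable `[0, t] (EFin \o g).
  apply: continuous_compact_integrable; first exact: segment_compact.
  by apply: continuous_subspaceT.
by rewrite fE -restrict_EFin; apply/integrable_restrict => //=; rewrite setTI.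
Qed.

Lemma prim_der g t : continuous g -> 0 < t -> is_derive t 1 (prim g) (g t).
Proof.
move=> cg t0.
have fE y : (fun x => g x * \1_`[0, y] x) = g \_ `[0, y].
  by apply/funext => x; rewrite patchE indicE; case: ifPn; rewrite ?mulr1 ?mulr0.
have E : prim g = (fun y => \int[leb]_(s in [set` `[0, y]]) g s).
  by apply/funext => y; rewrite /prim fE -Rintegral_mkcond.
have ifab : leb.-integrable `[0, t + 1] (EFin \o g).
  apply: continuous_compact_integrable; first exact: segment_compact.
  by apply: continuous_subspaceT.
have tt : t < t + 1 by lra.
have [d1 d2] := @continuous_FTC1_closed R g 0 t (t + 1) tt ifab t0 (cg t).
rewrite E; split; [exact: d1|by rewrite -derive1E].
Qed.

(** A bound by the primitive of a majorant: the growth of [e^s f] is absorbed by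
    choosing the majorant as a derivative. *)
Lemma prim_le g h H t : continuous g -> continuous h -> 0 < t ->
  (forall s, 0 <= s <= t -> `|g s| <= h s) -> (forall s, is_derive s 1 H (h s)) ->
  `|prim g t| <= H t - H 0.
Proof.
move=> cg ch t0 gh dH.
have [ih <-] := FTC_segment t0 (fun x _ => ch x) (fun x _ => dH x).
have ig := seg_int t cg.
have ign : intble leb (fun s => `|g s * \1_`[0, t] s|).
  apply: (@intble_le R _ R1 leb _ _ _ _ ih).
    by apply: measurableT_comp => //; exact: intble_meas1 ig.
  move=> s; rewrite normr_id normrM [`|\1_ _ _|]ger0_norm// !indicE.
  by case: (boolP (s \in _)) => [|_]; [rewrite inE/= in_itv/= => sI; rewrite !mulr1; exact: gh|rewrite !mulr0].
apply: le_trans (Rint_abs ig) _.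
apply: (Rint_le ign ih) => s; rewrite normrM [`|\1_ _ _|]ger0_norm// !indicE.
by case: (boolP (s \in _)) => [|_]; [rewrite inE/= in_itv/= => sI; rewrite !mulr1; exact: gh|rewrite !mulr0].
Qed.

(** An inequality between integrals on the half-line that holds because the
    difference of the integrands dominates a derivative. *)
Lemma halfline_certificate f h B B' (c1 c2 : R) : 0 < c2 ->
  intble leb (fun s => f s ^+ 2) -> measurable_fun setT (h : R1 -> R) -> (forall t, 0 <= h t) -> (forall t, t <= 0 -> h t = 0) ->
  (forall t, 0 < t -> is_derive t 1 B (B' t)) -> (forall t, 0 < t -> {for t, continuous B'}) ->
  (forall t, 0 < t -> B' t <= c1 * f t ^+ 2 - c2 * h t) -> 0 <= c1 ->
  B n.+2%:R @[n --> \oo] --> (0 : R) -> B (n.+2%:R^-1) @[n --> \oo] --> (0 : R) ->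
  intble leb h /\ c2 * Rint h <= c1 * Rint (fun s => f s ^+ 2).
Proof.
move=> c20 if2 mh h0 hz dB cB B'h c10 lB rB.
pose I n : set R := `[(n.+2%:R^-1 : R), n.+2%:R]%classic.
have ab n : (n.+2%:R^-1 : R) < n.+2%:R.
  by rewrite (@lt_le_trans _ _ 1)// ?invf_lt1 ?ltr1n ?ler1n ?ltr0n.
have p n : 0 < (n.+2%:R^-1 : R) by rewrite invr_gt0 ltr0n.
have key n : intble leb (fun s => h s * \1_(I n) s) /\ c2 * Rint (fun s => h s * \1_(I n) s) <= c1 * Rint (fun s => f s ^+ 2) - (B n.+2%:R - B (n.+2%:R^-1)).
  have [iB EB] := FTC_segment (ab n) (fun x hx => cB x (lt_le_trans (p n) (andP hx).1)) (fun x hx => dB x (lt_le_trans (p n) (andP hx).1)).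
  have mI : measurable_fun setT (\1_(I n) : R1 -> R) by apply: measurable_indic; exact: measurable_itv.
  have iF := intbleB (intbleZ c1 if2) iB.
  have pt s : c2 * (h s * \1_(I n) s) <= c1 * f s ^+ 2 - B' s * \1_(I n) s.
    rewrite indicE; case: (boolP (s \in _)) => [|_].
      rewrite inE /I /= in_itv/= => /andP[s1 _]; rewrite !mulr1.
      by have := B'h s (lt_le_trans (p n) s1); lra.
    by rewrite !mulr0 subr0 mulr_ge0 ?sqr_ge0.
  have m1 : measurable_fun setT (fun s : R1 => h s * \1_(I n) s) by exact: measurable_funM.
  have i1 : intble leb (fun s => c2 * (h s * \1_(I n) s)).
    apply: (@intble_le R _ R1 leb _ _ _ _ iF); first exact: measurable_funM.
    by move=> s; rewrite ger0_norm ?pt// !mulr_ge0// ltW.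
  have i2 : intble leb (fun s => h s * \1_(I n) s).
    by apply: eq_intble (intbleZ c2^-1 i1) => s; rewrite mulKf// gt_eqF.
  split => //; rewrite -(RintZ c2 i2) -(RintZ c1 if2) -EB -(RintB (intbleZ c1 if2) iB).
  exact: (Rint_le i1 iF).
pose r n : R := c1 * Rint (fun s => f s ^+ 2) - (B n.+2%:R - B (n.+2%:R^-1)).
have rl : r @ \oo --> c1 * Rint (fun s => f s ^+ 2).
  rewrite -[X in _ --> X]subr0; apply: cvgB; first exact: cvg_cst.
  by rewrite -[X in _ --> X](subr0 (0 : R)); exact: cvgB.
have pw s : h s * \1_(I n) s @[n --> \oo] --> h s.
  have [s0|s0] := leP s 0.
    rewrite hz//; apply: (@cvg_eq _ _ (fun=> 0)); last exact: cvg_cst.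
    by move=> n; rewrite mul0r.
  apply: (@cvg_trans _ (cst (h s) @ \oo)); last exact: cvg_cst.
  apply: near_eq_cvg; exists (Num.truncn (s + s^-1)) => // n /= Nn.
  rewrite indicE mem_set ?mulr1// /I/= in_itv/=.
  have t0 : 0 < s^-1 by rewrite invr_gt0.
  have b : s + s^-1 <= n.+2%:R.
    by rewrite (le_trans (ltW (truncnS_gt _)))// ler_nat ltnS (leq_trans Nn).
  apply/andP; split; last by lra.
  by rewrite -[leRHS]invrK lef_pV2 ?posrE ?ltr0n//; lra.
have [K Kr] : exists K, forall n, r n <= K.
  have /cvg_seq_bounded : cvg (r @ \oo) by apply/cvg_ex; eexists; exact: rl.
  move=> [M [_ hM]]; exists (M + 1) => n; apply: le_trans (ler_norm _) _.
  by apply: (hM (M + 1)) => //; lra.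
have [ih _] : intble leb h /\ Rint h <= c2^-1 * K.
  apply: (@Rint_fatou R _ R1 leb (fun n s => h s * \1_(I n) s)) => //.
  - by move=> n; exact: (key n).1.
  - by move=> n s; rewrite mulr_ge0.
  - by move=> n; rewrite ler_pdivlMl//; exact: le_trans (key n).2 (Kr n).
split => //.
have [_ lim] : intble leb h /\ Rint (fun s => h s * \1_(I n) s) @[n --> \oo] --> Rint h.
  apply: (@Rint_dct R _ R1 leb (fun n s => h s * \1_(I n) s) h h) => //.
  - by move=> n; apply: intble_meas1 (key n).1.
  - move=> n s; rewrite ger0_norm ?mulr_ge0// indicE.
    by case: (s \in _); rewrite ?mulr1 ?mulr0.
have l2 : r n - c2 * Rint (fun s => h s * \1_(I n) s) @[n --> \oo] --> c1 * Rint (fun s => f s ^+ 2) - c2 * Rint h.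
  by apply: cvgB => //; apply: cvgM => //; exact: cvg_cst.
rewrite -subr_ge0 -(cvg_lim _ l2)//; apply: limr_ge; first by apply/cvg_ex; eexists; exact: l2.
by near=> n; rewrite subr_ge0; exact: (key n).2.
Unshelve. all: by end_near.
Qed.

Section Volterra.
Variables (f : R -> R) (C : R).
Hypotheses (cf : continuous f) (fz : forall s, s <= 0 -> f s = 0) (C0 : 0 <= C)
  (fC : forall s, `|f s| <= C * w1 s).

Lemma f_int : intble leb f.
Proof.
apply: (@intble_le R _ R1 leb _ (fun s => C * w1 s)) => //; last by apply: intbleZ; exact: intble_w1.
exact: continuous_measurable_fun.
Qed.
Lemma f_bd s : `|f s| <= C.
Proof. by apply: le_trans (fC s) _; rewrite ler_piMr// w1_le1. Qed.
Lemma f2_int : intble leb (fun s => f s ^+ 2).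
Proof.
apply: (@intble_le R _ R1 leb _ (fun s => C * `|f s|)).
- by apply: measurable_funX; exact: continuous_measurable_fun.
- by move=> s; rewrite ger0_norm ?sqr_ge0// -real_normK ?num_real// expr2 ler_wpM2r// f_bd.
- apply: intbleZ; have := f_int; move/integrable_abse; exact.
Qed.

Let ep s := expR (1 * s) * f s.
Let em s := expR (-1 * s) * f s.
Let sm s := s * (expR (-1 * s) * f s).
Lemma cexpk (k : R) : continuous (fun s : R => expR (k * s)).
Proof. by move=> s; exact: der_cont (der_exp k s). Qed.
Let cep : continuous ep. Proof. by move=> s; apply: cvgM; [exact: cexpk|exact: cf]. Qed.
Let cem : continuous em. Proof. by move=> s; apply: cvgM; [exact: cexpk|exact: cf]. Qed.
Let csm : continuous sm. Proof. by move=> s; apply: cvgM; [exact: cvg_id|exact: cem]. Qed.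

(** The solution of [u' + u = f] on [s > 0] with [u (0) = 0]. *)
Definition volt t : R := if 0 < t then expR (-1 * t) * prim ep t else 0.
(** [ga] and [nu] solve [ga' = ga + f], [nu' = nu + ga / 2].  They grow like [e^t]
    in general: the two moment conditions are exactly what makes them decay,
    see [ga_inf] and [nu_inf]. *)
Let ga t : R := expR (1 * t) * prim em t.
Let nu t : R := expR (1 * t) * (t * prim em t - prim sm t) / 2.

Lemma volt_der t : 0 < t -> is_derive t 1 volt (- volt t + f t).
Proof.
move=> t0; apply: (derive_near t0 (g := fun t => expR (-1 * t) * prim ep t)).
  by move=> s s0; rewrite /volt s0.
apply: (derive_eqR (derM (der_exp (-1) t) (prim_der cep t0))).
rewrite /volt t0 /ep; have : expR (-1 * t) * expR (1 * t) = 1.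
  by rewrite -expRD (_ : _ + _ = 0) ?expR0//; ring.
by move=> E; rewrite [X in _ + X]mulrA E; ring.
Qed.
Let ga_der t : 0 < t -> is_derive t 1 ga (ga t + f t).
Proof.
move=> t0; apply: (derive_eqR (derM (der_exp 1 t) (prim_der cem t0))).
rewrite /ga /em; have : expR (1 * t) * expR (-1 * t) = 1.
  by rewrite -expRD (_ : _ + _ = 0) ?expR0//; ring.
by move=> E; rewrite [X in _ + X]mulrA E; ring.
Qed.
Let nu_der t : 0 < t -> is_derive t 1 nu (nu t + ga t / 2).
Proof.
move=> t0; have d1 := derM (is_derive_id t 1) (prim_der cem t0).
have d2 := derD d1 (derZ (-1) (prim_der csm t0)).
have d3 := derZ (2^-1) (derM (der_exp 1 t) d2).
have := derive_eqR d3 (l' := nu t + ga t / 2).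
have -> : (fun t => 2^-1 * (expR (1 * t) * (t * prim em t + -1 * prim sm t))) = nu.
  by apply/funext => s; rewrite /nu; ring.
by apply; rewrite /nu /ga /sm /em; field.
Qed.

Let ep_le s t : 0 <= s <= t -> `|ep s| <= C * expR (1 * t).
Proof.
move=> /andP[s0 st]; rewrite /ep normrM ger0_norm ?expR_ge0// mulrC.
by apply: ler_pM; rewrite ?expR_ge0 ?f_bd// ler_expR !mul1r.
Qed.
Lemma volt_bd1 t : `|volt t| <= C * pos t.
Proof.
rewrite /volt; case: ifPn => [t0|]; last by rewrite normr0 mulr_ge0 ?pos_ge0.
have := @prim_le ep (fun=> C * expR (1 * t)) (fun s => C * expR (1 * t) * s) t cep (fun=> @cvg_cst _ _ _ _ _) t0 (fun s => @ep_le s t).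
move=> H; rewrite normrM ger0_norm ?expR_ge0// pos_id ?(ltW t0)//.
have {}H : `|prim ep t| <= C * expR (1 * t) * t - C * expR (1 * t) * 0.
  apply: H => s; apply: (derive_eqR (derZ _ (is_derive_id s 1))); exact: mulr1.
apply: le_trans (ler_wpM2l (expR_ge0 _) H) _; rewrite mulr0 subr0.
have E : expR (-1 * t) * expR (1 * t) = 1 by rewrite -expRD (_ : _ + _ = 0) ?expR0//; ring.
have -> : expR (-1 * t) * (C * expR (1 * t) * t) = (expR (-1 * t) * expR (1 * t)) * (C * t) by ring.
by rewrite E mul1r.
Qed.
Lemma volt_bd2 t : `|volt t| <= C.
Proof.
rewrite /volt; case: ifPn => [t0|]; last by rewrite normr0.
have := @prim_le ep (fun s => C * expR (1 * s)) (fun s => C * expR (1 * s)) t cep _ t0 _ _.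
move=> H; have {}H : `|prim ep t| <= C * expR (1 * t) - C * expR (1 * 0).
  apply: H.
  - by move=> s; apply: cvgM; [exact: cvg_cst|exact: cexpk].
  - move=> s _; rewrite /ep normrM ger0_norm ?expR_ge0// mulrC.
    by rewrite ler_wpM2r ?expR_ge0 ?f_bd.
  - by move=> s; apply: (derive_eqR (derZ C (der_exp 1 s))); rewrite mul1r.
rewrite normrM ger0_norm ?expR_ge0//.
apply: (@le_trans _ _ (expR (-1 * t) * (C * expR (1 * t)))).
  rewrite ler_wpM2l ?expR_ge0//; apply: le_trans H _; rewrite gerBl mulr_ge0 ?expR_ge0//.
rewrite mulrCA -expRD (_ : -1 * t + 1 * t = 0) ?expR0 ?mulr1//; ring.
Qed.
Lemma volt_cont : continuous volt.
Proof. by apply: (@cont_glue _ _ C); [move=> s /volt_der[]|exact: volt_bd1]. Qed.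
Lemma volt_z t : t <= 0 -> volt t = 0.
Proof. by move=> t0; rewrite /volt ltNge t0. Qed.

(** The integral of [dens] is the quadratic form of the potential on profiles. *)
Definition dens t : R := volt t ^+ 2 * t^-1.
Lemma dens_ge0 t : 0 <= dens t.
Proof.
have [t0|t0] := leP t 0; first by rewrite /dens volt_z// expr0n/= mul0r.
by rewrite mulr_ge0 ?sqr_ge0// invr_ge0 ltW.
Qed.
Lemma dens_der t : 0 < t -> is_derive t 1 dens (2 * volt t * (- volt t + f t) * t^-1 + volt t ^+ 2 * (- t^-1 ^+ 2)).
Proof.
move=> t0; have d1 := derM (volt_der t0) (volt_der t0).
have := derM d1 (derV t0).
have -> : (fun t => volt t * volt t * t^-1) = dens by apply/funext => s; rewrite /dens expr2.
by move/derive_eqR; apply; ring.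
Qed.
Lemma dens_bd t : dens t <= C ^+ 2 * pos t.
Proof.
have [t0|t0] := leP t 0; first by rewrite /dens volt_z// expr0n/= mul0r mulr_ge0 ?sqr_ge0 ?pos_ge0.
rewrite /dens pos_id ?(ltW t0)// ler_pdivrMr// -mulrA -expr2 -exprMn.
rewrite -(real_normK (num_real (volt t))) lerXn2r ?nnegrE ?mulr_ge0 ?(ltW t0)//.
by have := volt_bd1 t; rewrite pos_id ?(ltW t0).
Qed.
Lemma dens_cont : continuous dens.
Proof.
apply: (@cont_glue _ _ (C ^+ 2)); first by move=> s /dens_der[].
by move=> s; rewrite ger0_norm ?dens_ge0 ?dens_bd.
Qed.

Lemma cvg_invn2 : n.+2%:R^-1 @[n --> \oo] --> (0 : R).
Proof.
have := @cvg_inv0 R => /cvgr0Pnorm_le h; apply/cvgr0Pnorm_le => e e0.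
have := h e e0; apply: filterS => n; apply: le_trans.
by rewrite !ger0_norm ?invr_ge0// lef_pV2 ?posrE ?ltr0n// ler_nat.
Qed.

Lemma sq_cvg0 (u_ : nat -> R) K : (forall n, `|u_ n| <= K * n.+2%:R^-1) -> u_ @ \oo --> (0 : R).
Proof.
move=> uK; have l : K * n.+2%:R^-1 @[n --> \oo] --> (0 : R).
  by rewrite -[X in _ --> X](mulr0 K); apply: cvgM; [exact: cvg_cst|exact: cvg_invn2].
apply/cvgr0Pnorm_le => e e0; have /cvgr0Pnorm_le/(_ e e0) := l.
by apply: filterS => n h; apply: le_trans (uK n) (le_trans (ler_norm _) h).
Qed.

(** With [u = volt], [f^2 - 2 u^2 / t = (f - u / t)^2 + (u^2 / t)']. *)
Lemma hardy_half : intble leb dens /\ 2 * Rint dens <= Rint (fun s => f s ^+ 2).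
Proof.
rewrite -[X in _ /\ _ <= X]mul1r.
apply: (@halfline_certificate f dens dens (fun t => 2 * volt t * (- volt t + f t) * t^-1 + volt t ^+ 2 * (- t^-1 ^+ 2))) => //.
- exact: f2_int.
- exact: continuous_measurable_fun dens_cont.
- exact: dens_ge0.
- by move=> t t0; rewrite /dens volt_z// expr0n/= mul0r.
- exact: dens_der.
- move=> t t0; have cV := der_cont (derV t0); have ca : {for t, continuous volt} := @volt_cont t.
  have cV2 : {for t, continuous (fun t : R => - t^-1 ^+ 2)}.
    by apply: cvgN; under eq_fun do rewrite expr2; apply: cvgM.
  apply: cvgD; apply: cvgM => //; last by under eq_fun do rewrite expr2; apply: cvgM.
  apply: cvgM => //; first by apply: cvgM => //; exact: cvg_cst.
  by apply: cvgD; [exact: cvgN|exact: cf].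
- move=> t t0; rewrite mul1r /dens -subr_ge0.
  have -> : f t ^+ 2 - 2 * (volt t ^+ 2 / t) - (2 * volt t * (- volt t + f t) / t + volt t ^+ 2 * - t^-1 ^+ 2) = (f t - volt t * t^-1) ^+ 2.
    by field; rewrite gt_eqF.
  exact: sqr_ge0.
- apply: (@sq_cvg0 _ (C ^+ 2)) => n; rewrite ger0_norm ?dens_ge0// /dens ler_wpM2r ?invr_ge0//.
  by rewrite -(real_normK (num_real (volt _))) lerXn2r ?nnegrE// volt_bd2.
- apply: (@sq_cvg0 _ (C ^+ 2)) => n; rewrite ger0_norm ?dens_ge0//.
  by apply: le_trans (dens_bd _) _; rewrite pos_id ?invr_ge0.
Qed.

Hypotheses (oc : Rint em = 0) (od : Rint sm = 0).

Lemma w1_anti s t : 0 <= t -> t <= s -> w1 s <= w1 t.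
Proof.
move=> t0 ts; rewrite /w1 lef_pV2 ?posrE ?ltr_wpDr ?sqr_ge0// lerD2l.
by rewrite lerXn2r ?nnegrE// (le_trans t0).
Qed.

(** If the integral of [g] vanishes, its primitive is minus the integral over the
    tail. *)
Let tail g (K a t : R) : continuous g -> intble leb g -> Rint g = 0 ->
  (forall s, s <= 0 -> g s = 0) -> 0 < a -> 0 < t -> (forall s, t < s -> `|g s| <= K * expR (- (a * s))) ->
  0 <= K -> `|prim g t| <= K * (expR (- (a * t)) / a).
Proof.
move=> cg ig zg g0 a0 t0 gK K0.
have is_ := seg_int t cg.
have -> : prim g t = - Rint (fun s => g s - g s * \1_`[0, t] s).
  by rewrite (RintB ig is_) zg sub0r opprK.
rewrite normrN; have id := intbleB ig is_.
apply: le_trans (Rint_abs id) _.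
have ie := intble_expR t a0.
rewrite -(Rint_expR t a0) -(RintZ K ie).
have pt s : `|g s - g s * \1_`[0, t] s| <= K * (expR (- (a * s)) * \1_`[t, +oo[ s).
  have r0 : 0 <= K * (expR (- (a * s)) * \1_`[t, +oo[ s) by rewrite !mulr_ge0// expR_ge0.
  have [s0|s0] := leP s 0; first by rewrite g0// mul0r subr0 normr0.
  have [st|st] := leP s t.
    by rewrite indicE mem_set/= ?in_itv/= ?(ltW s0)// mulr1 subrr normr0.
  rewrite !indicE memNset/= ?in_itv/= ?mulr0 ?subr0; last by rewrite [s <= t]leNgt st andbF.
  by rewrite mem_set/= ?in_itv/= ?(ltW st)// mulr1 gK.
apply: Rint_le => //; last exact: intbleZ.
apply: (@intble_le R _ R1 leb _ _ _ _ (intbleZ K ie)).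
  by apply: measurableT_comp => //; exact: intble_meas1 id.
by move=> s; rewrite normr_id.
Qed.

Let em_int : intble leb em.
Proof.
apply: (@intble_le R _ R1 leb _ (fun s => C * w1 s)); last by apply: intbleZ; exact: intble_w1.
  exact: continuous_measurable_fun.
move=> s; have [s0|s0] := leP s 0; first by rewrite /em fz// mulr0 normr0 mulr_ge0 ?w1_ge0.
apply: le_trans (fC s); rewrite /em normrM ger0_norm ?expR_ge0// ler_piMl//.
by rewrite -[leRHS]expR0 ler_expR; move: s0; lra.
Qed.
Let sm_int : intble leb sm.
Proof.
apply: (@intble_le R _ R1 leb _ (fun s => C * w1 s)); last by apply: intbleZ; exact: intble_w1.
  exact: continuous_measurable_fun.
move=> s; have [s0|s0] := leP s 0; first by rewrite /sm fz// !mulr0 normr0 mulr_ge0 ?w1_ge0.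
apply: le_trans (fC s); rewrite /sm mulrA normrM ler_piMl// ger0_norm ?mulr_ge0 ?expR_ge0 ?(ltW s0)//.
rewrite mulN1r expRN ler_pdivrMr ?expR_gt0// mul1r.
by have := expR_ge1Dx s; lra.
Qed.

Let ga_inf t : 0 < t -> `|ga t| <= C * w1 t.
Proof.
move=> t0; have K0 : 0 <= C * w1 t by rewrite mulr_ge0 ?w1_ge0.
have := @tail em (C * w1 t) 1 t cem em_int oc _ ltr01 t0 _ K0; rewrite mul1r divr1 => H.
rewrite /ga normrM ger0_norm ?expR_ge0// mul1r.
have {}H : `|prim em t| <= C * w1 t * expR (- t).
  apply: H; first by move=> s s0; rewrite /em fz// mulr0.
  move=> s ts; rewrite /em normrM ger0_norm ?expR_ge0// mulN1r mul1r mulrC ler_wpM2r ?expR_ge0//.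
  by apply: le_trans (fC s) _; rewrite ler_wpM2l// w1_anti// ltW.
apply: le_trans (ler_wpM2l (expR_ge0 _) H) _.
by rewrite mulrCA -expRD subrr expR0 mulr1.
Qed.

Let nu_inf t : 0 < t -> `|nu t| <= 2 * (C * w1 t).
Proof.
move=> t0; pose g s := t * em s - sm s.
have cg : continuous g by move=> s; apply: cvgB; [apply: cvgM; [exact: cvg_cst|exact: cem]|exact: csm].
have ig : intble leb g := intbleB (intbleZ t em_int) sm_int.
have zg : Rint g = 0.
  by rewrite (RintB (intbleZ t em_int) sm_int) (RintZ t em_int) oc od mulr0 subrr.
have K0 : 0 <= 2 * (C * w1 t) * expR (- (t / 2)) by rewrite !mulr_ge0 ?w1_ge0 ?expR_ge0.
have h2 : 0 < 2^-1 :> R by rewrite invr_gt0.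
have H := @tail g _ (2^-1) t cg ig zg _ h2 t0 _ K0.
have {}H : `|prim g t| <= 2 * (C * w1 t) * expR (- (t / 2)) * (expR (- (2^-1 * t)) / 2^-1).
  apply: H; first by move=> s s0; rewrite /g /em /sm fz// !mulr0 subrr.
  move=> s ts; have -> : g s = (t - s) * (expR (-1 * s) * f s) by rewrite /g /em /sm; ring.
  rewrite (normrM (t - s)) (distrC t s) (gtr0_norm (x := s - t)) ?subr_gt0// (normrM (expR _)) (ger0_norm (expR_ge0 _)).
  have b1 : `|f s| <= C * w1 t by apply: le_trans (fC s) _; rewrite ler_wpM2l// w1_anti// ltW.
  have b2 : s - t <= 2 * expR ((s - t) / 2) by have := expR_ge1Dx ((s - t) / 2); lra.
  have b3 : expR ((s - t) / 2) * expR (-1 * s) = expR (- (t / 2)) * expR (- (2^-1 * s)).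
    by rewrite -!expRD; congr expR; field.
  apply: (@le_trans _ _ (2 * expR ((s - t) / 2) * (expR (-1 * s) * (C * w1 t)))).
    apply: ler_pM => //; first by rewrite subr_ge0 ltW.
    by rewrite ler_wpM2l ?expR_ge0.
  by apply: le_of_eq; rewrite -[RHS]mulrA -b3; ring.
have gE : t * prim em t - prim sm t = prim g t.
  rewrite /prim -(RintZ t (seg_int t cem)) -(RintB (intbleZ t (seg_int t cem)) (seg_int t csm)).
  by congr (Rint _); apply/funext => s; rewrite /g; ring.
rewrite /nu gE normrM (ger0_norm (ltW h2)) normrM ger0_norm ?expR_ge0// mul1r.
rewrite ler_pdivrMr//; apply: le_trans (ler_wpM2l (expR_ge0 t) H) _.
have E : expR t * (expR (- (t / 2)) * expR (- (2^-1 * t))) = 1.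
  by rewrite -!expRD (_ : _ + _ = 0) ?expR0//; field.
apply: le_of_eq.
have -> : expR t * (2 * (C * w1 t) * expR (- (t / 2)) * (expR (- (2^-1 * t)) / 2^-1)) = (expR t * (expR (- (t / 2)) * expR (- (2^-1 * t)))) * (2 * (C * w1 t) / 2^-1) by ring.
by rewrite E; field.
Qed.

Let em_bd s : 0 <= s -> `|em s| <= C.
Proof.
move=> s0; apply: le_trans (f_bd s); rewrite /em normrM ger0_norm ?expR_ge0// ler_piMl//.
by rewrite -[leRHS]expR0 ler_expR; move: s0; lra.
Qed.
Let lin_der (k s : R) : is_derive s 1 (fun s : R => k * s) k.
Proof. by apply: (derive_eqR (derZ k (is_derive_id s 1))); rewrite mulr1. Qed.
Let cst_cont (k : R) : continuous (fun _ : R => k). Proof. by move=> s; exact: cvg_cst. Qed.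

Let exp3 t : 0 < t -> t <= 1 -> expR (1 * t) <= 3.
Proof.
move=> t0 t1; rewrite mul1r; apply: (@le_trans _ _ (expR 1)); first by rewrite ler_expR.
have h : expR (- (1 / 2)) >= 1 / 2 :> R by have := expR_ge1Dx (- (1 / 2) : R); lra.
have h2 : expR (- (1 / 3)) >= 2 / 3 :> R by have := expR_ge1Dx (- (1 / 3) : R); lra.
have h3 : expR (- 1) >= 8 / 27 :> R.
  have -> : (- 1 : R) = 3%:R * - (1 / 3) by field.
  rewrite expRM_natl; have -> : 8 / 27 = (2 / 3) ^+ 3 :> R by field.
  by rewrite lerXn2r ?nnegrE ?expR_ge0//; lra.
have h4 : expR (- (1 / 8)) >= 7 / 8 :> R by have := expR_ge1Dx (- (1 / 8) : R); lra.
have h5 : expR (- 1) >= 1 / 3 :> R.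
  have -> : (- 1 : R) = 8%:R * - (1 / 8) by field.
  rewrite expRM_natl; apply: (@le_trans _ _ ((7 / 8) ^+ 8)); first by lra.
  by rewrite lerXn2r ?nnegrE ?expR_ge0//; lra.
have := @expRN R 1 => E; rewrite E in h5.
have e0 := expR_gt0 (1 : R).
have : 1 / 3 * expR 1 <= 1 :> R by rewrite -ler_pdivlMr// [leRHS]mul1r.
by lra.
Qed.

Let ga_zero t : 0 < t -> t <= 1 -> `|ga t| <= 3 * C * t.
Proof.
move=> t0 t1.
have := prim_le (g := em) (h := fun=> C) (H := fun s => C * s) cem (@cst_cont C) t0 (fun s hs => em_bd (andP hs).1) (lin_der C).
rewrite mulr0 subr0 => H; rewrite /ga normrM ger0_norm ?expR_ge0// -mulrA.
by apply: ler_pM; rewrite ?expR_ge0// exp3.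
Qed.
Let nu_zero t : 0 < t -> t <= 1 -> `|nu t| <= 3 * C * t.
Proof.
move=> t0 t1.
have := prim_le (g := em) (h := fun=> C) (H := fun s => C * s) cem (@cst_cont C) t0 (fun s hs => em_bd (andP hs).1) (lin_der C).
rewrite mulr0 subr0 => H1.
have smb s : 0 <= s <= t -> `|sm s| <= C.
  move=> /andP[s0 st]; rewrite /sm normrM ger0_norm// -[leRHS]mul1r.
  by apply: ler_pM => //; [exact: le_trans st t1|exact: em_bd].
have := prim_le (g := sm) (h := fun=> C) (H := fun s => C * s) csm (@cst_cont C) t0 smb (lin_der C).
rewrite mulr0 subr0 => H2.
rewrite /nu normrM normrM ger0_norm ?expR_ge0// [`|2^-1|]ger0_norm ?invr_ge0//.
have H3 : `|t * prim em t - prim sm t| <= C * t + C * t.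
  apply: le_trans (ler_normB _ _) _; apply: lerD => //.
  by rewrite normrM gtr0_norm// (le_trans _ H1)// ler_piMl.
have H4 : expR (1 * t) * `|t * prim em t - prim sm t| <= 3 * (C * t + C * t).
  by apply: ler_pM; rewrite ?expR_ge0// exp3.
rewrite ler_pdivrMr//; apply: le_trans H4 _.
by apply: le_of_eq; ring.
Qed.

(** With three squares, the derivative of this function makes up
    [3 f^2 - 18 volt^2 / t]; it tends to 0 at both ends. *)
Let Bf t : R := (-32 * (nu t * nu t) + (-16 * (nu t * ga t) + -6 * (ga t * ga t))) +
  ((32 * (nu t * nu t) + 6 * (ga t * ga t)) + (-12 * (volt t * ga t) + 9 * (volt t * volt t))) * t^-1.

Let cadd g h t : {for t, continuous g} -> {for t, continuous h} -> {for t, continuous (fun s => g s + h s)}.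
Proof. by move=> *; exact: cvgD. Qed.
Let cmul g h t : {for t, continuous g} -> {for t, continuous h} -> {for t, continuous (fun s => g s * h s)}.
Proof. by move=> *; exact: cvgM. Qed.
Let copp g t : {for t, continuous g} -> {for t, continuous (fun s => - g s)}.
Proof. by move=> *; exact: cvgN. Qed.
Let B_bound (a g v y P Q : R) : `|a| <= P -> `|g| <= Q -> `|v| <= Q -> Q <= P -> 0 <= y ->
  `|(-32 * (v * v) + (-16 * (v * g) + -6 * (g * g))) + ((32 * (v * v) + 6 * (g * g)) + (-12 * (a * g) + 9 * (a * a))) * y| <= 54 * (Q * Q) + 59 * (P * P) * y.
Proof.
move=> aP gQ vQ QP y0.
have Q0 : 0 <= Q := le_trans (normr_ge0 _) gQ.
have P0 : 0 <= P := le_trans (normr_ge0 _) aP.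
have pr (x z X Z : R) : `|x| <= X -> `|z| <= Z -> `|x * z| <= X * Z.
  by move=> xX zZ; rewrite normrM; exact: ler_pM.
have vv := pr _ _ _ _ vQ vQ; have vg := pr _ _ _ _ vQ gQ; have gg := pr _ _ _ _ gQ gQ.
have ag := pr _ _ _ _ aP (le_trans gQ QP); have aa := pr _ _ _ _ aP aP.
have QQ : Q * Q <= P * P by exact: ler_pM.
move: vv vg gg ag aa QQ; rewrite !ler_norml.
move: (v * v) (v * g) (g * g) (a * g) (a * a) (Q * Q) (P * P) => b1 b2 b3 b4 b5 q p.
move=> /andP[? ?] /andP[? ?] /andP[? ?] /andP[? ?] /andP[? ?] ?.
set X := (32 * b1 + 6 * b3 + (-12 * b4 + 9 * b5)); have X1 : X <= 59 * p by rewrite /X; lra.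
have X2 : - (59 * p) <= X by rewrite /X; lra.
have := ler_wpM2r y0 X1; have := ler_wpM2r y0 X2; rewrite (mulNr (59 * p)).
by move: (X * y) (59 * p * y) => z w *; apply/andP; split; lra.
Qed.

(** The eigenvalues of the form with respect to [\int f^2] are 1/2, 1/4, 1/6, and
    so on; the two moments remove the first two. *)
Lemma hardy_sixth : 6 * Rint dens <= Rint (fun s => f s ^+ 2).
Proof.
pose B' t : R := (-32 * (2 * nu t * (nu t + ga t / 2)) + (-16 * ((nu t + ga t / 2) * ga t + nu t * (ga t + f t)) + -6 * (2 * ga t * (ga t + f t)))) +
  (((32 * (2 * nu t * (nu t + ga t / 2)) + 6 * (2 * ga t * (ga t + f t))) + (-12 * ((- volt t + f t) * ga t + volt t * (ga t + f t)) + 9 * (2 * volt t * (- volt t + f t)))) * t^-1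
  + ((32 * (nu t * nu t) + 6 * (ga t * ga t)) + (-12 * (volt t * ga t) + 9 * (volt t * volt t))) * (- t^-1 ^+ 2)).
have [] : intble leb dens /\ 18 * Rint dens <= 3 * Rint (fun s => f s ^+ 2); last by move=> _; lra.
(* [B'] is the derivative of [Bf] computed from the three differential equations *)
apply: (@halfline_certificate f dens Bf B').
- by [].
- exact: f2_int.
- exact: continuous_measurable_fun dens_cont.
- exact: dens_ge0.
- by move=> t t0; rewrite /dens volt_z// expr0n/= mul0r.
- move=> t t0; have dn := nu_der t0; have dg := ga_der t0; have da := volt_der t0.
  have d1 := derD (derZ (-32) (derM dn dn)) (derD (derZ (-16) (derM dn dg)) (derZ (-6) (derM dg dg))).
  have d2 := derD (derD (derZ 32 (derM dn dn)) (derZ 6 (derM dg dg))) (derD (derZ (-12) (derM da dg)) (derZ 9 (derM da da))).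
  by apply: (derive_eqR (derD d1 (derM d2 (derV t0)))); rewrite /B'; ring.
- move=> t t0; have cn : {for t, continuous nu} := der_cont (nu_der t0).
  have cg : {for t, continuous ga} := der_cont (ga_der t0).
  have ca : {for t, continuous volt} := der_cont (volt_der t0).
  have cft : {for t, continuous f} := @cf t.
  have cV : {for t, continuous (fun t : R => t^-1)} := der_cont (derV t0).
  have cV2 : {for t, continuous (fun t : R => - t^-1 ^+ 2)}.
    have -> : (fun t : R => - t^-1 ^+ 2) = (fun t => -1 * (t^-1 * t^-1)) by apply/funext => s; rewrite mulN1r expr2.
    by apply: cvgM; [exact: cvg_cst|exact: cvgM].
  have cK (k : R) : {for t, continuous (fun _ : R => k)} by exact: cvg_cst.
  pose ng := cadd cn (cmul cg (cK 2^-1)); pose gf := cadd cg cft; pose af := cadd (copp ca) cft.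
  pose T1 := cadd (cmul (cK (-32)) (cmul (cmul (cK 2) cn) ng)) (cadd (cmul (cK (-16)) (cadd (cmul ng cg) (cmul cn gf))) (cmul (cK (-6)) (cmul (cmul (cK 2) cg) gf))).
  pose T2 := cadd (cadd (cmul (cK 32) (cmul (cmul (cK 2) cn) ng)) (cmul (cK 6) (cmul (cmul (cK 2) cg) gf))) (cadd (cmul (cK (-12)) (cadd (cmul af cg) (cmul ca gf))) (cmul (cK 9) (cmul (cmul (cK 2) ca) af))).
  pose T3 := cadd (cadd (cmul (cK 32) (cmul cn cn)) (cmul (cK 6) (cmul cg cg))) (cadd (cmul (cK (-12)) (cmul ca cg)) (cmul (cK 9) (cmul ca ca))).
  exact: (cadd T1 (cadd (cmul T2 cV) (cmul T3 cV2))).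
- move=> t t0; rewrite -subr_ge0 /B' /dens.
  set a := volt t; set g := ga t; set v := nu t; set x := f t.
  (* the three squares *)
  have -> : 3 * x ^+ 2 - 18 * (a ^+ 2 / t) -
    ((-32 * (2 * v * (v + g / 2)) + (-16 * ((v + g / 2) * g + v * (g + x)) + -6 * (2 * g * (g + x)))) +
    (((32 * (2 * v * (v + g / 2)) + 6 * (2 * g * (g + x))) + (-12 * ((- a + x) * g + a * (g + x)) + 9 * (2 * a * (- a + x)))) / t +
     ((32 * (v * v) + 6 * (g * g)) + (-12 * (a * g) + 9 * (a * a))) * (- t^-1 ^+ 2))) =
    (8 * v + 4 * g + x - (4 * v + g) / t) ^+ 2 + ((2 * g + x + (4 * v - g) / t) ^+ 2 + (x + (2 * g - 3 * a) / t) ^+ 2).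
    by field; rewrite gt_eqF.
  by rewrite !addr_ge0 ?sqr_ge0.
- by [].
- apply: (@sq_cvg0 _ (113 * ((3 * C) * (3 * C)))) => n.
  have x0 : 0 < n.+2%:R^-1 :> R by rewrite invr_gt0 ltr0n.
  have x1 : n.+2%:R^-1 <= 1 :> R by rewrite invf_le1 ?ler1n ?ltr0n.
  have t0 : 0 < n.+2%:R :> R by rewrite ltr0n.
  have wx : w1 n.+2%:R <= n.+2%:R^-1 :> R.
    rewrite /w1; move: (n.+2%:R : R) t0 => t t0.
    have h0 : 0 < 1 + t ^+ 2 by have := sqr_ge0 t; lra.
    have h1 : t <= 1 + t ^+ 2 by have := sqr_ge0 (t - 1); have := sqr_ge0 (t + 1); rewrite !expr2; lra.
    by rewrite -(ler_pM2l h0) mulfV ?gt_eqF// -(ler_pM2r t0) mul1r -mulrA mulVf ?gt_eqF// mulr1.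
  have D0 : 0 <= 3 * C by rewrite mulr_ge0.
  have h1 : `|volt n.+2%:R| <= 3 * C by apply: le_trans (volt_bd2 _) _; move: C0; lra.
  have h2 : `|ga n.+2%:R| <= 3 * C * n.+2%:R^-1.
    apply: le_trans (ga_inf t0) _; by apply: ler_pM; [exact: C0|exact: w1_ge0|move: C0; lra|exact: wx].
  have h3 : `|nu n.+2%:R| <= 3 * C * n.+2%:R^-1.
    apply: le_trans (nu_inf t0) _; rewrite mulrA; by apply: ler_pM; [move: C0; lra|exact: w1_ge0|move: C0; lra|exact: wx].
  have h4 : 3 * C * n.+2%:R^-1 <= 3 * C by rewrite ler_piMr.
  apply: le_trans (B_bound h1 h2 h3 h4 (ltW x0)) _.
  move: (n.+2%:R^-1 : R) x0 x1 => x x0 x1; move: (3 * C) D0 => D D0.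
  have : D * x * (D * x) <= D * D * x.
    have -> : D * x * (D * x) = D * D * x * x by ring.
    by rewrite ler_piMr// mulr_ge0 ?mulr_ge0// ltW.
  by move: (D * x * (D * x)) => y yy; rewrite -[59 * _ * x]mulrA -[113 * _ * x]mulrA; move: yy; move: (D * D * x) => z; lra.
- apply: (@sq_cvg0 _ (113 * ((3 * C) * (3 * C)))) => n.
  have x0 : 0 < n.+2%:R^-1 :> R by rewrite invr_gt0 ltr0n.
  have x1 : n.+2%:R^-1 <= 1 :> R by rewrite invf_le1 ?ler1n ?ltr0n.
  have D0 : 0 <= 3 * C by rewrite mulr_ge0.
  move: (n.+2%:R^-1 : R) x0 x1 => x x0 x1.
  have h1 : `|volt x| <= 3 * C * x.
    apply: le_trans (volt_bd1 _) _; rewrite pos_id ?(ltW x0)//.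
    by rewrite ler_wpM2r ?(ltW x0)//; move: C0; lra.
  have xV : 0 <= x^-1 by rewrite invr_ge0 ltW.
  apply: le_trans (B_bound h1 (ga_zero x0 x1) (nu_zero x0 x1) (lexx _) xV) _.
  move: (3 * C) D0 => D D0.
  have -> : 59 * (D * x * (D * x)) / x = 59 * (D * D * x) by field; rewrite gt_eqF.
  have : D * x * (D * x) <= D * D * x.
    have -> : D * x * (D * x) = D * D * x * x by ring.
    by rewrite ler_piMr// mulr_ge0 ?mulr_ge0// ltW.
  by move: (D * x * (D * x)) => y yy; rewrite -[113 * _ * x]mulrA; move: yy; move: (D * D * x) => z; lra.
Qed.

End Volterra.
End HalfLine.

(** * Profiles of the soliton *)
Section ExponentialMoments.
Context {R : realType}.
Local Notation leb := (@lebesgue_measure R).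
Local Notation cintble := (cintegrable leb).
Local Notation R1 := (measurableTypeR R).
Implicit Types (f F G : R -> R[i]) (s t : R).

Lemma ccvg0_le (z_ : nat -> R[i]) (K : R) : (forall n, `N (z_ n) <= K * w1 (n.+1%:R : R)) -> ccvg z_ 0.
Proof.
move=> zK; apply: (@cvg_le0 R _ (fun n => K * n.+1%:R^-1)).
  move=> n; rewrite subr0 normc_ge0/=.
  have K0 : 0 <= K.
    have := le_trans (normc_ge0 _) (zK n); rewrite pmulr_lge0//; exact: w1_gt0.
  apply: le_trans (zK n) _; rewrite ler_wpM2l// /w1.
  have t1 : 1 <= n.+1%:R :> R by rewrite ler1n.
  move: (n.+1%:R : R) t1 => t t1.
  have h0 : 0 < 1 + t ^+ 2 by have := sqr_ge0 t; lra.
  have t0 : 0 < t by lra.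
  have h1 : t <= 1 + t ^+ 2 by rewrite expr2; nra.
  by rewrite lef_pV2.
by rewrite -[X in _ --> X](mulr0 K); apply: cvgM; [exact: cvg_cst|exact: cvg_inv0].
Qed.

(** The boundary term at infinity is absent. *)
Lemma cFTC_halfline f F : ccont f -> (forall s, 0 <= s -> hasder F s 1 (f s)) ->
  cintble (fun s : R1 => f s * (\1_`[0, +oo[ s)%:C) -> ccvg (fun n => F n.+1%:R) 0 ->
  cintegral leb (fun s : R1 => f s * (\1_`[0, +oo[ s)%:C) = - F 0.
Proof.
move=> [c1 c2] dF [i1 i2] /ccvgP[l1 l2].
have fE1 : (fun s => Re (f s * (\1_`[0, +oo[ s)%:C)) = (fun s => Re (f s) * \1_`[0, +oo[ s).
  by apply/funext => s; rewrite ReM ReC ImC mulr0 subr0.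
have fE2 : (fun s => Im (f s * (\1_`[0, +oo[ s)%:C)) = (fun s => Im (f s) * \1_`[0, +oo[ s).
  by apply/funext => s; rewrite ImM ReC ImC mulr0 add0r.
have i1' : intble leb (fun s => Re (f s) * \1_`[0, +oo[ s) by rewrite -fE1; exact: i1.
have i2' : intble leb (fun s => Im (f s) * \1_`[0, +oo[ s) by rewrite -fE2; exact: i2.
rewrite /cintegral fE1 fE2.
have l1' : Re (F (0 + n.+1%:R)) @[n --> \oo] --> (0 : R).
  by apply: (cvg_eq _ l1) => n; rewrite add0r.
have l2' : Im (F (0 + n.+1%:R)) @[n --> \oo] --> (0 : R).
  by apply: (cvg_eq _ l2) => n; rewrite add0r.
rewrite (FTC_halfline (fun x _ => c1 x) (fun x h => (dF x h).1) i1' l1').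
rewrite (FTC_halfline (fun x _ => c2 x) (fun x h => (dF x h).2) i2' l2').
by rewrite !sub0r -ReN -ImN; case: (- F 0).
Qed.
Lemma pexp_le k (a : R) : 0 < a ->
  exists2 C, 0 <= C & forall s, 0 <= s -> s ^+ k * expR (- (a * s)) <= C * w1 s.
Proof.
move=> a0; have an n : 0 < a ^+ n by rewrite exprn_gt0.
exists (k`!%:R / a ^+ k + k.+2`!%:R / a ^+ k.+2).
  by rewrite addr_ge0// divr_ge0// ltW.
move=> s s0; rewrite /w1 ler_pdivlMr; last by rewrite ltr_wpDr ?sqr_ge0.
have h n : s ^+ n * expR (- (a * s)) <= n`!%:R / a ^+ n.
  rewrite ler_pdivlMr// expRN mulrAC -exprMn [s * a]mulrC ler_pdivrMr ?expR_gt0//.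
  by apply: expR_power; rewrite mulr_ge0// ltW.
rewrite mulrDr mulr1; apply: lerD; first exact: h.
have -> : s ^+ k * expR (- (a * s)) * s ^+ 2 = s ^+ k.+2 * expR (- (a * s)) by rewrite mulrAC -exprD addn2.
exact: h.
Qed.

Definition pcexp k (a b : R) s : R[i] := (s ^+ k)%:C * cexp a b s.

Lemma pcexp_le k (a b : R) : 0 < a -> exists2 C, 0 <= C & forall s, 0 <= s -> `N (pcexp k a b s) <= C * w1 s.
Proof.
move=> a0; have [C C0 h] := pexp_le k a0; exists C => // s s0.
by rewrite /pcexp normcM normcR normc_cexp ger0_norm ?exprn_ge0 ?h.
Qed.
Lemma ccont_pcexp k a b : ccont (pcexp k a b).
Proof. by apply: ccontM; [apply: ccontR; exact: exprn_continuous|exact: ccont_cexp]. Qed.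

Lemma meas_half : measurable_fun setT (\1_`[0, +oo[ : R1 -> R).
Proof. by apply: measurable_indic; exact: measurable_itv. Qed.

Lemma pcexp_int k (a b : R) : 0 < a -> cintble (fun s : R1 => pcexp k a b s * (\1_`[0, +oo[ s)%:C).
Proof.
move=> a0; have [C C0 h] := pcexp_le k b a0.
apply: (@cint_dom1 R _ (fun s => C * w1 s)); last by apply: intbleZ; exact: intble_w1.
  apply: cmeasurableM; first exact: ccont_meas (ccont_pcexp k a b).
  by apply: cmeasurableC; exact: meas_half.
move=> s; rewrite normcM normcR ger0_norm// indicE.
case: (boolP (s \in _)) => [|_]; last by rewrite mulr0 mulr_ge0 ?w1_ge0.
by rewrite inE/= in_itv/= andbT mulr1; exact: h.
Qed.

(** Integration by parts lowers the power [k]. *)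
Lemma pcexp_val k (a b : R) : 0 < a ->
  cintegral leb (fun s : R1 => pcexp k a b s * (\1_`[0, +oo[ s)%:C) =
  (k`!%:R)%:C * (a%:C - 'i%C * b%:C)^-1 ^+ k.+1.
Proof.
move=> a0; elim: k => [|k IH].
  rewrite fact0 mul1r expr1 -[RHS]mul1r.
  have <- : cexp a b 0 = 1 by rewrite /cexp !mulr0 oppr0 expR0 cis0 mulr1.
  rewrite -(cintegral_cexp _ _ a0); apply: eq_cintegral => s.
  by rewrite /pcexp expr0 mul1r.
have z0 : a%:C - 'i%C * b%:C != 0 :> R[i].
  by apply/eqP => /(congr1 (@Re R)); rewrite !cE; move=> h; lra.
pose f s := (k.+1%:R)%:C * pcexp k a b s - (a%:C - 'i%C * b%:C) * pcexp k.+1 a b s.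
have cf : ccont f.
  have -> : f = fun s => (k.+1%:R)%:C * pcexp k a b s + (- (a%:C - 'i%C * b%:C)) * pcexp k.+1 a b s.
    by apply/funext => s; rewrite /f mulNr.
  by apply: ccontD; (apply: ccontM; [exact: ccont_cst|exact: ccont_pcexp]).
have dF s : hasder (pcexp k.+1 a b) s 1 (f s).
  have dp : hasder (fun s : R => (s ^+ k.+1)%:C) s 1 (k.+1%:R * s ^+ k)%:C.
    apply: hasderR; have := @is_deriveX _ _ (fun t : R => t) k.+1 s 1 1 (is_derive_id _ _).
    by rewrite exprfctE => /is_derive_eq; apply; rewrite /GRing.scale/= mulr1.
  apply: (hasder_eq (hasderM dp (hasder_cexp a b s))).
  rewrite /f /pcexp !RCM; move: (cexp a b s) (s ^+ k)%:C (s ^+ k.+1)%:C => *.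
  by ring.
have i1 := pcexp_int k b a0; have i2 := pcexp_int k.+1 b a0.
have fE s : (k.+1%:R)%:C * (pcexp k a b s * (\1_`[0, +oo[ s)%:C) - (a%:C - 'i%C * b%:C) * (pcexp k.+1 a b s * (\1_`[0, +oo[ s)%:C) = f s * (\1_`[0, +oo[ s)%:C.
  by rewrite /f; ring.
have e1 := cintZ (k.+1%:R)%:C i1; have e2 := cintZ (a%:C - 'i%C * b%:C) i2.
have if_ : cintble (fun s : R1 => f s * (\1_`[0, +oo[ s)%:C).
  by have := cintB e1 e2; rewrite (funext fE).
have lF : ccvg (fun n => pcexp k.+1 a b n.+1%:R) 0.
  by have [C C0 h] := pcexp_le k.+1 b a0; apply: (@ccvg0_le _ C) => n; exact: h.
have := cFTC_halfline cf (fun s _ => dF s) if_ lF.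
rewrite -(eq_cintegral leb fE) (cintegralB e1 e2) (cintegralZ _ i1) (cintegralZ _ i2) IH.
rewrite {2}/pcexp expr0n/= mul0r oppr0 factS natrM RCM.
move: (cintegral _ _) => X; move: (a%:C - 'i%C * b%:C) z0 => z z0.
move/eqP; rewrite subr_eq0 => /eqP E.
apply: (mulfI z0); rewrite -E [_ ^+ k.+2]exprS; move: (z^-1 ^+ k.+1) => W.
by field.
Qed.

Lemma pexp_val k (a : R) : 0 < a ->
  intble leb (fun s => s ^+ k * expR (- (a * s)) * \1_`[0, +oo[ s) /\
  Rintegral leb setT (fun s => s ^+ k * expR (- (a * s)) * \1_`[0, +oo[ s) = k`!%:R / a ^+ k.+1.
Proof.
move=> a0; have [i1 _] := pcexp_int k 0 a0; have := pcexp_val k 0 a0.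
have fE : (fun s => Re (pcexp k a 0 s * (\1_`[0, +oo[ s)%:C)) = (fun s => s ^+ k * expR (- (a * s)) * \1_`[0, +oo[ s).
  by apply/funext => s; rewrite /pcexp /cexp mul0r cis0 mulr1 -!RCM ReC.
split; first by rewrite -fE; exact: i1.
have := congr1 (@Re R) (pcexp_val k 0 a0); rewrite {1}/cintegral/= fE => ->.
by rewrite mulr0 subr0 -RCV ?gt_eqF// -rmorphXn -RCM ReC exprVn.
Qed.

End ExponentialMoments.

Section HardyCalculus.
Context {R : realType}.
Local Notation leb := (@lebesgue_measure R).
Local Notation R1 := (measurableTypeR R).
Implicit Types (f F G psi : R -> R[i]) (s t : R) (p : heis R).

Lemma pos_cont : continuous (pos : R -> R).
Proof.
have -> : (pos : R -> R) = (fun x => Num.max x 0) by [].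
by move=> x; apply: continuous_max; [exact: cvg_id|exact: cvg_cst].
Qed.
Lemma ccont_wav p : ccont (fun s => wav s p).
Proof.
apply: ccontM.
  apply: ccontR => s; apply: (@continuous_comp _ _ _ (fun s : R => - pos s * r2 p) expR); last exact: continuous_expR.
  by apply: cvgM; [apply: cvgN; exact: pos_cont|exact: cvg_cst].
by apply: ccont_cis => s; apply: cvgM; [exact: pos_cont|exact: cvg_cst].
Qed.
Lemma wav_cexp s p : 0 <= s -> wav s p = cexp (r2 p) p.2 s.
Proof.
by move=> s0; rewrite /wav /cexp pos_id// mulNr [s * r2 p]mulrC [s * p.2]mulrC.
Qed.

(** Integrate by parts in [s]: the condition on [F] at 0 removes the boundary
    term, and [d_s e^{isz} = i z e^{isz}]. *)
Lemma J_der F F' p : prof F -> prof F' -> (forall s, 0 < s -> hasder F s 1 (F' s)) ->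
  (exists C, forall s, `N (F s) <= C * pos s ^+ 2) ->
  J F' p = ((r2 p)%:C - 'i%C * (p.2)%:C) * J F p.
Proof.
move=> pF pF' dF [C hC]; have [cF zF [D D0 bF]] := pF; have [cF' zF' _] := pF'.
have iF := int_J p (prof_int pF); have iF' := int_J p (prof_int pF').
pose c : R[i] := - (r2 p)%:C + 'i%C * (p.2)%:C.
pose g s := F' s * wav s p + c * (F s * wav s p).
have cg : ccont g.
  apply: ccontD; first by apply: ccontM => //; exact: ccont_wav.
  by apply: ccontM; [exact: ccont_cst|apply: ccontM => //; exact: ccont_wav].
have dg s : hasder (fun s => F s * wav s p) s 1 (g s).
  have [s0|s0] := leP s 0.
    apply: (hasder_eq (hasder_zero (C := C) s0 _)).
      move=> t; rewrite normcM; apply: le_trans (hC t).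
      by rewrite ler_piMr ?normc_ge0 ?wav_le1.
    by rewrite /g zF// zF'// !(mul0r, mulr0) addr0.
  apply: (hasder_near (G := fun s => F s * cexp (r2 p) p.2 s) s0).
    by move=> t t0; rewrite wav_cexp// ltW.
  apply: (hasder_eq (hasderM (dF s s0) (hasder_cexp _ _ s))).
  rewrite /g /c wav_cexp ?(ltW s0)//; move: (cexp _ _ _) (F s) (F' s) => *; ring.
have ig : cintegrable leb (g : R1 -> R[i]) := cintD iF' (cintZ c iF).
have := cint_der0 (C := D) dg cg.1 cg.2 ig (fun s => le_trans _ (bF s)).
have nb s : `N (F s * wav s p) <= `N (F s) by rewrite normcM ler_piMr ?normc_ge0 ?wav_le1.
move/(_ nb).
rewrite (cintegralD iF' (cintZ c iF)) (cintegralZ c iF) -/(J F' p) -/(J F p) => /eqP.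
by rewrite addr_eq0 => /eqP ->; rewrite /c; move: (J F p) => *; ring.
Qed.

(** [ek k] is the profile of [k`! * (i / (z + i)) ^ k.+1]. *)
Definition ek k : R -> R[i] := fun s => pcexp k 1 0 s * (\1_`[0, +oo[ s)%:C.
Lemma ekE k s : ek k s = (s ^+ k * expR (- s) * \1_`[0, +oo[ s)%:C.
Proof. by rewrite /ek /pcexp /cexp mul0r cis0 mulr1 mul1r -!RCM. Qed.
Lemma ek_int k : cintegrable leb (ek k : R1 -> R[i]).
Proof. exact: pcexp_int. Qed.
Lemma J_ek k p : J (ek k) p = (k`!%:R)%:C * ('i%C / den p) ^+ k.+1.
Proof.
have a0 : 0 < 1 + r2 p by rewrite ltr_wpDr ?r2_ge0.
have -> : J (ek k) p = cintegral leb (fun s : R1 => pcexp k (1 + r2 p) p.2 s * (\1_`[0, +oo[ s)%:C).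
  apply: eq_cintegral => s; rewrite ekE indicE; case: (boolP (s \in _)) => [|_]; last by rewrite mulr0 mul0r mulr0.
  rewrite inE/= in_itv/= andbT => s0; rewrite wav_cexp// /pcexp /cexp !mulr1 RCM (mulrDl 1 (r2 p)) mul1r opprD expRD RCM.
  by move: (expR _)%:C (expR _)%:C (cis _) => *; ring.
have dn := den_neq0 p.
have i2 : 'i%C * 'i%C = -1 :> R[i] by rewrite -expr2 sqr_i.
have E : den p = 'i%C * ((1 + r2 p)%:C - 'i%C * (p.2)%:C).
  by rewrite mulrBr mulrA i2 /den (RCD 1); ring.
have KE : ((1 + r2 p)%:C - 'i%C * (p.2)%:C)^-1 = 'i%C / den p.
  move: dn; rewrite E; move: ((1 + r2 p)%:C - _) => z; rewrite mulf_eq0 negb_or => /andP[i0 z0].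
  by rewrite invfM mulrA mulfV// mul1r.
by rewrite (pcexp_val _ _ a0) KE.
Qed.

Lemma Qplus_ek p : Qplus p = (Num.sqrt 2)%:C * J (ek 0) p.
Proof. by rewrite J_ek fact0 mul1r expr1 /Qplus mulrA. Qed.
Lemma Qplus2_ek p : Qplus p ^+ 2 = 2%:C * J (ek 1) p.
Proof.
rewrite Qplus_ek exprMn -rmorphXn/= sqr_sqrtr// !J_ek fact0 expr1 !mul1r.
by [].
Qed.
Lemma pdQplus_ek p : pd es Qplus p = (Num.sqrt 2)%:C * 'i%C * J (ek 1) p.
Proof.
apply: hasder_pd; apply/hasder_es.
have dn := den_neq0 p.
have h0 : hasder (fun t : R => t%:C + ('i%C * (r2 p)%:C + 'i%C)) p.2 1 1.
  apply: (hasder_eq (hasderD (hasderR (is_derive_id _ _)) (hasder_cst _ _ _))).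
  by rewrite addr0.
have n0 : p.2%:C + ('i%C * (r2 p)%:C + 'i%C) != 0 by move: dn; rewrite /den addrA.
have := hasderM (hasder_cst ((Num.sqrt 2)%:C * 'i%C) _ _) (hasderV n0 h0).
have -> : (fun q : R => (Num.sqrt 2)%:C * 'i%C * (q%:C + ('i%C * (r2 p)%:C + 'i%C))^-1) = sline Qplus p.
  by apply/funext => q; rewrite /sline /Qplus /r2/= addrA.
move/hasder_eq; apply; rewrite addrA -/(den p) J_ek (_ : 1`!%:R = 1 :> R)// mul1r exprMn sqr_i.
by rewrite mul0r add0r; ring.
Qed.
End HardyCalculus.

(** * Multiplication by the soliton on profiles *)
Section ComplexVolterra.
Context {R : realType}.
Implicit Types (f F G psi : R -> R[i]) (s t : R) (p : heis R).

Definition re f s : R := Re (f s).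
Definition im f s : R := Im (f s).
(** The solution of [V' + V = f], [V 0 = 0]. *)
Definition V f : R -> R[i] := fun t => volt (re f) t +i* volt (im f) t.

Section profile.
Variables (f : R -> R[i]) (C : R).
Hypotheses (pf : prof f) (C0 : 0 <= C) (fC : forall s, `N (f s) <= C * w1 s).
Let rc : continuous (re f). Proof. by case: pf => [[c _] _ _]. Qed.
Let ic : continuous (im f). Proof. by case: pf => [[_ c] _ _]. Qed.
Let rz s : s <= 0 -> re f s = 0. Proof. by case: pf => [_ z _] s0; rewrite /re z. Qed.
Let iz s : s <= 0 -> im f s = 0. Proof. by case: pf => [_ z _] s0; rewrite /im z. Qed.
Let rb s : `|re f s| <= C * w1 s. Proof. by apply: le_trans (fC s); exact: normc_Re. Qed.
Let ib s : `|im f s| <= C * w1 s. Proof. by apply: le_trans (fC s); exact: normc_Im. Qed.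

Lemma re_hyps : [/\ continuous (re f), forall s, s <= 0 -> re f s = 0, 0 <= C & forall s, `|re f s| <= C * w1 s].
Proof. by []. Qed.
Lemma im_hyps : [/\ continuous (im f), forall s, s <= 0 -> im f s = 0, 0 <= C & forall s, `|im f s| <= C * w1 s].
Proof. by []. Qed.

Lemma V_der t : 0 < t -> hasder (V f) t 1 (- V f t + f t).
Proof.
move=> t0; split; rewrite ?ReD ?ImD ?ReN ?ImN.
  exact: (volt_der rc t0).
exact: (volt_der ic t0).
Qed.
Lemma V_cont : ccont (V f).
Proof. by split; [exact: (volt_cont rc C0 rb)|exact: (volt_cont ic C0 ib)]. Qed.
Lemma V_z t : t <= 0 -> V f t = 0.
Proof. by move=> t0; rewrite /V !volt_z. Qed.
End profile.

Let hw s : R := 2 * (expR (1 * s) * (4 + s ^+ 2)^-1).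
Let hw' s : R := 2 * (expR (1 * s) * (4 + s ^+ 2)^-1 - expR (1 * s) * (2 * s * (4 + s ^+ 2)^-1 ^+ 2)).
Let q0 s : 0 < 4 + s ^+ 2. Proof. by rewrite ltr_wpDr ?sqr_ge0. Qed.
Let hw_der s : is_derive s 1 hw (hw' s).
Proof.
have qn : 4 + s ^+ 2 != 0 by rewrite gt_eqF.
have d1 : is_derive s 1 (fun t : R => 4 + t ^+ 2) (2 * s).
  by apply: (derive_eqR (derD (is_derive_cst _ _ _) (is_derive_sqr s))); rewrite add0r.
have d2 : is_derive s 1 (fun t : R => (4 + t ^+ 2)^-1) (- (2 * s * (4 + s ^+ 2)^-1 ^+ 2)).
  apply: (is_derive_eq (is_deriveV (f := fun t : R => 4 + t ^+ 2) qn d1)).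
  by rewrite /GRing.scale/= exprVn; ring.
by apply: (derive_eqR (derZ 2 (derM (der_exp 1 s) d2))); rewrite /hw'; ring.
Qed.
Let hw_ge s : expR (1 * s) * (4 + s ^+ 2)^-1 <= hw' s.
Proof.
rewrite /hw' -mulrBr mulrCA ler_wpM2l ?expR_ge0// -subr_ge0.
have -> : 2 * ((4 + s ^+ 2)^-1 - 2 * s * (4 + s ^+ 2)^-1 ^+ 2) - (4 + s ^+ 2)^-1 = (s - 2) ^+ 2 * (4 + s ^+ 2)^-1 ^+ 2.
  by field; rewrite gt_eqF.
by rewrite mulr_ge0 ?sqr_ge0.
Qed.
Let hw_cont : continuous hw'.
Proof.
move=> s; have cq : {for s, continuous (fun t : R => (4 + t ^+ 2)^-1)}.
  apply: cvgV; first by rewrite gt_eqF.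
  by apply: cvgD; [exact: cvg_cst|exact: exprn_continuous].
have ce : {for s, continuous (fun t : R => expR (1 * t))} := der_cont (der_exp 1 s).
apply: cvgM; first exact: cvg_cst.
apply: cvgB; apply: cvgM => //.
apply: cvgM; first by apply: cvgM; [exact: cvg_cst|exact: cvg_id].
by apply: (@continuous_comp _ _ _ (fun t : R => (4 + t ^+ 2)^-1) (fun y => y ^+ 2)) => //; exact: exprn_continuous.
Qed.

(** Decay of [f] is inherited by [V f], as [e^{-t} \int_0^t e^s / (4 + s^2) ds] is
    at most [2 / (4 + t^2)]. *)
Lemma volt_w1 (g : R -> R) C t : continuous g -> 0 <= C -> (forall s, `|g s| <= C * w1 s) ->
  `|volt g t| <= 8 * C * w1 t.
Proof.
move=> cg C0 gC; rewrite /volt; case: ifPn => [t0|_]; last by rewrite normr0 !mulr_ge0 ?w1_ge0.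
have e1 s : 0 < 1 + s ^+ 2 by rewrite ltr_wpDr ?sqr_ge0.
have gq s : `|expR (1 * s) * g s| <= 4 * C * hw' s.
  apply: (@le_trans _ _ (4 * C * (expR (1 * s) * (4 + s ^+ 2)^-1))); last by rewrite ler_wpM2l ?hw_ge// mulr_ge0.
  rewrite normrM ger0_norm ?expR_ge0// [leRHS]mulrCA ler_wpM2l ?expR_ge0//.
  apply: le_trans (gC s) _; rewrite [4 * C]mulrC -mulrA ler_wpM2l// /w1.
  by rewrite -[leLHS]mul1r ler_pdivrMr// mulrAC ler_pdivlMr//; have := sqr_ge0 s; lra.
have cg' : continuous (fun s => expR (1 * s) * g s).
  by move=> s; apply: cvgM; [exact: cexpk|exact: cg].
have ch : continuous (fun s => 4 * C * hw' s) by move=> s; apply: cvgM; [exact: cvg_cst|exact: hw_cont].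
have H := prim_le cg' ch t0 (fun s _ => gq s) (fun s => derZ (4 * C) (hw_der s)).
rewrite normrM ger0_norm ?expR_ge0//; apply: le_trans (ler_wpM2l (expR_ge0 _) H) _.
have h0 : 0 <= hw 0 by rewrite /hw !mulr_ge0 ?expR_ge0 ?invr_ge0// ltW.
apply: (@le_trans _ _ (expR (-1 * t) * (4 * C * hw t))).
  by rewrite ler_wpM2l ?expR_ge0// gerBl mulr_ge0 ?mulr_ge0.
have E : expR (-1 * t) * expR (1 * t) = 1 by rewrite -expRD (_ : _ + _ = 0) ?expR0//; ring.
have -> : expR (-1 * t) * (4 * C * hw t) = (expR (-1 * t) * expR (1 * t)) * (8 * C * (4 + t ^+ 2)^-1) by rewrite /hw; ring.
rewrite E mul1r ler_wpM2l ?mulr_ge0// /w1 lef_pV2 ?posrE//.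
by rewrite lerD2r; lra.
Qed.

Lemma V_prof f : prof f -> prof (V f).
Proof.
move=> pf; have [cf zf [C C0 fC]] := pf; have [r1 r2 _ r3] := re_hyps pf C0 fC; have [i1 i2 _ i3] := im_hyps pf C0 fC.
split; [exact: (V_cont pf C0 fC)|exact: V_z|].
exists (16 * C); first by rewrite mulr_ge0.
move=> t; apply: le_trans (normc_leD _) _.
have -> : 16 * C * w1 t = 8 * C * w1 t + 8 * C * w1 t by ring.
by apply: lerD; exact: volt_w1.
Qed.

(** [V f] satisfies [(V f)' = f - V f], hence by [J_der]
    [J f = (1 - i z) J (V f)]; and [Q = sqrt 2 / (1 - i z)]. *)
Lemma Qplus_J f p : prof f -> (exists2 C, 0 <= C & forall s, `N (f s) <= C * pos s) ->
  Qplus p * J f p = (Num.sqrt 2)%:C * J (V f) p.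
Proof.
move=> pf [D D0 fD]; have [cf zf [C C0 fC]] := pf; have pV := V_prof pf.
have pN : prof (fun t => - V f t + f t).
  have [c1 z1 [C1 C10 b1]] := pV; split.
  - apply: ccontD => //; have -> : (fun t => - V f t) = (fun t => (-1) * V f t) by apply/funext => t; rewrite mulN1r.
    by apply: ccontM => //; exact: ccont_cst.
  - by move=> s s0; rewrite z1// zf// oppr0 addr0.
  - exists (C1 + C); first exact: addr_ge0.
    by move=> s; apply: le_trans (le_normcD _ _) _; rewrite normcN mulrDl lerD.
have b2 : exists K, forall s, `N (V f s) <= K * pos s ^+ 2.
  exists (2 * D) => t; have [t0|t0] := leP t 0; first by rewrite V_z// Normc.normc0 mulr_ge0 ?sqr_ge0 ?mulr_ge0.
  have one (g : R -> R) : continuous g -> (forall s, `|g s| <= D * pos s) -> `|volt g t| <= D * pos t ^+ 2.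
    move=> cg gD; rewrite /volt t0 (pos_id (ltW t0)).
    have cg' : continuous (fun s => expR (1 * s) * g s).
      by move=> s; apply: cvgM; [exact: cexpk|exact: cg].
    have H := @prim_le R (fun s => expR (1 * s) * g s) (fun=> expR (1 * t) * (D * t)) (fun s => expR (1 * t) * (D * t) * s) t cg' (fun=> @cvg_cst _ _ _ _ _) t0 _ _.
    have {}H : `|prim (fun s => expR (1 * s) * g s) t| <= expR (1 * t) * (D * t) * t - expR (1 * t) * (D * t) * 0.
      apply: H.
        move=> s /andP[s0 st]; rewrite normrM ger0_norm ?expR_ge0//.
        apply: ler_pM; rewrite ?expR_ge0// ?ler_expR ?mul1r//.
        by apply: le_trans (gD s) _; rewrite pos_id// ler_wpM2l.
      by move=> s; apply: (derive_eqR (derZ _ (is_derive_id s 1))); exact: mulr1.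
    rewrite normrM ger0_norm ?expR_ge0//; apply: le_trans (ler_wpM2l (expR_ge0 _) H) _.
    have E : expR (-1 * t) * expR (1 * t) = 1 by rewrite -expRD (_ : _ + _ = 0) ?expR0//; ring.
    rewrite mulr0 subr0; apply: le_of_eq.
    have -> : expR (-1 * t) * (expR (1 * t) * (D * t) * t) = (expR (-1 * t) * expR (1 * t)) * (D * t * t) by ring.
    by rewrite E mul1r expr2 mulrA.
  apply: le_trans (normc_leD _) _.
  have -> : 2 * D * pos t ^+ 2 = D * pos t ^+ 2 + D * pos t ^+ 2 by ring.
  have [r1 _ _ _] := re_hyps pf C0 fC; have [i1 _ _ _] := im_hyps pf C0 fC.
  apply: lerD; apply: one => // s; apply: le_trans (fD s); [exact: normc_Re|exact: normc_Im].
have iV := prof_int pV; have if_ := prof_int pf.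
have := J_der p pV pN (@V_der f pf) b2.
have -> : J (fun t => - V f t + f t) p = - J (V f) p + J f p.
  rewrite /J -(cintegralN (int_J p iV)) -(cintegralD (cintN (int_J p iV)) (int_J p if_)).
  by apply: eq_cintegral => s; move: (wav s p) => *; ring.
have dn := den_neq0 p; move=> E.
have {}E : J f p = (1 + (r2 p)%:C - 'i%C * (p.2)%:C) * J (V f) p.
  have -> : J f p = J (V f) p + (- J (V f) p + J f p) by rewrite addNKr.
  by rewrite E; ring.
rewrite E /Qplus -/(r2 p) -/(den p).
have i2 : 'i%C * 'i%C = -1 :> R[i] by rewrite -expr2 sqr_i.
have D1 : 'i%C * (1 + (r2 p)%:C - 'i%C * (p.2)%:C) = den p.
  by rewrite mulrBr mulrA i2 /den; ring.
rewrite mulrA; congr (_ * _).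
by rewrite mulrAC -[_ * 'i%C * _]mulrA D1 mulfK.
Qed.

End ComplexVolterra.

(** * Coercivity on profiles with small moments *)
Section Coercivity.
Context {R : realType}.
Local Notation leb := (@lebesgue_measure R).
Local Notation Rint := (Rintegral leb setT).
Local Notation cint := (cintegral leb).
Local Notation R1 := (measurableTypeR R).
Implicit Types (f g : R -> R) (s t : R).

Lemma volt_lin f g (a b : R) t : continuous f -> continuous g ->
  volt (fun s => a * f s + b * g s) t = a * volt f t + b * volt g t.
Proof.
move=> cf cg; rewrite /volt; case: ifP => _; last by rewrite !mulr0 addr0.
have ce h : continuous h -> continuous (fun s : R => expR (1 * s) * h s).
  by move=> ch s; apply: cvgM; [exact: cexpk|exact: ch].
have i1 := seg_int t (ce _ cf); have i2 := seg_int t (ce _ cg).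
have -> : prim (fun s => expR (1 * s) * (a * f s + b * g s)) t = a * prim (fun s => expR (1 * s) * f s) t + b * prim (fun s => expR (1 * s) * g s) t.
  rewrite /prim -(RintZ a i1) -(RintZ b i2) -(RintD (intbleZ a i1) (intbleZ b i2)).
  by congr (Rint _); apply/funext => s; ring.
by ring.
Qed.

(** Continuous on the whole line for [k > 0]: these correct the two moments of a
    profile. *)
Definition pe k s : R := pos s ^+ k * expR (- (1 * s)).
Lemma pe_cont k : continuous (pe k).
Proof.
move=> s; apply: cvgM; last exact: expR_cont.
by apply: (@continuous_comp _ _ _ (pos : R -> R) (fun y => y ^+ k)); [exact: pos_cont|exact: exprn_continuous].
Qed.
Lemma pe_z k s : s <= 0 -> pe k.+1 s = 0.
Proof. by move=> s0; rewrite /pe pos_neg// expr0n mul0r. Qed.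
Lemma pe_bd k : exists2 C, 0 <= C & forall s, `|pe k.+1 s| <= C * w1 s.
Proof.
have [C C0 h] := pexp_le (R := R) k.+1 ltr01; exists C => // s.
have [s0|s0] := leP s 0; first by rewrite pe_z// normr0 mulr_ge0 ?w1_ge0.
by rewrite /pe pos_id ?(ltW s0)// ger0_norm ?mulr_ge0 ?expR_ge0 ?exprn_ge0 ?(ltW s0)// h// ltW.
Qed.
Lemma pe_val k (h : R -> R) : (forall s, s <= 0 -> h s = 0) -> (forall s, 0 < s -> h s = s ^+ k * expR (- (2 * s))) ->
  (0 < k)%N -> Rint h = k`!%:R / 2 ^+ k.+1.
Proof.
move=> h0 h1 k0; have [_ <-] := pexp_val (R := R) k (ltr0Sn _ 1).
congr (Rint _); apply/funext => s; rewrite indicE.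
have [s0|s0] := ltP 0 s; first by rewrite h1// mem_set ?mulr1//= in_itv/= (ltW s0).
rewrite h0//; have [->|sn] := eqVneq s 0; first by rewrite expr0n gtn_eqF// !mul0r.
by rewrite memNset ?mulr0//= in_itv/= andbT leNgt lt_neqAle sn s0.
Qed.

Lemma sq11 (x y : R) : (x + y) ^+ 2 <= 11 / 10 * x ^+ 2 + 11 * y ^+ 2.
Proof. by have := sqr_ge0 (x - 10 * y); rewrite sqrrB sqrrD; lra. Qed.

Lemma sq2D (x y : R) : (x + y) ^+ 2 <= 2 * x ^+ 2 + 2 * y ^+ 2.
Proof. by rewrite sqrrD; have := sqr_ge0 (x - y); rewrite sqrrB; lra. Qed.
Lemma sq_a (c d : R) : (12 * c - 8 * d) ^+ 2 <= 288 * c ^+ 2 + 128 * d ^+ 2.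
Proof. by rewrite sqrrB !exprMn; have := sqr_ge0 (12 * c + 8 * d); rewrite sqrrD !exprMn; lra. Qed.
Lemma sq_b (c d : R) : (8 * (d - c)) ^+ 2 <= 128 * c ^+ 2 + 128 * d ^+ 2.
Proof. by rewrite exprMn sqrrB; have := sqr_ge0 (d + c); rewrite sqrrD; lra. Qed.

(** Subtracting from [f] a combination [g] of [s e^{-s}] and [s^2 e^{-s}] with
    the same two moments makes [hardy_sixth] available; [sq11] spreads the error
    so that the constant 6 only drops to 40/9. *)
Lemma hardy_moments f C : continuous f -> (forall s, s <= 0 -> f s = 0) -> 0 <= C ->
  (forall s, `|f s| <= C * w1 s) ->
  4 * Rint (dens f) <= 9 / 10 * Rint (fun s => f s ^+ 2) +
   11000 * (Rint (fun s => expR (-1 * s) * f s) ^+ 2 +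
            Rint (fun s => s * (expR (-1 * s) * f s)) ^+ 2).
Proof.
move=> cf fz C0 fC; set c := Rint (fun s => expR (-1 * s) * f s); set d := Rint (fun s => s * _).
pose b := 8 * (d - c); pose a := 12 * c - 8 * d.
have [C1 C10 b1] := pe_bd 0; have [C2 C20 b2] := pe_bd 1.
(* The moments of [s^k e^{-s}] against [e^{-s}] are 1/4, 1/4, 3/8 for [k = 1, 2, 3]:
   [a] and [b] solve the system that gives [g] the moments [c] and [d] of [f] *)
pose g s : R := a * pe 1 s + b * pe 2 s.
have cg : continuous g.
  by move=> s; apply: cvgD; (apply: cvgM; [exact: cvg_cst|exact: pe_cont]).
have gz s : s <= 0 -> g s = 0 by move=> s0; rewrite /g !pe_z// !mulr0 addr0.
pose D := `|a| * C1 + `|b| * C2.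
have D0 : 0 <= D by rewrite addr_ge0 ?mulr_ge0.
have gD s : `|g s| <= D * w1 s.
  apply: le_trans (ler_normD _ _) _; rewrite /D [X in _ <= X]mulrDl.
  have nM (x y K : R) : `|y| <= K * w1 s -> `|x * y| <= `|x| * K * w1 s by move=> h; rewrite normrM -mulrA ler_wpM2l.
  by apply: lerD; exact: nM.
pose f0 s : R := 1 * f s + (-1) * g s.
have cf0 : continuous f0.
  by move=> s; apply: cvgD; apply: cvgM; [exact: cvg_cst|exact: cf|exact: cvg_cst|exact: cg].
have f0z s : s <= 0 -> f0 s = 0 by move=> s0; rewrite /f0 fz// gz// !mulr0 addr0.
have CD0 : 0 <= C + D by rewrite addr_ge0.
have f0C s : `|f0 s| <= (C + D) * w1 s.
  by rewrite /f0 mul1r mulN1r mulrDl; apply: le_trans (ler_normB _ _) _; exact: lerD.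
have iexp (h : R -> R) K k : (forall s, s <= 0 -> h s = 0) -> continuous h -> 0 <= K -> (forall s, `|h s| <= K * w1 s) ->
    (k <= 1)%N -> intble leb (fun s => s ^+ k * (expR (-1 * s) * h s)).
  move=> hz ch K0 hK k1.
  apply: (@intble_le R _ R1 leb _ (fun s => K * w1 s)); last by apply: intbleZ; exact: intble_w1.
    apply: continuous_measurable_fun => s; apply: cvgM; first exact: exprn_continuous.
    by apply: cvgM; [exact: cexpk|exact: ch].
  move=> s; have [s0|s0] := leP s 0; first by rewrite hz// !mulr0 normr0 mulr_ge0 ?w1_ge0.
  apply: le_trans (hK s); rewrite mulrA normrM ler_piMl//.
  rewrite ger0_norm ?mulr_ge0 ?exprn_ge0 ?expR_ge0 ?(ltW s0)//.
  have e1 : expR (-1 * s) <= 1 by rewrite -[leRHS]expR0 ler_expR; move: s0; lra.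
  case: k k1 => [|[|//]] _; first by rewrite expr0 mul1r.
  have -> : -1 * s = - s by ring.
  by rewrite expr1 expRN ler_pdivrMr ?expR_gt0// mul1r; have := expR_ge1Dx s; lra.
have mom k : (k <= 1)%N -> Rint (fun s => s ^+ k * (expR (-1 * s) * g s)) = a * (k.+1`!%:R / 2 ^+ k.+2) + b * (k.+2`!%:R / 2 ^+ k.+3).
  move=> k1; have i1 := iexp (pe 1) C1 k (@pe_z 0) (@pe_cont 1) C10 b1 k1.
  have i2 := iexp (pe 2) C2 k (@pe_z 1) (@pe_cont 2) C20 b2 k1.
  have E2 (s : R) : expR (-1 * s) * expR (- (1 * s)) = expR (- (2 * s)) by rewrite -expRD; congr expR; ring.
  have v1 : Rint (fun s => s ^+ k * (expR (-1 * s) * pe 1 s)) = k.+1`!%:R / 2 ^+ k.+2.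
    apply: pe_val => // s s0; first by rewrite pe_z// !mulr0.
    by rewrite -E2 /pe pos_id ?(ltW s0)// !exprS; move: (expR _) (expR _) => *; ring.
  have v2 : Rint (fun s => s ^+ k * (expR (-1 * s) * pe 2 s)) = k.+2`!%:R / 2 ^+ k.+3.
    apply: pe_val => // s s0; first by rewrite pe_z// !mulr0.
    by rewrite -E2 /pe pos_id ?(ltW s0)// !exprS; move: (expR _) (expR _) => *; ring.
  rewrite -v1 -v2 -(RintZ a i1) -(RintZ b i2) -(RintD (intbleZ a i1) (intbleZ b i2)).
  by congr (Rint _); apply/funext => s; rewrite /g; ring.
have oc : Rint (fun s => expR (-1 * s) * f0 s) = 0.
  have i1 := iexp f C 0 fz cf C0 fC isT; have i2 := iexp g D 0 gz cg D0 gD isT.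
  have -> : (fun s => expR (-1 * s) * f0 s) = (fun s => s ^+ 0 * (expR (-1 * s) * f s) - s ^+ 0 * (expR (-1 * s) * g s)).
    by apply/funext => s; rewrite /f0 expr0; ring.
  rewrite (RintB i1 i2) mom//.
  have -> : (fun s => s ^+ 0 * (expR (-1 * s) * f s)) = (fun s => expR (-1 * s) * f s) by apply/funext => s; rewrite expr0 mul1r.
  by rewrite -/c /a /b !factS fact0; field.
have od : Rint (fun s => s * (expR (-1 * s) * f0 s)) = 0.
  have i1 := iexp f C 1 fz cf C0 fC isT; have i2 := iexp g D 1 gz cg D0 gD isT.
  have -> : (fun s => s * (expR (-1 * s) * f0 s)) = (fun s => s ^+ 1 * (expR (-1 * s) * f s) - s ^+ 1 * (expR (-1 * s) * g s)).
    by apply/funext => s; rewrite /f0 expr1; ring.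
  rewrite (RintB i1 i2) mom//.
  have -> : (fun s => s ^+ 1 * (expR (-1 * s) * f s)) = (fun s => s * (expR (-1 * s) * f s)) by apply/funext => s; rewrite expr1.
  by rewrite -/d /a /b !factS fact0; field.
have H6 := hardy_sixth cf0 f0z CD0 f0C oc od.
have [if0 _] := hardy_half cf0 CD0 f0C; have [ig H2] := hardy_half cg D0 gD; have [if_ _] := hardy_half cf C0 fC.
have sf := f2_int cf C0 fC; have sg := f2_int cg D0 gD; have sf0 := f2_int cf0 CD0 f0C.
have s1 := f2_int (@pe_cont 1) C10 b1; have s2 := f2_int (@pe_cont 2) C20 b2.
have L1 : Rint (dens f) <= 11 / 10 * Rint (dens f0) + 11 * Rint (dens g).
  rewrite -(RintZ _ if0) -(RintZ _ ig) -(RintD (intbleZ _ if0) (intbleZ _ ig)).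
  apply: (Rint_le if_ (intbleD (intbleZ _ if0) (intbleZ _ ig))) => s.
  have [s0|s0] := leP s 0; first by rewrite /dens !volt_z// expr0n/= mul0r !mulr0 addr0.
  rewrite /dens; have -> : 11 / 10 * (volt f0 s ^+ 2 * s^-1) + 11 * (volt g s ^+ 2 * s^-1) = (11 / 10 * volt f0 s ^+ 2 + 11 * volt g s ^+ 2) * s^-1 by ring.
  rewrite ler_wpM2r ?invr_ge0 ?(ltW s0)//.
  have -> : volt f s = volt f0 s + volt g s by rewrite /f0 (volt_lin _ _ s cf cg); ring.
  exact: sq11.
have L2 : Rint (fun s => f0 s ^+ 2) <= 11 / 10 * Rint (fun s => f s ^+ 2) + 11 * Rint (fun s => g s ^+ 2).
  rewrite -(RintZ _ sf) -(RintZ _ sg) -(RintD (intbleZ _ sf) (intbleZ _ sg)).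
  apply: (Rint_le sf0 (intbleD (intbleZ _ sf) (intbleZ _ sg))) => s.
  by have := sq11 (f s) (- g s); rewrite sqrrN /f0 mul1r mulN1r.
have v1 : Rint (fun s => pe 1 s ^+ 2) = 1 / 4.
  have := @pe_val 2 (fun s => pe 1 s ^+ 2); rewrite !factS fact0 => ->//.
  - by field.
  - by move=> s s0; rewrite pe_z// expr0n.
  - move=> s s0; rewrite /pe pos_id ?(ltW s0)// expr1 exprMn; congr (_ * _).
    by rewrite expr2 -expRD; congr expR; ring.
have v2 : Rint (fun s => pe 2 s ^+ 2) = 3 / 4.
  have := @pe_val 4 (fun s => pe 2 s ^+ 2); rewrite !factS fact0 => ->//.
  - by field.
  - by move=> s s0; rewrite pe_z// expr0n.
  - move=> s s0; rewrite /pe pos_id ?(ltW s0)// exprMn -exprM; congr (_ * _).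
    by rewrite expr2 -expRD; congr expR; ring.
have L3 : Rint (fun s => g s ^+ 2) <= 2 * a ^+ 2 * (1 / 4) + 2 * b ^+ 2 * (3 / 4).
  rewrite -v1 -v2 -(RintZ _ s1) -(RintZ _ s2) -(RintD (intbleZ _ s1) (intbleZ _ s2)).
  apply: (Rint_le sg (intbleD (intbleZ _ s1) (intbleZ _ s2))) => s; rewrite /g.
  have -> : 2 * a ^+ 2 * pe 1 s ^+ 2 = 2 * (a * pe 1 s) ^+ 2 by rewrite -mulrA -exprMn.
  have -> : 2 * b ^+ 2 * pe 2 s ^+ 2 = 2 * (b * pe 2 s) ^+ 2 by rewrite -mulrA -exprMn.
  exact: sq2D.
have ha : a ^+ 2 <= 288 * c ^+ 2 + 128 * d ^+ 2.
  exact: sq_a.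
have hb : b ^+ 2 <= 128 * c ^+ 2 + 128 * d ^+ 2.
  exact: sq_b.
have c2 := sqr_ge0 c; have d2 := sqr_ge0 d.
have f2 : 0 <= Rint (fun s => f s ^+ 2) by apply: Rint_ge0 => s; exact: sqr_ge0.
move: H6 H2 L1 L2 L3 ha hb c2 d2 f2.
move: (Rint (dens f)) (Rint (dens f0)) (Rint (dens g)) (Rint (fun s => f s ^+ 2)) (Rint (fun s => f0 s ^+ 2)) (Rint (fun s => g s ^+ 2)) (a ^+ 2) (b ^+ 2) (c ^+ 2) (d ^+ 2).
clear; move=> *; lra.
Qed.

Implicit Types (F G : R -> R[i]).

(** A measurable square root of [1 / t]. *)
Definition isq t : R := t `^ (- 2^-1).
Lemma isqM t : 0 < t -> isq t * isq t = t^-1.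
Proof.
move=> t0; rewrite /isq -powRD ?(gt_eqF t0) ?implybT//.
by rewrite (_ : - 2^-1 - 2^-1 = - 1) ?powRN ?powRr1 ?(ltW t0)//; field.
Qed.
(** [\int Vr F * conj (Vr G)] is the form [\int V F * conj (V G) / t]. *)
Definition Vr F t : R[i] := V F t * (isq t)%:C.
Lemma Vr_sq F t : `N (Vr F t) ^+ 2 = dens (re F) t + dens (im F) t.
Proof.
rewrite /Vr normcM normcR exprMn normcE2 /dens -mulrDl /=.
have [t0|t0] := leP t 0; first by rewrite !volt_z// expr0n/= addr0 !mul0r.
by rewrite real_normK ?num_real// (expr2 (isq t)) isqM.
Qed.
Lemma VrM F G t : Vr F t * (Vr G t)^* = (t^-1)%:C * (V F t * (V G t)^*).
Proof.
rewrite /Vr cJM cJR.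
have [t0|t0] := leP t 0; first by rewrite (V_z F t0) !mul0r mulr0.
by rewrite -(isqM t0) RCM; move: (V F t) (V G t)^* => *; ring.
Qed.
Lemma Vr_hardy F : prof F -> intble leb (fun t => `N (Vr F t) ^+ 2) /\
  2 * Rint (fun t => `N (Vr F t) ^+ 2) <= Rint (fun t => `N (F t) ^+ 2).
Proof.
move=> pF; have [_ _ [C C0 bF]] := pF.
have [c1 _ _ d1] := re_hyps pF C0 bF; have [c2 _ _ d2] := im_hyps pF C0 bF.
have [i1 h1] := hardy_half c1 C0 d1; have [i2 h2] := hardy_half c2 C0 d2.
have s1 := f2_int c1 C0 d1; have s2 := f2_int c2 C0 d2.
have -> : (fun t => `N (Vr F t) ^+ 2) = (fun t => dens (re F) t + dens (im F) t) by apply/funext => t; rewrite Vr_sq.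
have -> : (fun t => `N (F t) ^+ 2) = (fun t => re F t ^+ 2 + im F t ^+ 2) by apply/funext => t; rewrite normcE2.
split; first exact: intbleD.
rewrite (RintD i1 i2) (RintD s1 s2); move: h1 h2.
move: (Rint (dens (re F))) (Rint (dens (im F))) => x1 x2.
move: (Rint (fun s => re F s ^+ 2)) (Rint (fun s => im F s ^+ 2)) => y1 y2.
by clear; lra.
Qed.
Lemma meas_Vr F : prof F -> cmeasurable (Vr F : R1 -> R[i]).
Proof.
move=> /V_prof[c _ _]; apply: cmeasurableM; first exact: ccont_meas.
by apply: cmeasurableC; exact: measurable_powR.
Qed.
Definition bV F G : R[i] := cint (fun t : R1 => Vr F t * (Vr G t)^*).
Lemma bV_int F G : prof F -> prof G -> cintegrable leb (fun t : R1 => Vr F t * (Vr G t)^*).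
Proof.
move=> pF pG; apply: cint_sqM.
- exact: meas_Vr.
- by apply: cmeasurableJ; exact: meas_Vr.
- exact: (Vr_hardy pF).1.
- by apply: eq_intble (Vr_hardy pG).1 => t; rewrite normcJ.
Qed.
Lemma bV_CS F G : prof F -> prof G -> `N (bV F G) ^+ 2 <=
  4^-1 * (Rint (fun t => `N (F t) ^+ 2) * Rint (fun t => `N (G t) ^+ 2)).
Proof.
move=> pF pG; have [iF hF] := Vr_hardy pF; have [iG hG] := Vr_hardy pG.
have iG' : intble leb (fun t => `N ((Vr G t)^*) ^+ 2) by apply: eq_intble iG => t; rewrite normcJ.
have := CauchySchwarzC (meas_Vr pF) (cmeasurableJ (meas_Vr pG)) iF iG'; rewrite -/(bV F G).
have -> : (fun t => `N ((Vr G t)^*) ^+ 2) = (fun t => `N (Vr G t) ^+ 2) by apply/funext => t; rewrite normcJ.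
move=> h; apply: le_trans h _.
have p1 : 0 <= Rint (fun t => `N (Vr F t) ^+ 2) by apply: Rint_ge0 => t; exact: sqr_ge0.
have p2 : 0 <= Rint (fun t => `N (Vr G t) ^+ 2) by apply: Rint_ge0 => t; exact: sqr_ge0.
move: p1 p2 hF hG; move: (Rint (fun t => `N (Vr F t) ^+ 2)) (Rint (fun t => `N (Vr G t) ^+ 2)) => x y.
move: (Rint (fun t => `N (F t) ^+ 2)) (Rint (fun t => `N (G t) ^+ 2)) => z w x0 y0 hx hy.
have : (2 * x) * (2 * y) <= z * w by apply: ler_pM => //; exact: mulr_ge0.
by clear; lra.
Qed.
Lemma Vr_lin F G (a b : R) t : prof F -> prof G ->
  Vr (fun s => a%:C * F s + b%:C * G s) t = a%:C * Vr F t + b%:C * Vr G t.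
Proof.
move=> [[c1 c2] _ _] [[d1 d2] _ _].
have E : V (fun s => a%:C * F s + b%:C * G s) t = a%:C * V F t + b%:C * V G t.
  apply: cplxP; rewrite !cE !mul0r ?subr0 ?addr0 /V /=.
    rewrite -(volt_lin _ _ t c1 d1); congr (volt _ t); apply/funext => s.
    by rewrite /re !cE !mul0r !subr0.
  rewrite -(volt_lin _ _ t c2 d2); congr (volt _ t); apply/funext => s.
  by rewrite /im !cE !mul0r !addr0.
by rewrite /Vr E mulrDl !mulrA.
Qed.

Lemma Vr_coercive F : prof F ->
  4 * Rint (fun t => `N (Vr F t) ^+ 2) <= 9 / 10 * Rint (fun t => `N (F t) ^+ 2) +
  11000 * (`N (cint (fun s : R1 => (ek 0 s)^* * F s)) ^+ 2 + `N (cint (fun s : R1 => (ek 1 s)^* * F s)) ^+ 2).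
Proof.
move=> pF; have [_ zF [C C0 bF]] := pF.
have [c1 z1 _ d1] := re_hyps pF C0 bF; have [c2 z2 _ d2] := im_hyps pF C0 bF.
have [i1 _] := hardy_half c1 C0 d1; have [i2 _] := hardy_half c2 C0 d2.
have s1 := f2_int c1 C0 d1; have s2 := f2_int c2 C0 d2.
have -> : (fun t => `N (Vr F t) ^+ 2) = (fun t => dens (re F) t + dens (im F) t) by apply/funext => t; rewrite Vr_sq.
have -> : (fun t => `N (F t) ^+ 2) = (fun t => re F t ^+ 2 + im F t ^+ 2) by apply/funext => t; rewrite normcE2.
rewrite (RintD i1 i2) (RintD s1 s2).
have h1 := hardy_moments c1 z1 C0 d1; have h2 := hardy_moments c2 z2 C0 d2.
have kE k s : (ek k s)^* * F s = (s ^+ k * expR (-1 * s))%:C * F s.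
  have [s0|s0] := leP s 0; first by rewrite zF// !mulr0.
  rewrite ekE cJR indicE mem_set ?mulr1; first by congr ((_ * expR _)%:C * _); ring.
  by rewrite /= in_itv/= (ltW s0).
have rE k s : Re ((ek k s)^* * F s) = s ^+ k * (expR (-1 * s) * re F s) by rewrite kE !cE mul0r subr0 mulrA.
have iE k s : Im ((ek k s)^* * F s) = s ^+ k * (expR (-1 * s) * im F s) by rewrite kE !cE mul0r addr0 mulrA.
rewrite !normcE2 /cintegral/= (funext (rE 0)) (funext (iE 0)) (funext (rE 1)) (funext (iE 1)).
have e0 (h : R -> R) : (fun s => s ^+ 0 * h s) = h by apply/funext => s; rewrite expr0 mul1r.
have e1 (h : R -> R) : (fun s => s ^+ 1 * h s) = (fun s => s * h s) by apply/funext => s; rewrite expr1.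
rewrite !e0 !e1; move: h1 h2.
move: (Rint (dens (re F))) (Rint (dens (im F))) => x1 x2.
move: (Rint (fun s => re F s ^+ 2)) (Rint (fun s => im F s ^+ 2)) => y1 y2.
move: (Rintegral _ _ _) (Rintegral _ _ _) (Rintegral _ _ _) (Rintegral _ _ _); clear; move=> *; lra.
Qed.
End Coercivity.

(** * Weak limits of Hardy coefficients *)
Section Limits.
Context {R : realType}.

Lemma cvg_epsR (u_ : nat -> R) (l : R) : (forall e : R, 0 < e -> exists N, forall n, (N <= n)%N -> `|u_ n - l| <= e) ->
  u_ @ \oo --> l.
Proof.
move=> h; apply/cvgrPdist_le => e e0; have [N hN] := h e e0.
by exists N => // n Nn; rewrite distrC; exact: hN.
Qed.
Lemma cvgR_eps (u_ : nat -> R) (l : R) : u_ @ \oo --> l -> forall e : R, 0 < e ->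
  exists N, forall n, (N <= n)%N -> `|u_ n - l| <= e.
Proof.
move=> /cvgrPdist_le h e e0; have [N _ hN] := h e e0.
by exists N => n Nn; rewrite distrC; exact: hN.
Qed.
Lemma ccvg_epsP (z_ : nat -> R[i]) z : ccvg z_ z <-> forall e : R, 0 < e -> exists N, forall n, (N <= n)%N -> `N (z_ n - z) <= e.
Proof.
split=> [h e e0|h].
  have [N hN] := cvgR_eps h e0; exists N => n /hN; rewrite subr0 ger0_norm//; exact: normc_ge0.
apply: cvg_epsR => e /h[N hN]; exists N => n Nn; rewrite subr0 ger0_norm ?normc_ge0//; exact: hN.
Qed.
Lemma ccvg_eq (z_ : nat -> R[i]) (v_ : nat -> R[i]) z : z_ =1 v_ -> ccvg v_ z -> ccvg z_ z.
Proof. by move=> /funext ->. Qed.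
Lemma pow_le n (x y : R) : 0 <= x -> x <= y -> x ^+ n <= y ^+ n.
Proof. by move=> x0 xy; rewrite lerXn2r// nnegrE// (le_trans x0). Qed.
Lemma sqr_le (x e : R) : 0 <= e -> x ^+ 2 <= e ^+ 2 -> x <= e.
Proof.
move=> e0 h; have [x0|x0] := leP 0 x; last by rewrite (le_trans (ltW x0)).
by rewrite -(ler_pXn2r (n := 2))// nnegrE.
Qed.
(** The approximation error is bounded by [K * r k] whatever [m], so the limits
    in [m] and in [k] can be exchanged. *)
Lemma ccvg_exchange (z_ : nat -> R[i]) (B : nat -> nat -> R[i]) b z (r : nat -> R) (K : R) : (forall k, ccvg (B k) (b k)) ->
  ccvg b z -> r @ \oo --> (0 : R) -> 0 <= K -> (forall k m, `N (B k m - z_ m) ^+ 2 <= K * r k) -> ccvg z_ z.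
Proof.
move=> hB /ccvg_epsP hb hr K0 h; apply/ccvg_epsP => e e0.
have e3 : 0 < e / 3 by rewrite divr_gt0.
have e4 : 0 < (e / 3) ^+ 2 / (K + 1) by rewrite divr_gt0 ?exprn_gt0// ltr_wpDl.
have [N1 h1] := hb _ e3; have [N2 h2] := cvgR_eps hr e4.
pose k := maxn N1 N2; have b1 := h1 k (leq_maxl _ _); have b2 := h2 k (leq_maxr _ _).
have /ccvg_epsP/(_ _ e3)[N h3] := hB k; exists N => m Nm; have b3 := h3 m Nm.
have b4 : `N (B k m - z_ m) <= e / 3.
  apply: sqr_le; first exact: ltW.
  apply: le_trans (h k m) _; apply: (@le_trans _ _ (K * ((e / 3) ^+ 2 / (K + 1)))).
    by rewrite ler_wpM2l//; apply: le_trans b2; rewrite subr0 ler_norm.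
  have K1 : 0 < K + 1 by rewrite ltr_wpDl.
  by rewrite mulrA ler_pdivrMr// mulrC ler_wpM2l ?sqr_ge0// lerDl.
have -> : z_ m - z = (B k m - b k) + (b k - z) - (B k m - z_ m) by ring.
apply: le_trans (le_normcB _ _) _.
have := le_normcD (B k m - b k) (b k - z); lra.
Qed.
Lemma ccvg_le2 (z_ : nat -> R[i]) z c (K : R) N : ccvg z_ z -> (forall m, (N <= m)%N -> `N (z_ m - c) ^+ 2 <= K) -> `N (z - c) ^+ 2 <= K.
Proof.
move=> hz hK.
have hz' : ccvg (fun n => z_ (n + N)%N) z.
  apply/ccvg_epsP => e e0; have /ccvg_epsP/(_ e e0)[N' h] := hz.
  by exists N' => n Nn; apply: h; exact: leq_trans Nn (leq_addr _ _).
have h := ccvg_normc2 (a := c) hz'; have {}h : `N (z_ (n + N)%N - c) ^+ 2 @[n --> \oo] --> `N (z - c) ^+ 2.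
  rewrite -(normcN (z - c)) opprB; apply: (cvg_eq _ h) => n.
  by rewrite -normcN opprB.
by apply: (cvg_ub h) => n; apply: hK; rewrite leq_addl.
Qed.
Lemma ccvgZ (z_ : nat -> R[i]) (z c : R[i]) : ccvg z_ z -> ccvg (fun n => c * z_ n) (c * z).
Proof.
move=> h; apply: (@cvg_eq _ _ (fun n => `N c * `N (z_ n - z))).
  by move=> n; rewrite -mulrBr normcM.
by rewrite -[X in _ --> X](mulr0 (`N c)); apply: cvgM; [exact: cvg_cst|exact: h].
Qed.
End Limits.

Section WeakLimits.
Context {R : realType}.
Local Notation leb := (@lebesgue_measure R).
Local Notation Rint := (Rintegral leb setT).
Local Notation Rint3 := (Rintegral (leb3 R) setT).
Local Notation cint := (cintegral leb).
Local Notation cint3 := (cintegral (leb3 R)).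
Local Notation cintble := (cintegrable leb).
Local Notation cintble3 := (cintegrable (leb3 R)).
Local Notation intble3 F := (intble (leb3 R) F).
Local Notation R1 := (measurableTypeR R).
Local Notation leb3s := (prod_sf (prod_sf leb leb) leb).
Local Notation nsq F := (Rint (fun s => `N (F s) ^+ 2)).
Implicit Types (u v phi : hfun R) (psi F G : R -> R[i]).

Lemma wt_le1 p : wt p <= 1 :> R.
Proof. by rewrite /wt; apply: mulr_ile1; rewrite ?mulr_ge0 ?w1_ge0 ?w1_le1// mulr_ile1 ?w1_ge0 ?w1_le1. Qed.
(** Young's inequality [|d| w <= dl w + dl^-3 |d|^4] for a weight [w <= 1]:
    [L^4] convergence implies convergence against rapidly decreasing functions. *)
Lemma L4_dom (d : hfun R) phi (C dl : R) : cmeasurable (d : hmeas R -> R[i]) -> cmeasurable (phi : hmeas R -> R[i]) ->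
  0 <= C -> (forall p, `N (phi p) <= C * wt p) -> 0 < dl -> intble3 (fun p : hmeas R => `N (d p) ^+ 4) ->
  cintble3 (fun p => d p * phi p) /\
  `N (cint3 (fun p => d p * phi p)) <=
   C * (dl * Rint3 (wt : hmeas R -> R) + dl ^- 3 * Rint3 (fun p : hmeas R => `N (d p) ^+ 4)).
Proof.
move=> md mp C0 hp dl0 id.
have m : cmeasurable (fun p : hmeas R => d p * phi p) by exact: cmeasurableM.
have ig : intble3 (fun p : hmeas R => C * (dl * wt p + dl ^- 3 * `N (d p) ^+ 4)).
  exact: (@intbleZ R _ _ leb3s C _ (@intbleD R _ _ leb3s _ _ (@intbleZ R _ _ leb3s dl _ intble_wt) (@intbleZ R _ _ leb3s (dl ^- 3) _ id))).
have bd p : `N (d p * phi p) <= C * (dl * wt p + dl ^- 3 * `N (d p) ^+ 4).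
  rewrite normcM; apply: le_trans (ler_wpM2l (normc_ge0 _) (hp p)) _.
  rewrite mulrCA ler_wpM2l//; have y0 := normc_ge0 (d p); move: (`N (d p)) y0 => y y0.
  have w0 := wt_ge0 p; have w1_ := wt_le1 p; move: (wt p) w0 w1_ => w w0 w11.
  have D0 : 0 <= dl ^- 3 by rewrite invr_ge0 exprn_ge0// ltW.
  have [yd|yd] := leP y dl.
    apply: (@le_trans _ _ (dl * w)); first by rewrite ler_wpM2r.
    by rewrite lerDl mulr_ge0 ?exprn_ge0.
  apply: (@le_trans _ _ (dl ^- 3 * y ^+ 4)); last by rewrite lerDr mulr_ge0// ltW.
  apply: (@le_trans _ _ y); first by rewrite ler_piMr.
  rewrite ler_pdivlMl ?exprn_gt0// [y ^+ 4]exprSr mulrC [y ^+ 3 * y]mulrC ler_wpM2l//.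
  by apply: pow_le; exact: ltW.
split; first exact: (@cint_dom R _ _ leb3s _ _ m bd ig).
apply: le_trans (@normc_cintegral_le R _ _ leb3s _ _ m bd ig) _.
rewrite (@RintZ R _ _ leb3s C _ (@intbleD R _ _ leb3s _ _ (@intbleZ R _ _ leb3s dl _ intble_wt) (@intbleZ R _ _ leb3s (dl ^- 3) _ id))).
rewrite (@RintD R _ _ leb3s _ _ (@intbleZ R _ _ leb3s dl _ intble_wt) (@intbleZ R _ _ leb3s (dl ^- 3) _ id)).
by rewrite (@RintZ R _ _ leb3s dl _ intble_wt) (@RintZ R _ _ leb3s (dl ^- 3) _ id).
Qed.

Lemma L4_pair (d : nat -> hfun R) phi (C : R) : (forall n, cmeasurable (d n : hmeas R -> R[i])) ->
  (fun n => Lpnorm 4 (d n)) @ \oo --> (0%E : \bar R) -> cmeasurable (phi : hmeas R -> R[i]) ->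
  0 <= C -> (forall p, `N (phi p) <= C * wt p) ->
  forall e : R, 0 < e -> exists N, forall n, (N <= n)%N -> cintble3 (fun p => d n p * phi p) /\
   `N (cint3 (fun p => d n p * phi p)) <= e.
Proof.
move=> md Ld mp C0 hp e e0.
set W := Rint3 (wt : hmeas R -> R).
have W0 : 0 <= W by apply: (@Rint_ge0 R _ _ leb3s) => p; exact: wt_ge0.
pose dl := e / (2 * (C * W + 1)).
have CW : 0 < C * W + 1 by rewrite ltr_wpDl ?mulr_ge0.
have dl0 : 0 < dl by rewrite divr_gt0 ?mulr_gt0.
have D3 : 0 < dl ^+ 3 by rewrite exprn_gt0.
have C1 : 0 < C + 1 by rewrite ltr_wpDl.
have e1 : 0 < dl ^+ 3 * (e / (2 * (C + 1))) by apply: mulr_gt0 => //; apply: divr_gt0 => //; exact: mulr_gt0.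
have [N hN] := L4_cvg md Ld e1; exists N => n /hN[id Id].
have [i1 i2] := L4_dom (md n) mp C0 hp dl0 id; split => //; apply: le_trans i2 _.
rewrite -/W mulrDr.
have t1 : C * (dl * W) <= e / 2.
  have -> : C * (dl * W) = (C * W) / (C * W + 1) * (e / 2) by rewrite /dl; field; rewrite gt_eqF.
  by rewrite ler_piMl ?divr_ge0 ?(ltW e0)// ler_pdivrMr// mul1r lerDl.
have t2 : C * (dl ^- 3 * Rint3 (fun p : hmeas R => `N (d n p) ^+ 4)) <= e / 2.
  apply: (@le_trans _ _ (C * (dl ^- 3 * (dl ^+ 3 * (e / (2 * (C + 1))))))).
    by rewrite ler_wpM2l// ler_wpM2l ?invr_ge0 ?exprn_ge0 ?(ltW dl0).
  rewrite mulKf ?gt_eqF//; have -> : C * (e / (2 * (C + 1))) = C / (C + 1) * (e / 2) by field; rewrite gt_eqF.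
  by rewrite ler_piMl ?divr_ge0 ?(ltW e0)// ler_pdivrMr// mul1r lerDl.
by rewrite [leRHS]splitr; exact: lerD.
Qed.

Lemma pow4_le (x y : R) : 0 <= x -> 0 <= y -> (x + y) ^+ 4 <= 8 * x ^+ 4 + 8 * y ^+ 4.
Proof.
move=> x0 y0; have h (a b : R) : (a + b) ^+ 2 <= 2 * a ^+ 2 + 2 * b ^+ 2 := sq2D a b.
rewrite -[4%N]/(2 * 2)%N !exprM.
apply: (@le_trans _ _ ((2 * x ^+ 2 + 2 * y ^+ 2) ^+ 2)).
  by apply: pow_le; [exact: sqr_ge0|exact: h].
by apply: le_trans (h _ _) _; rewrite !exprMn; lra.
Qed.
Lemma schwartz_pow4 u : schwartz u -> intble3 (fun p : hmeas R => `N (u p) ^+ 4).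
Proof.
move=> su; have [C C0 uC] := schwartz_bound su.
apply: (@intble_le R _ _ leb3s _ (fun p => C ^+ 4 * wt p)).
- by apply: Npow_meas; exact: schwartz_meas.
- move=> p; rewrite ger0_norm ?exprn_ge0 ?normc_ge0//.
  apply: (@le_trans _ _ ((C * wt p) ^+ 4)); first by apply: pow_le; [exact: normc_ge0|exact: uC].
  by rewrite exprMn ler_wpM2l ?exprn_ge0// exprS ler_piMr ?wt_ge0// exprn_ile1 ?wt_ge0 ?wt_le1.
- exact: (@intbleZ R _ _ leb3s _ _ intble_wt).
Qed.
Lemma approx_pow4 (w : nat -> hfun R) h : cmeasurable (h : hmeas R -> R[i]) -> approximates w h ->
  intble3 (fun p : hmeas R => `N (h p) ^+ 4).
Proof.
move=> mh [sw _ Lw].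
have md n : cmeasurable ((fun p => w n p - h p) : hmeas R -> R[i]).
  by apply: cmeasurableB => //; exact: schwartz_meas.
have [N /(_ N (leqnn N))[id _]] := L4_cvg md Lw ltr01.
apply: (@intble_le R _ _ leb3s _ (fun p => 8 * `N (w N p) ^+ 4 + 8 * `N (w N p - h p) ^+ 4)).
- exact: Npow_meas.
- move=> p; rewrite ger0_norm ?exprn_ge0 ?normc_ge0//.
  apply: le_trans (pow4_le (normc_ge0 _) (normc_ge0 _)).
  rewrite lerXn2r ?nnegrE ?addr_ge0 ?normc_ge0//.
  have {1}-> : h p = w N p - (w N p - h p) by ring.
  exact: le_normcB.
- exact: (@intbleD R _ _ leb3s _ _ (@intbleZ R _ _ leb3s 8 _ (schwartz_pow4 (sw N))) (@intbleZ R _ _ leb3s 8 _ id)).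
Qed.

Lemma approx_pair (w : nat -> hfun R) h phi : cmeasurable (h : hmeas R -> R[i]) -> approximates w h -> schwartz phi ->
  cintble3 (fun p => h p * (phi p)^*) /\
  ccvg (fun m => cint3 (fun p => w m p * (phi p)^*)) (cint3 (fun p => h p * (phi p)^*)).
Proof.
move=> mh [sw _ Lw] sp; have [C C0 pC] := schwartz_bound sp.
have md n : cmeasurable ((fun p => w n p - h p) : hmeas R -> R[i]).
  by apply: cmeasurableB => //; exact: schwartz_meas.
have mp : cmeasurable ((fun p => (phi p)^*) : hmeas R -> R[i]) by apply: cmeasurableJ; exact: schwartz_meas.
have pC' p : `N ((phi p)^*) <= C * wt p by rewrite normcJ.
have H := L4_pair md Lw mp C0 pC'.
have iw n : cintble3 (fun p => w n p * (phi p)^*) := schwartz_int (schwartzMM (sw n) (schwartzJ sp)).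
have ih : cintble3 (fun p => h p * (phi p)^*).
  have [N /(_ N (leqnn N))[id _]] := H _ ltr01.
  have := @cintB R _ _ leb3s _ _ (iw N) id.
  have -> // : (fun p => w N p * (phi p)^* - (w N p - h p) * (phi p)^*) = (fun p => h p * (phi p)^*).
  by apply/funext => p; ring.
split => //; apply/ccvg_epsP => e /H[N hN]; exists N => n /hN[id]; apply: le_trans.
rewrite -(@cintegralB R _ _ leb3s _ _ (iw n) ih); apply: le_of_eq.
by congr (`N _); apply: eq_cintegral => p; rewrite mulrBl.
Qed.

(** [S phi] is constant, hence not square integrable, on [s <= 0]. *)
Definition Sp phi s : R[i] := if 0 < s then S phi s else 0.
Lemma Sp_bd phi : schwartz phi -> exists2 C, 0 <= C & forall s, `N (Sp phi s) <= C * w1 s.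
Proof.
move=> sp; have sD2 := schwartz_Ds (schwartz_Ds sp).
have bd u : schwartz u -> exists2 C, 0 <= C & forall s, `N (S u s) <= C.
  move=> su; exists (Rint3 (fun p : hmeas R => `N (u p))).
    by apply: (@Rint_ge0 R _ _ leb3s) => p; exact: normc_ge0.
  by move=> s; apply: S_bound; exact: schwartz_int.
have [C C0 hC] := bd _ sp; have [D D0 hD] := bd _ sD2.
exists (C + D); first exact: addr_ge0.
move=> s; rewrite /Sp; case: ifP => s0; last by rewrite Normc.normc0 mulr_ge0 ?w1_ge0 ?addr_ge0.
rewrite /w1 ler_pdivlMr; last by rewrite ltr_wpDr ?sqr_ge0.
rewrite mulrDr mulr1; apply: lerD; first exact: hC.
have := hD s; rewrite S_Ds; last exact: schwartz_Ds.
by rewrite S_Ds// mulrA -RCM pos_id ?(ltW s0)// normcM normcR -expr2 ger0_norm ?sqr_ge0// mulrC.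
Qed.
Lemma meas_Sp phi : schwartz phi -> cmeasurable (Sp phi : R1 -> R[i]).
Proof.
move=> sp; have pc := chi_prof sp.
have -> : Sp phi = (fun s => (pos s)^-1%:C * chi phi s).
  apply/funext => s; rewrite /Sp chiE//; case: ltP => s0; last by rewrite pos_neg// mul0r mulr0.
  by rewrite pos_id ?(ltW s0)// mulrA -RCM mulVf ?gt_eqF// mul1r.
apply: cmeasurableM; last by apply: ccont_meas; case: pc.
have -> : (fun s : R => ((pos s)^-1)%:C) = (fun s : R => (pos s `^ (-1))%:C).
  by apply/funext => s; rewrite powRN powRr1 ?pos_ge0.
apply: cmeasurableC; apply: (@measurableT_comp _ _ _ _ _ _ (fun x : R1 => x `^ (-1))); first exact: measurable_powR.
by apply: meas_pos.
Qed.
Lemma Sp_sq phi : schwartz phi -> intble leb (fun s => `N (Sp phi s) ^+ 2).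
Proof.
move=> sp; have [C C0 b] := Sp_bd sp.
apply: (@intble_le R _ R1 leb _ (fun s => C ^+ 2 * w1 s)).
- by apply: normc2_meas; exact: meas_Sp.
- move=> s; rewrite ger0_norm ?sqr_ge0//; apply: (@le_trans _ _ ((C * w1 s) ^+ 2)).
    by rewrite lerXn2r ?nnegrE ?normc_ge0 ?mulr_ge0 ?w1_ge0.
  by rewrite exprMn ler_wpM2l ?sqr_ge0// expr2 ler_piMr ?w1_ge0 ?w1_le1.
- by apply: intbleZ; exact: intble_w1.
Qed.

Lemma eta_cut_cvg (g : R -> R) : intble leb g -> (forall s, 0 <= g s) -> (forall s, s <= 0 -> g s = 0) ->
  Rint (fun s => (1 - eta n.+1%:R^-1 0 s) ^+ 2 * g s) @[n --> \oo] --> (0 : R).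
Proof.
move=> ig g0 gz; have -> : (0 : R) = Rint (fun=> 0).
  by rewrite Rintegral_cst//= mul0r.
have e0 n := @invn_gt0 R n.
have [] // := @Rint_dct R _ R1 leb (fun n s => (1 - eta n.+1%:R^-1 0 s) ^+ 2 * g s) (fun=> 0) g _ _ _ ig.
- move=> n; apply: measurable_funM; last exact: intble_meas1 ig.
  by apply: measurable_funX; apply: measurable_funB => //; exact: meas_eta.
- move=> s; have [s0|s0] := ltP 0 s; last first.
    by apply: (@cvg_eq _ _ (fun=> 0)) => [n|]; [rewrite gz// mulr0|exact: cvg_cst].
  rewrite -[X in _ --> X](mul0r (g s)); apply: cvgM; last exact: cvg_cst.
  rewrite -[X in _ --> X](expr0n _ 2) -(subrr (1 : R)).
  apply: (@cvg_comp _ _ _ _ (fun x : R => x ^+ 2) _ (nbhs (1 - 1 : R))); last exact: exprn_continuous.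
  by apply: cvgB; [exact: cvg_cst|exact: cvg_eta].
- by move=> n s; rewrite ger0_norm; [rewrite ler_piMl// eta1_sq|exact: mulr_ge0 (sqr_ge0 _) (g0 s)].
Qed.

(** Test first against [J (cutoff phi e)]: the pairing with [h] only sees its
    profile, the pairing with [w m] is an integral of Hardy coefficients, and the
    [L^4] limit in [m] is allowed.  The cut-off is then removed, uniformly in [m]
    by Cauchy-Schwarz since the coefficients are bounded in [L^2]. *)
Lemma chi_weak (w : nat -> hfun R) h phi (M : R) : cmeasurable (h : hmeas R -> R[i]) -> approximates w h -> V0plus h ->
  (forall m, nsq (chi (w m)) <= M) -> schwartz phi ->
  ccvg (fun m => (pi ^- 2)%:C * cint (fun s : R1 => chi (w m) s * (S phi s)^*))
       (cint3 (fun p => h p * (phi p)^*)).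
Proof.
move=> mh aw Vh hM sp; have [sw _ _] := aw.
have [g gz hg] := V0_profile Vh.
have e0 n := @invn_gt0 R n.
pose ph k : hfun R := J (cutoff phi k.+1%:R^-1).
have fl k : flat (cutoff phi k.+1%:R^-1) := flat_cutoff sp (e0 k).
have sph k : schwartz (ph k) := flat_J (fl k).
have M0 : 0 <= M by apply: le_trans (hM 0%N); apply: (@Rint_ge0 R _ R1 leb) => s; exact: sqr_ge0.
have K0 : 0 <= (pi ^- 2) ^+ 2 * M :> R by rewrite mulr_ge0 ?sqr_ge0.
have sqS := Sp_sq sp; have mS := meas_Sp sp.
apply: (@ccvg_exchange _ _ (fun k m => cint3 (fun p => w m p * (ph k p)^*)) (fun k => cint3 (fun p => h p * (ph k p)^*)) _ (fun k => Rint (fun s => (1 - eta k.+1%:R^-1 0 s) ^+ 2 * `N (Sp phi s) ^+ 2)) _ _ _ _ K0).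
- by move=> k; exact: (approx_pair mh aw (sph k)).2.
- have [i0 ->] := hg phi sp.
  have E k : cint3 (fun p => h p * (ph k p)^*) = cint (fun s : R1 => (eta k.+1%:R^-1 0 s)%:C * (g s * (S phi s)^*)).
    have [_ ->] := hg _ (sph k); apply: eq_cintegral => s.
    have [s0|s0] := leP s 0; first by rewrite gz// !mul0r mulr0.
    by rewrite S_cutoff// (cJM _%:C) cJR mulrCA.
  apply: (ccvg_eq E).
  have [_ H] : cintble (fun s : R1 => g s * (S phi s)^*) /\ ccvg (fun k => cint (fun s : R1 => (eta k.+1%:R^-1 0 s)%:C * (g s * (S phi s)^*))) (cint (fun s : R1 => g s * (S phi s)^*)); last exact: H.
  apply: (@cint_dct R _ R1 leb _ _ (fun s => `N (g s * (S phi s)^*))).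
  + by move=> k; apply: cmeasurableM; [apply: cmeasurableC; exact: meas_eta|exact: cint_meas i0].
  + exact: cint_meas i0.
  + move=> s; have [s0|s0] := ltP 0 s; last first.
      rewrite /ccvg gz//; apply: (@cvg_eq _ _ (fun=> 0)); last exact: cvg_cst.
      by move=> n; rewrite !mul0r mulr0 subr0 Normc.normc0.
    move: (g s * (S phi s)^*) => z; apply: (@cvg_eq _ _ (fun k => `|eta k.+1%:R^-1 0 s - 1| * `N z)).
      move=> k; rewrite -[X in _ - X]mul1r -mulrBl normcM; congr (_ * _).
      by rewrite -normcR; congr (`N _); rewrite rmorphB rmorph1.
    rewrite -[X in _ --> X](mul0r (`N z)); apply: cvgM; last exact: cvg_cst.
    by apply/norm_cvg0P; rewrite -(subrr (1 : R)); apply: cvgB; [exact: cvg_eta|exact: cvg_cst].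
  + exact: cint_normc.
  + by move=> k s; rewrite normcM normcR ger0_norm ?eta_ge0// ler_piMl ?normc_ge0// eta_le1.
- apply: eta_cut_cvg => //; first by move=> s; exact: sqr_ge0.
  by move=> s s0; rewrite /Sp ltNge s0/= Normc.normc0 expr0n.
- move=> k m; have pX := chi_prof (sw m); have [cX zX _] := pX; have iX := prof_int pX.
  have pc := prof_int (flat_prof (fl k)).
  have [_ ->] := JS_fubini (schwartz_int (sw m)) pc.
  have iS : cintble (fun s : R1 => chi (w m) s * (S phi s)^*).
    have [D hD] : exists D : R, forall s, `N (S phi s) <= D by eexists => s; apply: S_bound; exact: schwartz_int.
    have mX := ccont_meas cX.
    have EE : (fun s : R1 => chi (w m) s * (S phi s)^*) = (fun s => chi (w m) s * (Sp phi s)^*).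
      apply/funext => s; rewrite /Sp; case: ifPn => // /negbTE s0.
      by rewrite zX ?mul0r// leNgt s0.
    rewrite EE; apply: cint_sqM => //; first exact: cmeasurableJ.
      exact: prof_sq.
    by apply: eq_intble sqS => s; rewrite normcJ.
  have iL : cintble (fun s : R1 => (cutoff phi k.+1%:R^-1 s)^* * S (w m) s) := int_psiS (schwartz_int (sw m)) pc.
  rewrite -(cintegralZ _ iS) -(cintegralB iL (cintZ _ iS)).
  pose d s := (1 - eta k.+1%:R^-1 0 s)%:C * Sp phi s.
  have md : cmeasurable (d : R1 -> R[i]).
    apply: cmeasurableM => //; apply: cmeasurableC; apply: measurable_funB => //; exact: meas_eta.
  have dE s : `N (d s) ^+ 2 = (1 - eta k.+1%:R^-1 0 s) ^+ 2 * `N (Sp phi s) ^+ 2.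
    by rewrite /d normcM normcR exprMn real_normK ?num_real.
  have id : intble leb (fun s => `N ((d s)^*) ^+ 2).
    apply: (@intble_le R _ R1 leb _ _ _ _ sqS); first by apply: normc2_meas; exact: cmeasurableJ.
    by move=> s; rewrite ger0_norm ?sqr_ge0// normcJ dE ler_piMl ?sqr_ge0 ?eta1_sq.
  have E : cint (fun s : R1 => (cutoff phi k.+1%:R^-1 s)^* * S (w m) s - (pi ^- 2)%:C * (chi (w m) s * (S phi s)^*)) = - (pi ^- 2)%:C * cint (fun s : R1 => chi (w m) s * (d s)^*).
    have iXd : cintble (fun s : R1 => chi (w m) s * (d s)^*).
      exact: (cint_sqM (ccont_meas cX) (cmeasurableJ md) (prof_sq pX) id).
    rewrite -(cintegralZ _ iXd); apply: eq_cintegral => s.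
    have [s0|s0] := leP s 0.
      rewrite zX// !mul0r !mulr0 subr0; have [_ z0 _] := flat_prof (fl k).
      by rewrite z0// conjc0 mul0r.
    rewrite /d /Sp s0 (cJM _%:C (S phi s)) cJR /cutoff (cJM _%:C) cJR (chiE s sp) (chiE s (sw m)) (cJM _%:C (S phi s)) cJR.
    rewrite RCM (_ : (1 - eta k.+1%:R^-1 0 s)%:C = 1 - (eta k.+1%:R^-1 0 s)%:C); last by rewrite rmorphB rmorph1.
    move: (S (w m) s) (S phi s)^* (pos s)%:C (eta _ _ _)%:C (pi ^- 2)%:C; clear; move=> *; ring.
  rewrite E normcM normcN normcR exprMn real_normK ?num_real// -[leRHS]mulrA; apply: ler_wpM2l; first exact: sqr_ge0.
  have := CauchySchwarzC (ccont_meas cX) (cmeasurableJ md) (prof_sq pX) id.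
  have -> : (fun s => `N ((d s)^*) ^+ 2) = (fun s => (1 - eta k.+1%:R^-1 0 s) ^+ 2 * `N (Sp phi s) ^+ 2) by apply/funext => s; rewrite normcJ dE.
  move=> h1; apply: le_trans h1 _; rewrite ler_wpM2r//.
  by apply: (@Rint_ge0 R _ R1 leb) => s; rewrite mulr_ge0 ?sqr_ge0.
Qed.
End WeakLimits.

(** * The two potential terms *)
Section PotentialTerms.
Context {R : realType}.
Local Notation leb := (@lebesgue_measure R).
Local Notation Rint := (Rintegral leb setT).
Local Notation cint := (cintegral leb).
Local Notation cint3 := (cintegral (leb3 R)).
Local Notation cintble := (cintegrable leb).
Local Notation cintble3 := (cintegrable (leb3 R)).
Local Notation intble3 F := (intble (leb3 R) F).
Local Notation R1 := (measurableTypeR R).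
Local Notation leb3s := (prod_sf (prod_sf leb leb) leb).
Local Notation nsq F := (Rint (fun s => `N (F s) ^+ 2)).
Implicit Types (u v phi : hfun R) (psi F G : R -> R[i]).

Definition lin psi := exists2 C : R, 0 <= C & forall s, `N (psi s) <= C * pos s.
Lemma chi_lin (w : hfun R) : schwartz w -> lin (chi w).
Proof.
move=> sw; exists (Rintegral (leb3 R) setT (fun p : hmeas R => `N (w p))).
  by apply: (@Rint_ge0 R _ _ leb3s) => p; exact: normc_ge0.
move=> s; rewrite chiE// normcM normcR (ger0_norm (pos_ge0 s)) mulrC.
apply: ler_wpM2r; first exact: pos_ge0.
by apply: S_bound; exact: schwartz_int.
Qed.
Lemma cutoff_lin (w : hfun R) (e : R) : schwartz w -> 0 < e -> lin (cutoff w e).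
Proof.
move=> sw e0; have [C C0 h] := chi_lin sw; exists (pi ^- 2 * C).
  by rewrite mulr_ge0// ipi0.
move=> s; rewrite /cutoff normcM normcR ger0_norm ?mulr_ge0 ?ipi0 ?eta_ge0//.
rewrite -!mulrA ler_wpM2l ?ipi0//; apply: le_trans (h s).
by rewrite ler_piMl ?normc_ge0 ?eta_le1.
Qed.

Lemma pi2K : pi ^- 2 * (2 * pi ^+ 2) = 2 :> R.
Proof. by rewrite mulrCA mulVf ?mulr1// expf_neq0// gt_eqF// pi_gt0. Qed.
Lemma mult_Q : mult (Qplus : hfun R).
Proof. exact: (multM (mult_cst _) (@mult_den R)). Qed.
Lemma mult_QQ : mult (fun p : heis R => (`N (Qplus p) ^+ 2)%:C).
Proof.
have -> : (fun p : heis R => (`N (Qplus p) ^+ 2)%:C) = (fun p => Qplus p * (Qplus p)^*) by apply/funext => p; rewrite mulcJ.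
by apply: multM; [exact: mult_Q|apply: multJ; exact: mult_Q].
Qed.

(** Write [|Q|^2 = Q conj(Q)]: both factors act as [sqrt 2 V] on profiles, and
    [S (J (V psi)) = (pi^2 / t) V psi] produces the weight [1 / t]. *)
Lemma potential_form chi_ psi : prof chi_ -> lin chi_ -> flat psi -> lin psi ->
  cint (fun s : R1 => chi_ s * (S (fun p => (`N (Qplus p) ^+ 2)%:C * J psi p) s)^*) = (2 * pi ^+ 2)%:C * bV chi_ psi.
Proof.
move=> pc lc fp lp; have pp := flat_prof fp; have sJ := flat_J fp.
pose phi : hfun R := fun p => (`N (Qplus p) ^+ 2)%:C * J psi p.
have sp : schwartz phi := schwartzM mult_QQ sJ.
have pV := V_prof pc; have pW := V_prof pp.
have sVJ : schwartz (J (V psi)).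
  have -> : J (V psi) = (fun p => ((Num.sqrt 2)^-1)%:C * (Qplus p * J psi p)).
    apply/funext => p; rewrite Qplus_J// mulrA -RCM mulVf ?mul1r// gt_eqF// sqrtr_gt0//.
  by apply: schwartzZ; exact: schwartzM mult_Q sJ.
rewrite -/phi.
have step F u : prof F -> schwartz u -> cint (fun s : R1 => F s * (S u s)^*) = cint3 (fun p => J F p * (u p)^*).
  move=> pF su; have iF := prof_int pF; have iu := schwartz_int su.
  have i1 := int_psiS iu iF; have [_ E] := JS_fubini iu iF.
  have i2 : cintble3 (fun p => u p * (J F p)^*).
    apply: (@cint_dom R _ _ leb3s _ (fun p => Rint (fun s => `N (F s)) * `N (u p))).
    - by apply: cmeasurableM; [exact: schwartz_meas|apply: cmeasurableJ; exact: meas_J].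
    - by move=> p; rewrite normcM normcJ mulrC ler_wpM2r ?normc_ge0// J_bound.
    - by apply: (@intbleZ R _ _ leb3s); exact: (@cint_normc R _ _ leb3s).
  transitivity (cint (fun s : R1 => (F s)^* * S u s))^*.
    by rewrite -(cintegralJ i1); apply: eq_cintegral => s; rewrite cJM conjcK.
  rewrite -E -(@cintegralJ R _ _ leb3s _ i2); apply: eq_cintegral => p.
  by rewrite (cJM (u p)) conjcK mulrC.
rewrite (step _ _ pc sp).
have E p : J chi_ p * (phi p)^* = 2%:C * (J (V chi_) p * (J (V psi) p)^*).
  rewrite /phi -mulcJ.
  have h1 := Qplus_J p pc lc; have h2 := Qplus_J p pp lp.
  transitivity ((Qplus p * J chi_ p) * (Qplus p * J psi p)^*).
    rewrite (cJM (Qplus p * (Qplus p)^*) (J psi p)) (cJM (Qplus p) (Qplus p)^*) conjcK (cJM (Qplus p) (J psi p)); move: (Qplus p) (Qplus p)^* (J chi_ p) (J psi p)^*; clear; move=> *; ring.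
  have -> : 2%:C = (Num.sqrt 2)%:C * (Num.sqrt 2)%:C :> R[i] by rewrite -RCM -expr2 sqr_sqrtr.
  rewrite h1 h2 cJM cJR.
  move: (J _ p) (J _ p)^* (Num.sqrt _)%:C; clear; move=> *; ring.
rewrite (eq_cintegral (leb3 R) E).
have iV : cintble (fun s : R1 => V chi_ s * (S (J (V psi)) s)^*).
  have := int_psiS (schwartz_int sVJ) (prof_int pV) => /cintJ.
  by have -> : (fun x : R1 => ((V chi_ x)^* * S (J (V psi)) x)^*) = (fun s => V chi_ s * (S (J (V psi)) s)^*) by apply/funext => s; rewrite cJM conjcK.
have i3 : cintble3 (fun p => J (V chi_) p * (J (V psi) p)^*).
  apply: (@cint_dom R _ _ leb3s _ (fun p => Rint (fun s => `N (V chi_ s)) * `N (J (V psi) p))).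
  - by apply: cmeasurableM; [apply: meas_J; exact: prof_int|apply: cmeasurableJ; exact: schwartz_meas].
  - by move=> p; rewrite normcM normcJ ler_wpM2r ?normc_ge0//; apply: J_bound; exact: prof_int.
  - by apply: (@intbleZ R _ _ leb3s); apply: (@cint_normc R _ _ leb3s); exact: schwartz_int.
rewrite (@cintegralZ R _ _ leb3s _ _ i3) -(step _ _ pV sVJ) RCM -mulrA; congr (_ * _).
have -> : (fun s : R1 => V chi_ s * (S (J (V psi)) s)^*) = (fun t : R1 => (pi ^+ 2)%:C * (Vr chi_ t * (Vr psi t)^*)).
  apply/funext => t; rewrite VrM; have [t0|t0] := leP t 0; first by rewrite (V_z chi_ t0) !mul0r !mulr0.
  by rewrite S_J// (cJM _%:C) cJR RCM; move: (V chi_ t) (V psi t)^*; clear; move=> *; ring.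
by rewrite (cintegralZ _ (bV_int pc pp)).
Qed.

(** [Q^2] is the superposition [2 \int t e^{-t} e^{itz} dt], and [J_triple]
    evaluates its pairing with [J psi e^{isz}].  The result depends on [s] only
    through the factor [e^{-s}]: the operator has rank one. *)
Lemma S_Q2 psi s : flat psi -> 0 <= s ->
  S (fun p => Qplus p ^+ 2 * (J psi p)^*) s = (2 * pi ^+ 2 * expR (- s))%:C * (cint (fun t : R1 => ek 0 t * psi t))^*.
Proof.
move=> fp s0; have pp := flat_prof fp; have sJ := flat_J fp; have [_ zp _] := pp.
have sW : schwartz (fun p => J psi p * wav s p).
  have -> : (fun p => J psi p * wav s p) = (fun p => wav s p * J psi p) by apply/funext => p; rewrite mulrC.
  exact: schwartzM (mult_wav s) sJ.
have iW := schwartz_int sW; have i1 := @ek_int R 1.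
have [_ E] := JS_fubini iW i1.
have i2 : cintble3 (fun p => J psi p * wav s p * (J (ek 1) p)^*).
  apply: (@cint_dom R _ _ leb3s _ (fun p => Rint (fun s => `N (ek 1 s)) * `N (J psi p * wav s p))).
  - by apply: cmeasurableM; [exact: schwartz_meas|apply: cmeasurableJ; exact: meas_J].
  - by move=> p; rewrite normcM normcJ mulrC ler_wpM2r ?normc_ge0// J_bound.
  - by apply: (@intbleZ R _ _ leb3s); exact: (@cint_normc R _ _ leb3s).
transitivity (2%:C * (cint3 (fun p => J psi p * wav s p * (J (ek 1) p)^*))^*).
  rewrite -(@cintegralJ R _ _ leb3s _ i2) -(@cintegralZ R _ _ leb3s _ _ (@cintJ R _ _ leb3s _ i2)).
  apply: eq_cintegral => p; rewrite Qplus2_ek !cJM conjcK -!/(conjc (wav s p)).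
  by move: (J (ek 1) p) (J psi p)^* (wav s p)^*; clear; move=> *; ring.
rewrite E.
have T t : (ek 1 t)^* * S (fun p => J psi p * wav s p) t = (pi ^+ 2)%:C * (ek 0 t * psi (t - s)).
  have [t0|t0] := leP t 0.
    rewrite zp ?mulr0; last by rewrite subr_le0 (le_trans t0).
    rewrite ekE indicE; have [->|tn] := eqVneq t 0; first by rewrite expr1 !mul0r cJR mul0r.
    rewrite memNset ?mulr0 ?cJR ?mul0r//= in_itv/= andbT leNgt.
    by rewrite lt_neqAle tn t0.
  have -> : S (fun p => J psi p * wav s p) t = (pi ^+ 2 / t)%:C * psi (t - s) := J_triple pp sJ s0 t0.
  rewrite !ekE cJR expr1 expr0 mul1r [LHS]mulrA [RHS]mulrA -!RCM; congr (_%:C * _).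
  by field; rewrite gt_eqF.
have -> : (fun t : R1 => (ek 1 t)^* * S (fun p => J psi p * wav s p) t) = (fun t => (pi ^+ 2)%:C * (ek 0 t * psi (t - s))) by apply/funext => t; exact: T.
have ik : cintble (fun t : R1 => ek 0 t * psi t).
  have [c _ [C C0 b]] := pp.
  apply: (@cint_dom1 R _ (fun t => `N (psi t))).
  - by apply: cmeasurableM; [exact: cint_meas (@ek_int R 0)|exact: ccont_meas].
  - move=> t; rewrite normcM ler_piMl ?normc_ge0//.
    rewrite ekE normcR expr0 mul1r indicE; case: (boolP (t \in _)) => [|_]; last by rewrite mulr0 normr0.
    by rewrite inE/= in_itv/= andbT => t0; rewrite mulr1 ger0_norm ?expR_ge0// -[leRHS]expR0 ler_expR oppr_le0.
  - exact: cint_normc (prof_int pp).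
have H t : ek 0 (t + s) * psi (t + s - s) = (expR (- s))%:C * (ek 0 t * psi t).
  rewrite addrK; have [t0|t0] := leP t 0; first by rewrite zp// !mulr0.
  rewrite !ekE !expr0 !mul1r !indicE !mem_set ?mulr1/= ?in_itv/= ?andbT ?(ltW t0) ?addr_ge0 ?(ltW t0)//.
  by rewrite opprD expRD RCM; move: (expR _)%:C (expR _)%:C (psi t); clear; move=> *; ring.
have iks : cintble (fun t : R1 => ek 0 t * psi (t - s)).
  have [c _ [C C0 b]] := pp.
  have ct : ccont (fun t => psi (t - s)).
    have [c1 c2] := c.
    have cs : continuous (fun t : R => t - s) by move=> t; apply: cvgB; [exact: cvg_id|exact: cvg_cst].
    by split => t; [apply: (@continuous_comp _ _ _ (fun t : R => t - s) (fun t => Re (psi t)))|apply: (@continuous_comp _ _ _ (fun t : R => t - s) (fun t => Im (psi t)))]; [exact: cs|exact: c1|exact: cs|exact: c2].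
  apply: (@cint_dom1 R _ (fun t => C * `N (ek 0 t))).
  - by apply: cmeasurableM; [exact: cint_meas (@ek_int R 0)|exact: ccont_meas].
  - move=> t; rewrite normcM mulrC ler_wpM2r ?normc_ge0//; apply: le_trans (b _) _.
    by rewrite ler_piMr ?w1_le1.
  - by apply: intbleZ; exact: cint_normc (@ek_int R 0).
rewrite (cintegralZ _ iks) -(cintegral_translate s iks).
have -> : (fun x : R1 => ek 0 (x + s) * psi (x + s - s)) = (fun t => (expR (- s))%:C * (ek 0 t * psi t)) by apply/funext => t; exact: H.
rewrite (cintegralZ _ ik) !RCM; move: (cint (fun t : R1 => ek 0 t * psi t)) => I.
rewrite !cJM !cJR; move: I^* (expR _)%:C (pi%:C); clear; move=> *; ring.
Qed.

(** The fourth power of [Q] is integrable. *)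
Lemma den_wt (p : heis R) : (`N (den p) ^+ 4)^-1 <= wt p.
Proof.
have -> : `N (den p) ^+ 4 = (p.2 ^+ 2 + (1 + r2 p) ^+ 2) ^+ 2.
  by rewrite -[4%N]/(2 * 2)%N exprM normcE2 Im_den Re_den.
rewrite /wt /w1 -!invfM /r2; have := sqr_ge0 p.1.1; have := sqr_ge0 p.1.2; have := sqr_ge0 p.2.
move: (p.1.1 ^+ 2) (p.1.2 ^+ 2) (p.2 ^+ 2) => a b c c0 b0 a0.
have u1 : (1 + a) * (1 + b) <= (1 + (a + b)) ^+ 2 by rewrite expr2; nra.
have a1 : 1 <= 1 + a by rewrite lerDl.
have b1 : 1 <= 1 + b by rewrite lerDl.
have u0 : 1 <= (1 + a) * (1 + b) by nra.
move: u1; move: ((1 + (a + b)) ^+ 2) => u u1.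
have d0 : 0 < (1 + a) * (1 + b) * (1 + c) by rewrite mulr_gt0 ?mulr_gt0//; lra.
have u2 : (1 + a) * (1 + b) * (1 + c) <= (c + u) ^+ 2.
  have := ler_wpM2r (_ : 0 <= 1 + c) u1; rewrite addr_ge0// => /(_ isT) h; apply: le_trans h _.
  by rewrite expr2; nra.
by rewrite lef_pV2 ?posrE// (lt_le_trans d0).
Qed.
Lemma normQ (p : heis R) : `N (Qplus p) ^+ 2 = 2 * (`N (den p) ^+ 2)^-1.
Proof.
rewrite /Qplus -/(r2 p) -/(den p) !normcM normcR normci mulr1 exprMn real_normK ?num_real// sqr_sqrtr//.
congr (_ * _); rewrite -exprVn; congr (_ ^+ 2).
have d1 := den_neq0 p; have n0 : `N (den p) != 0 by rewrite normc_eq0.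
apply: (mulfI n0); rewrite -normcM !mulfV//; exact: Normc.normc1.
Qed.
(** [|Q|^4 |h|^2] is bounded by [|Q|^8 + |h|^4], up to a constant. *)
Lemma Q2_L2 (h g : hfun R) : cmeasurable (h : hmeas R -> R[i]) -> cmeasurable (g : hmeas R -> R[i]) ->
  intble3 (fun p : hmeas R => `N (h p) ^+ 4) ->
  (forall p, `N (g p) = `N (Qplus p) ^+ 2 * `N (h p)) ->
  intble3 (fun p : hmeas R => `N (g p) ^+ 2).
Proof.
move=> mh mg ih gE.
apply: (@intble_le R _ _ leb3s _ (fun p => 2 * wt p + 2 * `N (h p) ^+ 4)).
- exact: Npow_meas.
- move=> p; rewrite ger0_norm ?sqr_ge0// gE exprMn normQ exprMn.
  have := den_wt p; have d1 := den_ge1 p; have d2 : 1 <= `N (den p) ^+ 2 by exact: exprn_ege1.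
  have -> : `N (den p) ^+ 4 = (`N (den p) ^+ 2) ^+ 2 by rewrite -exprM.
  have -> : `N (h p) ^+ 4 = (`N (h p) ^+ 2) ^+ 2 by rewrite -exprM.
  rewrite -exprVn; move: (`N (den p) ^+ 2) d2 (`N (h p) ^+ 2) (wt p) => D D1 y W hW.
  have x1 : D^-1 <= 1 by rewrite invf_le1// (lt_le_trans ltr01).
  have x0 : 0 <= D^-1 by rewrite invr_ge0 (le_trans ler01).
  move: (D^-1) x1 x0 hW => x x1 x0 hW.
  have h4 : (x ^+ 2) ^+ 2 <= x ^+ 2 by rewrite expr2 ler_piMr ?sqr_ge0// expr2 mulr_ile1.
  have := sqr_ge0 (x ^+ 2 - y); rewrite sqrrB; move: (x ^+ 2) h4 hW => z h4 hW.
  rewrite (_ : 2 ^+ 2 = 4 :> R); last by ring.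
  by lra.
- exact: (@intbleD R _ _ leb3s _ _ (@intbleZ R _ _ leb3s 2 _ (@intble_wt R)) (@intbleZ R _ _ leb3s 2 _ ih)).
Qed.

Lemma cutoff_lim (f w : hfun R) : schwartz w -> cmeasurable (f : hmeas R -> R[i]) ->
  intble3 (fun p : hmeas R => `N (f p) ^+ 2) ->
  ccvg (fun k => cint3 (fun p => f p * (J (cutoff w k.+1%:R^-1) p)^*)) (cint3 (fun p => f p * (J (bar w) p)^*)).
Proof.
move=> sw mf if2; have e0 n := @invn_gt0 R n.
set K := Rintegral (leb3 R) setT (fun p : hmeas R => `N (f p) ^+ 2).
have K0 : 0 <= K by apply: (@Rint_ge0 R _ _ leb3s) => p; exact: sqr_ge0.
have mb : cmeasurable (J (bar w) : hmeas R -> R[i]) by apply: meas_J; exact: prof_int (bar_prof sw).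
have ib := sq_bar sw.
have conjsq (u : hfun R) : intble3 (fun p : hmeas R => `N (u p) ^+ 2) -> intble3 (fun p : hmeas R => `N ((u p)^*) ^+ 2).
  by apply: eq_intble => p; rewrite normcJ.
have tl := tau_cvg sw e0 (@cvg_inv0 R).
pose b := cint3 (fun p => f p * (J (bar w) p)^*).
have bd k : `N (cint3 (fun p => f p * (J (cutoff w k.+1%:R^-1) p)^*) - b) ^+ 2 <= K * tau w k.+1%:R^-1.
  have sc := flat_J (flat_cutoff sw (e0 k)); have mc := schwartz_meas sc.
  have [id Id] := L2_cutoff sw (e0 k).
  have i1 := @cint_sqM R _ _ leb3s _ _ mf (cmeasurableJ mc) if2 (conjsq _ (schwartz_sq sc)).
  have i2 := @cint_sqM R _ _ leb3s _ _ mf (cmeasurableJ mb) if2 (conjsq _ ib).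
  rewrite /b -(@cintegralB R _ _ leb3s _ _ i1 i2).
  have md := cmeasurableB mc mb.
  have := @CauchySchwarzC R _ _ leb3s _ _ mf (cmeasurableJ md) if2 (conjsq _ id).
  have -> : (fun p : hmeas R => `N ((J (cutoff w k.+1%:R^-1) p - J (bar w) p)^*) ^+ 2) = (fun p => `N (J (cutoff w k.+1%:R^-1) p - J (bar w) p) ^+ 2) by apply/funext => p; rewrite normcJ.
  have -> : cintegral leb3s (fun p : hmeas R => f p * (J (cutoff w k.+1%:R^-1) p - J (bar w) p)^*) = cintegral leb3s (fun p : hmeas R => f p * (J (cutoff w k.+1%:R^-1) p)^* - f p * (J (bar w) p)^*).
    by apply: eq_cintegral => p; rewrite -mulrBr; congr (_ * _); rewrite cJD; congr (_ + _); apply: cplxP; rewrite !cE.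
  by move=> h; apply: le_trans h _; rewrite ler_wpM2l.
apply/ccvg_epsP => e ep; have e2 : 0 < e ^+ 2 / (K + 1) by rewrite divr_gt0 ?exprn_gt0// ltr_wpDl.
have [N hN] := cvgR_eps tl e2; exists N => k /hN hk; apply: sqr_le; first exact: ltW.
apply: le_trans (bd k) _; apply: (@le_trans _ _ (K * (e ^+ 2 / (K + 1)))).
  by rewrite ler_wpM2l//; apply: le_trans hk; rewrite subr0 ler_norm.
by rewrite mulrA ler_pdivrMr ?ltr_wpDl// mulrC ler_wpM2l ?sqr_ge0// lerDl.
Qed.

Section approximation.
Variables (h : hfun R) (w : nat -> hfun R) (M : R).
Hypotheses (mh : cmeasurable (h : hmeas R -> R[i])) (aw : approximates w h) (Vh : V0plus h)
  (hM : forall m, nsq (chi (w m)) <= M).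
Let sw n : schwartz (w n). Proof. by case: aw. Qed.

(** [potential_form] computes the pairing with cut off profiles; both limits are
    exchanged by the bound [bV_CS]. *)
Lemma term_A n : ccvg (fun m => 2%:C * bV (chi (w m)) (bar (w n)))
  (cint3 (fun p => (`N (Qplus p) ^+ 2)%:C * h p * (J (bar (w n)) p)^*)).
Proof.
have e0 n := @invn_gt0 R n.
have M0 : 0 <= M by apply: le_trans (hM 0%N); apply: (@Rint_ge0 R _ R1 leb) => s; exact: sqr_ge0.
pose psi k := cutoff (w n) k.+1%:R^-1.
have fl k : flat (psi k) := flat_cutoff (sw n) (e0 k).
have ln k : lin (psi k) := cutoff_lin (sw n) (e0 k).
have mult2 := mult_QQ.
pose phi k : hfun R := fun p => (`N (Qplus p) ^+ 2)%:C * J (psi k) p.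
have sph k : schwartz (phi k) := schwartzM mult_QQ (flat_J (fl k)).
have mQ : cmeasurable (Qplus : hmeas R -> R[i]).
  have -> : (Qplus : hfun R) = (fun p => (Num.sqrt 2)%:C * J (ek 0) p) by apply/funext => p; exact: Qplus_ek.
  by apply: cmeasurableM; [exact: cmeasurable_cst|apply: meas_J; exact: ek_int].
have mf : cmeasurable ((fun p => (`N (Qplus p) ^+ 2)%:C * h p) : hmeas R -> R[i]).
  by apply: cmeasurableM => //; apply: cmeasurableC; exact: Npow_meas.
have if2 : intble3 (fun p : hmeas R => `N ((`N (Qplus p) ^+ 2)%:C * h p) ^+ 2).
  apply: (Q2_L2 mh mf (approx_pow4 mh aw)) => p.
  by rewrite normcM normcR ger0_norm ?sqr_ge0.
have pc := chi_prof (sw n).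
apply: (@ccvg_exchange R _ (fun k m => (pi ^- 2)%:C * cint (fun s : R1 => chi (w m) s * (S (phi k) s)^*))
  (fun k => cint3 (fun p => h p * (phi k p)^*)) _
  (fun k => Rint (fun s => (1 - eta k.+1%:R^-1 0 s) ^+ 2 * `N (bar (w n) s) ^+ 2)) M _ _ _ M0).
- by move=> k; exact: (chi_weak mh aw Vh hM (sph k)).
- apply: (ccvg_eq _ (cutoff_lim (sw n) mf if2)) => k; apply: eq_cintegral => p.
  by rewrite /phi (cJM _%:C) cJR mulrA [h p * _]mulrC.
- have pb := bar_prof (sw n); apply: eta_cut_cvg; first exact: prof_sq.
    by move=> s; exact: sqr_ge0.
  by move=> s s0; case: pb => _ z _; rewrite z// Normc.normc0 expr0n.
- move=> k m; have pm := chi_prof (sw m); have pb := bar_prof (sw n).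
  rewrite (potential_form pm (chi_lin (sw m)) (fl k) (ln k)).
  have -> : (pi ^- 2)%:C * ((2 * pi ^+ 2)%:C * bV (chi (w m)) (psi k)) = 2%:C * bV (chi (w m)) (psi k).
    by rewrite mulrA -RCM; rewrite pi2K.
  rewrite -mulrBr.
  pose d s := 1%:C * psi k s + (-1)%:C * bar (w n) s.
  have pp := flat_prof (fl k).
  have pd_ : prof d.
    have [c1 z1 [C1 C10 b1]] := prof_Z 1%:C pp; have [c2 z2 [C2 C20 b2]] := prof_Z (-1)%:C pb; split.
    - exact: ccontD.
    - by move=> s s0; rewrite /d z1// z2// addr0.
    - exists (C1 + C2); first exact: addr_ge0.
      by move=> s; apply: le_trans (le_normcD _ _) _; rewrite mulrDl lerD.
  have -> : bV (chi (w m)) (psi k) - bV (chi (w m)) (bar (w n)) = bV (chi (w m)) d.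
    rewrite -(cintegralB (bV_int pm pp) (bV_int pm pb)); apply: eq_cintegral => t.
    rewrite -mulrBr; congr (_ * _); rewrite (Vr_lin _ _ t pp pb).
    by move: (Vr _ t) (Vr _ t); clear; move=> x y; apply: cplxP; rewrite !cE; ring.
  rewrite normcM normcR exprMn real_normK ?num_real//.
  have := bV_CS pm pd_.
  have -> : nsq d = Rint (fun s => (1 - eta k.+1%:R^-1 0 s) ^+ 2 * `N (bar (w n) s) ^+ 2).
    congr (Rint _); apply/funext => s.
    have -> : d s = - ((1 - eta k.+1%:R^-1 0 s)%:C * bar (w n) s).
      rewrite /d /psi /cutoff /bar RCM (_ : (1 - eta k.+1%:R^-1 0 s)%:C = 1 - (eta k.+1%:R^-1 0 s)%:C); last by rewrite rmorphB rmorph1.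
      rewrite (_ : (-1)%:C = -1 :> R[i]) ?rmorphN1// (_ : 1%:C = 1 :> R[i])//.
      by move: (chi _ s) (eta _ _ _)%:C (pi ^- 2)%:C; clear; move=> *; ring.
    by rewrite normcN normcM normcR exprMn real_normK ?num_real.
  have q0 : 0 <= Rint (fun s => (1 - eta k.+1%:R^-1 0 s) ^+ 2 * `N (bar (w n) s) ^+ 2).
    by apply: (@Rint_ge0 R _ R1 leb) => s; rewrite mulr_ge0 ?sqr_ge0.
  have := ler_wpM2r q0 (hM m).
  move: (Rintegral _ _ _) (Rintegral _ _ _) (`N _ ^+ 2) q0; clear; move=> *.
  rewrite (_ : 2 ^+ 2 = 4 :> R); last by ring.
  by lra.
Qed.

(** For each cut-off the pairing is a limit of multiples of the moments
    [\int e^{-s} chi (w m)], by [S_Q2]. *)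
Lemma term_B n : ccvg (fun m => cint (fun s : R1 => (ek 0 s)^* * chi (w m) s)) 0 ->
  cint3 (fun p => Qplus p ^+ 2 * (h p)^* * (J (bar (w n)) p)^*) = 0.
Proof.
move=> c0; have e0 n := @invn_gt0 R n.
pose psi k := cutoff (w n) k.+1%:R^-1.
have fl k : flat (psi k) := flat_cutoff (sw n) (e0 k).
pose phi k : hfun R := fun p => Qplus p ^+ 2 * (J (psi k) p)^*.
have sph k : schwartz (phi k).
  have -> : phi k = (fun p => Qplus p * Qplus p * (J (psi k) p)^*) by [].
  by apply: schwartzM; [apply: multM; exact: mult_Q|apply: schwartzJ; exact: flat_J].
have mQ : cmeasurable (Qplus : hmeas R -> R[i]).
  have -> : (Qplus : hfun R) = (fun p => (Num.sqrt 2)%:C * J (ek 0) p) by apply/funext => p; exact: Qplus_ek.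
  by apply: cmeasurableM; [exact: cmeasurable_cst|apply: meas_J; exact: ek_int].
have mf : cmeasurable ((fun p => Qplus p ^+ 2 * (h p)^*) : hmeas R -> R[i]).
  by apply: cmeasurableM; [exact: cmeasurableM|exact: cmeasurableJ].
have if2 : intble3 (fun p : hmeas R => `N (Qplus p ^+ 2 * (h p)^*) ^+ 2).
  apply: (Q2_L2 mh mf (approx_pow4 mh aw)) => p.
  by rewrite normcM normcX normcJ.
have H := cutoff_lim (sw n) mf if2.
apply: (ccvg_unique H).
have Z k : cint3 (fun p => Qplus p ^+ 2 * (h p)^* * (J (psi k) p)^*) = 0.
  have [ih _] := approx_pair mh aw (sph k).
  have -> : cint3 (fun p => Qplus p ^+ 2 * (h p)^* * (J (psi k) p)^*) = (cint3 (fun p => h p * (phi k p)^*))^*.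
    rewrite -(@cintegralJ R _ _ leb3s _ ih); apply: eq_cintegral => p.
    by rewrite cJM conjcK /phi mulrAC mulrC.
  suff -> : cint3 (fun p => h p * (phi k p)^*) = 0 by rewrite conjc0.
  apply: (ccvg_unique (chi_weak mh aw Vh hM (sph k))).
  have E m : (pi ^- 2)%:C * cint (fun s : R1 => chi (w m) s * (S (phi k) s)^*) = (2%:C * cint (fun t : R1 => ek 0 t * psi k t)) * cint (fun s : R1 => (ek 0 s)^* * chi (w m) s).
    have pm := chi_prof (sw m); have [cm zm [C C0 bm]] := pm.
    have ik : cintble (fun s : R1 => (ek 0 s)^* * chi (w m) s).
      apply: (@cint_dom1 R _ (fun t => C * `N (ek 0 t))).
      - by apply: cmeasurableM; [apply: cmeasurableJ; exact: cint_meas (@ek_int R 0)|exact: ccont_meas].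
      - move=> t; rewrite normcM normcJ mulrC ler_wpM2r ?normc_ge0//; apply: le_trans (bm _) _.
        by rewrite ler_piMr ?w1_le1.
      - by apply: intbleZ; exact: cint_normc (@ek_int R 0).
    set I0 := cint (fun t : R1 => ek 0 t * psi k t).
    have -> : (fun s : R1 => chi (w m) s * (S (phi k) s)^*) = (fun s => ((2 * pi ^+ 2)%:C * I0) * ((ek 0 s)^* * chi (w m) s)).
      apply/funext => s; have [s0|s0] := leP s 0; first by rewrite zm// !(mul0r, mulr0).
      rewrite (S_Q2 (fl k) (ltW s0)) -/I0 cJM conjcK cJR ekE cJR expr0 mul1r indicE mem_set ?mulr1/= ?in_itv/= ?(ltW s0)//.
      by rewrite RCM; move: (expR _)%:C I0 (chi _ s) (2 * pi ^+ 2)%:C; clear; move=> *; ring.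
    by rewrite (cintegralZ _ ik) mulrA [X in X * _ = _]mulrA -RCM pi2K.
  apply: (ccvg_eq E); have := ccvgZ (2%:C * cint (fun t : R1 => ek 0 t * psi k t)) c0.
  by rewrite mulr0.
apply: (ccvg_eq Z); apply/ccvg_epsP => e ep; exists 0%N => m _.
by rewrite subrr Normc.normc0 ltW.
Qed.
End approximation.
End PotentialTerms.

(** * The soliton in the energy space *)
Section SolitonApproximation.
Context {R : realType}.
Local Notation leb := (@lebesgue_measure R).
Local Notation Rint := (Rintegral leb setT).
Local Notation cint := (cintegral leb).
Local Notation cintble := (cintegrable leb).
Local Notation R1 := (measurableTypeR R).
Local Notation leb3s := (prod_sf (prod_sf leb leb) leb).
Local Notation nsq F := (Rint (fun s => `N (F s) ^+ 2)).
Implicit Types (u v phi : hfun R) (psi F G : R -> R[i]) (s : R) (p : heis R).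

Lemma flatZ (c : R[i]) F : flat F -> flat (fun s => c * F s).
Proof.
move=> [X XF clX]; exists (fun H => exists2 A, X A & H = (fun s => c * A s)); first by exists F.
move=> _ [A XA ->]; have [z1 [C1 b1] [P1 XP1 e1] [Q1 XQ1 f1] [D1 XD1 d1]] := clX A XA.
split.
- by move=> s s0; rewrite z1// mulr0.
- by exists (`N c * C1) => s; rewrite normcM ler_wpM2l ?normc_ge0.
- by exists (fun s => c * P1 s); [exists P1|move=> s; rewrite mulrCA e1].
- by exists (fun s => c * Q1 s); [exists Q1|move=> s; rewrite f1 mulrCA].
- exists (fun s => c * D1 s); first by exists D1.
  move=> s; apply: (hasder_eq (hasderM (hasder_cst c s 1) (d1 s))).
  by rewrite mul0r add0r.
Qed.
Lemma chi_J F s : flat F -> chi (J F) s = (pi ^+ 2)%:C * F s.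
Proof.
move=> fF; have pF := flat_prof fF; have sJ := flat_J fF; rewrite chiE//.
have [s0|s0] := leP s 0; first by case: pF => _ z _; rewrite z// pos_neg// mul0r mulr0.
rewrite pos_id ?(ltW s0)// (S_J pF sJ s0) mulrA -RCM; congr (_%:C * _).
by field; rewrite gt_eqF.
Qed.
Lemma en_JJ F : flat F -> en (J F) (J F) = pi ^+ 2 * nsq F.
Proof.
move=> fF; have pF := flat_prof fF; have sJ := flat_J fF; rewrite (en_J sJ pF).
have -> : (fun s : R1 => (F s)^* * chi (J F) s) = (fun s => (pi ^+ 2 * `N (F s) ^+ 2)%:C).
  apply/funext => s; rewrite chi_J// RCM -mulcJ; move: (F s) (F s)^* (pi ^+ 2)%:C; clear; move=> *; ring.
by rewrite cintegralC ReC (RintZ _ (prof_sq pF)).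
Qed.
Lemma J_B F G p : flat F -> flat G -> J F p - J G p = J (fun s => F s - G s) p.
Proof.
move=> fF fG; have iF := int_J p (prof_int (flat_prof fF)); have iG := int_J p (prof_int (flat_prof fG)).
by rewrite /J -(cintegralB iF iG); apply: eq_cintegral => s; rewrite mulrBl.
Qed.

(** The profile of the soliton and of its derivative, cut off at low frequencies. *)
Definition peta k (e : R) : R -> R[i] := fun s => (1 * eta e 0 s)%:C * (1 * s ^+ k * expR (- s))%:C.
Lemma flat_peta k e : 0 < e -> flat (peta k e).
Proof. by move=> e0; apply: (efl_flat e0 (@tame_exp R)); apply: efl1; exact: pexp1. Qed.
Lemma petaE k e s : peta k e s = (eta e 0 s)%:C * ek k s.
Proof.
rewrite /peta ekE !mul1r; have [s0|s0] := ltP 0 s; last by rewrite /eta ltNge s0/= !mul0r.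
by rewrite indicE mem_set ?mulr1//= in_itv/= (ltW s0).
Qed.
Lemma ekN k s : `N (ek k s) = s ^+ k * expR (- s) * \1_`[0, +oo[ s.
Proof.
rewrite ekE normcR ger0_norm// indicE; case: (boolP (s \in _)) => [|_]; last by rewrite mulr0.
by rewrite inE/= in_itv/= andbT => s0; rewrite mulr1 mulr_ge0 ?exprn_ge0 ?expR_ge0.
Qed.
Lemma peta_der k e s : 0 < e -> 0 < s -> hasder (peta k e) s 1
  ((e * eta e 2 s * s ^+ k * expR (- s) + eta e 0 s * (k%:R * s ^+ k.-1) * expR (- s))%:C - peta k e s).
Proof.
move=> e0 s0.
have d1 : is_derive s 1 (fun t : R => expR (- (e / t))) (e * eta e 2 s).
  have d : is_derive s 1 (fun t : R => - (e / t)) (e * s^-1 ^+ 2).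
    have := derZ (- e) (derV s0); rewrite (_ : (fun t : R => - e * t^-1) = (fun t => - (e / t))).
      by move/derive_eqR; apply; ring.
    by apply/funext => t; rewrite mulNr.
  apply: (derive_eqR (is_derive1_comp (is_derive_expR _) d)).
  by rewrite /eta s0; ring.
have d2 : is_derive s 1 (fun t : R => t ^+ k) (k%:R * s ^+ k.-1).
  have := @is_deriveX _ _ (fun t : R => t) k s 1 1 (is_derive_id _ _).
  by rewrite exprfctE => /is_derive_eq; apply; rewrite /GRing.scale/= mulr1.
have d3 := derM (derM d1 d2) (der_exp (-1) s).
have d4 := hasderR d3.
apply: (hasder_near s0 (G := fun t => (expR (- (e / t)) * t ^+ k * expR (-1 * t))%:C)).
  move=> t t0; rewrite /peta /eta t0 expr0 !mul1r !mulr1 -RCM mulrA.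
  by congr ((_ * expR _)%:C); ring.
apply: (hasder_eq d4); rewrite /peta /eta s0 expr0 !mul1r mulr1 -RCM.
have -> : -1 * s = - s by ring.
rewrite -rmorphB; congr (_%:C); move: (expR _) (expR _) (s ^+ k) (s ^+ k.-1) (s^-1 ^+ 2); clear; move=> *; ring.
Qed.

(** By [J_der], the product of [J F] with [z + i] is, up to the factor [i], [J (F + F')].
    Here [e^s F (s)] is nondecreasing: hence [F + F'] is nonnegative and its integral
    is that of [F], which is bounded uniformly in [e]. *)
Lemma J_peta_le k e p : 0 < e -> `N (den p) * `N (J (peta k e) p) <= Rint (fun s => `N (ek k s)).
Proof.
move=> e0; have fF := flat_peta k e0; have [X XF clX] := fF.
have pF := flat_prof fF; have [cF zF [C C0 bF]] := pF.
have [_ _ _ [G XG FG] [F' XF' dF]] := clX _ XF.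
have [_ _ _ [G' XG' GG'] _] := clX _ XG.
have [_ [D bG'] _ _ _] := clX _ XG'.
have pF' : prof F' by apply: flat_prof; exists X.
have b2 : exists D, forall s, `N (peta k e s) <= D * pos s ^+ 2.
  exists D => s; rewrite FG GG' mulrA -RCM normcM normcR -expr2 ger0_norm ?sqr_ge0// mulrC.
  by rewrite ler_wpM2r ?sqr_ge0.
have iF := prof_int pF; have iF' := prof_int pF'.
have E := J_der p pF pF' (fun s _ => dF s) b2.
have S1 : J (fun s => peta k e s + F' s) p = (1 + (r2 p)%:C - 'i%C * (p.2)%:C) * J (peta k e) p.
  transitivity (J (peta k e) p + J F' p); last by rewrite E; ring.
  rewrite /J -(cintegralD (int_J p iF) (int_J p iF')).
  by apply: eq_cintegral => s; rewrite mulrDl.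
have i2 : 'i%C * 'i%C = -1 :> R[i] by rewrite -expr2 sqr_i.
have D1 : 'i%C * (1 + (r2 p)%:C - 'i%C * (p.2)%:C) = den p.
  by rewrite mulrBr mulrA i2 /den; ring.
rewrite -D1 !normcM normci mul1r -normcM -S1.
have ii : cintble ((fun s => peta k e s + F' s) : R1 -> R[i]) := cintD iF iF'.
apply: le_trans (J_bound p ii) _.
have pt s : `N (peta k e s + F' s) = Re (peta k e s + F' s).
  have [s0|s0] := leP s 0.
    by case: pF' => _ z' _; rewrite zF// z'// addr0 Normc.normc0.
  have -> : F' s = (e * eta e 2 s * s ^+ k * expR (- s) + eta e 0 s * (k%:R * s ^+ k.-1) * expR (- s))%:C - peta k e s.
    have [h1 h2] := dF s; have [g1 g2] := peta_der k e0 s0.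
    by apply: cplxP; [case: h1 => _ <-; case: g1 => _ <-|case: h2 => _ <-; case: g2 => _ <-].
  rewrite addrC subrK normcR ReC ger0_norm//.
  by rewrite addr_ge0// !mulr_ge0 ?expR_ge0 ?exprn_ge0 ?eta_ge0 ?(ltW s0) ?(ltW e0).
have -> : (fun s => `N (peta k e s + F' s)) = (fun s => Re (peta k e s + F' s)) by apply/funext.
have z : cint (F' : R1 -> R[i]) = 0.
  by case: pF' => -[c1 c2] _ _; exact: cint_der0 dF c1 c2 iF' bF.
have -> : Rint (fun s => Re (peta k e s + F' s)) = Re (cint ((fun s => peta k e s + F' s) : R1 -> R[i])) by [].
rewrite (cintegralD iF iF') z addr0.
apply: (Rint_le iF.1 (cint_normc (@ek_int R k))) => s.
apply: le_trans (ler_norm _) _; apply: le_trans (normc_Re _) _.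
by rewrite petaE normcM normcR ger0_norm ?eta_ge0// ler_piMl ?normc_ge0 ?eta_le1.
Qed.

Lemma meas_ekpos k (c : R[i]) : intble leb (fun s => `N (c * ek k s) ^+ 2 * \1_`]0, +oo[ s).
Proof.
have [K K0 hK] := pexp_le (R := R) k ltr01.
apply: (@intble_le R _ R1 leb _ (fun s => `N c ^+ 2 * K * `N (ek k s))).
- apply: measurable_funM; last by apply: measurable_indic; exact: measurable_itv.
  apply: normc2_meas; apply: cmeasurableM; first exact: cmeasurable_cst.
  exact: cint_meas (@ek_int R k).
- move=> s; rewrite normcM exprMn ger0_norm; last first.
    by apply: mulr_ge0; [exact: mulr_ge0 (sqr_ge0 _) (sqr_ge0 _)|rewrite indicE ler0n].
  have kK : `N (ek k s) <= K.
    rewrite ekN indicE; case: (boolP (s \in _)) => [|_]; last by rewrite mulr0.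
    rewrite inE/= in_itv/= andbT => s0; rewrite mulr1 -[s in expR (- s)]mul1r.
    by apply: le_trans (hK s s0) _; rewrite ler_piMr ?w1_le1.
  apply: (@le_trans _ _ (`N c ^+ 2 * `N (ek k s) ^+ 2)).
    by rewrite indicE; case: (_ \in _); rewrite ?mulr1// mulr0 mulr_ge0 ?sqr_ge0.
  by rewrite -mulrA ler_wpM2l ?sqr_ge0// expr2 ler_wpM2r ?normc_ge0.
- by apply: intbleZ; exact: cint_normc (@ek_int R k).
Qed.

Lemma small_sum (P e x y : R) : 0 < P -> 0 < e -> x <= e / (5 * P) -> y <= e / (5 * P) -> P * (2 * x + 2 * y) < e.
Proof.
move=> P0 ep hx hy; have h : 2 * x + 2 * y <= 4 * (e / (5 * P)) by lra.
apply: le_lt_trans (ler_wpM2l (ltW P0) h) _.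
have -> : P * (4 * (e / (5 * P))) = 4 / 5 * e by field; rewrite gt_eqF.
by lra.
Qed.

(** The cut off solitons are Cauchy for the energy, which is an [L^2] norm of
    profiles, and converge in [L^4] by domination, thanks to [J_peta_le]. *)
Lemma soliton_approx (c : R[i]) k : exists w, approximates w (fun p => c * J (ek k) p).
Proof.
have e0 n := @invn_gt0 R n.
pose F n s := c * peta k n.+1%:R^-1 s.
have fF n : flat (F n) by apply: flatZ; exact: flat_peta.
exists (fun n => J (F n)).
have JF n p : J (F n) p = c * J (peta k n.+1%:R^-1) p.
  rewrite /J -(cintegralZ c (int_J p (prof_int (flat_prof (flat_peta k (e0 n)))))).
  by apply: eq_cintegral => s; rewrite mulrA.
split.
- by move=> n; exact: flat_J.
- pose g s : R := `N (c * ek k s) ^+ 2 * \1_`]0, +oo[ s.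
  have ig : intble leb g := meas_ekpos k c.
  have g0 s : 0 <= g s by rewrite mulr_ge0 ?sqr_ge0.
  have gz s : s <= 0 -> g s = 0.
    by move=> s0; rewrite /g indicE memNset ?mulr0//= in_itv/= andbT ltNge s0.
  have lim := eta_cut_cvg ig g0 gz.
  pose r n : R := Rint (fun s => (1 - eta n.+1%:R^-1 0 s) ^+ 2 * g s).
  have ir n : intble leb (fun s => (1 - eta n.+1%:R^-1 0 s) ^+ 2 * g s).
    apply: (@intble_le R _ R1 leb _ _ _ _ ig).
      apply: measurable_funM; last exact: intble_meas1 ig.
      by apply: measurable_funX; apply: measurable_funB => //; exact: meas_eta.
    by move=> s; rewrite ger0_norm; [rewrite ler_piMl// eta1_sq|exact: mulr_ge0 (sqr_ge0 _) (g0 s)].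
  have key m n : dotS (fun p => J (F m) p - J (F n) p) (fun p => J (F m) p - J (F n) p) <= pi ^+ 2 * (2 * r m + 2 * r n).
    have -> : (fun p => J (F m) p - J (F n) p) = J (fun s => F m s - F n s) by apply/funext => p; exact: J_B.
    have fB := flatB (fF m) (fF n).
    rewrite -enE (en_JJ fB) ler_wpM2l ?sqr_ge0//.
    have i2 := intbleD (intbleZ 2 (ir m)) (intbleZ 2 (ir n)).
    have E := etrans (RintD (intbleZ 2 (ir m)) (intbleZ 2 (ir n))) (f_equal2 +%R (RintZ 2 (ir m)) (RintZ 2 (ir n))).
    apply: le_trans (le_of_eq E); apply: (Rint_le (prof_sq (flat_prof fB)) i2) => s.
    have [s0|s0] := leP s 0.
      have [z _ _ _ _] := flat_cl fB; rewrite (z s s0) Normc.normc0 expr0n/=.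
      by apply: addr_ge0; (apply: mulr_ge0 => //; exact: mulr_ge0 (sqr_ge0 _) (g0 s)).
    have -> : F m s - F n s = (eta m.+1%:R^-1 0 s - eta n.+1%:R^-1 0 s)%:C * (c * ek k s).
      rewrite /F !petaE RCD RCN; move: (eta _ _ _)%:C (eta _ _ _)%:C (ek k s); clear; move=> *; ring.
    rewrite normcM normcR exprMn real_normK ?num_real//.
    rewrite /g indicE mem_set ?mulr1; last by rewrite /= in_itv/= s0.
    have Y0 := sqr_ge0 (`N (c * ek k s)); move: (`N (c * ek k s) ^+ 2) Y0 => Y Y0.
    have := sq2D (1 - eta n.+1%:R^-1 0 s) (- (1 - eta m.+1%:R^-1 0 s)); rewrite sqrrN.
    have -> : 1 - eta n.+1%:R^-1 0 s - (1 - eta m.+1%:R^-1 0 s) = eta m.+1%:R^-1 0 s - eta n.+1%:R^-1 0 s by ring.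
    move/(ler_wpM2r Y0) => h; apply: le_trans h _.
    by rewrite mulrDl -!mulrA addrC.
  move=> e ep; have p2 : 0 < pi ^+ 2 :> R by rewrite exprn_gt0// pi_gt0.
  have e5 : 0 < e / (5 * pi ^+ 2) by rewrite divr_gt0// mulr_gt0.
  have [N hN] := cvgR_eps lim e5; exists N => m n /hN hm /hN hn.
  apply: le_lt_trans (key m n) _.
  have hm' : r m <= e / (5 * pi ^+ 2) by apply: le_trans hm; rewrite subr0 ler_norm.
  have hn' : r n <= e / (5 * pi ^+ 2) by apply: le_trans hn; rewrite subr0 ler_norm.
  exact: small_sum.
- set K := `N c * (Rint (fun s => `N (ek k s)) + k`!%:R).
  have I0 : 0 <= Rint (fun s => `N (ek k s)).
    by apply: (@Rint_ge0 R _ R1 leb) => s; exact: normc_ge0.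
  have K0 : 0 <= K by rewrite mulr_ge0 ?normc_ge0// addr_ge0.
  have bd n p : `N (J (F n) p - c * J (ek k) p) <= K * (`N (den p))^-1.
    have d1 := den_ge1 p; have d0 : 0 < `N (den p) := lt_le_trans ltr01 d1.
    rewrite JF -mulrBr normcM /K -mulrA ler_wpM2l ?normc_ge0//.
    apply: le_trans (le_normcB _ _) _; rewrite mulrDl; apply: lerD.
      by rewrite ler_pdivlMr// mulrC; exact: J_peta_le.
    rewrite J_ek normcM normcR ger0_norm// ler_wpM2l//.
    rewrite normcX normcM normci mul1r.
    have -> : `N ((den p)^-1) = (`N (den p))^-1.
      have n0 : `N (den p) != 0 by rewrite gt_eqF.
      by apply: (mulfI n0); rewrite -normcM !mulfV ?den_neq0//; exact: Normc.normc1.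
    rewrite exprS ler_piMr ?invr_ge0 ?(ltW d0)// exprn_ile1 ?invr_ge0 ?(ltW d0)//.
    by rewrite invf_le1.
  have md n : cmeasurable ((fun p => J (F n) p - c * J (ek k) p) : hmeas R -> R[i]).
    apply: cmeasurableB; first by apply: meas_J; exact: prof_int (flat_prof (fF n)).
    by apply: cmeasurableM; [exact: cmeasurable_cst|apply: meas_J; exact: ek_int].
  have b4 n p : `N (J (F n) p - c * J (ek k) p) ^+ 4 <= K ^+ 4 * wt p.
    apply: le_trans (pow_le 4 (normc_ge0 _) (bd n p)) _.
    by rewrite exprMn exprVn ler_wpM2l ?exprn_ge0// den_wt.
  have iK := @intbleZ R _ _ leb3s (K ^+ 4) _ (@intble_wt R).
  apply: L4_cvgI.
    move=> n; apply: (@intble_le R _ _ leb3s _ _ _ _ iK); first exact: Npow_meas.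
    by move=> p; rewrite ger0_norm ?exprn_ge0 ?normc_ge0.
  have pw p : `N (J (F n) p - c * J (ek k) p) @[n --> \oo] --> (0 : R).
    pose u (s : R1) : R[i] := c * (ek k s * wav s p).
    have iu : cintble u := cintZ c (int_J p (@ek_int R k)).
    have [iu' Eu] := cintegral_off0 (u 0) iu.
    have -> : c * J (ek k) p = cint (fun s : R1 => u s - u 0 * (\1_[set (0:R)] s : R)%:C).
      by rewrite Eu /u (cintegralZ c (int_J p (@ek_int R k))).
    have [_ H] : cintble (fun s : R1 => u s - u 0 * (\1_[set (0:R)] s : R)%:C) /\
       ccvg (fun n => cint (fun s : R1 => F n s * wav s p)) (cint (fun s : R1 => u s - u 0 * (\1_[set (0:R)] s : R)%:C)); last exact: H.
    apply: (@cint_dct R _ R1 leb _ _ (fun s => `N (u s))).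
    + by move=> n; exact: cint_meas (int_J p (prof_int (flat_prof (fF n)))).
    + exact: cint_meas iu'.
    + move=> s; have [s0|s0] := ltP 0 s; last first.
        have -> : u s - u 0 * (\1_[set (0:R)] s : R)%:C = 0.
          have [->|sn] := eqVneq s 0; first by rewrite indicE mem_set// mulr1 subrr.
          rewrite indicE memNset ?mulr0 ?subr0; last by move=> /= /eqP; apply/negP.
          rewrite /u ekE indicE memNset ?mulr0 ?mul0r ?mulr0//= in_itv/= andbT leNgt.
          by rewrite lt_neqAle sn s0.
        rewrite /ccvg; apply: (@cvg_eq _ _ (fun=> 0)); last exact: cvg_cst.
        by move=> n; have [z _ _ _ _] := flat_cl (fF n); rewrite z// mul0r subr0 Normc.normc0.
      have -> : u s - u 0 * (\1_[set (0:R)] s : R)%:C = u s.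
        by rewrite indicE memNset ?mulr0 ?subr0//= => s00; rewrite s00 ltxx in s0.
      apply: (@cvg_eq _ _ (fun n => `|eta n.+1%:R^-1 0 s - 1| * `N (u s))).
        move=> n; rewrite -normcR -normcM; congr (`N _).
        rewrite /F petaE /u RCD RCN (_ : 1%:C = 1 :> R[i])//; move: (eta _ _ _)%:C (ek k s) (wav s p); clear; move=> *; ring.
      rewrite -[X in _ --> X](mul0r (`N (u s))); apply: cvgM; last exact: cvg_cst.
      by apply/norm_cvg0P; rewrite -(subrr (1 : R)); apply: cvgB; [exact: cvg_eta|exact: cvg_cst].
    + exact: cint_normc.
    + move=> n s; have -> : F n s * wav s p = (eta n.+1%:R^-1 0 s)%:C * u s.
        rewrite /F petaE /u; move: (eta _ _ _)%:C (ek k s) (wav s p); clear; move=> *; ring.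
      rewrite (normcM _%:C) normcR ger0_norm ?eta_ge0//.
      by rewrite ler_piMl ?normc_ge0 ?eta_le1.
  have -> : (0 : R) = Rintegral (leb3 R) setT (fun=> 0).
    by rewrite Rintegral_cst//= mul0r.
  have [] // := @Rint_dct R _ _ leb3s (fun n (p : hmeas R) => `N (J (F n) p - c * J (ek k) p) ^+ 4) (fun=> 0) _ _ _ _ iK.
  + by move=> n; exact: Npow_meas.
  + move=> p; rewrite -[X in _ --> X](expr0n _ 4).
    by apply: (@cvg_comp _ _ _ _ (fun x : R => x ^+ 4) _ (nbhs (0 : R))); [exact: pw|exact: exprn_continuous].
  + by move=> n p; rewrite ger0_norm ?exprn_ge0 ?normc_ge0.
Qed.
End SolitonApproximation.

(** * Cauchy sequences for the energy *)
Section CauchySequences.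
Context {R : realType}.
Implicit Types (u w : nat -> hfun R) (x y : nat -> R).

Lemma cauchyR x : (forall e : R, 0 < e -> exists N, forall m n, (N <= m)%N -> (N <= n)%N -> `|x m - x n| <= e) ->
  exists l : R, x @ \oo --> l.
Proof.
move=> h; apply/cvg_ex; apply: R_complete; apply: cauchy_exP => e e0.
have e2 : 0 < e / 2 by rewrite divr_gt0.
have [N hN] := h _ e2; exists (x N); exists N => // n Nn.
rewrite /= -ball_normE /ball_/=; apply: le_lt_trans (hN _ _ (leqnn N) Nn) _.
by rewrite ltr_pdivrMr// ltr_pMr// ltr1n.
Qed.
Lemma small_sq (e K : R) : 0 < e -> 0 <= K -> exists2 d, 0 < d & d * K <= e ^+ 2.
Proof.
move=> e0 K0; have K1 : 0 < K + 1 by rewrite ltr_wpDl.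
exists (e ^+ 2 / (K + 1)); first by rewrite divr_gt0 ?exprn_gt0.
by rewrite mulrAC ler_pdivrMr// ler_wpM2l ?sqr_ge0// lerDl.
Qed.
Lemma sqr_abs_le (a e : R) : 0 <= e -> a ^+ 2 <= e ^+ 2 -> `|a| <= e.
Proof. by move=> e0 h; apply: sqr_le => //; rewrite real_normK ?num_real. Qed.
Lemma cvg_leE x y (a b : R) : x @ \oo --> a -> y @ \oo --> b ->
  (forall e : R, 0 < e -> exists N, forall n, (N <= n)%N -> x n <= y n + e) -> a <= b.
Proof.
move=> hx hy h; rewrite leNgt; apply/negP => ba.
have e0 : 0 < (a - b) / 4 by rewrite divr_gt0// subr_gt0.
have [N1 h1] := h _ e0; have [N2 h2] := cvgR_eps hx e0; have [N3 h3] := cvgR_eps hy e0.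
pose n := maxn N1 (maxn N2 N3).
have := h1 n (leq_maxl _ _); have := h2 n (leq_trans (leq_maxl _ _) (leq_maxr _ _)).
have := h3 n (leq_trans (leq_maxr _ _) (leq_maxr _ _)).
by rewrite !ler_norml => /andP[a1 a2] /andP[b1 b2]; lra.
Qed.
Lemma cvg_le2 x (a c K : R) N : x @ \oo --> a -> (forall m, (N <= m)%N -> (x m - c) ^+ 2 <= K) -> (a - c) ^+ 2 <= K.
Proof.
move=> hx hK; have E (b d : R) : `N (b%:C - d%:C) ^+ 2 = (b - d) ^+ 2.
  by rewrite -RCN -RCD normcR real_normK ?num_real.
rewrite -E; apply: (@ccvg_le2 R (fun n => (x n)%:C) _ _ _ N); last by move=> m /hK; rewrite E.
apply/ccvg_epsP => e /(cvgR_eps hx)[N' h]; exists N' => n /h.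
by rewrite -RCN -RCD normcR.
Qed.

Definition encau w := forall e : R, 0 < e -> exists N, forall m n, (N <= m)%N -> (N <= n)%N ->
  en (fun p => w m p - w n p) (fun p => w m p - w n p) <= e.
Lemma approx_encau w (h : hfun R) : approximates w h -> encau w.
Proof.
move=> [_ c _] e /c[N hN]; exists N => m n Nm Nn.
by rewrite enE ltW// hN.
Qed.
Lemma en_le2 (u v : hfun R) : schwartz u -> schwartz v ->
  en u u <= 2 * en (fun p => u p - v p) (fun p => u p - v p) + 2 * en v v.
Proof.
move=> su sv; rewrite en_sqB//.
have s2 : schwartz (fun p => 2%:C * v p) by exact: schwartzZ.
have := en_ge0 (schwartzB su s2); rewrite en_sqB//.
have -> : en u (fun p => 2%:C * v p) = 2 * en u v by rewrite enC// enZ// (enC sv su).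
have -> : en (fun p => 2%:C * v p) (fun p => 2%:C * v p) = 4 * en v v.
  by rewrite enZ// enC// enZ// mulrA; congr (_ * _); ring.
by move: (en _ _) (en _ _) (en _ _); clear; move=> *; lra.
Qed.
Lemma encau_bd w : (forall n, schwartz (w n)) -> encau w -> exists2 M, 0 <= M & forall n, en (w n) (w n) <= M.
Proof.
move=> sw /(_ 1 ltr01)[N hN].
pose T := \sum_(i < N) en (w i) (w i); have e0 i : 0 <= en (w i) (w i) := en_ge0 (sw i).
have T0 : 0 <= T by apply: sumr_ge0.
exists (2 + 2 * en (w N) (w N) + T); first by rewrite !addr_ge0// mulr_ge0.
move=> n; have [Nn|nN] := leqP N n.
  apply: le_trans (en_le2 (sw n) (sw N)) _.
  have := hN _ _ Nn (leqnn N); move: T0; move: T; clear; move=> T; lra.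
have : en (w n) (w n) <= T.
  by rewrite /T (bigD1 (Ordinal nN))//= lerDl sumr_ge0.
by move=> hT; apply: le_trans hT _; rewrite lerDr addr_ge0// mulr_ge0.
Qed.

Lemma en_cvg w u : (forall n, schwartz (w n)) -> (forall n, schwartz (u n)) -> encau w -> encau u ->
  exists l : R, (fun n => en (w n) (u n)) @ \oo --> l.
Proof.
move=> sw su cw cu; have [M M0 hM] := encau_bd sw cw; have [K K0 hK] := encau_bd su cu.
apply: cauchyR => e ep; have e2 : 0 < e / 2 by rewrite divr_gt0.
have [d d0 hd] := small_sq e2 (addr_ge0 M0 K0).
have [N1 h1] := cw _ d0; have [N2 h2] := cu _ d0.
exists (maxn N1 N2) => m n; rewrite !geq_max => /andP[m1 m2] /andP[n1 n2].
have -> : en (w m) (u m) - en (w n) (u n) = en (fun p => w m p - w n p) (u m) + en (w n) (fun p => u m p - u n p).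
  by rewrite enBl// enBr//; ring.
apply: le_trans (ler_normD _ _) _; rewrite [leRHS]splitr; apply: lerD; (apply: sqr_abs_le; first exact: ltW).
  apply: le_trans (en_CS (schwartzB (sw m) (sw n)) (su m)) _; apply: le_trans hd.
  apply: ler_pM; rewrite ?en_ge0 ?h1//; first exact: schwartzB.
  by apply: le_trans (hK m) _; rewrite lerDr.
apply: le_trans (en_CS (sw n) (schwartzB (su m) (su n))) _; apply: le_trans hd; rewrite mulrC.
apply: ler_pM; rewrite ?en_ge0 ?h2//; first exact: schwartzB.
by apply: le_trans (hM n) _; rewrite lerDl.
Qed.
End CauchySequences.

(** * The orthogonality conditions *)
Section Orthogonality.
Context {R : realType}.
Local Notation leb := (@lebesgue_measure R).
Local Notation cint := (cintegral leb).
Local Notation cint3 := (cintegral (leb3 R)).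
Local Notation R1 := (measurableTypeR R).
Local Notation leb3s := (prod_sf (prod_sf leb leb) leb).

Definition moment (w : nat -> hfun R) k n : R[i] := cint (fun s : R1 => (ek k s)^* * chi (w n) s).

(** The pairing of [- Lap u] with [J (ek k)] is a moment of [chi u]. *)
Lemma en_ek (u : hfun R) c k : schwartz u ->
  Re (cint3 (fun p => c * J (ek k) p * (- Lap u p)^*)) =
  Re (c^* * cint (fun s : R1 => (ek k s)^* * chi u s)).
Proof.
move=> su; have sL := schwartz_LapN su; have iL := schwartz_int sL; have iK := @ek_int R k.
have [mJ E] := JS_fubini iL iK.
have i1 : cintegrable (leb3 R) (fun p => - Lap u p * (J (ek k) p)^*).
  apply: (@cint_dom R _ _ leb3s _ (fun p => Rintegral leb setT (fun s => `N (ek k s)) * `N (- Lap u p))).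
  - by apply: cmeasurableM; [exact: schwartz_meas|apply: cmeasurableJ; exact: meas_J].
  - by move=> p; rewrite normcM normcJ mulrC ler_wpM2r ?normc_ge0// J_bound.
  - by apply: (@intbleZ R _ _ leb3s); exact: (@cint_normc R _ _ leb3s).
have -> : cint (fun s : R1 => (ek k s)^* * chi u s) = cint3 (fun p => - Lap u p * (J (ek k) p)^*).
  by rewrite E; apply: eq_cintegral => s; rewrite chi_Lap.
rewrite -[RHS]ReJ cJM conjcK -(@cintegralJ R _ _ leb3s _ i1) -(@cintegralZ R _ _ leb3s c _ (@cintJ R _ _ leb3s _ i1)).
apply: (congr1 (@complex.Re R)); apply: eq_cintegral => p.
by move: (J (ek k) p) (Lap u p); clear; move=> a b; apply: cplxP; rewrite !cE; ring.
Qed.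

(** The pairing of [w n] with the approximations [u j] of [c * J (ek k)] tends to
    a multiple of the moment of [chi (w n)] as [j] grows, and is uniformly close to
    the pairing of [w j] with [u j], which tends to the inner product. *)
Lemma orth_moment (h : hfun R) c k : approximates (appr h) h -> dotH1 h (fun p => c * J (ek k) p) = 0 ->
  Re (c^* * moment (appr h) k n) @[n --> \oo] --> (0 : R).
Proof.
move=> aw; set q : hfun R := fun p => c * J (ek k) p.
have au : approximates (appr q) q := xgetPex _ (soliton_approx c k).
have mq : cmeasurable (q : hmeas R -> R[i]).
  by apply: cmeasurableM; [exact: cmeasurable_cst|apply: meas_J; exact: ek_int].
move: au; rewrite /dotH1; set w := appr h in aw *; set u := appr q => au.
have [sw _ _] := aw; have [su _ _] := au; have cw := approx_encau aw; have cu := approx_encau au.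
have [K K0 hK] := encau_bd su cu.
have [l hl] := en_cvg sw su cw cu.
have -> : (fun n => dotS (w n) (u n)) = (fun n => en (w n) (u n)) by apply/funext => n; rewrite enE.
rewrite (cvg_lim _ hl)// => l0; rewrite {}l0 in hl.
apply: cvg_epsR => e ep; have [d d0 hd] := small_sq ep K0; have [N hN] := cw _ d0.
exists N => n Nn; rewrite subr0; apply: sqr_abs_le; first exact: ltW.
have [_ H] := approx_pair mq au (schwartz_LapN (sw n)).
have [HR _] := (ccvgP _ _).1 H.
have EE j : Re (cint3 (fun p => u j p * (- Lap (w n) p)^*)) = en (w n) (u j).
  rewrite enE /dotS /rpair -ReJ -(@cintegralJ R _ _ leb3s).
    by congr (Re _); apply: eq_cintegral => p; rewrite cJM conjcK mulrC.
  exact: schwartz_int (schwartzMM (su j) (schwartzJ (schwartz_LapN (sw n)))).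
have {}HR : en (w n) (u j) @[j --> \oo] --> Re (c^* * moment w k n).
  have <- : _ = Re (c^* * moment w k n) := en_ek c k (sw n).
  by apply: (cvg_eq _ HR) => j; rewrite EE.
have HD : en (w n) (u j) - en (w j) (u j) @[j --> \oo] --> Re (c^* * moment w k n).
  by rewrite -[X in _ --> X]subr0; exact: cvgB.
rewrite -[X in X ^+ 2]subr0; apply: (cvg_le2 (N := N) HD) => j Nj; rewrite subr0 -enBl//.
apply: le_trans (en_CS (schwartzB (sw n) (sw j)) (su j)) _; apply: le_trans hd.
by apply: ler_pM; rewrite ?en_ge0 ?hN//; exact: schwartzB.
Qed.

Lemma Re_sqrt2 (z : R[i]) : Re ((Num.sqrt 2)%:C^* * z) = Num.sqrt 2 * Re z.
Proof. by rewrite cJR !cE mul0r subr0. Qed.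
Lemma Re_nsqrt2 (z : R[i]) : Re ((- (Num.sqrt 2)%:C)^* * z) = - (Num.sqrt 2 * Re z).
Proof. by rewrite -RCN cJR !cE mul0r subr0 mulNr. Qed.
Lemma Re_isqrt2 (z : R[i]) : Re (('i%C * (Num.sqrt 2)%:C)^* * z) = Num.sqrt 2 * Im z.
Proof. by rewrite cJM cJR !cE; ring. Qed.
Lemma cvg_sqrt2 (x : nat -> R) : Num.sqrt 2 * x n @[n --> \oo] --> (0 : R) -> x @ \oo --> (0 : R).
Proof.
move=> hx; have s2 : Num.sqrt 2 != 0 :> R by rewrite gt_eqF// sqrtr_gt0.
rewrite -[X in _ --> X](mulr0 (Num.sqrt 2)^-1); apply: (@cvg_eq _ _ (fun n => (Num.sqrt 2)^-1 * (Num.sqrt 2 * x n))).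
  by move=> n; rewrite mulKf.
by apply: cvgM => //; exact: cvg_cst.
Qed.

(** [Q] and [d_s Q] are multiples of [J (ek 0)] and [J (ek 1)]; their products
    with [i] give access to the imaginary parts of the moments. *)
Lemma moments_vanish (h : hfun R) : approximates (appr h) h ->
  dotH1 h Qplus = 0 -> dotH1 h (fun p => 'i%C * Qplus p) = 0 ->
  dotH1 h (pd es Qplus) = 0 -> dotH1 h (fun p => 'i%C * pd es Qplus p) = 0 ->
  ccvg (moment (appr h) 0) 0 /\ ccvg (moment (appr h) 1) 0.
Proof.
move=> aw.
have -> : Qplus = (fun p : heis R => (Num.sqrt 2)%:C * J (ek 0) p) by apply/funext => p; exact: Qplus_ek.
move/(orth_moment aw) => h1.
have -> : (fun p : heis R => 'i%C * ((Num.sqrt 2)%:C * J (ek 0) p)) = (fun p => ('i%C * (Num.sqrt 2)%:C) * J (ek 0) p).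
  by apply/funext => p; rewrite mulrA.
move/(orth_moment aw) => h2.
have -> : (fun p : heis R => (Num.sqrt 2)%:C * J (ek 0) p) = Qplus by apply/funext => p; rewrite Qplus_ek.
have -> : pd es Qplus = (fun p : heis R => ('i%C * (Num.sqrt 2)%:C) * J (ek 1) p).
  by apply/funext => p; rewrite pdQplus_ek [_ * 'i%C]mulrC.
move/(orth_moment aw) => h3.
have -> : (fun p : heis R => 'i%C * ('i%C * (Num.sqrt 2)%:C * J (ek 1) p)) = (fun p => (- (Num.sqrt 2)%:C) * J (ek 1) p).
  by apply/funext => p; rewrite !mulrA -expr2 sqr_i mulN1r.
move/(orth_moment aw) => h4.
split; apply/ccvgP; rewrite Re0 Im0; split; apply: cvg_sqrt2.
- by apply: (cvg_eq _ h1) => n; rewrite Re_sqrt2.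
- by apply: (cvg_eq _ h2) => n; rewrite Re_isqrt2.
- apply: cvg_epsR => e /(cvgR_eps h4)[N hN]; exists N => n /hN.
  by rewrite Re_nsqrt2 !subr0 normrN.
- by apply: (cvg_eq _ h3) => n; rewrite Re_isqrt2.
Qed.
End Orthogonality.

(** * Coercivity of the linearized operator *)
Section Coercive.
Context {R : realType}.
Local Notation leb := (@lebesgue_measure R).
Local Notation Rint := (Rintegral leb setT).
Local Notation cint := (cintegral leb).
Local Notation cint3 := (cintegral (leb3 R)).
Local Notation R1 := (measurableTypeR R).
Local Notation leb3s := (prod_sf (prod_sf leb leb) leb).
Local Notation nsq F := (Rint (fun s => `N (F s) ^+ 2)).

Lemma nsq_ge0 (F : R -> R[i]) : 0 <= nsq F.
Proof. by apply: (@Rint_ge0 R _ R1 leb) => s; exact: sqr_ge0. Qed.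
Lemma chi_B (u v : hfun R) s : schwartz u -> schwartz v -> chi (fun p => u p - v p) s = chi u s - chi v s.
Proof.
move=> su sv; rewrite !chiE//; last exact: schwartzB.
have -> : S (fun p => u p - v p) s = S u s - S v s.
  rewrite /S -(@cintegralB R _ _ leb3s _ _ (int_S s (schwartz_int su)) (int_S s (schwartz_int sv))).
  by apply: eq_cintegral => p; rewrite mulrBl.
by rewrite mulrBr.
Qed.
Lemma nsq_chi (u : hfun R) : schwartz u -> nsq (chi u) <= pi ^+ 2 * en u u.
Proof.
move=> su; have := chi_energy su; rewrite ler_pdivrMl ?exprn_gt0 ?pi_gt0//.
Qed.

Section sequence.
Variables (h : hfun R) (w : nat -> hfun R).
Hypotheses (mh : cmeasurable (h : hmeas R -> R[i])) (aw : approximates w h) (Vh : V0plus h).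
Let sw n : schwartz (w n). Proof. by case: aw. Qed.
Let cw : encau w. Proof. exact: approx_encau aw. Qed.
Let pw n : prof (chi (w n)). Proof. exact: chi_prof (sw n). Qed.
Variable M : R.
Hypotheses (M0 : 0 <= M) (hM : forall n, en (w n) (w n) <= M).
Let p2 : 0 < pi ^+ 2 :> R. Proof. by rewrite exprn_gt0// pi_gt0. Qed.
Let nM n : nsq (chi (w n)) <= pi ^+ 2 * M.
Proof. by apply: le_trans (nsq_chi (sw n)) _; rewrite ler_wpM2l ?hM// ltW. Qed.
Let nB m n : nsq (fun s => chi (w m) s - chi (w n) s) <= pi ^+ 2 * en (fun p => w m p - w n p) (fun p => w m p - w n p).
Proof.
have := nsq_chi (schwartzB (sw m) (sw n)).
by have -> : chi (fun p => w m p - w n p) = (fun s => chi (w m) s - chi (w n) s) by apply/funext => s; exact: chi_B.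
Qed.

Let vN n : R := Rint (fun t => `N (Vr (chi (w n)) t) ^+ 2).
Let bVn n : bV (chi (w n)) (chi (w n)) = (vN n)%:C.
Proof. by rewrite -cintegralC; apply: eq_cintegral => t; rewrite mulcJ. Qed.

(** Both [- Lap (w n)] and [Ds (w n)] have the Hardy coefficients [chi (w n)]. *)
Lemma pair_Lap n : cint3 (fun p => h p * (- Lap (w n) p)^*) = cint3 (fun p => h p * (Ds (w n) p)^*).
Proof.
have H1 := chi_weak mh aw Vh nM (schwartz_LapN (sw n)).
have E : S (fun p => - Lap (w n) p) = chi (w n) by apply/funext => s; rewrite chi_Lap.
rewrite E in H1; apply: (ccvg_unique H1).
exact: (chi_weak mh aw Vh nM (schwartz_Ds (sw n))).
Qed.

Lemma small_en (e : R) : 0 < e -> exists N, forall m n, (N <= m)%N -> (N <= n)%N ->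
  en (fun p => w m p - w n p) (fun p => w m p - w n p) * M <= e ^+ 2.
Proof.
move=> ep; have [d d0 hd] := small_sq ep M0; have [N hN] := cw d0; exists N => m n Nm Nn.
by apply: le_trans hd; rewrite ler_wpM2r// hN.
Qed.

(** The pairing of [h] with [Ds (w n)] is a limit both of [\int chi (w m) conj
    chi (w n)] and, by [pair_Lap], of the energy pairings of [w m] and [w n]. *)
Lemma kinetic_limit (e : R) : 0 < e -> exists N, forall n, (N <= n)%N ->
  `|rpair h (Ds (w n)) - pi ^- 2 * nsq (chi (w n))| <= e /\ `|rpair h (Ds (w n)) - en (w n) (w n)| <= e.
Proof.
move=> ep; have [N hN] := small_en ep; exists N => n Nn; split; (apply: sqr_abs_le; first exact: ltW).
  have H := chi_weak mh aw Vh nM (schwartz_Ds (sw n)).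
  set z := cint3 (fun p => h p * (Ds (w n) p)^*) in H.
  have -> : rpair h (Ds (w n)) - pi ^- 2 * nsq (chi (w n)) = Re (z - (pi ^- 2 * nsq (chi (w n)))%:C).
    by rewrite ReD ReN ReC.
  apply: (@le_trans _ _ (`N (z - (pi ^- 2 * nsq (chi (w n)))%:C) ^+ 2)).
    by rewrite normcE2 lerDl sqr_ge0.
  apply: (ccvg_le2 (N := N) H) => m Nm; apply: le_trans (hN m n Nm Nn).
  have i1 m' : cintegrable leb (fun s : R1 => chi (w m') s * (chi (w n) s)^*).
    apply: cint_sqM; [exact: ccont_meas (let: And3 c _ _ := pw m' in c)|apply: cmeasurableJ; exact: ccont_meas (let: And3 c _ _ := pw n in c)|exact: prof_sq|].
    by apply: eq_intble (prof_sq (pw n)) => s; rewrite normcJ.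
  have -> : (pi ^- 2 * nsq (chi (w n)))%:C = (pi ^- 2)%:C * cint (fun s : R1 => chi (w n) s * (chi (w n) s)^*).
    by rewrite RCM -cintegralC; congr (_ * _); apply: eq_cintegral => s; rewrite mulcJ.
  rewrite -/(chi (w n)) -mulrBr -(cintegralB (i1 m) (i1 n)) normcM normcR exprMn real_normK ?num_real//.
  have [cm _ _] := pw m; have [cn _ _] := pw n.
  have sB : prof (fun s => chi (w m) s - chi (w n) s).
    have -> : (fun s => chi (w m) s - chi (w n) s) = chi (fun p => w m p - w n p) by apply/funext => s; rewrite chi_B.
    by apply: chi_prof; exact: schwartzB.
  have [cB _ _] := sB.
  have iJ : intble leb (fun s => `N ((chi (w n) s)^*) ^+ 2) by apply: eq_intble (prof_sq (pw n)) => s; rewrite normcJ.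
  have := CauchySchwarzC (ccont_meas cB) (cmeasurableJ (ccont_meas cn)) (prof_sq sB) iJ.
  have -> : (fun s => `N ((chi (w n) s)^*) ^+ 2) = (fun s => `N (chi (w n) s) ^+ 2) by apply/funext => s; rewrite normcJ.
  have -> : cint (fun x : R1 => (chi (w m) x - chi (w n) x) * (chi (w n) x)^*) = cint (fun x : R1 => chi (w m) x * (chi (w n) x)^* - chi (w n) x * (chi (w n) x)^*).
    by apply: eq_cintegral => s; rewrite mulrBl.
  move=> h1; apply: le_trans (ler_wpM2l (sqr_ge0 _) h1) _.
  have h2 := ler_pM (nsq_ge0 _) (nsq_ge0 _) (nB m n) (nM n).
  apply: le_trans (ler_wpM2l (sqr_ge0 _) h2) _.
  by apply: le_of_eq; move: (en _ _) (pi ^+ 2) p2 => x P P0; field; rewrite gt_eqF.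
have [_ H] := approx_pair mh aw (schwartz_LapN (sw n)); rewrite (pair_Lap n) in H.
have [HR _] := (ccvgP _ _).1 H.
have EE j : Re (cint3 (fun p => w j p * (- Lap (w n) p)^*)) = en (w n) (w j).
  rewrite enE /dotS /rpair -ReJ -(@cintegralJ R _ _ leb3s).
    by congr (Re _); apply: eq_cintegral => p; rewrite cJM conjcK mulrC.
  exact: schwartz_int (schwartzMM (sw j) (schwartzJ (schwartz_LapN (sw n)))).
have {}HR : en (w n) (w j) @[j --> \oo] --> rpair h (Ds (w n)).
  by apply: (cvg_eq _ HR) => j; rewrite EE.
apply: (cvg_le2 (N := N) HR) => m Nm; rewrite -enBr//.
apply: le_trans (en_CS (sw n) (schwartzB (sw m) (sw n))) _; apply: le_trans (hN m n Nm Nn).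
by rewrite mulrC ler_wpM2l ?hM// en_ge0//; exact: schwartzB.
Qed.

Let bVB m n F : prof F -> `N (bV (chi (w m)) F - bV (chi (w n)) F) ^+ 2 <=
  4^-1 * (pi ^+ 2 * en (fun p => w m p - w n p) (fun p => w m p - w n p) * nsq F).
Proof.
move=> pF; have sB : prof (fun s => 1%:C * chi (w m) s + (-1)%:C * chi (w n) s).
  have -> : (fun s => 1%:C * chi (w m) s + (-1)%:C * chi (w n) s) = chi (fun p => w m p - w n p).
    by apply/funext => s; rewrite chi_B// RCN (_ : 1%:C = 1 :> R[i])// mul1r mulN1r.
  by apply: chi_prof; exact: schwartzB.
have -> : bV (chi (w m)) F - bV (chi (w n)) F = bV (fun s => 1%:C * chi (w m) s + (-1)%:C * chi (w n) s) F.
  rewrite -(cintegralB (bV_int (pw m) pF) (bV_int (pw n) pF)); apply: eq_cintegral => t.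
  rewrite -mulrBl; congr (_ * _); rewrite (Vr_lin _ _ t (pw m) (pw n)).
  by rewrite RCN (_ : 1%:C = 1 :> R[i])// mul1r mulN1r.
apply: le_trans (bV_CS sB pF) _; rewrite ler_wpM2l ?invr_ge0//; apply: ler_wpM2r; first exact: nsq_ge0.
apply: le_trans (nB m n); apply: le_of_eq.
congr (Rint _); apply/funext => s.
by rewrite RCN (_ : 1%:C = 1 :> R[i])// mul1r mulN1r.
Qed.

Lemma potential_limit (e : R) : 0 < e -> exists N, forall n, (N <= n)%N ->
  `|rpair (fun p => (`N (Qplus p) ^+ 2)%:C * h p) (J (bar (w n))) - 2 * (pi ^- 2 * vN n)| <= e.
Proof.
move=> ep; have [N hN] := small_en ep; exists N => n Nn; apply: sqr_abs_le; first exact: ltW.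
have H := term_A mh aw Vh nM n.
set z := cint3 (fun p => (`N (Qplus p) ^+ 2)%:C * h p * (J (bar (w n)) p)^*) in H.
have -> : rpair (fun p => (`N (Qplus p) ^+ 2)%:C * h p) (J (bar (w n))) - 2 * (pi ^- 2 * vN n) = Re (z - (2 * (pi ^- 2 * vN n))%:C).
  by rewrite ReD ReN ReC.
apply: (@le_trans _ _ (`N (z - (2 * (pi ^- 2 * vN n))%:C) ^+ 2)).
  by rewrite normcE2 lerDl sqr_ge0.
have pb := bar_prof (sw n).
have E0 : (2 * (pi ^- 2 * vN n))%:C = 2%:C * bV (chi (w n)) (bar (w n)).
  rewrite 2!RCM -bVn -(cintegralZ _ (bV_int (pw n) (pw n))); congr (_ * _); apply: eq_cintegral => t.
  have -> : bar (w n) = (fun s => (pi ^- 2)%:C * chi (w n) s + 0%:C * chi (w n) s).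
    by apply/funext => s; rewrite /bar mul0r addr0.
  by rewrite (Vr_lin _ _ t (pw n) (pw n)) mul0r addr0 (cJM _%:C) cJR mulrCA.
apply: (ccvg_le2 (N := N) H) => m Nm; apply: le_trans (hN m n Nm Nn).
rewrite E0 -mulrBr normcM normcR exprMn real_normK ?num_real//.
apply: le_trans (ler_wpM2l (sqr_ge0 _) (bVB m n pb)) _.
have -> : nsq (bar (w n)) = (pi ^- 2) ^+ 2 * nsq (chi (w n)).
  rewrite -(RintZ _ (prof_sq (pw n))); congr (Rint _); apply/funext => s.
  by rewrite /bar normcM normcR exprMn real_normK ?num_real.
have e0 := en_ge0 (schwartzB (sw m) (sw n)).
have := ler_wpM2l (mulr_ge0 (ltW p2) e0) (ler_wpM2l (sqr_ge0 (pi ^- 2)) (nM n)).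
move: (en _ _) e0 (nsq _) => x x0 y hxy.
have -> : 2 ^+ 2 * (4^-1 * (pi ^+ 2 * x * (pi ^- 2 ^+ 2 * y))) = pi ^+ 2 * x * (pi ^- 2 ^+ 2 * y) by move: (pi ^+ 2) p2 => P P0; field; rewrite gt_eqF.
apply: le_trans hxy _.
by apply: le_of_eq; move: (pi ^+ 2) p2 => P P0; field; rewrite gt_eqF.
Qed.

Lemma cJB (x y : R[i]) : (x - y)^* = x^* - y^*.
Proof. by rewrite cJD; congr (_ + _); apply: cplxP; rewrite !cE. Qed.
Lemma alg_split (a x y : R) (b : R[i]) : (a * x - a * y)%:C = a%:C * ((x%:C - b) + (b - y%:C)).
Proof. by rewrite RCD RCN !RCM; move: a%:C x%:C y%:C; clear; move=> *; ring. Qed.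
Lemma volterra_cauchy (e : R) : 0 < e -> exists N, forall m n, (N <= m)%N -> (N <= n)%N ->
  `|pi ^- 2 * vN m - pi ^- 2 * vN n| <= e.
Proof.
move=> ep; have [N hN] := small_en ep; exists N => m n Nm Nn.
have one a b c : (N <= a)%N -> (N <= b)%N -> `N (bV (chi (w a)) (chi (w c)) - bV (chi (w b)) (chi (w c))) <= pi ^+ 2 * (e / 2).
  move=> Na Nb; apply: sqr_le; first by rewrite mulr_ge0 ?divr_ge0 ?(ltW p2) ?(ltW ep).
  apply: le_trans (bVB a b (pw c)) _.
  have e0 := en_ge0 (schwartzB (sw a) (sw b)).
  have := ler_wpM2l (mulr_ge0 (ltW p2) e0) (nM c); have := hN a b Na Nb.
  move: (en _ _) e0 (nsq _) => x x0 y h1 h2.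
  apply: (@le_trans _ _ (4^-1 * (pi ^+ 2 * x * (pi ^+ 2 * M)))); first by rewrite ler_wpM2l ?invr_ge0.
  have -> : 4^-1 * (pi ^+ 2 * x * (pi ^+ 2 * M)) = (4^-1 * (pi ^+ 2) ^+ 2) * (x * M) by ring.
  have -> : (pi ^+ 2 * (e / 2)) ^+ 2 = (4^-1 * (pi ^+ 2) ^+ 2) * e ^+ 2 by field.
  by rewrite ler_wpM2l// mulr_ge0 ?invr_ge0 ?sqr_ge0.
have bVJ a b : bV (chi (w a)) (chi (w b)) = (bV (chi (w b)) (chi (w a)))^*.
  rewrite -(cintegralJ (bV_int (pw b) (pw a))); apply: eq_cintegral => t.
  by rewrite (cJM (Vr (chi (w b)) t) (Vr (chi (w a)) t)^*) conjcK mulrC.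
have E : (pi ^- 2 * vN m - pi ^- 2 * vN n)%:C = (pi ^- 2)%:C * ((bV (chi (w m)) (chi (w m)) - bV (chi (w n)) (chi (w m))) + (bV (chi (w m)) (chi (w n)) - bV (chi (w n)) (chi (w n)))^*).
  have -> : (bV (chi (w m)) (chi (w n)) - bV (chi (w n)) (chi (w n)))^* = bV (chi (w n)) (chi (w m)) - bV (chi (w n)) (chi (w n)).
    exact: (etrans (cJB _ _) (congr2 (fun x y => x - y) (esym (bVJ n m)) (esym (bVJ n n)))).
  exact: (etrans (alg_split (pi ^- 2) (vN m) (vN n) (bV (chi (w n)) (chi (w m))))
    (congr2 (fun x y => (pi ^- 2)%:C * ((x - bV (chi (w n)) (chi (w m))) + (bV (chi (w n)) (chi (w m)) - y))) (esym (bVn m)) (esym (bVn n)))).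
rewrite -normcR E normcM normcR ger0_norm ?ipi0//.
apply: (@le_trans _ _ (pi ^- 2 * (pi ^+ 2 * (e / 2) + pi ^+ 2 * (e / 2)))).
  rewrite ler_wpM2l ?ipi0//; apply: le_trans (le_normcD _ _) _; rewrite normcJ.
  by apply: lerD; exact: one.
by apply: le_of_eq; move: (pi ^+ 2) p2 => P P0; field; rewrite gt_eqF.
Qed.

Lemma tri_cauchy (e x1 x2 y1 y2 z1 z2 v1 v2 l : R) : `|x1 - z1| <= e / 20 -> `|x2 - z2| <= e / 20 ->
  `|y1 - 2 * v1| <= e / 20 -> `|y2 - 2 * v2| <= e / 20 -> `|v1 - v2| <= e / 20 ->
  `|z1 - l| <= e / 20 -> `|z2 - l| <= e / 20 -> `|x1 - 2 * y1 - (x2 - 2 * y2)| <= e.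
Proof.
rewrite !ler_norml => /andP[? ?] /andP[? ?] /andP[? ?] /andP[? ?] /andP[? ?] /andP[? ?] /andP[? ?].
by apply/andP; split; lra.
Qed.
Lemma tri_lower (e x y z v q : R) : `|x - q| <= e / 10 -> `|x - z| <= e / 10 -> `|y - 2 * v| <= e / 10 ->
  4 * v <= 9 / 10 * q + e / 2 -> 10^-1 * z <= x - 2 * y + e.
Proof. by rewrite !ler_norml => /andP[? ?] /andP[? ?] /andP[? ?] ?; lra. Qed.

(** Of the kinetic energy, the potential takes at most the fraction 9/10. *)
Lemma Lop_coercive : ccvg (moment w 0) 0 -> ccvg (moment w 1) 0 ->
  exists l L : R, [/\ (fun n => en (w n) (w n)) @ \oo --> l, (fun n => Lop h (w n)) @ \oo --> L & 10^-1 * l <= L].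
Proof.
move=> m0 m1; have [l hl] := en_cvg sw sw cw cw.
have mQ : cmeasurable (Qplus : hmeas R -> R[i]).
  have -> : (Qplus : hfun R) = (fun p => (Num.sqrt 2)%:C * J (ek 0) p) by apply/funext => p; exact: Qplus_ek.
  by apply: cmeasurableM; [exact: cmeasurable_cst|apply: meas_J; exact: ek_int].
have LE n : Lop h (w n) = rpair h (Ds (w n)) - 2 * rpair (fun p => (`N (Qplus p) ^+ 2)%:C * h p) (J (bar (w n))).
  have mA : cmeasurable ((fun p => (`N (Qplus p) ^+ 2)%:C * h p) : hmeas R -> R[i]).
    by apply: cmeasurableM => //; apply: cmeasurableC; exact: Npow_meas.
  have mB : cmeasurable ((fun p => Qplus p ^+ 2 * (h p)^*) : hmeas R -> R[i]).
    by apply: cmeasurableM; [exact: cmeasurableM|exact: cmeasurableJ].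
  rewrite /Lop /Pi0_dist /Ds_dist (rpair_Pi0 (sw n) mA) (rpair_Pi0 (sw n) mB).
  have -> : rpair (fun p => Qplus p ^+ 2 * (h p)^*) (J (bar (w n))) = 0.
    by rewrite /rpair (term_B mh aw Vh nM n m0) Re0.
  by rewrite subr0.
have [L hL] : exists L : R, (fun n => Lop h (w n)) @ \oo --> L.
  apply: cauchyR => e ep; have e10 : 0 < e / 20 by rewrite divr_gt0.
  have [N1 h1] := kinetic_limit e10; have [N2 h2] := potential_limit e10; have [N3 h3] := volterra_cauchy e10.
  have [N4 h4] := cvgR_eps hl e10.
  exists (maxn (maxn N1 N2) (maxn N3 N4)) => m n; rewrite !geq_max.
  move=> /andP[/andP[a1 a2] /andP[a3 a4]] /andP[/andP[b1 b2] /andP[b3 b4]].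
  rewrite !LE.
  have [_ c1] := h1 m a1; have [_ c2] := h1 n b1; have c3 := h2 m a2; have c4 := h2 n b2.
  have c5 := h3 m n a3 b3; have c6 := h4 m a4; have c7 := h4 n b4.
  exact: (tri_cauchy c1 c2 c3 c4 c5 c6 c7).
exists l, L; split => //; have lz : 10^-1 * en (w n) (w n) @[n --> \oo] --> 10^-1 * l by apply: cvgM => //; exact: cvg_cst.
apply: (cvg_leE lz hL) => e ep.
have e10 : 0 < e / 10 by rewrite divr_gt0.
have [K K0 cv_] : exists2 K : R, 0 < K & forall n, 4 * vN n <= 9 / 10 * nsq (chi (w n)) + K * (`N (moment w 0 n) ^+ 2 + `N (moment w 1 n) ^+ 2).
  by exists 11000; [lra|move=> n; exact: Vr_coercive (pw n)].
have q0 : 0 < e * pi ^+ 2 / (4 * K) by apply: divr_gt0; apply: mulr_gt0.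
have [N1 h1] := kinetic_limit e10; have [N2 h2] := potential_limit e10.
have [d d0 hd] : exists2 d : R, 0 < d & d ^+ 2 <= e * pi ^+ 2 / (4 * K).
  exists (Num.sqrt (e * pi ^+ 2 / (4 * K))); first by rewrite sqrtr_gt0.
  by rewrite sqr_sqrtr// ltW.
have /ccvg_epsP/(_ d d0)[N3 h3] := m0; have /ccvg_epsP/(_ d d0)[N4 h4] := m1.
exists (maxn (maxn N1 N2) (maxn N3 N4)) => n; rewrite !geq_max => /andP[/andP[a1 a2] /andP[a3 a4]].
rewrite LE; have [c1 c2] := h1 n a1; have c3 := h2 n a2.
have c4 := pow_le 2 (normc_ge0 _) (h3 n a3); have c5 := pow_le 2 (normc_ge0 _) (h4 n a4); rewrite subr0 in c4; rewrite subr0 in c5.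
have [y1 [y2 [c4' c5' cv]]] : exists y1 y2, [/\ y1 <= e * pi ^+ 2 / (4 * K), y2 <= e * pi ^+ 2 / (4 * K) &
    4 * vN n <= 9 / 10 * nsq (chi (w n)) + K * (y1 + y2)].
  exists (`N (moment w 0 n) ^+ 2), (`N (moment w 1 n) ^+ 2).
  by split; [exact: le_trans c4 hd|exact: le_trans c5 hd|exact: cv_].
have cv' : 4 * (pi ^- 2 * vN n) <= 9 / 10 * (pi ^- 2 * nsq (chi (w n))) + e / 2.
  have s1 : y1 + y2 <= 2 * (e * pi ^+ 2 / (4 * K)) by rewrite mulr_natl mulr2n; exact: lerD.
  have s2 : 4 * vN n <= 9 / 10 * nsq (chi (w n)) + K * (2 * (e * pi ^+ 2 / (4 * K))).
    by apply: le_trans cv _; rewrite lerD2l ler_wpM2l// ltW.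
  have := ler_wpM2l (@ipi0 R) s2.
  have -> : pi ^- 2 * (9 / 10 * nsq (chi (w n)) + K * (2 * (e * pi ^+ 2 / (4 * K)))) = 9 / 10 * (pi ^- 2 * nsq (chi (w n))) + e / 2.
    by move: (nsq _) (pi ^+ 2) p2 K0 => y P P0 K0; field; rewrite !gt_eqF.
  by rewrite mulrCA.
exact: (tri_lower c1 c2 c3 cv').
Qed.
End sequence.
End Coercive.

Theorem theorem1p2 (R : realType) :
  exists2 c : R, 0 < c &
    forall h : hfun R, inH1 h -> V0plus h ->
      dotH1 h Qplus = 0 ->
      dotH1 h (fun p => 'i%C * Qplus p) = 0 ->
      dotH1 h (pd es Qplus) = 0 ->
      dotH1 h (fun p => 'i%C * pd es Qplus p) = 0 ->
      c * normH1 h ^+ 2 <= dualpair (Lop h) h.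
Proof.
exists 10^-1; first by rewrite invr_gt0.
move=> h [mh exw] Vh o1 o2 o3 o4.
have aw : approximates (appr h) h := xgetPex _ exw.
have [m0 m1] := moments_vanish aw o1 o2 o3 o4.
have sw n : schwartz (appr h n) by case: aw.
have [M M0 hM] := encau_bd sw (approx_encau aw).
have [l [L [hl hL lL]]] := Lop_coercive mh aw Vh M0 hM m0 m1.
rewrite /dualpair (cvg_lim _ hL)// /normH1 /dotH1.
have -> : (fun n => dotS (appr h n) (appr h n)) = (fun n => en (appr h n) (appr h n)) by apply/funext => n; rewrite enE.
rewrite (cvg_lim _ hl)// sqr_sqrtr//.
rewrite -(cvg_lim _ hl)//; apply: limr_ge; first by apply/cvg_ex; exists l.
by near=> n; exact: en_ge0.
Unshelve. all: by end_near.
Qed.
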